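(* Let $A$ be a finite dimensional $E$-tame algebra over an algebraically closed field $k$, $\theta\in K_0(\operatorname{proj}A)$, and $\theta=\theta_1\oplus\cdots\oplus\theta_\ell$ its canonical decomposition. Then $[\theta]_{\rm TF}=\operatorname{cone}^\circ\{\theta_1,\ldots,\theta_\ell\}$.
   Context: $K_0(\operatorname{proj}A)$ has basis the classes $[P(i)]$ of indecomposable projectives; $\theta(X)=\langle\theta,[X]\rangle$ with $\langle[P(i)],[S(j)]\rangle=\delta_{ij}$. $\overline{\mathcal{T}}_\theta=\{X\mid\theta(X')\ge0$ for all factor modules $X'\}$, $\overline{\mathcal{F}}_\theta=\{X\mid\theta(X')\le0$ for all submodules $X'\}$; $[\theta]_{\rm TF}=\{\eta\in K_0(\operatorname{proj}A)_\mathbb{R}\mid\overline{\mathcal{T}}_\eta=\overline{\mathcal{T}}_\theta,\ \overline{\mathcal{F}}_\eta=\overline{\mathcal{F}}_\theta\}$. $\operatorname{cone}^\circ X=\sum_{x\in X}\mathbb{R}_{>0}x$. For $\theta\in K_0(\operatorname{proj}A)$, $\theta=[P_0]-[P_1]$ without common nonzero summands, $\operatorname{Hom}(\theta)=\operatorname{Hom}_A(P_1,P_0)$, $P_f$ the 2-term complex of $f$, $E(\eta,\theta)=\min\{\dim_k\operatorname{Hom}_{\mathsf{K}^b(\operatorname{proj}A)}(P_f,P_g[1])\mid f\in\operatorname{Hom}(\eta),g\in\operatorname{Hom}(\theta)\}$. $A$ is $E$-tame if $E(\theta,\theta)=0$ for all $\theta\in K_0(\operatorname{proj}A)$. A canonical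 decomposition $\theta=\theta_1\oplus\cdots\oplus\theta_\ell$: $\theta=\sum\theta_i$, each $\theta_i$ indecomposable ($P_g$ indecomposable for general $g\in\operatorname{Hom}(\theta_i)$), and for general $f\in\operatorname{Hom}(\theta)$ (nonempty Zariski open dense set) $P_f\cong\bigoplus P_{f_i}$ with $f_i\in\operatorname{Hom}(\theta_i)$. *)

(* Defs.v *)
From HB Require Import structures.
From mathcomp Require Import all_boot all_order all_algebra all_field.
From mathcomp Require Import reals.
Set Implicit Arguments. Unset Strict Implicit. Unset Printing Implicit Defensive.
Import Order.TTheory GRing.Theory Num.Theory.
Local Open Scope ring_scope.

Definition idem (k : fieldType) (A : falgType k) (x : A) : Prop := x * x = x.

(* primitive idempotent: e A is an indecomposable (nonzero) projective *)
Definition primitive_idem (k : fieldType) (A : falgType k) (x : A) : Prop :=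
  idem x /\ x <> 0 /\
  forall a b : A, idem a -> idem b -> a * b = 0 -> b * a = 0 -> a + b = x ->
    a = 0 \/ b = 0.

(* f A ~= e A as right A-modules (Hom(fA,eA) = eAf by left multiplication) *)
Definition idem_iso (k : fieldType) (A : falgType k) (f e : A) : Prop :=
  exists x y : A, x = e * x * f /\ y = f * y * e /\ y * x = f /\ x * y = e.

(* e 0, ..., e (n-1) : P(i) = e_i A is a complete irredundant list of the
   indecomposable projective right A-modules up to isomorphism *)
Definition complete_projectives (k : fieldType) (A : falgType k) (n : nat)
    (e : 'I_n -> A) : Prop :=
  (forall i, primitive_idem (e i)) /\
  (forall i j, idem_iso (e i) (e j) -> i = j) /\
  (forall f : A, primitive_idem f -> exists i, idem_iso f (e i)).

(* a right module structure on row vectors k^d : v . a = v *m act a *)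
Record module (k : fieldType) (A : falgType k) := Module {
  mdim : nat;
  mact : A -> 'M[k]_mdim;
  mact_lin : forall (c : k) (a b : A), mact (c *: a + b) = c *: mact a + mact b;
  mact_mul : forall a b : A, mact (a * b) = mact a *m mact b;
  mact_one : mact 1 = 1%:M }.

Definition is_modhom (k : fieldType) (A : falgType k) (X Y : module A)
    (M : 'M[k]_(mdim X, mdim Y)) : Prop :=
  forall a : A, mact X a *m M = M *m mact Y a.

Definition factor_module (k : fieldType) (A : falgType k) (X' X : module A) : Prop :=
  exists M : 'M[k]_(mdim X, mdim X'), is_modhom M /\ row_full M.

Definition sub_module (k : fieldType) (A : falgType k) (X' X : module A) : Prop :=
  exists M : 'M[k]_(mdim X', mdim X), is_modhom M /\ row_free M.

(* theta(X) = <theta, [X]>, with <[P(i)], [X]> = dim Hom_A(e_i A, X) = dim X e_i *)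
Definition theta_eval (k : fieldType) (A : falgType k) (n : nat) (e : 'I_n -> A)
    (R : realType) (th : 'rV[R]_n) (X : module A) : R :=
  \sum_(i < n) th 0 i * (\rank (mact X (e i)))%:R.

Definition Tbar (k : fieldType) (A : falgType k) (n : nat) (e : 'I_n -> A)
    (R : realType) (th : 'rV[R]_n) (X : module A) : Prop :=
  forall X' : module A, factor_module X' X -> 0 <= theta_eval e th X'.

Definition Fbar (k : fieldType) (A : falgType k) (n : nat) (e : 'I_n -> A)
    (R : realType) (th : 'rV[R]_n) (X : module A) : Prop :=
  forall X' : module A, sub_module X' X -> theta_eval e th X' <= 0.

Definition TF_equiv (k : fieldType) (A : falgType k) (n : nat) (e : 'I_n -> A)
    (R : realType) (eta th : 'rV[R]_n) : Prop :=
  forall X : module A, (Tbar e eta X <-> Tbar e th X) /\ (Fbar e eta X <-> Fbar e th X).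

(* ---------- Projective modules and 2-term complexes ----------
   A projective  P = (+)_{t < size s} e_{s_t} A  is encoded by s : seq 'I_n.
   A morphism from (s) to (r) is an "A-matrix" x : nat -> nat -> A with
   x u t in e_{r_u} A e_{s_t} (acting by left multiplication); entries outside
   the range are forced to be 0. *)

Definition pmat (k : fieldType) (A : falgType k) := nat -> nat -> A.

Definition ee (k : fieldType) (A : falgType k) (n : nat) (e : 'I_n -> A)
    (r : seq 'I_n) (u : nat) : A := nth 0 (map e r) u.

Definition is_mor (k : fieldType) (A : falgType k) (n : nat) (e : 'I_n -> A)
    (r s : seq 'I_n) (x : pmat A) : Prop :=
  forall u t, x u t = ee e r u * x u t * ee e s t.

Definition comp (k : fieldType) (A : falgType k) (m : nat) (x y : pmat A) : pmat A :=
  fun u t => \sum_(j < m) x u j * y j t.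

Definition padd (k : fieldType) (A : falgType k) (x y : pmat A) : pmat A :=
  fun u t => x u t + y u t.

Definition psub (k : fieldType) (A : falgType k) (x y : pmat A) : pmat A :=
  fun u t => x u t - y u t.

Definition peq (k : fieldType) (A : falgType k) (x y : pmat A) : Prop :=
  forall u t, x u t = y u t.

Definition pid (k : fieldType) (A : falgType k) (n : nat) (e : 'I_n -> A)
    (r : seq 'I_n) : pmat A :=
  fun u t => if u == t then ee e r u else 0.

Definition bdiag (k : fieldType) (A : falgType k) (p q : nat) (x y : pmat A) : pmat A :=
  fun u t => if (u < p)%N then (if (t < q)%N then x u t else 0)
             else (if (t < q)%N then 0 else y (u - p)%N (t - q)%N).

(* 2-term complex  P_f = (P1 --f--> P0), P1 in degree -1, P0 in degree 0 *)
Record cplx (n : nat) (k : fieldType) (A : falgType k) := Cplx {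
  c1 : seq 'I_n; c0 : seq 'I_n; cd : pmat A }.

Definition valid_cplx (k : fieldType) (A : falgType k) (n : nat) (e : 'I_n -> A)
    (P : cplx n A) : Prop := is_mor e (c0 P) (c1 P) (cd P).

Definition zero_cplx (k : fieldType) (A : falgType k) (n : nat) : cplx n A :=
  Cplx [::] [::] (fun _ _ => 0).

Definition dsum (k : fieldType) (A : falgType k) (n : nat) (P Q : cplx n A) : cplx n A :=
  Cplx (c1 P ++ c1 Q) (c0 P ++ c0 Q) (bdiag (size (c0 P)) (size (c1 P)) (cd P) (cd Q)).

Definition bigdsum (k : fieldType) (A : falgType k) (n : nat) (Ps : seq (cplx n A)) :
  cplx n A := foldr (@dsum k A n) (zero_cplx A n) Ps.

Definition chain_map (k : fieldType) (A : falgType k) (n : nat) (e : 'I_n -> A)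
    (P Q : cplx n A) (u1 u0 : pmat A) : Prop :=
  is_mor e (c1 Q) (c1 P) u1 /\ is_mor e (c0 Q) (c0 P) u0 /\
  peq (comp (size (c0 P)) u0 (cd P)) (comp (size (c1 Q)) (cd Q) u1).

Definition null_homotopic (k : fieldType) (A : falgType k) (n : nat) (e : 'I_n -> A)
    (P Q : cplx n A) (u1 u0 : pmat A) : Prop :=
  exists h : pmat A, is_mor e (c1 Q) (c0 P) h /\
    peq u0 (comp (size (c1 Q)) (cd Q) h) /\ peq u1 (comp (size (c0 P)) h (cd P)).

Definition kiso (k : fieldType) (A : falgType k) (n : nat) (e : 'I_n -> A)
    (P Q : cplx n A) : Prop :=
  exists u1 u0 v1 v0 : pmat A,
    chain_map e P Q u1 u0 /\ chain_map e Q P v1 v0 /\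
    null_homotopic e P P (psub (comp (size (c1 Q)) v1 u1) (pid e (c1 P)))
                         (psub (comp (size (c0 Q)) v0 u0) (pid e (c0 P))) /\
    null_homotopic e Q Q (psub (comp (size (c1 P)) u1 v1) (pid e (c1 Q)))
                         (psub (comp (size (c0 P)) u0 v0) (pid e (c0 Q))).

Definition kindec (k : fieldType) (A : falgType k) (n : nat) (e : 'I_n -> A)
    (P : cplx n A) : Prop :=
  ~ kiso e P (zero_cplx A n) /\
  forall Q1 Q2 : cplx n A, valid_cplx e Q1 -> valid_cplx e Q2 ->
    kiso e P (dsum Q1 Q2) -> kiso e Q1 (zero_cplx A n) \/ kiso e Q2 (zero_cplx A n).

(* Hom_{K^b(proj A)}(P_f, P_g[1]) = 0 : every h : P1^f -> P0^g is of the form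
   g a + b f *)
Definition hom_shift_zero (k : fieldType) (A : falgType k) (n : nat) (e : 'I_n -> A)
    (P Q : cplx n A) : Prop :=
  forall h : pmat A, is_mor e (c0 Q) (c1 P) h ->
    exists a b : pmat A, is_mor e (c1 Q) (c1 P) a /\ is_mor e (c0 Q) (c0 P) b /\
      peq h (padd (comp (size (c1 Q)) (cd Q) a) (comp (size (c0 P)) b (cd P))).

(* ---------- K_0(proj A) = Z^n with basis [P(i)] ---------- *)

(* theta = [P0] - [P1] without common summands *)
Definition P0seq (n : nat) (th : 'rV[int]_n) : seq 'I_n :=
  flatten [seq nseq (if 0 <= th 0 i then absz (th 0 i) else 0%N) i | i <- enum 'I_n].
Definition P1seq (n : nat) (th : 'rV[int]_n) : seq 'I_n :=
  flatten [seq nseq (if th 0 i <= 0 then absz (th 0 i) else 0%N) i | i <- enum 'I_n].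

Definition in_Hom (k : fieldType) (A : falgType k) (n : nat) (e : 'I_n -> A)
    (th : 'rV[int]_n) (f : pmat A) : Prop := is_mor e (P0seq th) (P1seq th) f.

Definition Pf (k : fieldType) (A : falgType k) (n : nat) (th : 'rV[int]_n)
    (f : pmat A) : cplx n A := Cplx (P1seq th) (P0seq th) f.

Inductive polyfun (k : fieldType) (A : falgType k) : (pmat A -> k) -> Prop :=
  | pf_const (c : k) : polyfun (fun _ => c)
  | pf_coord (u t : nat) (j : 'I_(\dim (fullv : {vspace A}))) :
      polyfun (fun f => coord (vbasis fullv) j (f u t))
  | pf_add p q : polyfun p -> polyfun q -> polyfun (fun f => p f + q f)
  | pf_mul p q : polyfun p -> polyfun q -> polyfun (fun f => p f * q f).

(* Q holds for general f in Hom(theta): on a nonempty Zariski open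
   (hence dense) subset of the affine space Hom(theta) *)
Definition general (k : fieldType) (A : falgType k) (n : nat) (e : 'I_n -> A)
    (th : 'rV[int]_n) (Q : pmat A -> Prop) : Prop :=
  exists p : pmat A -> k, polyfun p /\
    (exists f, in_Hom e th f /\ p f != 0) /\
    (forall f, in_Hom e th f -> p f != 0 -> Q f).

Definition E_zero (k : fieldType) (A : falgType k) (n : nat) (e : 'I_n -> A)
    (th : 'rV[int]_n) : Prop :=
  exists f g : pmat A, in_Hom e th f /\ in_Hom e th g /\
    hom_shift_zero e (Pf th f) (Pf th g).

Definition E_tame (k : fieldType) (A : falgType k) (n : nat) (e : 'I_n -> A) : Prop :=
  forall th : 'rV[int]_n, E_zero e th.

Definition indec_K0 (k : fieldType) (A : falgType k) (n : nat) (e : 'I_n -> A)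
    (th : 'rV[int]_n) : Prop :=
  general e th (fun g => kindec e (Pf th g)).

Definition canonical_decomposition (k : fieldType) (A : falgType k) (n : nat)
    (e : 'I_n -> A) (th : 'rV[int]_n) (ths : seq 'rV[int]_n) : Prop :=
  th = \sum_(x <- ths) x /\
  (forall x, x \in ths -> indec_K0 e x) /\
  general e th (fun f =>
    exists fs : seq (pmat A), size fs = size ths /\
      (forall i, (i < size ths)%N -> in_Hom e (nth 0 ths i) (nth (fun _ _ => 0) fs i)) /\
      kiso e (Pf th f)
        (bigdsum [seq Pf (nth 0 ths i) (nth (fun _ _ => 0) fs i) | i <- iota 0 (size ths)])).

Definition in_open_cone (R : realType) (n : nat) (ths : seq 'rV[int]_n)
    (eta : 'rV[R]_n) : Prop :=
  exists c : nat -> R, (forall i, (i < size ths)%N -> 0 < c i) /\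
    eta = \sum_(i < size ths) c i *: map_mx (fun z : int => z%:~R) (nth 0 ths i).

(* Main.v *)
(* Write E(f, g) = 0 when Hom(P_f, P_g[1]) = 0.  The summands theta_i are
   represented by maps f_i, g_j with E(f_i, g_j) = 0 for all i, j; these exhibit every
   module X as an extension of Z by Y, where every Hom(f_i, Y) is onto and every
   Hom(g_j, Z) injective.  Hence X is in Tbar_eta, for eta in the open cone, iff it
   is in every Tbar_{theta_i}, and dually for Fbar: the open cone lies in one class.

   For the converse, let f, g in Hom(theta) be generic.  An integral zeta which
   vanishes on the theta-semistable modules, is nonnegative on the factors of
   coker g and nonpositive on the submodules of the kernel of nu f, has
   E(zeta, rho) = E(rho, zeta) = 0 for rho = m theta - zeta, m >> 0, by E-tameness
   applied to zeta and rho; and zeta, rho are compatible with every theta_i.  Then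
   zeta is a sum of theta_i's: on the line from a map of class zeta + rho to a map of
   class sum_i m theta_i there is a polynomial family of chain endomorphisms,
   projecting onto the zeta-part at one end and acting by distinct scalars on the
   theta_i at the other.  The pattern of eigenvalue multiplicities of a general member
   persists at every member, up to merging of eigenvalues (elimination); as the theta_i
   are indecomposable, the generalized eigenspaces of a general member have classes
   among the theta_i, and those of eigenvalue 1 at the first end add up to zeta.  Finally,
   if eta is TF-equivalent to theta, then M eta - theta, M >> 0, is a convex
   combination of such zeta's. *)
Require Import Defs.
From HB Require Import structures.
From mathcomp Require Import all_boot all_order all_algebra all_field.
From mathcomp Require Import perm.
From mathcomp Require Import boolp reals.
From mathcomp Require Import zify ring lra.
Import Order.TTheory GRing.Theory Num.Theory.
Local Open Scope ring_scope.
Set Implicit Arguments. Unset Strict Implicit. Unset Printing Implicit Defensive.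

(** E-tameness only gives maps [f], [g] of one class with [Ez f g]; [Ez f f] may fail for every [f],
    as in the one-parameter families over a Kronecker algebra. Without rigidity, a class compatible
    with the [theta_i] cannot be recognized by a generic isomorphism. What survives deformation is
    the characteristic polynomial of an endomorphism on the tops of the two projectives: it records
    classes in K_0 and is polynomial in the parameter. An idempotent deforms only to an
    endomorphism: truncated lifts are idempotent, but the correction that makes them exactly
    polynomial is linear and forgets this, hence eigenvalue patterns instead of ranks. Generality is
    tested only along lines, where it means all but finitely many parameters. Compatibility is open
    because it is a rank condition on one fixed module: surjectivity on [coker g], or injectivity on
    the dual module [kernu f]. E-tameness enters through a converse of sign conditions: membership
    of X in Tbar of a class yields a map of that class with Hom(f, X) onto. Theta is subtracted from
    M eta so that every coefficient of eta ends up strictly positive. *)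

Section Corner.
Variables (k : closedFieldType) (A : falgType k) (e : A).
Hypothesis He : primitive_idem e.

Let ee_ : e * e = e. Proof. by case: He. Qed.
Let e0 : e != 0. Proof. by case: He => _ [/eqP]. Qed.

(** * Local corner rings of primitive idempotents *)

Definition corner (x : A) := e * x * e = x.
Definition nilp (x : A) := exists m, x ^+ m = 0.
Definition cunit (x : A) := exists2 z, corner z & z * x = e /\ x * z = e.

Lemma corner_l x : corner x -> e * x = x.
Proof. by move=> <-; rewrite !mulrA ee_. Qed.
Lemma corner_r x : corner x -> x * e = x.
Proof. by move=> <-; rewrite -!mulrA ee_. Qed.
Lemma cornerI x : e * x = x -> x * e = x -> corner x.
Proof. by rewrite /corner => -> ->. Qed.
Lemma corner_mul x : corner (e * x * e).
Proof. by rewrite /corner !mulrA ee_ -mulrA ee_. Qed.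
Lemma cornerM x y : corner x -> corner y -> corner (x * y).
Proof. by move=> Hx Hy; rewrite /corner mulrA corner_l // -mulrA corner_r. Qed.
Lemma cornerB x y : corner x -> corner y -> corner (x - y).
Proof. by move=> Hx Hy; rewrite /corner mulrBr mulrBl Hx Hy. Qed.
Lemma cornerD x y : corner x -> corner y -> corner (x + y).
Proof. by move=> Hx Hy; rewrite /corner mulrDr mulrDl Hx Hy. Qed.
Lemma cornerZ c x : corner x -> corner (c *: x).
Proof. by move=> Hx; rewrite /corner -scalerAr -scalerAl Hx. Qed.
Lemma corner_e : corner e.
Proof. by rewrite /corner ee_ ee_. Qed.

Lemma algebraic (x : A) : exists2 p : {poly k}, p != 0 & horner_alg x p = 0.
Proof.
pose d := \dim (fullv : {vspace A}).
pose X := [tuple x ^+ i | i < d.+1].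
have : ~~ free X.
  apply/negP => /eqP fX; have := dimvS (subvf <<X>>); rewrite fX size_tuple.
  by rewrite ltnn.
move=> /freeP nf; apply: contrapT => H; apply: nf => c Hc i.
apply: contrapT => /eqP ci; apply: H.
exists (\poly_(j < d.+1) (c (inord j))).
  apply/eqP => /(congr1 (fun p : {poly k} => p`_i)).
  by rewrite coef_poly ltn_ord inord_val coef0 => /eqP; rewrite (negPf ci).
rewrite poly_def raddf_sum /= -[RHS]Hc; apply: eq_bigr => j _.
by rewrite linearZ /= rmorphXn /= horner_algX inord_val mulr_algl (nth_map j) ?size_enum_ord // nth_ord_enum.
Qed.

(** An annihilating polynomial q X^m with q(0) nonzero splits [e] into the orthogonal idempotents
    [e * g] and [e - e * g]; primitivity kills one of them, which leaves [x] invertible or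
    nilpotent. *)
Lemma fitting x : corner x -> cunit x \/ nilp x.
Proof.
move=> Hx; have [p p0 px] := algebraic x.
have [m [q /implyP /(_ p0) q0 Ep]] := multiplicity_XsubC p 0.
(* The exponent [m.+1] instead of [m] keeps a factor [x] in the Bezout identity even when 0 is not a
   root of [p]. *)
have: coprimep (('X - 0%:P) ^+ m.+1) q by rewrite coprimep_expl // coprimep_sym coprimep_XsubC.
rewrite subr0 in Ep *; move=> /Bezout_eq1_coprimepP [[a b] /= Hab].
pose h := horner_alg x : {poly k} -> A.
have hX : h 'X = x by rewrite /h horner_algX.
have hM r s : h (r * s) = h r * h s by rewrite /h rmorphM.
have comh r : e * h r = h r * e.
  elim/poly_ind: r => [|r c IH]; first by rewrite /h rmorph0 mulr0 mul0r.
  rewrite /h rmorphD rmorphM /= horner_algX horner_algC -/h mulrDr mulrDl.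
  rewrite mulrA IH -!mulrA corner_l // corner_r //; congr (_ + _).
  by rewrite -scalerAr -scalerAl mulr1 mul1r.
have qx : h (q * 'X ^+ m.+1) = 0 by rewrite exprSr mulrA -Ep hM /h px mul0r.
pose g := h (b * q).
have g1 : h (a * 'X ^+ m.+1) = 1 - g.
  by apply/eqP; rewrite eq_sym subr_eq /g -[_ + _](rmorphD (horner_alg x)) Hab rmorph1.
have gg : g * g = g.
  apply/eqP; rewrite eq_sym -subr_eq0 -{1}[g]mulr1 -mulrBr -g1 /g -hM.
  rewrite (_ : b * q * _ = b * a * (q * 'X ^+ m.+1)); last by ring.
  by rewrite hM qx mulr0.
have eg : e * g = g * e by rewrite /g comh.
have i1 : idem (e * g) by rewrite /idem {1}eg -mulrA [e * (e * g)]mulrA ee_ eg mulrA gg.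
have ege : (e * g) * e = e * g by rewrite -mulrA -eg mulrA ee_.
have i2 : idem (e - e * g).
  by rewrite /idem mulrBl !mulrBr ee_ i1 ege mulrA ee_ subrr subr0.
case: (He.2.2 _ _ i1 i2).
- by rewrite mulrBr i1 ege subrr.
- by rewrite mulrBl i1 mulrA ee_ subrr.
- by rewrite addrC subrK.
- move=> eg0; left.
  have E : e * h (a * 'X ^+ m.+1) = e by rewrite g1 mulrBr mulr1 eg0 subr0.
  exists (e * h (a * 'X ^+ m)); first by apply: cornerI; rewrite ?mulrA ?ee_ // -mulrA -comh mulrA ee_.
  split; first by rewrite -[X in _ * X]hX -mulrA -hM -mulrA -exprSr.
  rewrite mulrA corner_r // -[in RHS]E -{1}(corner_l Hx) -mulrA -{1}hX -hM.
  by congr (e * h _); rewrite exprSr; ring.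
- move=> /eqP; rewrite subr_eq0 => /eqP Hg; right; exists m.+1.
  have -> : x ^+ m.+1 = e * x ^+ m.+1 by rewrite exprS mulrA corner_l.
  have -> : x ^+ m.+1 = h ('X ^+ m.+1) by rewrite /h rmorphXn /= horner_algX.
  rewrite Hg -mulrA /g -hM.
  by rewrite -mulrA hM qx !mulr0.
Qed.

Lemma nilp_cunit_excl x : corner x -> nilp x -> forall z, z * x = e -> False.
Proof.
move=> Hx [m xm] z zx.
have H j : x ^+ j.+1 = 0 -> e = 0.
  elim: j => [|j IH]; first by rewrite expr1 => H; rewrite -zx H mulr0.
  by move=> H; apply: IH; rewrite exprS -[X in X * _](corner_l Hx) -zx -!mulrA -!exprS H mulr0.
have: x ^+ m.+1 = 0 by rewrite exprS xm mulr0.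
by move/H/eqP; rewrite (negPf e0).
Qed.

Lemma cunitNnilp x : corner x -> cunit x -> ~ nilp x.
Proof. by move=> Hx [z _ [zx _]] nx; apply: (nilp_cunit_excl Hx nx zx). Qed.

Lemma nilpMl z x : corner z -> corner x -> nilp x -> nilp (z * x).
Proof.
move=> Hz Hx nx; case: (fitting (cornerM Hz Hx)) => // -[w _ [wx _]].
by case: (@nilp_cunit_excl _ Hx nx (w * z)); rewrite -mulrA.
Qed.

Lemma nilpMr z x : corner z -> corner x -> nilp x -> nilp (x * z).
Proof.
move=> Hz Hx [m xm]; case: (nilpMl Hz Hx (ex_intro _ m xm)) => p Hp.
have H q : (x * z) ^+ q.+1 = x * (z * x) ^+ q * z.
  elim: q => [|q IH]; first by rewrite expr1 expr0 mulr1.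
  by rewrite exprS IH exprS !mulrA.
by exists p.+1; rewrite H Hp mulr0 mul0r.
Qed.

Lemma nilp_oneB x : corner x -> nilp x -> cunit (e - x).
Proof.
move=> Hx nx; case: (fitting (cornerB corner_e Hx)) => // -[m Hm].
suff [z zx] : exists z, z * x = e by case: (nilp_cunit_excl Hx nx zx).
suff H j : exists2 z, corner z & (e - x) ^+ j.+1 = e - z * x.
  have [z _ Hz] := H m; exists z; apply/eqP; rewrite eq_sym -subr_eq0 -Hz.
  by rewrite exprS Hm mulr0.
elim: j => [|j [z Hz IH]].
  by exists e; rewrite ?expr1 ?corner_l //; apply: corner_e.
exists (z + e - z * x); first by apply: cornerB; [apply: cornerD => //; apply: corner_e | apply: cornerM].
rewrite exprSr IH mulrBr !mulrBl ee_ corner_l // -[z * x * e]mulrA corner_r // mulrDl corner_l //.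
by rewrite opprB !opprD !opprK !addrA addrAC -!addrA; congr (_ + _); rewrite addrC -!addrA.
Qed.

(** Were x + y a unit with inverse w, then w y = e - w x would be a unit because w x is nilpotent,
    although w y is nilpotent. So the nilpotents form an ideal and the corner is local. *)
Lemma nilpD x y : corner x -> corner y -> nilp x -> nilp y -> nilp (x + y).
Proof.
move=> Hx Hy nx ny; case: (fitting (cornerD Hx Hy)) => // -[w Hw [wx _]].
have E : w * y = e - w * x by rewrite -wx mulrDr addrC addKr.
have := nilp_oneB (cornerM Hw Hx) (nilpMl Hw Hx nx).
by rewrite -E => /cunitNnilp; case; [apply: cornerM | apply: nilpMl].
Qed.

Lemma nilpZ c x : nilp x -> nilp (c *: x).
Proof. by case=> m Hm; exists m; rewrite exprZn Hm scaler0. Qed.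

Lemma nilpB x y : corner x -> corner y -> nilp x -> nilp y -> nilp (x - y).
Proof.
by move=> Hx Hy nx ny; rewrite -scaleN1r; apply: nilpD => //; [apply: cornerZ|apply: nilpZ].
Qed.

Lemma cunitZe c : c != 0 -> cunit (c *: e).
Proof.
move=> c0; exists (c^-1 *: e); first exact: cornerZ corner_e.
by rewrite -!scalerAl -!scalerAr ee_ !scalerA mulVf // divff // scale1r.
Qed.

(** If no [x - c *: e] were nilpotent, all would be units, and so the product over the roots of an
    annihilating polynomial, which is 0, would be left invertible. Algebraic closedness makes the
    residue field [k] here. *)
Lemma residue_ex x : corner x -> exists c : k, nilp (x - c *: e).
Proof.
move=> Hx; have [p p0 px] := algebraic x.
have [r Er] := closed_field_poly_normal p.
apply: contrapT => H.
have Hu c : cunit (x - c *: e).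
  case: (fitting (cornerB Hx (cornerZ c corner_e))) => // nx.
  by case: H; exists c.
have: exists2 z, corner z & z * horner_alg x (\prod_(c <- r) ('X - c%:P)) = e.
  elim: r {Er} => [|c r [z Hz IH]].
    by exists e; rewrite ?big_nil ?rmorph1 ?mulr1 //; apply: corner_e.
  have [w Hw [wx _]] := Hu c.
  exists (z * w); first exact: cornerM.
  rewrite big_cons rmorphM rmorphB /= horner_algX horner_algC -mulrA [w * _]mulrA.
  rewrite (_ : w * (x - c%:A) = e); first by rewrite mulrA corner_r.
  by rewrite -wx !mulrBr -!scalerAr mulr1 corner_r.
case=> z _; suff -> : horner_alg x (\prod_(c <- r) ('X - c%:P)) = 0.
  by rewrite mulr0 => /esym/eqP; rewrite (negPf e0).
apply: (scalerI (_ : lead_coef p != 0)); first by rewrite lead_coef_eq0.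
by rewrite scaler0 -px {2}Er linearZ /= mulr_algl.
Qed.

Lemma residue_uniq x (c d : k) : nilp (x - c *: e) -> nilp (x - d *: e) -> corner x -> c = d.
Proof.
move=> nc nd Hx; apply/eqP; rewrite -subr_eq0; apply: contrapT => /negP cd.
have C a : corner (x - a *: e) by apply: cornerB => //; apply: cornerZ corner_e.
apply: (@cunitNnilp ((c - d) *: e) (cornerZ _ corner_e) (cunitZe cd)).
rewrite scalerBl (_ : _ - _ = (x - d *: e) - (x - c *: e)); first exact: nilpB.
by rewrite opprB [in RHS]addrC addrA [_ - x + x]subrK.
Qed.

End Corner.

(** * Residues at the indecomposable projectives *)

Section Residue.
Variables (k : closedFieldType) (A : falgType k) (n : nat) (e : 'I_n -> A).
Hypothesis He : complete_projectives e.

Let Hp i : primitive_idem (e i). Proof. by case: He. Qed.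
Let ee_ i : e i * e i = e i. Proof. by case: (Hp i). Qed.

Lemma eeK x v : x * e v * e v = x * e v.
Proof. by rewrite -mulrA ee_. Qed.

(* The residue of [e_v x e_v] in the local algebra [e_v A e_v], whose residue
   field is [k] because [k] is algebraically closed. *)
Definition eps (v : 'I_n) (x : A) : k :=
  sval (cid (residue_ex (Hp v) (corner_mul (Hp v) x))).

Lemma epsP v x : nilp (e v * x * e v - eps v x *: e v).
Proof. exact: svalP (cid (residue_ex (Hp v) (corner_mul (Hp v) x))). Qed.

Lemma epsE v x c : nilp (e v * x * e v - c *: e v) -> eps v x = c.
Proof. by move=> H; apply: (residue_uniq (Hp v) (epsP v x) H); apply: corner_mul. Qed.

Let C v x : corner (e v) (e v * x * e v - eps v x *: e v).
Proof. by apply: cornerB; [exact: corner_mul | apply: cornerZ; exact: corner_e]. Qed.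

Lemma epsD v x y : eps v (x + y) = eps v x + eps v y.
Proof.
apply: epsE; rewrite mulrDr mulrDl scalerDl opprD addrACA.
by apply: nilpD (epsP v x) (epsP v y).
Qed.

Lemma epsZ v c x : eps v (c *: x) = c * eps v x.
Proof.
apply: epsE; rewrite -scalerAr -scalerAl -scalerA -scalerBr.
by apply: nilpZ (epsP v x).
Qed.

Lemma eps_corner v x : eps v (e v * x * e v) = eps v x.
Proof. by apply: epsE; rewrite corner_mul //; apply: epsP. Qed.

Lemma eps_e v : eps v (e v) = 1.
Proof. by apply: epsE; rewrite ee_ ee_ scale1r subrr; exists 1; rewrite expr1. Qed.

Lemma eps_nilp v x : nilp (e v * x * e v) -> eps v x = 0.
Proof. by move=> H; apply: epsE; rewrite scale0r subr0. Qed.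

Lemma epsM v x y : eps v (x * e v * y) = eps v x * eps v y.
Proof.
rewrite -[LHS]eps_corner; apply: epsE.
set a := e v * x * e v; set b := e v * y * e v.
have Ha : corner (e v) a by apply: corner_mul. have Hb : corner (e v) b by apply: corner_mul.
rewrite (_ : e v * (_ * e v) * e v = a * b); last by rewrite /a /b !mulrA !eeK ee_.
rewrite (_ : _ - _ = (a - eps v x *: e v) * b + eps v x *: (b - eps v y *: e v)); last first.
  by rewrite mulrBl scalerBr -scalerAl (corner_l (Hp v) Hb) addrA subrK scalerA.
apply: (nilpD (Hp v)).
- by apply: (cornerM (Hp v)) => //; apply: C.
- by apply: cornerZ; apply: C.
- by apply: (nilpMr (Hp v) Hb (C v x)); apply: epsP.
- by apply: nilpZ; apply: epsP.
Qed.

(** If [a * b] were a unit of the corner at [v] with inverse [z], then [b * (z * a)] would be a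
    nonzero idempotent in the corner at [w], hence [e w] itself, and [a], [b] would give an
    isomorphism between two distinct projectives of the list. *)
Lemma epsM_neq v w x y : v != w -> eps v (x * e w * y) = 0.
Proof.
move=> vw; apply: eps_nilp.
set a := e v * x * e w; set b := e w * y * e v.
rewrite (_ : _ * _ * _ = a * b); last by rewrite /a /b !mulrA eeK.
have Ha : e v * a * e w = a by rewrite /a !mulrA ee_ eeK.
have Hb : e w * b * e v = b by rewrite /b !mulrA ee_ eeK.
have al : e v * a = a by rewrite -Ha !mulrA !ee_.
have ar : a * e w = a by rewrite -Ha eeK.
have bl : e w * b = b by rewrite -Hb !mulrA !ee_.
have br : b * e v = b by rewrite -Hb eeK.
clearbody a b.
have Hab : corner (e v) (a * b) by rewrite /corner mulrA al -mulrA br.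
case: (fitting (Hp v) Hab) => // -[z Hz [zab abz]].
have zl : e v * z = z by apply: corner_l. have zr : z * e v = z by apply: corner_r.
pose u := b * (z * a).
have i1 : idem u by rewrite /idem /u -{3}zl -zab !mulrA.
have ul : e w * u = u by rewrite /u mulrA bl.
have ur : u * e w = u by rewrite /u -!mulrA ar.
have i2 : idem (e w - u) by rewrite /idem mulrBl !mulrBr ee_ i1 ul ur subrr subr0.
have ev0 : e v <> 0 by case: (Hp v) => _ [].
case: ((Hp w).2.2 _ _ i1 i2).
- by rewrite mulrBr i1 ur subrr.
- by rewrite mulrBl i1 ul subrr.
- by rewrite addrC subrK.
- move=> u0; case: ev0; rewrite -[e v]ee_ -zab.
  rewrite [LHS](_ : _ = z * a * u * b); first by rewrite u0 mulr0 mul0r.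
  by rewrite /u !mulrA.
- move=> /eqP; rewrite subr_eq0 => /eqP Eu.
  have /eqP := vw; case; apply: (He.2.1); exists b, (z * a); split; first by rewrite Hb.
  split; first by rewrite mulrA zl -mulrA ar.
  by split; rewrite -?mulrA ?zab // Eu.
Qed.

Lemma eps0 v : eps v 0 = 0.
Proof. by rewrite -[X in eps v X](scale0r 0) epsZ mul0r. Qed.
Lemma eps_sum v (I : Type) (r : seq I) (F : I -> A) :
  eps v (\sum_(i <- r) F i) = \sum_(i <- r) eps v (F i).
Proof. by apply: (big_morph (eps v) (epsD v) (eps0 v)). Qed.
End Residue.

(** * Cofinite and infinite sets of parameters *)

Section Cofinite.
Variable k : closedFieldType.

Definition cofin (Q : k -> Prop) := exists2 p : {poly k}, p != 0 & forall c, p.[c] != 0 -> Q c.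

Lemma cofinW (Q Q' : k -> Prop) : (forall c, Q c -> Q' c) -> cofin Q -> cofin Q'.
Proof. by move=> QQ [p p0 Hp]; exists p => // c /Hp /QQ. Qed.

Lemma cofin_true (Q : k -> Prop) : (forall c, Q c) -> cofin Q.
Proof. by exists 1; rewrite ?oner_eq0. Qed.

Lemma cofin_and (Q Q' : k -> Prop) : cofin Q -> cofin Q' -> cofin (fun c => Q c /\ Q' c).
Proof.
move=> [p p0 Hp] [q q0 Hq]; exists (p * q); first by rewrite mulf_neq0.
by move=> c; rewrite hornerM mulf_eq0 negb_or => /andP[/Hp ? /Hq].
Qed.

Lemma poly_nonroot (p : {poly k}) : p != 0 -> exists c, p.[c] != 0.
Proof. by move=> p0; have [c] := closed_nonrootP p p0; rewrite /root => Hc; exists c. Qed.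

Lemma cofin_ex (Q : k -> Prop) : cofin Q -> exists c, Q c.
Proof. by case=> p /poly_nonroot [c Hc] H; exists c; apply: H. Qed.

Lemma cofin_forall (I : finType) (Q : I -> k -> Prop) :
  (forall i, cofin (Q i)) -> cofin (fun c => forall i, Q i c).
Proof.
move=> H; suff: cofin (fun c => forall i, i \in enum I -> Q i c).
  by apply: cofinW => c Hc i; apply: Hc; rewrite mem_enum.
elim: (enum I) => [|i r IH]; first exact: cofin_true.
apply: cofinW (cofin_and (H i) IH) => c [Hi Hr] j.
by rewrite inE => /predU1P [->|/Hr].
Qed.

Lemma cofin_neq0 (p : {poly k}) : p != 0 -> cofin (fun c => p.[c] != 0).
Proof. by exists p. Qed.

(** Since [k] is infinite, this says that [Q] holds for infinitely many parameters; the form with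
    [cofin] is the one in which it is applied. *)
Definition infin (Q : k -> Prop) := forall Q', cofin Q' -> exists c, Q c /\ Q' c.

Lemma infinW (Q Q' : k -> Prop) : (forall c, Q c -> Q' c) -> infin Q -> infin Q'.
Proof. by move=> QQ H Q1 /H [c [/QQ]]; exists c. Qed.

Lemma cofin_infin (Q : k -> Prop) : cofin Q -> infin Q.
Proof. by move=> H Q1 /(cofin_and H)/cofin_ex. Qed.

Lemma infin_poly0 (p : {poly k}) : infin (fun c => p.[c] = 0) -> p = 0.
Proof.
move=> H; apply/eqP; apply: contrapT => /negP /cofin_neq0 /H [c [-> ]].
by rewrite eqxx.
Qed.

Lemma cofinNinfin (Q : k -> Prop) : ~ infin Q -> cofin (fun c => ~ Q c).
Proof.
move=> H; apply: contrapT => H'; apply: H => Q1 H1; apply: contrapT => H2; apply: H'.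
by apply: cofinW H1 => c Hc Qc; apply: H2; exists c.
Qed.

Lemma infin_pigeonhole (I : finType) (Q : k -> Prop) (S : I -> k -> Prop) :
  infin Q -> (forall c, Q c -> exists i, S i c) -> exists i, infin (S i).
Proof.
move=> HQ HS; apply: contrapT => H.
have: cofin (fun c => forall i, ~ S i c).
  by apply: cofin_forall => i; apply: cofinNinfin => Hi; apply: H; exists i.
by move/HQ => [c [/HS [i Hi] /(_ i)]].
Qed.

(** [P] and [Q] compress [M] to an identity matrix of size its rank; the determinant of the
    compressed line is a polynomial in c with value 1 at c = 0. *)
Lemma rank_line a b (M N : 'M[k]_(a, b)) :
  cofin (fun c => (\rank M <= \rank (M + c *: N)%R)%N).
Proof.
pose P := pinvmx (col_base M); pose Q := pinvmx (row_base M).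
have HP : P *m col_base M = 1%:M by rewrite mulVpmx ?col_base_full.
have HQ : row_base M *m Q = 1%:M by rewrite mulmxVp ?row_base_free.
have HM : P *m M *m Q = 1%:M by have := congr1 (fun Z => P *m Z *m Q) (mulmx_base M); rewrite /= mulmxA HP mul1mx HQ.
pose p := \det (map_mx polyC (P *m M *m Q) + 'X *: map_mx polyC (P *m N *m Q)).
have pE c : p.[c] = \det (P *m (M + c *: N) *m Q).
  rewrite /p -horner_evalE -det_map_mx; congr (\det _).
  apply/matrixP => i j; rewrite mulmxDr mulmxDl -scalemxAr -scalemxAl.
  by rewrite !mxE /= horner_evalE hornerD hornerM hornerX !hornerC.
exists p.
  apply/eqP => p0; have := pE 0; rewrite p0 horner0 scale0r addr0 HM det1.
  by move/eqP; rewrite eq_sym oner_eq0.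
move=> c; rewrite pE => H.
have: row_free (P *m (M + c *: N) *m Q) by rewrite row_free_unit unitmxE unitfE.
rewrite /row_free => /eqP E.
apply: (@leq_trans (\rank (P *m (M + c *: N)%R *m Q))); first by rewrite E.
by rewrite -mulmxA; apply: (leq_trans (mxrankM_maxr _ _)); apply: mxrankM_maxl.
Qed.
End Cofinite.

(** * Hom from projectives into a module, as matrices *)

Section XMul.
Variables (k : closedFieldType) (A : falgType k).
Implicit Type X : module A.

Lemma mactD X a b : mact X (a + b) = mact X a + mact X b.
Proof. by rewrite -[a in LHS]scale1r mact_lin scale1r. Qed.
Lemma mact0 X : mact X 0 = 0.
Proof. by apply: (addrI (mact X 0)); rewrite -mactD !addr0. Qed.
Lemma mactZ X c a : mact X (c *: a) = c *: mact X a.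
Proof. by rewrite -[c *: a]addr0 mact_lin mact0 addr0. Qed.
Lemma mact_sum X (I : Type) (r : seq I) (F : I -> A) :
  mact X (\sum_(i <- r) F i) = \sum_(i <- r) mact X (F i).
Proof. by apply: (big_morph (mact X) (mactD X) (mact0 X)). Qed.

(* The rows of [x] are elements of [X]: this is [Hom_A(f, X)] applied to [x], since
   [Hom_A(e_i A, X) = X e_i]. *)
Definition xmul X m p (x : 'M[k]_(m, mdim X)) (f : 'M[A]_(m, p)) : 'M[k]_(p, mdim X) :=
  \matrix_(t < p) \sum_u row u x *m mact X (f u t).

Lemma row_xmul X m p (x : 'M[k]_(m, mdim X)) (f : 'M[A]_(m, p)) t :
  row t (xmul x f) = \sum_u row u x *m mact X (f u t).
Proof. by rewrite rowK. Qed.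

Lemma xmulA X m p q (x : 'M[k]_(m, mdim X)) (f : 'M[A]_(m, p)) (g : 'M[A]_(p, q)) :
  xmul (xmul x f) g = xmul x (f *m g).
Proof.
apply/row_matrixP => t; rewrite !row_xmul.
under eq_bigr => u _ do rewrite row_xmul mulmx_suml.
rewrite exchange_big; apply: eq_bigr => u _ /=.
rewrite mxE mact_sum mulmx_sumr; apply: eq_bigr => j _.
by rewrite mact_mul mulmxA.
Qed.

Lemma xmulDl X m p (x y : 'M[k]_(m, mdim X)) (f : 'M[A]_(m, p)) :
  xmul (x + y) f = xmul x f + xmul y f.
Proof.
apply/row_matrixP => t; rewrite linearD /= !row_xmul -big_split; apply: eq_bigr => u _.
by rewrite linearD /= mulmxDl.
Qed.
Lemma xmulZl X m p c (x : 'M[k]_(m, mdim X)) (f : 'M[A]_(m, p)) :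
  xmul (c *: x) f = c *: xmul x f.
Proof.
apply/row_matrixP => t; rewrite linearZ /= !row_xmul scaler_sumr; apply: eq_bigr => u _.
by rewrite linearZ /= scalemxAl.
Qed.
Lemma xmulBl X m p (x y : 'M[k]_(m, mdim X)) (f : 'M[A]_(m, p)) :
  xmul (x - y) f = xmul x f - xmul y f.
Proof. by rewrite -scaleN1r xmulDl xmulZl scaleN1r. Qed.
Lemma xmul0l X m p (f : 'M[A]_(m, p)) : xmul (0 : 'M[k]_(m, mdim X)) f = 0.
Proof. by rewrite -(scale0r 0) xmulZl scale0r. Qed.
Lemma xmulDr X m p (x : 'M[k]_(m, mdim X)) (f g : 'M[A]_(m, p)) :
  xmul x (f + g) = xmul x f + xmul x g.
Proof.
apply/row_matrixP => t; rewrite linearD /= !row_xmul -big_split; apply: eq_bigr => u _.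
by rewrite mxE mactD mulmxDr.
Qed.
Lemma xmul1 X m (x : 'M[k]_(m, mdim X)) : xmul x 1%:M = x.
Proof.
apply/row_matrixP => t; rewrite row_xmul (bigD1 t) //= big1.
  by rewrite mxE eqxx mact_one mulmx1 addr0.
by move=> u /negPf ut; rewrite mxE ut mact0 mulmx0.
Qed.
Lemma xmul_hom X Y m p (M : 'M_(mdim X, mdim Y)) (x : 'M[k]_(m, mdim X)) (f : 'M[A]_(m, p)) :
  is_modhom M -> xmul (x *m M) f = xmul x f *m M.
Proof.
move=> HM; apply/row_matrixP => t; rewrite row_mul !row_xmul mulmx_suml.
by apply: eq_bigr => u _; rewrite row_mul -!mulmxA HM.
Qed.

(** The [k]-linear map [xmul _ f] on flattened tuples, through which surjectivity and injectivity of
    Hom_A(f, X) become rank conditions. *)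
Definition bact X m p (f : 'M[A]_(m, p)) : 'M[k]_(\sum_(i < m) mdim X, \sum_(j < p) mdim X) :=
  \mxblock_(u, t) mact X (f u t).

Definition flat X m (x : 'M[k]_(m, mdim X)) : 'rV[k]_(\sum_(i < m) mdim X) :=
  \mxrow_i row i x.
Definition unflat X m (v : 'rV[k]_(\sum_(i < m) mdim X)) : 'M[k]_(m, mdim X) :=
  \matrix_i submxrow v i.

Lemma flatK X m : cancel (@flat X m) (@unflat X m).
Proof. by move=> x; apply/row_matrixP => i; rewrite rowK mxrowK. Qed.
Lemma unflatK X m : cancel (@unflat X m) (@flat X m).
Proof. by move=> v; apply/mxrowP => i; rewrite mxrowK rowK. Qed.

Lemma flat_xmul X m p (x : 'M[k]_(m, mdim X)) (f : 'M[A]_(m, p)) :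
  flat (xmul x f) = flat x *m bact X f.
Proof.
rewrite /bact /flat mul_mxrow_mxblock; apply/mxrowP => i.
by rewrite !mxrowK row_xmul.
Qed.

Lemma bactM X m p q (f : 'M[A]_(m, p)) (g : 'M[A]_(p, q)) :
  bact X (f *m g) = bact X f *m bact X g.
Proof.
rewrite /bact mul_mxblock; apply/mxblockP => i j; rewrite !mxblockK mxE mact_sum.
by apply: eq_bigr => u _; rewrite mact_mul.
Qed.

Lemma bactD X m p (f g : 'M[A]_(m, p)) : bact X (f + g) = bact X f + bact X g.
Proof. by apply/matrixP => i j; rewrite !mxE mactD mxE. Qed.
Lemma bactZ X m p c (f : 'M[A]_(m, p)) : bact X (map_mx ( *:%R c) f) = c *: bact X f.
Proof. by apply/matrixP => i j; rewrite !mxE mactZ mxE. Qed.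
End XMul.

(** * Submodules, quotients and exact sequences *)

Section SubQuo.
Variables (k : closedFieldType) (A : falgType k).
Implicit Types X Y Z : module A.

Definition stable X q (N : 'M[k]_(q, mdim X)) := forall a : A, (N *m mact X a <= N)%MS.

Section Sub.
Variables (X : module A) (q : nat) (N : 'M[k]_(q, mdim X)) (sN : stable N).
Let R := row_base N.
Definition sub_act (a : A) := R *m mact X a *m pinvmx R.

Lemma sub_actK a : sub_act a *m R = R *m mact X a.
Proof.
rewrite /sub_act mulmxKpV // /R eq_row_base.
by apply: submx_trans (sN a); apply: submxMr; rewrite eq_row_base.
Qed.

Let Rinj m : injective (fun x : 'M_(m, _) => x *m R).
Proof. exact: row_free_inj (row_base_free N). Qed.

Lemma sub_act_lin c a b : sub_act (c *: a + b) = c *: sub_act a + sub_act b.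
Proof. by rewrite /sub_act mact_lin mulmxDr mulmxDl -scalemxAr -scalemxAl. Qed.
Lemma sub_act_mul a b : sub_act (a * b) = sub_act a *m sub_act b.
Proof. by apply: Rinj; rewrite /= -mulmxA !sub_actK mulmxA sub_actK mact_mul mulmxA. Qed.
Lemma sub_act_one : sub_act 1 = 1%:M.
Proof. by apply: Rinj; rewrite /= sub_actK mact_one mul1mx mulmx1. Qed.

Definition submod := Module sub_act_lin sub_act_mul sub_act_one.

Definition sub_inc : 'M[k]_(mdim submod, mdim X) := R.
Lemma sub_inc_hom : is_modhom sub_inc.
Proof. by move=> a; exact: sub_actK. Qed.
Lemma sub_inc_free : row_free sub_inc.
Proof. exact: row_base_free. Qed.
Lemma sub_inc_eq m (x : 'M[k]_(m, mdim X)) : (x <= N)%MS -> exists y, x = y *m sub_inc.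
Proof. by rewrite -(eq_row_base N) => /submxP. Qed.
Lemma sub_inc_le m (y : 'M[k]_(m, mdim submod)) : (y *m sub_inc <= N)%MS.
Proof. by rewrite -(eq_row_base N) submxMl. Qed.
End Sub.

Section Quo.
Variables (X : module A) (q : nat) (N : 'M[k]_(q, mdim X)) (sN : stable N).
Let K := col_base (cokermx N).
Let S := pinvmx K.
Let SK : S *m K = 1%:M. Proof. by rewrite mulVpmx ?col_base_full. Qed.
Let K0 m (x : 'M[k]_(m, mdim X)) : (x <= N)%MS = (x *m K == 0).
Proof.
rewrite -mulmx_cokermx_eq0 || rewrite submxE -[cokermx N in LHS]mulmx_base mulmxA -/K.
rewrite mulmx_free_eq0 ?row_base_free //.
Qed.

Definition quo_act (a : A) := S *m mact X a *m K.
Lemma quo_actK a : K *m quo_act a = mact X a *m K.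
Proof.
apply/eqP; rewrite -subr_eq0 /quo_act mulmxA [K *m (_ *m _)]mulmxA -mulmxBl.
suff: (K *m S *m mact X a - mact X a <= N)%MS by rewrite K0.
rewrite (_ : _ - _ = (K *m S - 1%:M) *m mact X a); last by rewrite mulmxBl mul1mx.
apply: submx_trans (sN a); apply: submxMr; rewrite K0 mulmxBl -mulmxA SK mulmx1 mul1mx.
by rewrite subrr.
Qed.

Let Kinj m : injective (fun x : 'M_(_, m) => K *m x).
Proof. exact: row_full_inj (col_base_full (cokermx N)). Qed.

Lemma quo_act_lin c a b : quo_act (c *: a + b) = c *: quo_act a + quo_act b.
Proof. by rewrite /quo_act mact_lin mulmxDr mulmxDl -scalemxAr -scalemxAl. Qed.
Lemma quo_act_mul a b : quo_act (a * b) = quo_act a *m quo_act b.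
Proof. by apply: Kinj; rewrite /= mulmxA !quo_actK -mulmxA quo_actK mact_mul mulmxA. Qed.
Lemma quo_act_one : quo_act 1 = 1%:M.
Proof. by apply: Kinj; rewrite /= quo_actK mact_one mul1mx mulmx1. Qed.

Definition quomod := Module quo_act_lin quo_act_mul quo_act_one.
Definition quo_pr : 'M[k]_(mdim X, mdim quomod) := K.
Lemma quo_pr_hom : is_modhom quo_pr.
Proof. by move=> a; rewrite -quo_actK. Qed.
Lemma quo_pr_full : row_full quo_pr.
Proof. exact: col_base_full. Qed.
Lemma quo_pr_eq0 m (x : 'M[k]_(m, mdim X)) : (x <= N)%MS = (x *m quo_pr == 0).
Proof. exact: K0. Qed.
Lemma quo_pr_lift m (y : 'M[k]_(m, mdim quomod)) : exists x, y = x *m quo_pr.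
Proof. by exists (y *m S); rewrite -mulmxA SK mulmx1. Qed.
End Quo.

Definition exact_seq Y X Z (R : 'M[k]_(mdim Y, mdim X)) (K : 'M[k]_(mdim X, mdim Z)) :=
  [/\ is_modhom R, is_modhom K, row_free R, row_full K
    & forall m (x : 'M[k]_(m, mdim X)), x *m K = 0 <-> exists y, x = y *m R].

Lemma exact_subquo X q (N : 'M[k]_(q, mdim X)) (sN : stable N) :
  exact_seq (sub_inc sN) (quo_pr sN).
Proof.
split; [exact: sub_inc_hom | exact: quo_pr_hom | exact: sub_inc_free | exact: quo_pr_full|].
move=> m x; split.
  by move/eqP; rewrite -quo_pr_eq0 => /(sub_inc_eq sN).
by case=> y ->; apply/eqP; rewrite -quo_pr_eq0 sub_inc_le.
Qed.

(** Multiplication by an idempotent is exact: the part of X a killed by [K] comes from [Y] and is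
    fixed by a, so it is Y a. *)
Lemma exact_rank Y X Z R K : @exact_seq Y X Z R K ->
  forall a : A, a * a = a ->
  \rank (mact X a) = (\rank (mact Y a) + \rank (mact Z a))%N.
Proof.
move=> [hR hK fR fK E] a aa.
rewrite -(mxrank_mul_ker (mact X a) K) addnC hK; congr (_ + _)%N.
  rewrite -[RHS](mxrankMfree _ fR) hR; apply/eqP; rewrite eqn_leq.
  apply/andP; split; apply: mxrankS; last first.
    rewrite sub_capmx submxMl /=; apply/sub_kermxP; rewrite -mulmxA hK mulmxA.
    suff -> : R *m K = 0 by rewrite mul0mx.
    by apply/E; exists 1%:M; rewrite mul1mx.
  set V := capmx _ _; have VX : (V <= mact X a)%MS by apply: capmxSl.
  have /E [y Ey] : V *m K = 0 by apply/sub_kermxP; apply: capmxSr.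
  suff -> : V = V *m mact X a by rewrite {1}Ey -mulmxA submxMl.
  by have /submxP [w ->] := VX; rewrite -mulmxA -mact_mul aa.
by rewrite (eqmxMfull _ fK).
Qed.

Lemma kernel_stable X Z (K : 'M[k]_(mdim X, mdim Z)) : is_modhom K -> stable (kermx K).
Proof. by move=> hK a; apply/sub_kermxP; rewrite -mulmxA hK mulmxA mulmx_ker mul0mx. Qed.

Lemma factor_exact X Z : factor_module Z X ->
  exists Y R K, @exact_seq Y X Z R K.
Proof.
case=> K [hK fK]; exists (submod (kernel_stable hK)), (sub_inc (kernel_stable hK)), K.
split => //; [exact: sub_inc_hom | exact: sub_inc_free |].
move=> m x; split; first by move/sub_kermxP/(sub_inc_eq (kernel_stable hK)).
by case=> y ->; apply/sub_kermxP; apply: sub_inc_le.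
Qed.

Lemma image_stable X Y (R : 'M[k]_(mdim Y, mdim X)) : is_modhom R -> stable R.
Proof. by move=> hR a; rewrite -hR submxMl. Qed.

Lemma sub_exact X Y : sub_module Y X ->
  exists Z R K, @exact_seq Y X Z R K.
Proof.
case=> R [hR fR]; exists (quomod (image_stable hR)), R, (quo_pr (image_stable hR)).
split => //; [exact: quo_pr_hom | exact: quo_pr_full |].
move=> m x; split; last by case=> y ->; apply/eqP; rewrite -quo_pr_eq0 submxMl.
by move/eqP; rewrite -quo_pr_eq0 => /submxP.
Qed.

Lemma exact_factor Y X Z R K : @exact_seq Y X Z R K -> factor_module Z X.
Proof. by case=> *; exists K. Qed.
Lemma exact_sub Y X Z R K : @exact_seq Y X Z R K -> sub_module Y X.
Proof. by case=> *; exists R. Qed.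

Lemma factor_trans X Y Z : factor_module Y X -> factor_module Z Y -> factor_module Z X.
Proof.
case=> K [hK fK] [L [hL fL]]; exists (K *m L); split.
  by move=> a; rewrite mulmxA hK -mulmxA hL mulmxA.
by rewrite /row_full (eqmxMfull _ fK).
Qed.
Lemma sub_trans X Y Z : sub_module Y X -> sub_module Z Y -> sub_module Z X.
Proof.
case=> K [hK fK] [L [hL fL]]; exists (L *m K); split.
  by move=> a; rewrite mulmxA hL -mulmxA hK mulmxA.
by rewrite /row_free mxrankMfree.
Qed.
Lemma factor_refl X : factor_module X X.
Proof.
exists 1%:M; split; first by move=> a; rewrite mulmx1 mul1mx.
by rewrite row_full_unit unitmx1.
Qed.
Lemma sub_refl X : sub_module X X.
Proof.
exists 1%:M; split; first by move=> a; rewrite mulmx1 mul1mx.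
by rewrite row_free_unit unitmx1.
Qed.
Lemma factor_rank X Z a : factor_module Z X -> a * a = a ->
  (\rank (mact Z a) <= \rank (mact X a))%N.
Proof. by case/factor_exact => Y [R [K E]] /(exact_rank E) ->; rewrite leq_addl. Qed.
Lemma sub_rank X Y a : sub_module Y X -> a * a = a ->
  (\rank (mact Y a) <= \rank (mact X a))%N.
Proof. by case/sub_exact => Z [R [K E]] /(exact_rank E) ->; rewrite leq_addr. Qed.
End SubQuo.

(** * Lines of maps *)

Section Scaling.
Variables (k : closedFieldType) (A : falgType k).
Definition sc m p (c : k) (f : 'M[A]_(m, p)) := map_mx ( *:%R c) f.
Definition ln m p (f g : 'M[A]_(m, p)) (c : k) := f + sc c (g - f).

Lemma scMl m p q c (f : 'M[A]_(m, p)) (g : 'M[A]_(p, q)) : sc c f *m g = sc c (f *m g).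
Proof.
apply/matrixP => i j; rewrite !mxE scaler_sumr; apply: eq_bigr => u _.
by rewrite mxE scalerAl.
Qed.
Lemma scMr m p q c (f : 'M[A]_(m, p)) (g : 'M[A]_(p, q)) : f *m sc c g = sc c (f *m g).
Proof.
apply/matrixP => i j; rewrite !mxE scaler_sumr; apply: eq_bigr => u _.
by rewrite mxE scalerAr.
Qed.
Lemma scD m p c (f g : 'M[A]_(m, p)) : sc c (f + g) = sc c f + sc c g.
Proof. by apply/matrixP => i j; rewrite !mxE scalerDr. Qed.
Lemma scDl m p c d (f : 'M[A]_(m, p)) : sc (c + d) f = sc c f + sc d f.
Proof. by apply/matrixP => i j; rewrite !mxE scalerDl. Qed.
Lemma sc1 m p (f : 'M[A]_(m, p)) : sc 1 f = f.
Proof. by apply/matrixP => i j; rewrite !mxE scale1r. Qed.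
Lemma sc0 m p (f : 'M[A]_(m, p)) : sc 0 f = 0.
Proof. by apply/matrixP => i j; rewrite !mxE scale0r. Qed.
Lemma ln_sym m p (f g : 'M[A]_(m, p)) c : ln f g c = ln g f (1 - c).
Proof.
apply/matrixP => i j; rewrite !mxE scalerBl scale1r addrA [g i j + (f i j - g i j)]addrC subrK.
by rewrite -scalerN opprB.
Qed.
End Scaling.

(** * Shapes of two-term complexes and openness along lines *)

Section Shapes.
Variables (k : closedFieldType) (A : falgType k) (n : nat) (e : 'I_n -> A).
Hypothesis He : complete_projectives e.
Let ee_ i : e i * e i = e i. Proof. by case: He => /(_ i) []. Qed.

Definition Epr m (s : 'I_m -> 'I_n) : 'M[A]_m := diag_mx (\row_i e (s i)).

Lemma EprE m (s : 'I_m -> 'I_n) i j : Epr s i j = e (s i) *+ (i == j).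
Proof. by rewrite !mxE. Qed.
Lemma Epr_l m p (s : 'I_m -> 'I_n) (f : 'M[A]_(m, p)) i j : (Epr s *m f) i j = e (s i) * f i j.
Proof. by rewrite mul_diag_mx !mxE. Qed.
Lemma Epr_r m p (s : 'I_m -> 'I_n) (f : 'M[A]_(p, m)) i j : (f *m Epr s) i j = f i j * e (s j).
Proof. by rewrite mul_mx_diag !mxE. Qed.
Lemma EprK m (s : 'I_m -> 'I_n) : Epr s *m Epr s = Epr s.
Proof. by apply/matrixP => i j; rewrite Epr_l EprE mulrnAr ee_. Qed.

Definition hom m p (r : 'I_m -> 'I_n) (s : 'I_p -> 'I_n) (f : 'M[A]_(m, p)) :=
  Epr r *m f *m Epr s = f.

Section Hom.
Variables (m p : nat) (r : 'I_m -> 'I_n) (s : 'I_p -> 'I_n).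
Lemma hom_l f : hom r s f -> Epr r *m f = f.
Proof. by move=> <-; rewrite !mulmxA EprK. Qed.
Lemma hom_r f : hom r s f -> f *m Epr s = f.
Proof. by move=> <-; rewrite -!mulmxA EprK. Qed.
Lemma homI f : Epr r *m f = f -> f *m Epr s = f -> hom r s f.
Proof. by rewrite /hom => -> ->. Qed.
Lemma hom_sand f : hom r s (Epr r *m f *m Epr s).
Proof. by rewrite /hom !mulmxA EprK -!mulmxA EprK. Qed.
Lemma homD f g : hom r s f -> hom r s g -> hom r s (f + g).
Proof. by rewrite /hom mulmxDr mulmxDl => -> ->. Qed.
Lemma homB f g : hom r s f -> hom r s g -> hom r s (f - g).
Proof. by rewrite /hom mulmxBr mulmxBl => -> ->. Qed.
Lemma homZ c f : hom r s f -> hom r s (sc c f).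
Proof. by rewrite /hom scMr scMl => ->. Qed.
Lemma hom0 : hom r s 0.
Proof. by rewrite /hom mulmx0 mul0mx. Qed.
Lemma hom_ln f g c : hom r s f -> hom r s g -> hom r s (ln f g c).
Proof. by move=> hf hg; apply: homD => //; apply: homZ; apply: homB. Qed.
End Hom.
Lemma homM m p q (r : 'I_m -> 'I_n) (s : 'I_p -> 'I_n) (t : 'I_q -> 'I_n) f g :
  hom r s f -> hom s t g -> hom r t (f *m g).
Proof.
by move=> hf hg; apply: homI; [rewrite mulmxA (hom_l hf) | rewrite -mulmxA (hom_r hg)].
Qed.
Lemma hom_Epr m (s : 'I_m -> 'I_n) : hom s s (Epr s).
Proof. by apply: homI; apply: EprK. Qed.

(* [y1] and [y0] list the indecomposable summands of the terms of degree -1 and 0 of a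
   two-term complex; its differential is then a matrix in [mor]. *)
Record shp := Shp { z1 : nat; z0 : nat; y1 : 'I_z1 -> 'I_n; y0 : 'I_z0 -> 'I_n }.

Arguments y1 : clear implicits.
Arguments y0 : clear implicits.
Implicit Types (S T : shp) (X : module A).
Notation mor S := 'M[A]_(z0 S, z1 S).
Definition shom S (f : mor S) := hom (y0 S) (y1 S) f.

(* [Esurj f X] says that [Hom_A(f, X)] is onto, i.e. [Hom(P_f, X[1]) = 0], and [Hinj f X]
   that it is injective, i.e. [Hom_A(coker f, X) = 0]. *)
Definition Esurj S (f : mor S) X := forall y : 'M[k]_(z1 S, mdim X),
  xmul y (Epr (y1 S)) = y -> exists x, xmul x f = y.
Definition Hinj S (f : mor S) X := forall x : 'M[k]_(z0 S, mdim X),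
  xmul x (Epr (y0 S)) = x -> xmul x f = 0 -> x = 0.
Definition Ez S T (f : mor S) (g : mor T) := forall h : 'M[A]_(z0 T, z1 S),
  hom (y0 T) (y1 S) h -> exists a b,
  [/\ hom (y1 T) (y1 S) a, hom (y0 T) (y0 S) b
    & h = g *m a + b *m f].

Arguments shom : clear implicits.
Arguments Esurj : clear implicits.
Arguments Hinj : clear implicits.
Arguments Ez : clear implicits.

(** The dimension of Hom_A(P, X) for the projective P with list of summands [s]. *)
Definition nrk X m (s : 'I_m -> 'I_n) := (\sum_i \rank (mact X (e (s i))))%N.

Lemma rank_bact_Epr X m (s : 'I_m -> 'I_n) : \rank (bact X (Epr s)) = nrk X s.
Proof.
rewrite /nrk -rank_mxdiag; congr (\rank _); apply/mxblockP => i j.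
rewrite mxblockK /mxdiag mxblockK EprE; case: eqP => [->|ij].
  by rewrite mulr1n conform_mx_id.
by rewrite mulr0n mact0.
Qed.

Lemma bact_le_r X m p (r : 'I_m -> 'I_n) (s : 'I_p -> 'I_n) f : hom r s f ->
  (bact X f <= bact X (Epr s))%MS.
Proof. by move=> hf; rewrite -(hom_r hf) bactM submxMl. Qed.

Lemma flat0 X m : flat (0 : 'M[k]_(m, mdim X)) = 0.
Proof. by rewrite /flat; apply/mxrowP => i; rewrite mxrowK row0 submxrow0. Qed.

(** The row space of [bact X f] lies in that of the idempotent [bact X (Epr (y1 S))], whose rank is
    [nrk X (y1 S)]; surjectivity is the equality of these two spaces. *)
Lemma Esurj_rank S f X : shom S f -> Esurj S f X <-> \rank (bact X f) = nrk X (y1 S).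
Proof.
move=> hf; rewrite -rank_bact_Epr; split=> [H|H].
  apply/eqP; rewrite eqn_leq; apply/andP; split; apply: mxrankS.
    exact: bact_le_r hf.
  apply/row_subP => i; set v := row i _.
  have vE : v *m bact X (Epr (y1 S)) = v.
    by rewrite /v -row_mul -bactM EprK.
  have [|x Hx] := H (unflat v).
    by apply: (can_inj (@flatK _ _ X _)); rewrite flat_xmul !unflatK.
  by rewrite -[v]unflatK -Hx flat_xmul submxMl.
move=> y yE; have le := bact_le_r X hf.
have: (flat y <= bact X f)%MS.
  apply: submx_trans (_ : (bact X (Epr (y1 S)) <= _)%MS); last first.
    by rewrite -(geq_leqif (mxrank_leqif_sup le)) H.
  by rewrite -yE flat_xmul submxMl.
case/submxP => w Hw; exists (unflat w).
by apply: (can_inj (@flatK _ _ X _)); rewrite flat_xmul unflatK Hw.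
Qed.

Lemma Hinj_rank S f X : shom S f -> Hinj S f X <-> \rank (bact X f) = nrk X (y0 S).
Proof.
move=> hf; rewrite -rank_bact_Epr; set E := bact X (Epr _).
have Ef : E *m bact X f = bact X f by rewrite -bactM (hom_l hf).
have EE : E *m E = E by rewrite -bactM EprK.
have D := mxrank_mul_ker E (bact X f); rewrite Ef in D.
split=> [H|H].
  rewrite -D; suff -> : (E :&: kermx (bact X f))%MS = 0 by rewrite mxrank0 addn0.
  apply/row_matrixP => i; rewrite row0; set v := row i _.
  have: (v <= E :&: kermx (bact X f))%MS by apply: row_sub.
  rewrite sub_capmx => /andP[/submxP [w vE] /sub_kermxP vf].
  rewrite -[v]unflatK (H (unflat v)) ?flat0 //; apply: (can_inj (@flatK _ _ X _)).
    by rewrite flat_xmul unflatK -/E vE -mulmxA EE.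
  by rewrite flat_xmul unflatK vf flat0.
have K0 : (E :&: kermx (bact X f))%MS = 0.
  by apply/eqP; rewrite -mxrank_eq0; move: D; rewrite H; lia.
move=> x xE xf; apply: (can_inj (@flatK _ _ X _)); rewrite flat0; apply/eqP.
rewrite -submx0 -K0 sub_capmx -{1}xE flat_xmul submxMl /=.
by apply/sub_kermxP; rewrite -flat_xmul xf flat0.
Qed.

Lemma rank_bact_le S f X : shom S f ->
  (\rank (bact X f) <= nrk X (y1 S))%N /\ (\rank (bact X f) <= nrk X (y0 S))%N.
Proof.
move=> hf; rewrite -!rank_bact_Epr; split.
  by rewrite -{1}(hom_r hf) bactM mxrankM_maxr.
by rewrite -{1}(hom_l hf) bactM mxrankM_maxl.
Qed.

Definition thS S X : int := (nrk X (y0 S))%:Z - (nrk X (y1 S))%:Z.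

Lemma Esurj_ge0 S (f : mor S) X : shom S f -> Esurj S f X -> 0 <= thS S X.
Proof.
by move=> hf /(Esurj_rank X hf) H; have [_] := rank_bact_le X hf; rewrite /thS; lia.
Qed.
Lemma Hinj_le0 S (f : mor S) X : shom S f -> Hinj S f X -> thS S X <= 0.
Proof.
by move=> hf /(Hinj_rank X hf) H; have [+ _] := rank_bact_le X hf; rewrite /thS; lia.
Qed.
Lemma Esurj_Hinj S (f : mor S) X : shom S f -> thS S X = 0 -> Esurj S f X <-> Hinj S f X.
Proof.
move=> hf H0; rewrite Esurj_rank // Hinj_rank //.
by have -> : nrk X (y1 S) = nrk X (y0 S) by move: H0; rewrite /thS; lia.
Qed.

(* Openness along lines is the only trace of the Zariski topology that is needed. *)
Definition lopen S (P : mor S -> Prop) := forall f g : mor S, shom S f -> shom S g ->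
  P f -> cofin (fun c => P (ln f g c)).

Lemma Esurj_open S X : lopen (fun f : mor S => Esurj S f X).
Proof.
move=> f g hf hg /(Esurj_rank X hf) Hf; apply: cofinW (rank_line (bact X f) (bact X (g - f))) => c.
rewrite -bactZ -bactD -/(sc _ _) -/(ln f g c) => Hc.
have h := hom_ln c hf hg; apply/(Esurj_rank X h).
by have [H _] := rank_bact_le X h; lia.
Qed.
Lemma Hinj_open S X : lopen (fun f : mor S => Hinj S f X).
Proof.
move=> f g hf hg /(Hinj_rank X hf) Hf; apply: cofinW (rank_line (bact X f) (bact X (g - f))) => c.
rewrite -bactZ -bactD -/(sc _ _) -/(ln f g c) => Hc.
have h := hom_ln c hf hg; apply/(Hinj_rank X h).
by have [_ H] := rank_bact_le X h; lia.
Qed.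
Lemma lopen_and S (P Q : mor S -> Prop) : lopen P -> lopen Q -> lopen (fun f => P f /\ Q f).
Proof. by move=> HP HQ f g hf hg [Pf Qf]; apply: cofin_and; [apply: HP | apply: HQ]. Qed.
Lemma lopen_back S (P : mor S -> Prop) f g : lopen P -> shom S f -> shom S g ->
  P g -> cofin (fun c => P (ln f g c)).
Proof.
move=> HP hf hg Pg; have [p p0 Hp] := HP g f hg hf Pg.
(* The line from [f] to [g] is the line from [g] to [f] read at 1 - c. *)
exists (p \Po (1 - 'X)).
  have [c Hc] := poly_nonroot p0; apply/eqP => E.
  have := horner_comp p (1 - 'X) (1 - c); rewrite E horner0 !hornerE opprB addrC subrK.
  by move/esym/eqP; rewrite (negPf Hc).
by move=> c; rewrite horner_comp !hornerE ln_sym => /Hp.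
Qed.
(** Two cofinite sets of parameters on the line joining [f] and [g] meet; this stands in for
    irreducibility of the whole space of maps. *)
Lemma lopen_meet S (P Q : mor S -> Prop) f g : lopen P -> lopen Q -> shom S f -> shom S g ->
  P f -> Q g -> exists h, [/\ shom S h, P h & Q h].
Proof.
move=> HP HQ hf hg Pf Qg.
have [c [Pc Qc]] := cofin_ex (cofin_and (HP f g hf hg Pf) (lopen_back HQ hf hg Qg)).
by exists (ln f g c); split => //; apply: hom_ln.
Qed.
Lemma lopen_all (I : eqType) (r : seq I) S (P : I -> mor S -> Prop) :
  (forall i, i \in r -> lopen (P i)) -> (forall i, i \in r -> exists2 f, shom S f & P i f) ->
  lopen (fun f => forall i, i \in r -> P i f) /\
  exists2 h, shom S h & forall i, i \in r -> P i h.
Proof.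
elim: r => [|i r IH] HP Hex.
  by split; [move=> *; apply: cofin_true | exists 0 => //; apply: hom0].
have [j Hj|j Hj|oR [h hh Hh]] := IH.
- by apply: HP; rewrite inE Hj orbT.
- by apply: Hex; rewrite inE Hj orbT.
have oi : lopen (P i) by apply: HP; rewrite mem_head.
split.
  move=> f g hf hg Pf.
  apply: cofinW (cofin_and (oi f g hf hg (Pf _ (mem_head _ _))) (oR f g hf hg _)).
    by move=> c [Hi Hr] j; rewrite inE => /predU1P [->|/Hr].
  by move=> j jr; apply: Pf; rewrite inE jr orbT.
have [f hf Pf] := Hex i (mem_head _ _).
have [u [hu Pu Qu]] := lopen_meet oi oR hf hh Pf Hh.
by exists u => // j; rewrite inE => /predU1P [->|/Qu].
Qed.
End Shapes.
Notation mor A S := 'M[A]_(z0 S, z1 S).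
Arguments Epr {k A n} e {m} s.
Arguments hom {k A n} e {m p} r s f.
Arguments shom {k A n} e S f.
Arguments Esurj {k A n} e S f X.
Arguments Hinj {k A n} e S f X.
Arguments Ez {k A n} e S T f g.
Arguments nrk {k A n} e X {m} s.
Arguments thS {k A n} e S X.
Arguments lopen {k A n} e S P.
Arguments y1 {n} s.
Arguments y0 {n} s.

(** * Torsion sequences and the classes Tbar and Fbar *)

Section TF.
Variables (k : closedFieldType) (A : falgType k) (n : nat) (e : 'I_n -> A).
Hypothesis He : complete_projectives e.
Let ee_ i : e i * e i = e i. Proof. by case: He => /(_ i) []. Qed.
Implicit Types (S T : shp n) (X Y Z : module A).

Lemma Esurj_factor S f X Z : factor_module Z X -> Esurj e S f X -> Esurj e S f Z.
Proof.
case=> K [hK fK] H y yE.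
have [y' Ey] : exists y', y = y' *m K by apply/submxP; apply: submx_full.
have [|x Hx] := H (xmul y' (Epr e (y1 S))); first by rewrite xmulA EprK.
by exists (x *m K); rewrite xmul_hom // Hx -xmul_hom // -Ey.
Qed.

Lemma Hinj_sub S f X Y : sub_module Y X -> Hinj e S f X -> Hinj e S f Y.
Proof.
case=> R [hR fR] H x xE xf; apply: (row_free_inj fR) => /=; rewrite mul0mx.
by apply: H; rewrite -?[xmul _ _](xmul_hom _ _ hR) ?xmul_hom ?xE ?xf ?mul0mx.
Qed.

Lemma Esurj_ext S f X Y Z R K : shom e S f -> @exact_seq _ _ Y X Z R K ->
  Esurj e S f Y -> Esurj e S f Z -> Esurj e S f X.
Proof.
move=> hf [hR hK fR fK E] HY HZ y yE.
have [|z Hz] := HZ (y *m K); first by rewrite xmul_hom ?yE.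
have [x0 Ex0] : exists x0, z = x0 *m K by apply/submxP; apply: submx_full.
have /E [w Hw] : (y - xmul x0 f) *m K = 0.
  by rewrite mulmxBl -xmul_hom // -Ex0 Hz subrr.
have [|x Hx] := HY w.
  apply: (row_free_inj fR) => /=; rewrite -xmul_hom // -Hw.
  by rewrite xmulBl yE xmulA (hom_r He hf).
exists (x *m R + x0); rewrite xmulDl xmul_hom // Hx -Hw.
by rewrite subrK.
Qed.

Lemma Hinj_ext S f X Y Z R K : shom e S f -> @exact_seq _ _ Y X Z R K ->
  Hinj e S f Y -> Hinj e S f Z -> Hinj e S f X.
Proof.
move=> hf [hR hK fR fK E] HY HZ x xE xf.
have /E [w Hw] : x *m K = 0.
  by apply: HZ; rewrite xmul_hom ?xE ?xf ?mul0mx.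
rewrite Hw (HY w) ?mul0mx //; apply: (row_free_inj fR) => /=.
  by rewrite -xmul_hom // -Hw.
by rewrite -xmul_hom // -Hw xf mul0mx.
Qed.

Section Generated.
Variable X : module A.

Lemma xmul_stable q (N : 'M[k]_(q, mdim X)) m p (x : 'M[k]_(m, mdim X)) (f : 'M[A]_(m, p)) :
  stable N -> (x <= N)%MS -> (xmul x f <= N)%MS.
Proof.
move=> sN xN; apply/row_subP => t; rewrite row_xmul; apply: summx_sub => u _.
by apply: submx_trans (sN (f u t)); apply: submxMr; apply: submx_trans (row_sub u x) xN.
Qed.

Let b := vbasis (fullv : {vspace A}).

(** The submodule generated by the rows of [x]; by linearity a basis of [A] supplies enough
    multipliers. *)
Definition gen m (x : 'M[k]_(m, mdim X)) : 'M[k]_(mdim X) :=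
  (\sum_(i < \dim (fullv : {vspace A})) <<x *m mact X b`_i>>)%MS.

Let act_b a : mact X a = \sum_(i < \dim (fullv : {vspace A})) coord b i a *: mact X b`_i.
Proof.
rewrite {1}(coord_vbasis (memvf a)) mact_sum; apply: eq_bigr => i _.
by rewrite mactZ.
Qed.

Lemma gen_act m (x : 'M[k]_(m, mdim X)) a : (x *m mact X a <= gen x)%MS.
Proof.
rewrite act_b mulmx_sumr; apply: summx_sub => i _.
by rewrite -scalemxAr scalemx_sub // (sumsmx_sup i) // genmxE.
Qed.

Lemma gen_le m (x : 'M[k]_(m, mdim X)) : (x <= gen x)%MS.
Proof. by have := gen_act x 1; rewrite mact_one mulmx1. Qed.

Lemma gen_stable m (x : 'M[k]_(m, mdim X)) : stable (gen x).
Proof.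
move=> a; rewrite sumsmxMr_gen; apply/sumsmx_subP => i _.
rewrite genmxE (eqmxMr _ (genmxE _)) -mulmxA -mact_mul; exact: gen_act.
Qed.

Lemma genP m p (x : 'M[k]_(m, mdim X)) (y : 'M[k]_(p, mdim X)) :
  (y <= gen x)%MS -> exists a : 'M[A]_(m, p), y = xmul x a.
Proof.
move=> /sub_sumsmxP [u ->].
have /fin_all_exists [w Hw] i : exists w : 'M_(p, m),
    u i *m <<x *m mact X b`_i>>%MS = w *m (x *m mact X b`_i).
  by apply/submxP; apply: submx_trans (submxMl _ _) _; rewrite genmxE.
exists (\matrix_(i, j) \sum_l w l j i *: b`_l).
apply/row_matrixP => t; rewrite row_xmul linear_sum /=.
under eq_bigr => i _ do rewrite Hw row_mul mulmxA (mulmx_sum_row (row t (w i)) x) mulmx_suml.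
rewrite exchange_big; apply: eq_bigr => v _ /=.
rewrite mxE mact_sum mulmx_sumr; apply: eq_bigr => l _.
by rewrite mactZ -scalemxAr -scalemxAl mxE.
Qed.
End Generated.

(** [Esurj] for the submodule [N], phrased inside [X] so that submodules can be enlarged without
    changing the ambient module. *)
Definition EsOn S (f : mor A S) X (N : 'M[k]_(mdim X)) := forall y : 'M[k]_(z1 S, mdim X),
  (y <= N)%MS -> xmul y (Epr e (y1 S)) = y -> exists2 x, (x <= N)%MS & xmul x f = y.

Section Torsion.
Variables (I J : Type) (SI : I -> shp n) (SJ : J -> shp n).
Variables (g : forall i, mor A (SI i)) (f : forall j, mor A (SJ j)).
Hypothesis hf : forall j, shom e (SJ j) (f j).
Hypothesis E0 : forall i j, Ez e (SJ j) (SI i) (f j) (g i).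

(** A new target is z + x a with z in [N]. Writing a = g a' + b f gives x a = (x g) a' + (x b) f:
    the first term lies in [N], where [HN] solves the equation, and the second is in the image
    already. *)
Lemma EsOn_gen X (N : 'M[k]_(mdim X)) i j (x : 'M[k]_(z0 (SI i), mdim X)) :
  stable N -> EsOn (f j) N -> xmul x (Epr e (y0 (SI i))) = x ->
  (xmul x (g i) <= N)%MS -> EsOn (f j) (N + gen x)%MS.
Proof.
move=> sN HN xE xg y /sub_addsmxP [[u v] /= Hy] yE.
have [a Ha] := genP (submxMl v (gen x)).
have uN := submxMl u N; move: Ha uN Hy; set w := v *m _; set z := u *m N => Ha zN Hy.
pose h := Epr e (y0 (SI i)) *m a *m Epr e (y1 (SJ j)).
have [a' [b [ha hb hE]]] := E0 (hom_sand He _ _ _ : hom e _ _ h).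
pose w0 := xmul z (Epr e (y1 (SJ j))) + xmul (xmul x (g i)) a'.
have w0N : (w0 <= N)%MS by apply: addmx_sub; apply: xmul_stable.
have [|x' x'N Hx'] := HN w0 w0N.
  by rewrite /w0 xmulDl xmulA EprK //; congr (_ + _); rewrite xmulA (hom_r He ha).
exists (x' + xmul x b).
  apply: addmx_sub; first by apply: submx_trans x'N _; apply: addsmxSl.
  apply: submx_trans (addsmxSr _ _); apply: xmul_stable; last exact: gen_le.
  exact: gen_stable.
rewrite xmulDl Hx' /w0 -yE Hy xmulDl -addrA; congr (_ + _).
by rewrite Ha !xmulA -xmulDr -hE /h -mulmxA -xmulA xE.
Qed.

(** [Y] is a submodule [N] of largest rank on which all Hom(f_j, N) are onto. By [EsOn_gen] any [x]
    with x g_i inside [N] could be adjoined, so maximality puts it in [N], and this is injectivity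
    on the quotient. *)
Lemma torsion_seq X : exists Y Z R K, [/\ @exact_seq _ _ Y X Z R K,
  forall j, Esurj e (SJ j) (f j) Y & forall i, Hinj e (SI i) (g i) Z].
Proof.
pose good (N : 'M[k]_(mdim X)) := stable N /\ forall j, EsOn (f j) N.
pose P r := `[< exists2 N, good N & \rank N = r >].
have P0 : exists r, P r.
  exists 0%N; apply/asboolP; exists 0; last exact: mxrank0.
  split=> [a|j y]; first by rewrite mul0mx sub0mx.
  by rewrite submx0 => /eqP -> _; exists 0; rewrite ?sub0mx ?xmul0l.
have Pm r : P r -> (r <= mdim X)%N by case/asboolP => N _ <-; apply: rank_leq_row.
case: (ex_maxnP P0 Pm) => r /asboolP [N [sN HN] rN] maxN.
have key i (x : 'M[k]_(z0 (SI i), mdim X)) :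
    xmul x (Epr e (y0 (SI i))) = x -> (xmul x (g i) <= N)%MS -> (x <= N)%MS.
  move=> xE xg; have le : (N <= N + gen x)%MS by apply: addsmxSl.
  apply: submx_trans (_ : (N + gen x <= N)%MS); first by apply: submx_trans (gen_le x) (addsmxSr _ _).
  rewrite -(geq_leqif (mxrank_leqif_sup le)) rN; apply: maxN; apply/asboolP.
  exists (N + gen x)%MS => //; split=> [a|j].
    by rewrite addsmxMr; apply: addsmxS; [exact: sN | exact: gen_stable].
  exact: EsOn_gen.
exists (submod sN), (quomod sN), (sub_inc sN), (quo_pr sN); split.
- exact: exact_subquo.
- move=> j y yE.
  have [||x xN Hx] := HN j (y *m sub_inc sN).
  + exact: sub_inc_le.
  + by rewrite xmul_hom ?yE //; apply: sub_inc_hom.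
  have [x' Hx'] := sub_inc_eq sN xN; exists x'.
  apply: (row_free_inj (sub_inc_free sN)); rewrite -[LHS]/(xmul x' (f j) *m sub_inc sN).
  by rewrite -(xmul_hom _ _ (@sub_inc_hom _ _ _ _ _ sN)) -Hx'.
- move=> i x xE xg; have [x' Hx'] := quo_pr_lift x.
  have hK := quo_pr_hom sN.
  pose x2 := xmul x' (Epr e (y0 (SI i))).
  have Ex : x = x2 *m quo_pr sN by rewrite /x2 -xmul_hom // -Hx' xE.
  rewrite Ex; apply/eqP; rewrite -quo_pr_eq0; apply: key.
    by rewrite /x2 xmulA EprK.
  by rewrite quo_pr_eq0 -xmul_hom // -Ex xg.
Qed.
End Torsion.

Definition cls S : 'rV[int]_n :=
  \row_v ((\sum_i (y0 S i == v))%N%:Z - (\sum_i (y1 S i == v))%N%:Z).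
Definition itheta (th : 'rV[int]_n) X : int := \sum_v th 0 v * (\rank (mact X (e v)))%:Z.
Definition Tz th X := forall X', factor_module X' X -> 0 <= itheta th X'.
Definition Fz th X := forall X', sub_module X' X -> itheta th X' <= 0.

Lemma nrk_count X m (s : 'I_m -> 'I_n) :
  (nrk e X s)%:Z = \sum_v (\sum_i (s i == v))%N%:Z * (\rank (mact X (e v)))%:Z.
Proof.
rewrite /nrk.
transitivity (\sum_v \sum_i ((s i == v) * \rank (mact X (e v)))%N%:Z); last first.
  by apply: eq_bigr => v _; rewrite -?PoszM ?big_distrl /= -?(big_morph Posz PoszD (erefl _)).
rewrite exchange_big /= (big_morph Posz PoszD (erefl _)); apply: eq_bigr => i _.
rewrite (bigD1 (s i)) //= eqxx mul1n big1 ?addr0 // => v /negPf sv.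
by rewrite eq_sym sv.
Qed.

Lemma itheta_cls S X : itheta (cls S) X = thS e S X.
Proof.
rewrite /thS !nrk_count -sumrB; apply: eq_bigr => v _.
by rewrite mxE mulrBl.
Qed.

Lemma ithetaD a b X : itheta (a + b) X = itheta a X + itheta b X.
Proof. by rewrite -big_split; apply: eq_bigr => v _; rewrite mxE mulrDl. Qed.
Lemma ithetaN a X : itheta (- a) X = - itheta a X.
Proof. by rewrite -sumrN; apply: eq_bigr => v _; rewrite mxE mulNr. Qed.
Lemma ithetaMn a m X : itheta (a *+ m) X = itheta a X *+ m.
Proof. by elim: m => [|m IH]; rewrite ?mulr0n ?mulrSr ?ithetaD ?IH //; apply: big1 => v _; rewrite mxE mul0r. Qed.
Lemma itheta_exact th X Y Z R K : @exact_seq _ _ Y X Z R K ->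
  itheta th X = itheta th Y + itheta th Z.
Proof.
move=> E; rewrite -big_split; apply: eq_bigr => v _.
by rewrite (exact_rank E) // PoszD mulrDr.
Qed.

Lemma Esurj_Tz S f X : shom e S f -> Esurj e S f X -> Tz (cls S) X.
Proof. by move=> hf H X' /Esurj_factor /(_ H); rewrite itheta_cls; apply: Esurj_ge0. Qed.
Lemma Hinj_Fz S f X : shom e S f -> Hinj e S f X -> Fz (cls S) X.
Proof. by move=> hf H X' /Hinj_sub /(_ H); rewrite itheta_cls; apply: Hinj_le0. Qed.

Lemma torsion_seq1 S f g X : shom e S f -> Ez e S S f g ->
  exists Y Z R K, [/\ @exact_seq _ _ Y X Z R K, Esurj e S f Y & Hinj e S g Z].
Proof.
move=> hf H.
have [Y [Z [R [K [E HY HZ]]]]] := @torsion_seq unit unit (fun _ => S) (fun _ => S) (fun _ => g) (fun _ => f) (fun _ _ => H) X.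
by exists Y, Z, R, K; split => //; [apply: (HY tt) | apply: (HZ tt)].
Qed.

(** The class is nonpositive on [Z] because Hom(g, Z) is injective and nonnegative because [Z] is a
    factor of [X]; hence Hom(g, Z) is bijective. Some map on the line from [f] to [g] is then onto
    on both [Y] and [Z], hence on [X]. *)
Lemma Tz_Esurj S f g X : shom e S f -> shom e S g -> Ez e S S f g -> Tz (cls S) X ->
  exists2 f', shom e S f' & Esurj e S f' X.
Proof.
move=> hf hg Efg HT; have [Y [Z [R [K [E HY HZ]]]]] := torsion_seq1 X hf Efg.
have z0 : thS e S Z = 0.
  apply/eqP; rewrite eq_le (Hinj_le0 He hg) //= -itheta_cls.
  exact: HT (exact_factor E).
have HZ' : Esurj e S g Z by apply/(Esurj_Hinj He hg z0).
have [h [hh h1 h2]] := lopen_meet (@Esurj_open _ _ _ _ He S Y) (@Esurj_open _ _ _ _ He S Z) hf hg HY HZ'.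
by exists h => //; apply: Esurj_ext E _ _.
Qed.

Lemma Fz_Hinj S f g X : shom e S f -> shom e S g -> Ez e S S f g -> Fz (cls S) X ->
  exists2 g', shom e S g' & Hinj e S g' X.
Proof.
move=> hf hg Efg HT; have [Y [Z [R [K [E HY HZ]]]]] := torsion_seq1 X hf Efg.
have z0 : thS e S Y = 0.
  apply/eqP; rewrite eq_le (Esurj_ge0 He hf) // andbT -itheta_cls.
  exact: HT (exact_sub E).
have HY' : Hinj e S f Y by apply/(Esurj_Hinj He hf z0).
have [h [hh h1 h2]] := lopen_meet (@Hinj_open _ _ _ _ He S Y) (@Hinj_open _ _ _ _ He S Z) hf hg HY' HZ.
by exists h => //; apply: Hinj_ext E _ _.
Qed.
End TF.

(** * Test modules: cokernels, and kernels after the Nakayama functor *)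

Import VectorInternalTheory.
Section TestModules.
Variables (k : closedFieldType) (A : falgType k) (n : nat) (e : 'I_n -> A).
Hypothesis He : complete_projectives e.
Implicit Types (S T : shp n).

Lemma lin1_mxP p q (f : 'rV[k]_p -> 'rV[k]_q) : linear f -> forall u, u *m lin1_mx f = f u.
Proof.
move=> lf u.
have f0 : f 0 = 0 by have := lf (-1) 0 0; rewrite !scaleN1r oppr0 addr0 addNr.
have fD x y : f (x + y) = f x + f y by have := lf 1 x y; rewrite !scale1r.
have fZ c x : f (c *: x) = c *: f x by have := lf c x 0; rewrite f0 !addr0.
rewrite {2}[u]row_sum_delta (big_morph f fD f0) mulmx_sum_row; apply: eq_bigr => i _.
by rewrite fZ; congr (_ *: _); apply/rowP => j; rewrite !mxE.
Qed.

Local Notation V m := {ffun 'I_m -> A}.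
Local Notation dV m := (dim (V m)).

Definition crd m (z : V m) : 'rV[k]_(dV m) := v2r z.
Definition dcr m (v : 'rV[k]_(dV m)) : V m := r2v v.
Lemma crdK m : cancel (@crd m) (@dcr m).
Proof. exact: v2rK. Qed.
Lemma dcrK m : cancel (@dcr m) (@crd m).
Proof. exact: r2vK. Qed.
Lemma crdD m (x y : V m) : crd (x + y) = crd x + crd y.
Proof. exact: linearD. Qed.
Lemma crdZ m c (x : V m) : crd (c *: x) = c *: crd x.
Proof. exact: linearZ. Qed.
Lemma crd_sum m (I : Type) (r : seq I) (F : I -> V m) :
  crd (\sum_(i <- r) F i) = \sum_(i <- r) crd (F i).
Proof. exact: linear_sum. Qed.
Definition lift_lin m p (F : V m -> V p) : 'M[k]_(dV m, dV p) :=
  lin1_mx (fun u => v2r (F (r2v u))).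
Lemma lift_linE m p (F : V m -> V p) : linear F -> forall z, crd z *m lift_lin F = crd (F z).
Proof.
move=> lF z; rewrite lin1_mxP /crd ?v2rK // => c x y.
by rewrite linearP lF linearP.
Qed.
Lemma lift_lin_comp m p q (F : V m -> V p) (G : V p -> V q) : linear F -> linear G ->
  lift_lin F *m lift_lin G = lift_lin (G \o F).
Proof.
move=> lF lG; apply/row_matrixP => i; rewrite row_mul !rowE -(r2vK (delta_mx 0 i)).
have lGF : linear (G \o F) by move=> c x y; rewrite /= lF lG.
by rewrite -/(crd _) !lift_linE.
Qed.

Definition rsc a m (z : V m) : V m := [ffun i => z i * a].
Definition lsc a m (z : V m) : V m := [ffun i => a * z i].
Definition lmu m p (M : 'M[A]_(p, m)) (z : V m) : V p := [ffun i => \sum_j M i j * z j].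
Definition rmu m p (M : 'M[A]_(m, p)) (z : V m) : V p := [ffun j => \sum_i z i * M i j].

Lemma rsc_lin a m : linear (@rsc a m).
Proof. by move=> c x y; apply/ffunP => i; rewrite !ffunE mulrDl scalerAl. Qed.
Lemma lsc_lin a m : linear (@lsc a m).
Proof. by move=> c x y; apply/ffunP => i; rewrite !ffunE mulrDr scalerAr. Qed.
Lemma lmu_lin m p (M : 'M[A]_(p, m)) : linear (lmu M).
Proof.
move=> c x y; apply/ffunP => i; rewrite !ffunE scaler_sumr -big_split.
by apply: eq_bigr => j _; rewrite !ffunE mulrDr scalerAr.
Qed.
Lemma rmu_lin m p (M : 'M[A]_(m, p)) : linear (rmu M).
Proof.
move=> c x y; apply/ffunP => i; rewrite !ffunE scaler_sumr -big_split.
by apply: eq_bigr => j _; rewrite !ffunE mulrDl scalerAl.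
Qed.

Section Free.
Variable m : nat.
Definition free_act a := lift_lin (@rsc a m).
Lemma free_act_lin c a b : free_act (c *: a + b) = c *: free_act a + free_act b.
Proof.
apply/row_matrixP => i; rewrite linearP /= !rowE -(r2vK (delta_mx 0 i)) -/(crd _).
rewrite !lift_linE; try exact: rsc_lin.
rewrite -linearP; congr v2r; apply/ffunP => j; rewrite !ffunE mulrDr.
by rewrite scalerAr.
Qed.
Lemma free_act_mul a b : free_act (a * b) = free_act a *m free_act b.
Proof.
rewrite /free_act lift_lin_comp; try exact: rsc_lin.
by congr lift_lin; apply: funext => z; apply/ffunP => i; rewrite !ffunE mulrA.
Qed.
Lemma free_act_one : free_act 1 = 1%:M.
Proof.
apply/row_matrixP => i; rewrite !rowE mulmx1 -(r2vK (delta_mx 0 i)) -/(crd _).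
rewrite lift_linE; last exact: rsc_lin.
by congr v2r; apply/ffunP => j; rewrite !ffunE mulr1.
Qed.
Definition freemod := Module free_act_lin free_act_mul free_act_one.

(** Transposed left multiplications act from the right: this is the dual of the left module A^m. *)
Definition dual_act a := (lift_lin (@lsc a m))^T.
Lemma dual_act_lin c a b : dual_act (c *: a + b) = c *: dual_act a + dual_act b.
Proof.
apply: trmx_inj; rewrite linearP /= !trmxK.
apply/row_matrixP => i; rewrite linearP /= !rowE -(r2vK (delta_mx 0 i)) -/(crd _).
rewrite !lift_linE; try exact: lsc_lin.
rewrite -linearP; congr v2r; apply/ffunP => j; rewrite !ffunE mulrDl.
by rewrite scalerAl.
Qed.
Lemma dual_act_mul a b : dual_act (a * b) = dual_act a *m dual_act b.
Proof.
rewrite /dual_act -trmx_mul lift_lin_comp; try exact: lsc_lin.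
by congr (lift_lin _)^T; apply: funext => z; apply/ffunP => i; rewrite !ffunE mulrA.
Qed.
Lemma dual_act_one : dual_act 1 = 1%:M.
Proof.
apply: trmx_inj; rewrite trmxK trmx1.
apply/row_matrixP => i; rewrite !rowE mulmx1 -(r2vK (delta_mx 0 i)) -/(crd _).
rewrite lift_linE; last exact: lsc_lin.
by congr v2r; apply/ffunP => j; rewrite !ffunE mul1r.
Qed.
Definition dualmod := Module dual_act_lin dual_act_mul dual_act_one.
End Free.

Definition cols m p (h : 'M[A]_(m, p)) : 'M[k]_(p, mdim (freemod m)) :=
  \matrix_(t < p) (crd [ffun i => h i t] : 'rV_(mdim (freemod m))).
Definition rows m p (h : 'M[A]_(m, p)) : 'M[k]_(m, mdim (dualmod p)) :=
  \matrix_(u < m) (crd [ffun j => h u j] : 'rV_(mdim (dualmod p))).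

Lemma cols_onto m p (y : 'M[k]_(p, mdim (freemod m))) : exists h : 'M[A]_(m, p), y = cols h.
Proof.
exists (\matrix_(i, t) dcr (row t y : 'rV_(dV m)) i).
apply/row_matrixP => t; rewrite rowK -[LHS]dcrK; congr crd.
by apply/ffunP => i; rewrite ffunE mxE.
Qed.
Lemma cols_inj m p : injective (@cols m p).
Proof.
move=> h h' E; apply/matrixP => i t; have := congr1 (row t) E.
by rewrite !rowK => /(can_inj (@crdK _))/ffunP/(_ i); rewrite !ffunE.
Qed.
Lemma colsM m p q (h : 'M[A]_(m, p)) (b : 'M[A]_(p, q)) :
  cols (h *m b) = xmul (X := freemod m) (cols h) b.
Proof.
apply/row_matrixP => t; rewrite row_xmul rowK.
have F u : row u (cols h) *m mact (freemod m) (b u t) = crd (rsc (b u t) [ffun i => h i u]).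
  by rewrite rowK; apply: lift_linE; exact: rsc_lin.
rewrite (eq_bigr _ (fun u _ => F u)).
rewrite -crd_sum; congr crd; apply/ffunP => i; rewrite ffunE mxE sum_ffunE.
by apply: eq_bigr => u _; rewrite !ffunE.
Qed.
Lemma cols_lmu m p q (M : 'M[A]_(q, m)) (h : 'M[A]_(m, p)) :
  cols (M *m h) = cols h *m lift_lin (lmu M).
Proof.
apply/row_matrixP => t; rewrite row_mul !rowK lift_linE; last exact: lmu_lin.
congr v2r; apply/ffunP => i; rewrite !ffunE mxE.
by apply: eq_bigr => u _; rewrite !ffunE.
Qed.
Lemma colsD m p (h h' : 'M[A]_(m, p)) : cols (h + h') = cols h + cols h'.
Proof.
apply/row_matrixP => t; rewrite linearD /= !rowK -linearD; congr v2r.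
by apply/ffunP => i; rewrite !ffunE mxE.
Qed.

Lemma rows_onto m p (y : 'M[k]_(m, mdim (dualmod p))) : exists h : 'M[A]_(m, p), y = rows h.
Proof.
exists (\matrix_(u, j) dcr (row u y : 'rV_(dV p)) j).
apply/row_matrixP => t; rewrite rowK -[LHS]dcrK; congr crd.
by apply/ffunP => i; rewrite ffunE mxE.
Qed.
Lemma rows_inj m p : injective (@rows m p).
Proof.
move=> h h' E; apply/matrixP => u j; have := congr1 (row u) E.
by rewrite !rowK => /(can_inj (@crdK _))/ffunP/(_ j); rewrite !ffunE.
Qed.
Lemma rowsD m p (h h' : 'M[A]_(m, p)) : rows (h + h') = rows h + rows h'.
Proof.
apply/row_matrixP => t; rewrite linearD /= !rowK -linearD; congr v2r.
by apply/ffunP => i; rewrite !ffunE mxE.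
Qed.
Lemma rows_rmu m p q (h : 'M[A]_(m, p)) (M : 'M[A]_(p, q)) :
  rows (h *m M) = rows h *m lift_lin (rmu M).
Proof.
apply/row_matrixP => t; rewrite row_mul !rowK lift_linE; last exact: rmu_lin.
congr v2r; apply/ffunP => i; rewrite !ffunE mxE.
by apply: eq_bigr => u _; rewrite !ffunE.
Qed.

Section Coker.
Variables (T : shp n) (g : mor A T).
Hypothesis hg : shom e T g.

(** The second summand kills the complement of P0 in the free module A^(z0 T), so that the quotient
    is the cokernel of [g] on the projectives themselves. *)
Definition cok_rel : 'M[k]_(mdim (freemod (z0 T))) :=
  (lift_lin (lmu g) + lift_lin (lmu (1%:M - Epr e (y0 T))))%MS.

Lemma lmu_rsc m p (M : 'M[A]_(p, m)) a z : lmu M (rsc a z) = rsc a (lmu M z).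
Proof.
apply/ffunP => i; rewrite !ffunE mulr_suml; apply: eq_bigr => j _.
by rewrite !ffunE mulrA.
Qed.

Lemma cok_stable : stable (X := freemod (z0 T)) cok_rel.
Proof.
move=> a; rewrite /cok_rel addsmxMr; apply: addsmxS => /=;
  rewrite /free_act lift_lin_comp; try (exact: lmu_lin || exact: rsc_lin).
- rewrite (_ : _ \o _ = lmu g \o rsc a (m := _)); last by apply: funext => z; rewrite /= lmu_rsc.
  by rewrite -lift_lin_comp ?submxMl //; [exact: rsc_lin | exact: lmu_lin].
- rewrite (_ : _ \o _ = lmu (1%:M - Epr e (y0 T)) \o rsc a (m := _)); last by apply: funext => z; rewrite /= lmu_rsc.
  by rewrite -lift_lin_comp ?submxMl //; [exact: rsc_lin | exact: lmu_lin].
Qed.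

Lemma cok_relP p (h : 'M[A]_(z0 T, p)) :
  (cols h <= cok_rel)%MS <-> exists a, Epr e (y0 T) *m h = g *m a.
Proof.
split=> [/sub_addsmxP [[u v] /= E]|[a Ha]].
  have [a Ea] := cols_onto u; have [c Ec] := cols_onto v.
  move: E; rewrite Ea Ec -!cols_lmu -colsD => /cols_inj ->; exists a.
  by rewrite mulmxDr !mulmxA (hom_l He hg) mulmxBr mulmx1 (EprK He) subrr mul0mx addr0.
have -> : h = g *m a + (1%:M - Epr e (y0 T)) *m h by rewrite mulmxBl mul1mx Ha addrC subrK.
rewrite colsD !cols_lmu; apply: addmx_sub.
  by apply: submx_trans (addsmxSl _ _); apply: submxMl.
by apply: submx_trans (addsmxSr _ _); apply: submxMl.
Qed.

Definition coker := quomod cok_stable.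

(** By projectivity a map from P1 of [f] to [coker] lifts to some h into P0 of [g]; it factors
    through [f] exactly when h is of the form g a + b f. *)
Lemma Esurj_coker S (f : mor A S) : shom e S f -> Esurj e S f coker <-> Ez e S T f g.
Proof.
move=> hf; pose pi := quo_pr cok_stable; have hpi : is_modhom pi := quo_pr_hom cok_stable.
split=> [H h hh|H y yE].
  have [|x Hx] := H (cols h *m pi).
    by rewrite xmul_hom // -colsM (hom_r He hh).
  have [x' Ex'] := quo_pr_lift x; have [b Eb] := cols_onto x'.
  have: (cols (h - b *m f) <= cok_rel)%MS.
    rewrite (quo_pr_eq0 cok_stable) -/pi; apply/eqP.
    have -> : cols (h - b *m f) = cols h - cols (b *m f).
      by apply/eqP; rewrite eq_sym subr_eq -colsD subrK.
    by rewrite mulmxBl -Hx Ex' Eb -/pi xmul_hom // -colsM subrr.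
  case/cok_relP => a Ha; exists (Epr e (y1 T) *m a *m Epr e (y1 S)), (Epr e (y0 T) *m b *m Epr e (y0 S)).
  split; try exact: hom_sand.
  have: h - Epr e (y0 T) *m b *m f = g *m a.
    by rewrite -Ha mulmxBr (hom_l He hh) mulmxA.
  move/(congr1 (mulmx^~ (Epr e (y1 S)))); rewrite mulmxBl (hom_r He hh) -!mulmxA (hom_r He hf).
  by rewrite (hom_l He hf) !mulmxA (hom_r He hg) => <-; rewrite subrK.
have [y' Ey'] := quo_pr_lift y; have [h0 Eh] := cols_onto y'.
have [a [b [ha hb E]]] := H _ (hom_sand He (y0 T) (y1 S) h0).
have K0 p (h : 'M[A]_(z0 T, p)) : (exists a, Epr e (y0 T) *m h = g *m a) -> cols h *m pi = 0.
  by move/cok_relP; rewrite (quo_pr_eq0 cok_stable) => /eqP.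
exists (cols b *m pi); rewrite xmul_hom // -colsM.
have -> : b *m f = Epr e (y0 T) *m h0 *m Epr e (y1 S) - g *m a by rewrite E addrC addKr.
rewrite -yE Ey' Eh -/pi xmul_hom // -colsM; apply/eqP; rewrite -subr_eq0 -mulmxBl; apply/eqP.
have -> : forall p (h h' : 'M[A]_(z0 T, p)), cols h - cols h' = cols (h - h').
  by move=> p h h'; apply/eqP; rewrite subr_eq -colsD subrK.
apply: K0; exists (- a); rewrite !mulmxBr !mulmxA (EprK He) (hom_l He hg).
by rewrite addrAC subrr add0r mulmxN.
Qed.
End Coker.

Section Ker.
Variables (S : shp n) (f : mor A S).
Hypothesis hf : shom e S f.

(** The trace pairing identifies tuples in [dualmod p] with linear functionals on matrices over [A];
    the action on tuples is adjoint to left multiplication, which is [pair_xmul]. *)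
Definition pair m p (w : 'M[k]_(m, mdim (dualmod p))) (h : 'M[A]_(m, p)) : k := \tr (w *m (rows h)^T).

Lemma pairD m p (w : 'M[k]_(m, mdim (dualmod p))) h h' : pair w (h + h') = pair w h + pair w h'.
Proof. by rewrite /pair rowsD linearD /= mulmxDr linearD. Qed.

Lemma pair_xmul m q p (w : 'M[k]_(m, mdim (dualmod p))) (b : 'M[A]_(m, q)) (h : 'M[A]_(q, p)) :
  pair (xmul (X := dualmod p) w b) h = pair w (b *m h).
Proof.
rewrite /pair !/mxtrace.
have L t : (xmul (X := dualmod p) w b *m (rows h)^T) t t =
    \sum_u (row u w *m (lift_lin (lsc (b u t) (m := p)))^T *m (row t (rows h))^T) 0 0.
  rewrite -[LHS]/((_ : 'M_(_, _)) t t).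
  have -> : forall Z : 'M[k]_(q, mdim (dualmod p)), (Z *m (rows h)^T) t t = (row t Z *m (row t (rows h))^T) 0 0.
    by move=> Z; rewrite !mxE; apply: eq_bigr => j _; rewrite !mxE.
  by rewrite row_xmul mulmx_suml summxE.
rewrite (eq_bigr _ (fun t _ => L t)) exchange_big; apply: eq_bigr => u _ /=.
have -> : (w *m (rows (b *m h))^T) u u = (row u w *m (row u (rows (b *m h)))^T) 0 0.
  by rewrite !mxE; apply: eq_bigr => j _; rewrite !mxE.
rewrite -summxE; under eq_bigr => t _ do rewrite -mulmxA -trmx_mul.
rewrite -mulmx_sumr -linear_sum /=; congr ((_ *m _^T) _ _).
have F t : row t (rows h) *m lift_lin (lsc (b u t) (m := p)) = crd (lsc (b u t) [ffun j => h t j]).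
  by rewrite rowK; apply: lift_linE; exact: lsc_lin.
rewrite rowK (eq_bigr _ (fun t _ => F t)).
rewrite -crd_sum; congr crd; apply/ffunP => j; rewrite ffunE mxE sum_ffunE.
by apply: eq_bigr => t _; rewrite !ffunE.
Qed.

Lemma pair_eq0 m p (w : 'M[k]_(m, mdim (dualmod p))) : (forall h, pair w h = 0) -> w = 0.
Proof.
move=> H; apply/matrixP => i j; have [h Eh] := rows_onto (delta_mx i j : 'M[k]_(m, mdim (dualmod p))).
have := H h; rewrite /pair -Eh /mxtrace (bigD1 i) //= big1 => [|l li].
  rewrite addr0 mxE (bigD1 j) //= big1 => [|l lj]; first by rewrite addr0 !mxE !eqxx mulr1.
  by rewrite !mxE (negPf lj) andbF mulr0.
by rewrite mxE big1 // => l' _; rewrite !mxE (negPf li) mulr0.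
Qed.

(* [ker_sub] gives the kernel of [f] after the Nakayama functor, i.e. the dual of the
   cokernel of [Hom_A(f, A)]. *)
Definition ker_sub : 'M[k]_(mdim (dualmod (z1 S))) := kermx (row_mx (lift_lin (rmu f))^T (lift_lin (rmu (1%:M - Epr e (y1 S))))^T).

Lemma rmu_lsc m p (M : 'M[A]_(m, p)) a z : rmu M (lsc a z) = lsc a (rmu M z).
Proof.
apply/ffunP => i; rewrite !ffunE mulr_sumr; apply: eq_bigr => j _.
by rewrite !ffunE mulrA.
Qed.

Lemma ker_subP q (w : 'M[k]_(q, mdim (dualmod (z1 S)))) : (w <= ker_sub)%MS <->
  w *m (lift_lin (rmu f))^T = 0 /\ w *m (lift_lin (rmu (1%:M - Epr e (y1 S))))^T = 0.
Proof.
split; first by move/sub_kermxP; rewrite mul_mx_row -row_mx0 => /eq_row_mx.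
by case=> H1 H2; apply/sub_kermxP; rewrite mul_mx_row H1 H2 row_mx0.
Qed.

Lemma ker_stable : stable (X := dualmod (z1 S)) ker_sub.
Proof.
have [H1 H2] := (ker_subP ker_sub).1 (submx_refl _).
have C m (M : 'M[A]_(m, z1 S)) a : ker_sub *m (lift_lin (rmu M))^T = 0 ->
    ker_sub *m (lift_lin (lsc a (m := z1 S)))^T *m (lift_lin (rmu M))^T = 0.
  move=> H; rewrite -mulmxA -trmx_mul lift_lin_comp; [|exact: rmu_lin|exact: lsc_lin].
  rewrite (_ : _ \o _ = rmu M \o lsc a (m := _)); last by apply: funext => z; rewrite /= rmu_lsc.
  rewrite -lift_lin_comp; [|exact: lsc_lin|exact: rmu_lin].
  by rewrite trmx_mul mulmxA H mul0mx.
by move=> a; apply/ker_subP; split; apply: C.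
Qed.

Definition kernu := submod ker_stable.

Lemma pair_ker m (w : 'M[k]_(m, mdim (dualmod (z1 S)))) : (w <= ker_sub)%MS <->
  (forall b : 'M[A]_(m, z0 S), pair w (b *m f) = 0) /\
  (forall h : 'M[A]_(m, z1 S), pair w (h *m (1%:M - Epr e (y1 S))) = 0).
Proof.
have C p (M : 'M[A]_(p, z1 S)) : w *m (lift_lin (rmu M))^T = 0 <->
    forall b : 'M[A]_(m, p), pair w (b *m M) = 0.
  have E b : pair w (b *m M) = pair (w *m (lift_lin (rmu M))^T) b.
    by rewrite /pair rows_rmu trmx_mul mulmxA.
  split=> [H b|H]; first by rewrite E H /pair mul0mx mxtrace0.
  by apply: pair_eq0 => b; rewrite -E.
by rewrite ker_subP -!C.
Qed.

(** Duality: the maps from the cokernel of [g] to [kernu] are the functionals on Hom(P1 of f, P0 of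
    g) that vanish on all sums g a + b f. They are all 0 exactly when these sums fill the space. *)
Lemma Hinj_ker T (g : mor A T) : shom e T g -> Hinj e T g kernu <-> Ez e S T f g.
Proof.
move=> hg; have hi := @sub_inc_hom _ _ _ _ _ ker_stable.
split=> [H h hh|H x xE xg]; last first.
  pose w : 'M[k]_(z0 T, mdim (dualmod (z1 S))) := x *m sub_inc ker_stable.
  have /pair_ker [wf wE] : (w <= ker_sub)%MS by exact: (sub_inc_le (sN := ker_stable) x).
  have w1 : xmul (X := dualmod (z1 S)) w (Epr e (y0 T)) = w by rewrite (xmul_hom _ _ hi) xE.
  have wg : xmul (X := dualmod (z1 S)) w g = 0 by rewrite (xmul_hom _ _ hi) xg mul0mx.
  suff w0 : w = 0.
    by apply: (row_free_inj (sub_inc_free ker_stable)); rewrite /= mul0mx -[RHS]w0.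
  apply: pair_eq0 => h; rewrite -w1 pair_xmul.
  have -> : Epr e (y0 T) *m h = Epr e (y0 T) *m h *m Epr e (y1 S) + Epr e (y0 T) *m h *m (1%:M - Epr e (y1 S)).
    by rewrite mulmxBr mulmx1 addrC subrK.
  rewrite pairD wE addr0.
  have [a [b [ha hb ->]]] := H _ (hom_sand He (y0 T) (y1 S) h).
  by rewrite pairD wf addr0 -pair_xmul wg /pair mul0mx mxtrace0.
pose unr m (y : 'M[k]_(m, mdim (dualmod (z1 S)))) : 'M[A]_(m, z1 S) := \matrix_(u, j) dcr (row u y : 'rV_(dV (z1 S))) j.
have unrK m (y : 'M[k]_(m, mdim (dualmod (z1 S)))) : rows (unr m y) = y.
  apply/row_matrixP => t; rewrite rowK -[RHS]dcrK; congr crd.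
  by apply/ffunP => i; rewrite ffunE mxE.
pose LM m (M : 'M[A]_(z0 T, m)) := lin1_mx (fun v => mxvec (rows (M *m unr m (vec_mx v)))).
have LME m (M : 'M[A]_(z0 T, m)) h' : mxvec (rows h') *m LM m M = mxvec (rows (M *m h')).
  rewrite lin1_mxP; first by rewrite mxvecK; congr (mxvec (rows (M *m _))); apply: rows_inj; rewrite unrK.
  move=> c x y; rewrite -linearP; congr mxvec.
  have rZ p q (h1 : 'M[A]_(p, q)) : rows (sc c h1) = c *: rows h1.
    apply/row_matrixP => t; rewrite linearZ /= !rowK -linearZ; congr v2r.
    by apply/ffunP => i; rewrite !ffunE mxE.
  rewrite -rZ -rowsD -scMr -mulmxDr; congr (rows (M *m _)).
  by apply: rows_inj; rewrite rowsD rZ !unrK linearP.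
pose RM m (M : 'M[A]_(m, z1 S)) := lin_mulmxr (lift_lin (rmu M)) : 'M_(z0 T * dV m, _).
have RME m (M : 'M[A]_(m, z1 S)) (h' : 'M[A]_(z0 T, m)) : mxvec (rows h') *m RM m M = mxvec (rows (h' *m M)).
  by rewrite mul_vec_lin /= rows_rmu.
(* Besides the g a and b f, [W] contains what the idempotents of P0 and P1 kill, so that a
   functional vanishing on [W] lives on Hom between the projectives. *)
pose W := (LM _ g + LM _ (1%:M - Epr e (y0 T)) + RM _ f + RM _ (1%:M - Epr e (y1 S)))%MS.
have dec m (v : 'rV[k]_(m * mdim (dualmod (z1 S)))) : exists h' : 'M[A]_(m, z1 S), v = mxvec (rows h').
  by have [h' Eh'] := rows_onto (vec_mx v); exists h'; rewrite -Eh' vec_mxK.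
have dec0 m (v : 'rV[k]_(z0 T * dV m)) : exists h' : 'M[A]_(z0 T, m), v = mxvec (rows h').
  by have [h' Eh'] := rows_onto (vec_mx v : 'M_(_, mdim (dualmod m))); exists h'; rewrite -Eh' vec_mxK.
have [|nW] := boolP (mxvec (rows h) <= W)%MS.
  case/sub_addsmxP => -[v4' v4] /= E4.
  have /sub_addsmxP [[v3' v3] /= E3] := submxMl v4' (LM _ g + LM _ (1%:M - Epr e (y0 T)) + RM _ f)%MS.
  have /sub_addsmxP [[v1 v2] /= E2] := submxMl v3' (LM _ g + LM _ (1%:M - Epr e (y0 T)))%MS.
  have [h1 Eh1] := dec _ v1; have [h2 Eh2] := dec _ v2.
  have [h3 Eh3] := dec0 _ v3; have [h4 Eh4] := dec0 _ v4.
  move: E4; rewrite E3 E2 Eh1 Eh2 Eh3 Eh4 !LME !RME -!linearD -!rowsD.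
  move/(can_inj mxvecK)/rows_inj => Eh.
  exists (Epr e (y1 T) *m h1 *m Epr e (y1 S)), (Epr e (y0 T) *m h3 *m Epr e (y0 S)).
  split; try exact: hom_sand.
  have e0D : Epr e (y0 T) *m (1%:M - Epr e (y0 T)) = 0 by rewrite mulmxBr mulmx1 (EprK He) subrr.
  have e1D : (1%:M - Epr e (y1 S)) *m Epr e (y1 S) = 0 by rewrite mulmxBl mul1mx (EprK He) subrr.
  move: e0D e1D Eh; move: (1%:M - Epr e (y0 T)) (1%:M - Epr e (y1 S)) => D0 D1 e0D e1D Eh.
  rewrite -[LHS]hh Eh !mulmxDr !mulmxDl [Epr _ _ *m (D0 *m _)]mulmxA e0D !mul0mx addr0.
  rewrite -[_ *m (h4 *m D1) *m _]mulmxA -[h4 *m D1 *m _]mulmxA e1D !mulmx0 addr0.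
  congr (_ + _).
    by rewrite !mulmxA (hom_l He hg) (hom_r He hg).
  by rewrite -!mulmxA (hom_l He hf) (hom_r He hf).
(* A column of [cokermx W] that does not kill [h] is the separating functional, turned by [pair]
   into the tuple [w] of dual elements. *)
have [j Hj] : exists j, (mxvec (rows h) *m cokermx W) 0 j != 0.
  by apply/rV0Pn; rewrite -submxE.
pose c := col j (cokermx W).
have W0 m (v : 'M_(m, _)) : (v <= W)%MS -> v *m c = 0.
  by rewrite submxE => /eqP H0; rewrite /c colE mulmxA H0 mul0mx.
pose w : 'M[k]_(z0 T, mdim (dualmod (z1 S))) := vec_mx c^T.
have pw h' : pair w h' = (mxvec (rows h') *m c) 0 0.
  rewrite /pair -[c]trmxK -[c^T]vec_mxK -/w mxE /mxtrace.
  under eq_bigr => i _ do rewrite mxE.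
  rewrite pair_big /= (reindex (fun ij => (ij.1, ij.2))) /=; last by exists id => -[].
  rewrite [RHS](reindex _ (curry_mxvec_bij _ _)) /=.
  by apply: eq_bigr => -[a b] _; rewrite /= [(mxvec w)^T _ _]mxE [(rows h')^T _ _]mxE !mxvecE mulrC.
have wW h' : (mxvec (rows h') <= W)%MS -> pair w h' = 0.
  by move=> /W0 E; rewrite pw E mxE.
have wg a : pair w (g *m a) = 0.
  apply: wW; rewrite -LME; apply: submx_trans (submxMl _ _) _.
  by rewrite /W -!addsmxA addsmxSl.
have wE a : pair w ((1%:M - Epr e (y0 T)) *m a) = 0.
  apply: wW; rewrite -LME; apply: submx_trans (submxMl _ _) _.
  by rewrite /W -!addsmxA; apply: submx_trans (addsmxSr _ _); apply: addsmxSl.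
have /pair_ker wk : (forall b : 'M[A]_(z0 T, z0 S), pair w (b *m f) = 0) /\
  (forall h : 'M[A]_(z0 T, z1 S), pair w (h *m (1%:M - Epr e (y1 S))) = 0).
  split=> b; apply: wW; rewrite -RME; apply: submx_trans (submxMl _ _) _; rewrite /W.
    by apply: submx_trans (addsmxSl _ _); apply: addsmxSr.
  exact: addsmxSr.
have [x Ex] := sub_inc_eq ker_stable wk.
have inj := row_free_inj (sub_inc_free ker_stable).
have x0 : x = 0.
  apply: H.
    apply: inj; rewrite -[LHS]/(xmul x (Epr e (y0 T)) *m sub_inc ker_stable).
    rewrite -(xmul_hom _ _ hi) -Ex; apply/eqP; rewrite eq_sym -subr_eq0; apply/eqP.
    apply: pair_eq0 => h'.
    have -> : w - xmul (X := dualmod (z1 S)) w (Epr e (y0 T)) = xmul (X := dualmod (z1 S)) w (1%:M - Epr e (y0 T)).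
      by apply/eqP; rewrite subr_eq -xmulDr subrK xmul1.
    by rewrite pair_xmul.
  apply: inj; rewrite -[LHS]/(xmul x g *m sub_inc ker_stable) -(xmul_hom _ _ hi) -Ex.
  rewrite -[RHS]/(0 *m sub_inc ker_stable) mul0mx.
  by apply: pair_eq0 => h'; rewrite pair_xmul.
have : pair w h = 0 by rewrite Ex x0 mul0mx /pair mul0mx mxtrace0.
rewrite pw /c colE mulmxA -colE mxE => /eqP; rewrite (negPf Hj) //.
Qed.
End Ker.
End TestModules.

(** * Generalized inverses over a domain *)

Section GenInverse.
Variable R : idomainType.

Lemma frac_clear (x : {fraction R}) : exists n d : R, d != 0 /\ x * FracField.tofrac d = FracField.tofrac n.
Proof.
elim/quotW: x => r; exists (frac r).1, (frac r).2; split; first exact: denom_ratioP.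
rewrite -[LHS]/(FracField.mul _ _) !piE; apply/eqmodP => /=.
rewrite FracField.equivfE /FracField.mulf !numden_Ratio ?mulr1 ?oner_eq0 ?denom_ratioP //.
by rewrite mulrC.
Qed.

(** The pseudo-inverse over the fraction field, multiplied by the product of the denominators of its
    entries. *)
Lemma generalized_inverse p q (M : 'M[R]_(p, q)) :
  exists2 d, d != 0 & exists Q, M *m Q *m M = d *: M.
Proof.
pose P := pinvmx (map_mx (@FracField.tofrac R) M).
have MPM : map_mx (@FracField.tofrac R) M *m P *m map_mx (@FracField.tofrac R) M = map_mx (@FracField.tofrac R) M.
  by rewrite mulmxKpV.
clearbody P.
have [d d0 [Q HQ]] : exists2 d, d != 0 & exists Q, map_mx (@FracField.tofrac R) Q = (FracField.tofrac d) *: P.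
  have /fin_all_exists [nd Hnd] (ij : 'I_q * 'I_p) : exists nd : R * R, nd.2 != 0 /\
      P ij.1 ij.2 * FracField.tofrac nd.2 = FracField.tofrac nd.1.
    by have [n [d [d0 H]]] := frac_clear (P ij.1 ij.2); exists (n, d).
  exists (\prod_ij (nd ij).2).
    by apply/prodf_neq0 => ij _; case: (Hnd ij).
  exists (\matrix_(i, j) ((nd (i, j)).1 * \prod_(ij | ij != (i, j)) (nd ij).2)).
  apply/matrixP => i j; rewrite !mxE [\prod_ij _](bigD1 (i, j)) //= !rmorphM /= mulrAC; congr (_ * _).
  by rewrite mulrC; case: (Hnd (i, j)) => _ /= ->.
exists d => //; exists Q.
have inj : injective (@FracField.tofrac R).
  by move=> x y /eqP; rewrite tofrac_eq => /eqP.
have E : map_mx (@FracField.tofrac R) (M *m Q *m M) = map_mx (@FracField.tofrac R) (d *: M).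
  by rewrite !map_mxM map_mxZ HQ -scalemxAr -scalemxAl MPM.
apply/matrixP => i j; apply: inj; have := congr1 (fun Z : 'M_(p, q) => Z i j) E.
by rewrite ![(map_mx _ _) _ _]mxE.
Qed.
End GenInverse.

(** * Lifting an idempotent along a line of matrices *)

Section Lift.
Variables (k : closedFieldType) (D : nat).
Local Notation R := {poly k}.
Local Notation MR := 'M[R]_D.
Definition cst (B : 'M[k]_D) : MR := map_mx polyC B.
Definition ev (c : k) (U : MR) : 'M[k]_D := map_mx (horner_eval c) U.

Lemma ev_cst c B : ev c (cst B) = B.
Proof. by apply/matrixP => i j; rewrite !mxE /horner_eval hornerC. Qed.
Lemma evM c U V : ev c (U *m V) = ev c U *m ev c V.
Proof. exact: map_mxM. Qed.
Lemma evD c U V : ev c (U + V) = ev c U + ev c V.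
Proof. exact: map_mxD. Qed.
Lemma evB c U V : ev c (U - V) = ev c U - ev c V.
Proof. exact: map_mxB. Qed.
Lemma evZ c p U : ev c (p *: U) = p.[c] *: ev c U.
Proof. exact: map_mxZ. Qed.
Lemma ev1 c : ev c 1%:M = 1%:M.
Proof. exact: map_mx1. Qed.
Lemma cstM B C : cst (B *m C) = cst B *m cst C.
Proof. exact: map_mxM. Qed.
Lemma scaleX_inj N p q : injective (fun U : 'M[R]_(p, q) => 'X^N *: U).
Proof.
move=> U V /= E; apply/matrixP => i j.
have := congr1 (fun Z : 'M_(p, q) => Z i j) E; rewrite /= !mxE; apply: mulfI.
by rewrite monic_neq0 ?monicXn.
Qed.

Lemma ev0_divX U : ev 0 U = 0 -> exists V, U = 'X *: V.
Proof.
move=> H; exists (map_mx (fun p : R => p %/ 'X) U); apply/matrixP => i j; rewrite !mxE.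
have := congr1 (fun Z : 'M_D => Z i j) H; rewrite !mxE /horner_eval => /rootP.
rewrite -dvdp_XsubCl subr0 => dv.
by rewrite mulrC divpK.
Qed.

Lemma coef_comm (C : 'M[k]_D) (U : MR) j : cst C *m U = U *m cst C ->
  C *m map_mx (coefp j) U = map_mx (coefp j) U *m C.
Proof.
move=> H; apply/matrixP => x y; have := congr1 (fun Z : MR => (Z x y : {poly k})`_j) H.
rewrite /= !mxE !coef_sum => E.
transitivity (\sum_i (cst C x i * U i y)`_j).
  by apply: eq_bigr => i _; rewrite !mxE coefCM.
by rewrite E; apply: eq_bigr => i _; rewrite !mxE coefMC.
Qed.

Lemma ev_coef (U : MR) : exists N, forall c, ev c U = \sum_(j < N) c ^+ j *: map_mx (coefp j) U.
Proof.
exists (\max_(ij : 'I_D * 'I_D) size (U ij.1 ij.2))%N => c.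
apply/matrixP => x y; rewrite summxE mxE /horner_eval (@horner_coef_wide _ (\max_(ij : 'I_D * 'I_D) size (U ij.1 ij.2))).
  by apply: eq_bigr => j _; rewrite !mxE mulrC.
exact: (leq_bigmax (x, y)).
Qed.

Definition comm (U V : MR) := U *m V - V *m U.

Lemma comm0P U V : comm U V = 0 <-> U *m V = V *m U.
Proof. by split=> [/eqP|H]; [rewrite subr_eq0 => /eqP | rewrite /comm H subrr]. Qed.

Section Exact.
Variables (q : nat) (G : 'I_q -> MR) (e : 'M[k]_D).
Hypothesis approx : forall N, exists U, ev 0 U = e /\
  forall j, exists H, comm U (G j) = 'X^N *: H.

(* A generalized inverse over [{poly k}], with denominator [d], of the linear system
   corrects an approximate solution as soon as the order exceeds that of [d] at 0. *)
Lemma exact_section : exists U, ev 0 U = e /\ forall j, comm U (G j) = 0.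
Proof.
pose L (v : 'rV[R]_(D * D)) : 'rV[R]_(q * (D * D)) :=
  mxvec (\matrix_(j < q) mxvec (comm (vec_mx v) (G j))).
have lL : linear L.
  move=> c x y; rewrite -linearP; congr mxvec; apply/row_matrixP => j.
  rewrite rowK [RHS]linearP /= !rowK -linearP; congr mxvec; rewrite /comm [vec_mx _]linearP /=.
  rewrite mulmxDl mulmxDr -scalemxAl -scalemxAr opprD addrACA; congr (_ + _).
  by rewrite scalerBr.
have LE u : u *m lin1_mx L = L u.
  have L0 : L 0 = 0 by have := lL (-1) 0 0; rewrite !scaleN1r oppr0 addr0 addNr.
  have fD x y : L (x + y) = L x + L y by have := lL 1 x y; rewrite !scale1r.
  have fZ c x : L (c *: x) = c *: L x by have := lL c x 0; rewrite L0 !addr0.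
  rewrite {2}[u]row_sum_delta (big_morph L fD L0) mulmx_sum_row; apply: eq_bigr => i _.
  by rewrite fZ; congr (_ *: _); apply/rowP => j; rewrite !mxE.
have [d d0 [Q HQ]] := generalized_inverse (lin1_mx L).
have [s [d' /implyP /(_ d0) d'0 Ed]] := multiplicity_XsubC d 0; rewrite subr0 in Ed.
have [U [U0 HU]] := approx s.+1.
have /fin_all_exists [H HH] := HU.
pose a := mxvec U; pose b := mxvec (\matrix_(j < q) mxvec (H j)).
have aM : a *m lin1_mx L = 'X^(s.+1) *: b.
  rewrite LE /L /a mxvecK /b -linearZ; congr mxvec; apply/row_matrixP => j.
  by rewrite linearZ /= !rowK HH linearZ.
have bM : b *m Q *m lin1_mx L = d *: b.
  apply: (@scaleX_inj s.+1) => /=; by rewrite !scalemxAl -aM -!mulmxA [lin1_mx L *m _]mulmxA HQ -scalemxAr aM scalerA mulrC -scalerA.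
(* Up to the unit d'(0), the first term has the prescribed value at 0; the second term is divisible
   by X and restores exact commutation. *)
pose w := d' *: a - 'X *: (b *m Q).
have wM : w *m lin1_mx L = 0.
  apply: (@scaleX_inj s) => /=; rewrite scaler0 scalemxAl /w scalerBr !scalerA [_ * d']mulrC -Ed -exprSr.
  by rewrite mulmxBl -!scalemxAl aM bM !scalerA mulrC subrr.
have d'00 : d'.[0] != 0 by [].
exists ((d'.[0])^-1%:P *: vec_mx w); split.
  have Ew : vec_mx w = d' *: U - 'X *: vec_mx (b *m Q).
    by rewrite /w linearB !linearZ /= /a mxvecK.
  rewrite evZ hornerC Ew evB !evZ hornerX scale0r subr0 U0.
  by rewrite scalerA mulVf // scale1r.
move=> j; rewrite /comm -scalemxAl -scalemxAr -scalerBr.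
have := wM; rewrite LE /L => /(canRL mxvecK); rewrite linear0 => E.
have := congr1 (row j) E; rewrite rowK row0 => /(canRL mxvecK); rewrite linear0 /comm => ->.
by rewrite scaler0.
Qed.
End Exact.

(* Conjugating by [1 + 'X^N v] with [v] off-diagonal for [e] removes the [N]-th order
   error of an idempotent commuting with [f + 'X g]; [od1] and [od2] provide [v].
   The truncated solutions become exact by [exact_section]. *)
Section Newton.
Variables (q : nat) (B B' : 'I_q -> 'M[k]_D) (f g e : 'M[k]_D).
Let adm h := forall j, B j *m h = h *m B' j.
Let com v := forall j, B j *m v = v *m B j /\ B' j *m v = v *m B' j.
Hypotheses (af : adm f) (ag : adm g) (ce : com e) (ee : e *m e = e) (ef : e *m f = f *m e).
Hypothesis od1 : forall h, adm h -> exists v, [/\ com v, e *m v = v, v *m e = 0 &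
  v *m f - f *m v = e *m h *m (1%:M - e)].
Hypothesis od2 : forall h, adm h -> exists v, [/\ com v, e *m v = 0, v *m e = v &
  v *m f - f *m v = (1%:M - e) *m h *m e].
Let F := cst f + 'X *: cst g.
Let comR (U : MR) := forall j, cst (B j) *m U = U *m cst (B j) /\ cst (B' j) *m U = U *m cst (B' j).
Let good N U H := [/\ U *m U = U, ev 0 U = e, comR U & comm U F = 'X^(N.+1) *: H].

Let ev0F : ev 0 F = f.
Proof. by rewrite evD evZ hornerX scale0r addr0 ev_cst. Qed.

Let good_adm N U H : good N U H -> adm (ev 0 H).
Proof.
case=> _ _ cU E j.
have aF : cst (B j) *m F = F *m cst (B' j).
  rewrite mulmxDr mulmxDl -scalemxAr -scalemxAl -!cstM; congr (cst _ + _ *: cst _); [exact: af|exact: ag].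
have: cst (B j) *m H = H *m cst (B' j).
  apply: (@scaleX_inj N.+1) => /=; rewrite scalemxAr scalemxAl -E /comm.
  have [c1 c2] := cU j.
  rewrite mulmxBr mulmxBl !mulmxA c1 aF -[U *m cst _ *m F]mulmxA aF.
  by rewrite -[F *m cst _ *m U]mulmxA c2 !mulmxA.
by move/(congr1 (ev 0)); rewrite !evM !ev_cst.
Qed.

Let good_step N U H v : good N U H -> com v -> v *m v = 0 ->
  exists U' H', good N U' H' /\
    ev 0 H' = ev 0 H + ((e *m v - v *m e) *m f - f *m (e *m v - v *m e)).
Proof.
case=> UU U0 cU E cv vv; pose V := 'X^(N.+1) *: cst v.
have VV : V *m V = 0.
  by rewrite /V -scalemxAl -scalemxAr -cstM vv [cst 0]map_mx0 !scaler0.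
have inv1 : (1%:M + V) *m (1%:M - V) = 1%:M.
  by rewrite mulmxBr mulmx1 mulmxDl mul1mx VV addr0 addrK.
pose Z := U *m cst v - cst v *m U - 'X^(N.+1) *: (cst v *m U *m cst v).
have EU : (1%:M - V) *m U *m (1%:M + V) = U + 'X^(N.+1) *: Z.
  rewrite mulmxDr mulmx1 !mulmxBl !mul1mx /Z /V !scalerBr -!scalemxAl -!scalemxAr.
  rewrite -addrA; congr (_ + _); rewrite [LHS]addrA [- _ + _]addrC -!addrA; congr (_ + _).
exists ((1%:M - V) *m U *m (1%:M + V)), (H + comm Z F); split; last first.
  have Z0 : ev 0 Z = e *m v - v *m e.
    by rewrite /Z !evB !evM evZ hornerXn exprS mul0r scale0r subr0 ev_cst U0.
  by rewrite evD /comm evB !evM ev0F Z0.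
split.
- rewrite -[LHS]mulmxA [(1%:M + V) *m _]mulmxA [(1%:M + V) *m _]mulmxA inv1 mul1mx.
  by rewrite !mulmxA -[_ *m U *m U]mulmxA UU.
- by rewrite EU evD evZ hornerXn exprS mul0r scale0r addr0.
- move=> j; have [c1 c2] := cU j; have [d1 d2] := cv j.
  have C C0 : cst C0 *m U = U *m cst C0 -> C0 *m v = v *m C0 ->
     cst C0 *m ((1%:M - V) *m U *m (1%:M + V)) = (1%:M - V) *m U *m (1%:M + V) *m cst C0.
    move=> a1 a2; have a3 : cst C0 *m V = V *m cst C0 by rewrite /V -scalemxAr -scalemxAl -!cstM a2.
    rewrite !mulmxA mulmxBr mulmx1 a3 -{1}[cst C0]mul1mx -mulmxBl.
    rewrite -![(1%:M - V) *m _ *m _]mulmxA; congr (_ *m _).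
    by rewrite -!mulmxA ?mulmxA a1 -?mulmxA; congr (U *m _); rewrite mulmxDr mulmxDl mulmx1 mul1mx a3.
  by split; apply: C.
- rewrite EU /comm mulmxDl mulmxDr -scalemxAl -scalemxAr opprD addrACA -scalerBr -/(comm U F) E.
  by rewrite -scalerDr.
Qed.

Lemma newton N : exists U H, good N U H.
Proof.
elim: N => [|N [U [H G]]].
  exists (cst e), (comm (cst e) (cst g)); split.
  - by rewrite -cstM ee.
  - exact: ev_cst.
  - by move=> j; have [c1 c2] := ce j; rewrite -!cstM c1 c2.
  - rewrite expr1 /comm mulmxDr mulmxDl -!cstM ef opprD addrACA subrr add0r.
    by rewrite -scalemxAr -scalemxAl -scalerBr !cstM.
have ah := good_adm G; set h := ev 0 H in ah.
have [UU U0 cU E] := G.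
(* Idempotency of [U] gives U [U, F] U = 0, and likewise for 1 - U, so the leading error [h] has
   only its two off-diagonal blocks for [e]. *)
have hoff1 : e *m h *m e = 0.
  have : U *m H *m U = 0.
    apply: (@scaleX_inj N.+1) => /=; rewrite scaler0 scalemxAl scalemxAr -E /comm mulmxBr mulmxBl.
    by rewrite !mulmxA UU -[_ *m U *m U]mulmxA UU subrr.
  by move/(congr1 (ev 0)); rewrite !evM U0 [ev 0 0]map_mx0.
have hoff2 : (1%:M - e) *m h *m (1%:M - e) = 0.
  have U1 : (1%:M - U) *m U = 0 by rewrite mulmxBl mul1mx UU subrr.
  have U2 : U *m (1%:M - U) = 0 by rewrite mulmxBr mulmx1 UU subrr.
  have : (1%:M - U) *m H *m (1%:M - U) = 0.
    apply: (@scaleX_inj N.+1) => /=; rewrite scaler0 scalemxAl scalemxAr -E; move: (1%:M - U) U1 U2 => W U1 U2.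
    by rewrite /comm mulmxBr mulmxBl mulmxA U1 !mul0mx -!mulmxA U2 !mulmx0 subrr.
  by move/(congr1 (ev 0)); rewrite !evM evB ev1 U0 [ev 0 0]map_mx0.
have hE : h = e *m h *m (1%:M - e) + (1%:M - e) *m h *m e.
  move: hoff2; rewrite !mulmxBr !mulmxBl !mulmx1 !mul1mx hoff1 !subr0 => /eqP.
  by rewrite -addrA -opprD subr_eq0 => /eqP.
have [v [cv ev1' ve1 Hv]] := od1 ah; have [w [cw ew1 we1 Hw]] := od2 ah.
have vv : (- v) *m (- v) = 0 by rewrite mulNmx mulmxN opprK -{2}ev1' mulmxA ve1 mul0mx.
have ww : w *m w = 0 by rewrite -{1}we1 -mulmxA ew1 mulmx0.
have cNv : com (- v) by move=> j; have [c1 c2] := cv j; rewrite !mulmxN !mulNmx c1 c2.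
(* The blocks are removed in turn. The commutator with [e] is [v] itself for the first and [- w] for
   the second, whence the opposite signs of the two conjugators. *)
have [U1 [H1 [G1 E1]]] := good_step G cNv vv.
have [U2 [H2 [G2 E2]]] := good_step G1 cw ww.
have [|H3 EH3] := @ev0_divX H2.
  rewrite E2 E1 -/h mulmxN mulNmx ev1' ve1 ew1 we1 oppr0 subr0 sub0r.
  rewrite !mulNmx !mulmxN opprK [- _ + _]addrC.
  by rewrite -opprD Hw -[f *m v - _]opprB Hv -addrA -opprD {1}hE subrr.
exists U2, H3; have [a b c d] := G2; split => //.
by rewrite d EH3 scalerA -exprSr.
Qed.

(** Commutation with all [B j], [B' j] and [F] is linear in [U], so it survives the passage to an
    exact solution. Idempotency does not: it is kept only at the parameter 0. *)
Lemma section_ex : exists U, [/\ ev 0 U = e, comR U & U *m F = F *m U].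
Proof.
pose G (j : 'I_q + 'I_q + 'I_1) := match j with
  | inl (inl j) => cst (B j) | inl (inr j) => cst (B' j) | inr _ => F end.
have [|U [U0 HU]] := @exact_section #|{: 'I_q + 'I_q + 'I_1}| (fun j => G (enum_val j)) e.
  move=> N; have [U [H [UU U0 cU E]]] := newton N.
  exists U; split => // j; case: (enum_val j) => [[l|l]|l] /=.
  - by exists 0; rewrite scaler0; apply/comm0P; have [] := cU l.
  - by exists 0; rewrite scaler0; apply/comm0P; have [] := cU l.
  - by exists ('X *: H); rewrite E scalerA -exprSr.
have HG j : U *m G j = G j *m U by apply/comm0P; have := HU (enum_rank j); rewrite enum_rankK.
exists U; split => //; last exact: (HG (inr ord0)).
by move=> j; rewrite (HG (inl (inl j))) (HG (inl (inr j))).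
Qed.
End Newton.
End Lift.

(** * Matrices over the algebra as matrices over the field *)

Section RegularRep.
Variables (k : closedFieldType) (A : falgType k).
Local Notation V m := {ffun 'I_m -> A}.
Local Notation dV m := (dim (V m)).

(* [commutant]: [Phi] identifies the matrices over [A] with the commutant of [Lam], so
   that being a matrix over [A] becomes a system of commutation relations over [k]. *)
Definition Phi m (M : 'M[A]_m) : 'M[k]_(dV m) := lift_lin (rmu M).
Definition Lam m (a : A) : 'M[k]_(dV m) := lift_lin (lsc a (m := m)).

Lemma lift_lin_eq m p (F : V m -> V p) (M : 'M[k]_(dV m, dV p)) : linear F ->
  (forall z, crd z *m M = crd (F z)) -> lift_lin F = M.
Proof.
move=> lF H; apply/row_matrixP => i; rewrite !rowE -(dcrK (delta_mx 0 i)) H.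
exact: lift_linE.
Qed.

Lemma PhiE m (M : 'M[A]_m) z : crd z *m Phi M = crd (rmu M z).
Proof. by apply: lift_linE; apply: rmu_lin. Qed.
Lemma LamE m a (z : V m) : crd z *m Lam m a = crd (lsc a z).
Proof. by apply: lift_linE; apply: lsc_lin. Qed.

Lemma PhiM m (M N : 'M[A]_m) : Phi (M *m N) = Phi M *m Phi N.
Proof.
apply: lift_lin_eq; first exact: rmu_lin.
move=> z; rewrite mulmxA !PhiE; congr crd; apply/ffunP => j; rewrite !ffunE.
under eq_bigr => i _ do rewrite ffunE mulr_suml.
rewrite exchange_big; apply: eq_bigr => i _ /=.
by rewrite mxE mulr_sumr; apply: eq_bigr => l _; rewrite mulrA.
Qed.
Lemma PhiD m (M N : 'M[A]_m) : Phi (M + N) = Phi M + Phi N.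
Proof.
apply: lift_lin_eq; first exact: rmu_lin.
move=> z; rewrite mulmxDr !PhiE -crdD; congr crd; apply/ffunP => j; rewrite !ffunE.
by rewrite -big_split; apply: eq_bigr => i _; rewrite mxE mulrDr.
Qed.
Lemma PhiZ m c (M : 'M[A]_m) : Phi (sc c M) = c *: Phi M.
Proof.
apply: lift_lin_eq; first exact: rmu_lin.
move=> z; rewrite -scalemxAr PhiE -crdZ; congr crd; apply/ffunP => j; rewrite !ffunE.
by rewrite scaler_sumr; apply: eq_bigr => i _; rewrite mxE scalerAr.
Qed.
Lemma Phi1 m : Phi (1%:M : 'M[A]_m) = 1%:M.
Proof.
apply: lift_lin_eq; first exact: rmu_lin.
move=> z; rewrite mulmx1; congr crd; apply/ffunP => j; rewrite !ffunE (bigD1 j) //= big1.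
  by rewrite mxE eqxx mulr1 addr0.
by move=> i /negPf ij; rewrite mxE ij mulr0.
Qed.
Lemma Phi0 m : Phi (0 : 'M[A]_m) = 0.
Proof. by rewrite -(sc0 0) PhiZ scale0r. Qed.
Lemma PhiB m (M N : 'M[A]_m) : Phi (M - N) = Phi M - Phi N.
Proof. by apply/eqP; rewrite eq_sym subr_eq -PhiD subrK. Qed.
Lemma Phi_inj m : injective (@Phi m).
Proof.
move=> M N E; apply/matrixP => i j.
have := PhiE M [ffun l => (l == i)%:R]; rewrite E PhiE => /(can_inj (@crdK _ _ _))/ffunP/(_ j).
have S (Q : 'M[A]_m) : rmu Q [ffun l => (l == i)%:R] j = Q i j.
  rewrite ffunE (bigD1 i) //= big1 => [|l /negPf li]; last by rewrite ffunE li mul0r.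
  by rewrite ffunE eqxx mul1r addr0.
by rewrite !S.
Qed.
Lemma Phi_Lam m (M : 'M[A]_m) a : Lam m a *m Phi M = Phi M *m Lam m a.
Proof.
apply/row_matrixP => i; rewrite !row_mul !rowE -(dcrK (delta_mx 0 i)) LamE PhiE PhiE LamE.
by rewrite rmu_lsc.
Qed.

Let b := vbasis (fullv : {vspace A}).
Lemma Lam_sum m a : Lam m a = \sum_(i < \dim (fullv : {vspace A})) coord b i a *: Lam m b`_i.
Proof.
apply: lift_lin_eq; first exact: lsc_lin.
move=> z; rewrite mulmx_sumr.
under eq_bigr => i _ do rewrite -scalemxAr LamE.
under eq_bigr => i _ do rewrite -crdZ.
rewrite -crd_sum; congr crd; apply/ffunP => j; rewrite sum_ffunE !ffunE.
rewrite {2}(coord_vbasis (memvf a)) mulr_suml; apply: eq_bigr => i _.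
by rewrite !ffunE scalerAl.
Qed.

Lemma commutant m (u : 'M[k]_(dV m)) :
  (forall i : 'I_(\dim (fullv : {vspace A})), Lam m b`_i *m u = u *m Lam m b`_i) ->
  exists M, u = Phi M.
Proof.
move=> H; have Hu a : Lam m a *m u = u *m Lam m a.
  rewrite Lam_sum mulmx_suml mulmx_sumr; apply: eq_bigr => i _.
  by rewrite -scalemxAl -scalemxAr H.
pose dl i : V m := [ffun l => (l == i)%:R].
exists (\matrix_(i, j) dcr (crd (dl i) *m u) j); symmetry; apply: lift_lin_eq; first exact: rmu_lin.
move=> z; have -> : z = \sum_i lsc (z i) (dl i).
  apply/ffunP => j; rewrite sum_ffunE (bigD1 j) //= big1 => [|i /negPf ij].
    by rewrite !ffunE eqxx mulr1 addr0.
  by rewrite !ffunE eq_sym ij mulr0.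
set y := \sum_i _.
rewrite /y crd_sum mulmx_suml; under eq_bigr => i _ do rewrite -LamE -mulmxA Hu mulmxA.
rewrite -/y; have Ey i : y i = z i.
  rewrite /y sum_ffunE (bigD1 i) //= big1 => [|l /negPf il].
    by rewrite !ffunE eqxx mulr1 addr0.
  by rewrite !ffunE eq_sym il mulr0.
under eq_bigr => i _ do rewrite -[crd (dl i) *m u]dcrK LamE.
rewrite -crd_sum; congr crd; apply/ffunP => j; rewrite sum_ffunE ffunE.
by apply: eq_bigr => i _; rewrite Ey !ffunE mxE.
Qed.
End RegularRep.

Lemma sc_block (k : closedFieldType) (A : falgType k) m1 m2 n1 n2 c
    (a : 'M[A]_(m1, n1)) (b : 'M[A]_(m1, n2)) (a' : 'M[A]_(m2, n1)) (b' : 'M[A]_(m2, n2)) :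
  sc c (block_mx a b a' b') = block_mx (sc c a) (sc c b) (sc c a') (sc c b').
Proof. exact: map_block_mx. Qed.
Lemma sc_0 (k : closedFieldType) (A : falgType k) m p c : sc c (0 : 'M[A]_(m, p)) = 0.
Proof. by apply/matrixP => i j; rewrite !mxE scaler0. Qed.

Lemma corner_comm (R : nzRingType) p q (P : 'M[R]_p) (Q : 'M[R]_q) a b (L : 'M[R]_(p, q)) :
  P *m L = L -> L *m Q = L -> a *m L = L *m b -> P *m a *m P *m L = L *m (Q *m b *m Q).
Proof. by move=> l r E; rewrite -mulmxA l -mulmxA E mulmxA l !mulmxA r -E -mulmxA r. Qed.

(** * Extending an idempotent chain endomorphism along a line *)

Section SectionLemma.
Variables (k : closedFieldType) (A : falgType k) (n : nat) (e : 'I_n -> A).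
Hypothesis He : complete_projectives e.
Variables (S : shp n) (f0 f1 : mor A S) (u0 : 'M[A]_(z0 S)) (u1 : 'M[A]_(z1 S)).
Hypotheses (hf0 : shom e S f0) (hf1 : shom e S f1).
Hypotheses (hu0 : hom e (y0 S) (y0 S) u0) (hu1 : hom e (y1 S) (y1 S) u1).
Hypotheses (u00 : u0 *m u0 = u0) (u11 : u1 *m u1 = u1) (uf : u0 *m f0 = f0 *m u1).
Let E0 := Epr e (y0 S).
Let E1 := Epr e (y1 S).
Hypothesis od1 : forall h, shom e S h -> exists a b,
  [/\ hom e (y1 S) (y1 S) a, hom e (y0 S) (y0 S) b
   & u0 *m h *m (E1 - u1) = f0 *m a + b *m f0].
Hypothesis od2 : forall h, shom e S h -> exists a b,
  [/\ hom e (y1 S) (y1 S) a, hom e (y0 S) (y0 S) b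
   & (E0 - u0) *m h *m u1 = f0 *m a + b *m f0].

Definition psum m p N (w : nat -> 'M[A]_(m, p)) (c : k) := \sum_(j < N) sc (c ^+ j) (w j).

Let m := (z0 S + z1 S)%N.
Let up (f : mor A S) : 'M[A]_m := block_mx 0 f 0 0.
Let dg (a : 'M[A]_(z0 S)) (b : 'M[A]_(z1 S)) : 'M[A]_m := block_mx a 0 0 b.
Let P0 := dg E0 0.
Let P1 := dg 0 E1.
Let d := \dim (fullv : {vspace A}).
Let b := vbasis (fullv : {vspace A}).
(** Intertwining [B] and [B'] characterizes the matrices [up h] with [shom e S h]: the [Lam] force
    entries in [A], the last two indices force the idempotent [P0] on the left and [P1] on the
    right. *)
Let B (j : 'I_(d + 2)) := match split j with
  | inl i => Lam m b`_i | inr i => if i == 0 then Phi P0 else 1%:M end.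
Let B' (j : 'I_(d + 2)) := match split j with
  | inl i => Lam m b`_i | inr i => if i == 0 then 1%:M else Phi P1 end.

Let dgM a c a' c' : dg a c *m dg a' c' = dg (a *m a') (c *m c').
Proof. by rewrite /dg mulmx_block !mul0mx !mulmx0 !addr0 add0r. Qed.
Let dgup a c f : dg a c *m up f = up (a *m f).
Proof. by rewrite /dg /up mulmx_block !mul0mx !mulmx0 !addr0. Qed.
Let updg a c f : up f *m dg a c = up (f *m c).
Proof. by rewrite /dg /up mulmx_block !mul0mx !mulmx0 !addr0 !add0r. Qed.
Let upD f g : up f + up g = up (f + g).
Proof. by rewrite /up add_block_mx !addr0. Qed.
Let upB f g : up f - up g = up (f - g).
Proof. by apply/eqP; rewrite subr_eq upD subrK. Qed.
Let com_dg a c : hom e (y0 S) (y0 S) a -> hom e (y1 S) (y1 S) c ->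
  forall j, B j *m Phi (dg a c) = Phi (dg a c) *m B j /\ B' j *m Phi (dg a c) = Phi (dg a c) *m B' j.
Proof.
move=> ha hc j; rewrite /B /B'; case: split => i; first by rewrite Phi_Lam.
case: eqP => _; rewrite !mul1mx !mulmx1 -!PhiM !dgM !mul0mx !mulmx0.
  by rewrite (hom_l He ha) (hom_r He ha).
by rewrite (hom_l He hc) (hom_r He hc).
Qed.

Let adm_up h : shom e S h -> forall j, B j *m Phi (up h) = Phi (up h) *m B' j.
Proof.
move=> hh j; rewrite /B /B'; case: split => i; first by rewrite Phi_Lam.
case: eqP => _; first by rewrite mulmx1 -PhiM dgup (hom_l He hh).
by rewrite mul1mx -PhiM updg (hom_r He hh).
Qed.

Let Blam (i : 'I_d) : B (lshift 2 i) = Lam m b`_i /\ B' (lshift 2 i) = Lam m b`_i.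
Proof.
rewrite /B /B'; have -> : split (lshift 2 i) = inl i :> ('I_d + 'I_2) by rewrite -[lshift 2 i]/(unsplit (inl i)) unsplitK.
by [].
Qed.
Let BP (i : 'I_2) : B (rshift d i) = (if i == 0 then Phi P0 else 1%:M) /\ B' (rshift d i) = (if i == 0 then 1%:M else Phi P1).
Proof.
rewrite /B /B'; have -> : split (rshift d i) = inr i :> ('I_d + 'I_2) by rewrite -[rshift d i]/(unsplit (inr i)) unsplitK.
by [].
Qed.

Let adm_ex h : (forall j, B j *m h = h *m B' j) -> exists2 f, shom e S f & h = Phi (up f).
Proof.
move=> H; have [|M EM] := @commutant _ A m h.
  by move=> i; have := H (lshift 2 i); have [-> ->] := Blam i.
have := H (rshift d 0); have [-> ->] := BP 0; rewrite eqxx mulmx1 EM -PhiM => /Phi_inj M0.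
have := H (rshift d 1); have [-> ->] := BP 1; rewrite /= mul1mx EM -PhiM => /Phi_inj M1.
exists (E0 *m ursubmx M *m E1); first exact: hom_sand.
congr Phi; rewrite -[LHS]M0 [in LHS]M1 -[M in LHS]submxK /P0 /P1 /dg !mulmx_block.
by rewrite !(mul0mx, mulmx0, addr0, add0r) mulmxA.
Qed.

(** The obstruction at each order is an off-diagonal part of an admissible map. By [od1] and [od2]
    it is f0 a + b f0, and cutting a and b down by the idempotents gives the conjugator that the
    Newton step needs. *)
Lemma homotopy_section : exists N (w0 : nat -> 'M[A]_(z0 S)) (w1 : nat -> 'M[A]_(z1 S)),
  [/\ forall j, hom e (y0 S) (y0 S) (w0 j) /\ hom e (y1 S) (y1 S) (w1 j),
      psum N w0 0 = u0 /\ psum N w1 0 = u1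
    & forall c, psum N w0 c *m ln f0 f1 c = ln f0 f1 c *m psum N w1 c].
Proof.
have hE1 : hom e (y1 S) (y1 S) E1 by apply: hom_Epr.
have hE0 : hom e (y0 S) (y0 S) E0 by apply: hom_Epr.
have uE0 : u0 *m E0 = u0 by exact: hom_r hu0. have Eu0 : E0 *m u0 = u0 by exact: hom_l hu0.
have uE1 : u1 *m E1 = u1 by exact: hom_r hu1. have Eu1 : E1 *m u1 = u1 by exact: hom_l hu1.
have u1c : u1 *m (E1 - u1) = 0 by rewrite mulmxBr uE1 u11 subrr.
have u1c' : (E1 - u1) *m u1 = 0 by rewrite mulmxBl Eu1 u11 subrr.
have u0c : u0 *m (E0 - u0) = 0 by rewrite mulmxBr uE0 u00 subrr.
have u0c' : (E0 - u0) *m u0 = 0 by rewrite mulmxBl Eu0 u00 subrr.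
have c1 : (E1 - u1) *m (E1 - u1) = E1 - u1 by rewrite mulmxBl u1c subr0 mulmxBr (EprK He) Eu1.
have c0 : (E0 - u0) *m (E0 - u0) = E0 - u0 by rewrite mulmxBl u0c subr0 mulmxBr (EprK He) Eu0.
have fu1 : f0 *m (E1 - u1) = (E0 - u0) *m f0 by rewrite mulmxBr mulmxBl uf (hom_l He hf0) (hom_r He hf0).
have [|||||||U [U0 cU UF]] := @section_ex k _ _ B B' (Phi (up f0)) (Phi (up (f1 - f0))) (Phi (dg u0 u1)).
- exact: adm_up.
- by apply: adm_up; apply: homB.
- exact: com_dg.
- by rewrite -PhiM dgM u00 u11.
- by rewrite -!PhiM dgup updg uf.
- move=> _ /adm_ex [h hh ->]; have [a [c [ha hc E]]] := od1 hh.
  exists (Phi (dg (u0 *m c *m (E0 - u0)) (- (u1 *m a *m (E1 - u1))))); split.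
  + apply: com_dg; first by apply: (homM He (homM He hu0 hc)); apply: homB.
    by rewrite -[- _]sub0r; apply: homB; [apply: hom0 | apply: (homM He (homM He hu1 ha)); apply: homB].
  + by rewrite -PhiM dgM mulmxN !mulmxA u00 u11.
  + rewrite -PhiM dgM mulNmx -!mulmxA u1c' u0c' !mulmx0 oppr0.
    by rewrite /dg (_ : block_mx _ _ _ _ = 0) ?Phi0 //; apply: block_mx0.
  + rewrite -!PhiM dgup updg -!PhiB -(Phi1 A) -PhiB -!PhiM upB; congr Phi.
    rewrite [RHS]mulmxBr mulmx1 dgup updg upB; congr up.
    transitivity (u0 *m h *m (E1 - u1)); last by rewrite mulmxBr -[u0 *m h *m E1]mulmxA (hom_r He hh).
    have -> : u0 *m h *m (E1 - u1) = u0 *m (f0 *m a + c *m f0) *m (E1 - u1).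
      by rewrite -E !mulmxA u00 -[RHS]mulmxA c1.
    rewrite mulmxDr mulmxDl mulmxN opprK addrC; congr (_ + _).
      by rewrite !mulmxA -uf.
    by rewrite -!mulmxA fu1.
- move=> _ /adm_ex [h hh ->]; have [a [c [ha hc E]]] := od2 hh.
  exists (Phi (dg ((E0 - u0) *m c *m u0) (- ((E1 - u1) *m a *m u1)))); split.
  + apply: com_dg; first by apply: (homM He _ hu0); apply: (homM He _ hc); apply: homB.
    by rewrite -[- _]sub0r; apply: homB; [apply: hom0 | apply: (homM He _ hu1); apply: (homM He _ ha); apply: homB].
  + rewrite -PhiM dgM mulmxN !mulmxA u1c u0c !mul0mx oppr0.
    by rewrite /dg (_ : block_mx _ _ _ _ = 0) ?Phi0 //; apply: block_mx0.
  + by rewrite -PhiM dgM mulNmx -!mulmxA u00 u11.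
  + rewrite -!PhiM dgup updg -!PhiB -(Phi1 A) -PhiB -!PhiM upB; congr Phi.
    rewrite [(1%:M - _) *m up h]mulmxBl mul1mx dgup upB updg; congr up.
    transitivity ((E0 - u0) *m h *m u1); last by rewrite [(E0 - u0) *m h]mulmxBl (hom_l He hh).
    have -> : (E0 - u0) *m h *m u1 = (E0 - u0) *m (f0 *m a + c *m f0) *m u1.
      by rewrite -E !mulmxA c0 -[RHS]mulmxA u11.
    rewrite mulmxDr mulmxDl mulmxN opprK addrC; congr (_ + _).
      by rewrite !mulmxA -fu1.
    by rewrite -!mulmxA uf.
have [N evN] := ev_coef U.
(* Each coefficient of [U] commutes with the [Lam] as well, so it comes from a matrix over [A]. *)
pose Uj j := map_mx (coefp j) U.
have /choice [w Hw] j : exists M, Uj j = Phi M.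
  apply: commutant => i; have [+ _] := cU (lshift 2 i); have [-> _] := Blam i.
  by move=> H; apply: coef_comm; rewrite H.
have evU c : ev c U = Phi (psum N w c).
  have -> : Phi (psum N w c) = \sum_(j < N) c ^+ j *: Uj j.
    rewrite /psum (big_morph (@Phi _ A m) (@PhiD _ A m) (@Phi0 _ A m)).
    by apply: eq_bigr => j _; rewrite PhiZ Hw.
  exact: evN.
have psumM p q r s (a : 'M[A]_(p, q)) (v : nat -> 'M[A]_(q, r)) (a' : 'M[A]_(r, s)) c :
    psum N (fun j => a *m v j *m a') c = a *m psum N v c *m a'.
  rewrite /psum mulmx_sumr mulmx_suml; apply: eq_bigr => j _.
  by rewrite scMr scMl.
have psumL p q r s (F : 'M[A]_(p, q) -> 'M[A]_(r, s)) (v : nat -> 'M[A]_(p, q)) c :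
    (forall x y, F (x + y) = F x + F y) -> (forall c' x, F (sc c' x) = sc c' (F x)) ->
    psum N (fun j => F (v j)) c = F (psum N v c).
  move=> FD FZ; have F0 : F 0 = 0 by rewrite -(sc0 0) FZ sc0.
  by rewrite /psum (big_morph F FD F0); apply: eq_bigr => j _; rewrite FZ.
have psU c : psum N (fun j => ulsubmx (w j)) c = ulsubmx (psum N w c :> 'M_m).
  by apply: psumL => [x y|c' x]; apply/matrixP => i j; rewrite !mxE.
have psD c : psum N (fun j => drsubmx (w j)) c = drsubmx (psum N w c :> 'M_m).
  by apply: psumL => [x y|c' x]; apply/matrixP => i j; rewrite !mxE.
exists N, (fun j => E0 *m ulsubmx (w j) *m E0), (fun j => E1 *m drsubmx (w j) *m E1); split.
- by move=> j; split; apply: hom_sand.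
- have := evU 0; rewrite U0 => /Phi_inj E.
  by rewrite !psumM psU psD -E /dg block_mxKul block_mxKdr Eu0 uE0 Eu1 uE1.
move=> c; rewrite !psumM psU psD.
have := congr1 (ev c) UF; rewrite !evM evU evD evZ hornerX !ev_cst -PhiZ -PhiD.
have -> : up f0 + sc c (up (f1 - f0)) = up (ln f0 f1 c).
  rewrite /up /ln; have -> : sc c (block_mx 0 (f1 - f0) 0 0) = block_mx 0 (sc c (f1 - f0)) 0 0.
    by move=> n0 n1; rewrite sc_block !sc_0.
  by rewrite add_block_mx !addr0.
rewrite -!PhiM => /Phi_inj; set W := psum N w c.
rewrite -[W]submxK /up !mulmx_block !(mul0mx, mulmx0, addr0, add0r) => /eq_block_mx [_ E _ _].
rewrite submxK.
have hl := hom_ln c hf0 hf1.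
by apply: corner_comm E; [exact: hom_l hl | exact: hom_r hl].
Qed.
End SectionLemma.

(** * Elimination of eigenvalues *)

Section Elimination.
Variable k : closedFieldType.

(* Polynomial functions of [c] and of [lam 0, .., lam d.-1]. *)
Inductive PF (d : nat) : (k -> (nat -> k) -> k) -> Prop :=
  | PF_poly (p : {poly k}) : PF d (fun c _ => p.[c])
  | PF_var a : (a < d)%N -> PF d (fun _ lam => lam a)
  | PF_add F G : PF d F -> PF d G -> PF d (fun c lam => F c lam + G c lam)
  | PF_mul F G : PF d F -> PF d G -> PF d (fun c lam => F c lam * G c lam).

Lemma PF_eq d F G : (forall c lam, F c lam = G c lam) -> PF d F -> PF d G.
Proof. by move=> H; have -> // : G = F; apply: funext => c; apply: funext => lam; rewrite H. Qed.

Lemma PF_const d x : PF d (fun _ _ => x).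
Proof. by apply: PF_eq (PF_poly d x%:P) => c lam; rewrite hornerC. Qed.

Lemma PF_sum d (I : Type) (r : seq I) (F : I -> k -> (nat -> k) -> k) :
  (forall i, PF d (F i)) -> PF d (fun c lam => \sum_(i <- r) F i c lam).
Proof.
move=> H; elim: r => [|i r IH].
  by apply: PF_eq (PF_const d 0) => c lam; rewrite big_nil.
by apply: PF_eq (PF_add (H i) IH) => c lam; rewrite big_cons.
Qed.

Lemma PF_prod d (I : Type) (r : seq I) (F : I -> k -> (nat -> k) -> k) :
  (forall i, PF d (F i)) -> PF d (fun c lam => \prod_(i <- r) F i c lam).
Proof.
move=> H; elim: r => [|i r IH].
  by apply: PF_eq (PF_const d 1) => c lam; rewrite big_nil.
by apply: PF_eq (PF_mul (H i) IH) => c lam; rewrite big_cons.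
Qed.

Lemma PF_exp d F j : PF d F -> PF d (fun c lam => F c lam ^+ j).
Proof.
move=> H; elim: j => [|j IH]; first by apply: PF_eq (PF_const d 1) => c lam; rewrite expr0.
by apply: PF_eq (PF_mul H IH) => c lam; rewrite exprS.
Qed.

Lemma PF_ext d F c lam lam' : PF d F -> (forall a, (a < d)%N -> lam a = lam' a) ->
  F c lam = F c lam'.
Proof. by move=> H E; elim: H => [p|a ad|F' G _ IF _ IG|F' G _ IF _ IG] //=; rewrite ?E ?IF ?IG. Qed.

(** Powers of the last variable are collected; the degree bound [m] is uniform in the parameters, so
    that [PF_norm] can expand the polynomial with a fixed number of coefficients. *)
Lemma PF_split d F : PF d.+1 F -> exists (m : nat) (P : k -> (nat -> k) -> {poly k}),
  [/\ forall j, PF d (fun c lam => (P c lam)`_j), forall c lam, (size (P c lam) <= m)%N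
    & forall c lam, F c lam = (P c lam).[lam d]].
Proof.
elim=> {F} [p|a ad|F G _ [m [P [P1 P2 P3]]] _ [m' [Q [Q1 Q2 Q3]]]|F G _ [m [P [P1 P2 P3]]] _ [m' [Q [Q1 Q2 Q3]]]].
- exists 1%N, (fun c _ => p.[c]%:P); split=> [j|c lam|c lam]; last by rewrite hornerC.
    by apply: PF_eq (_ : PF d (fun c _ => if j == 0%N then p.[c] else 0)) => [c lam|]; [rewrite coefC|case: eqP => _; [exact: PF_poly|exact: PF_const]].
  exact: size_polyC_leq1.
- have [->|ne] := eqVneq a d.
    exists 2, (fun _ _ => 'X); split=> [j|c lam|c lam]; last by rewrite hornerX.
      exact: PF_const.
    by rewrite size_polyX.
  exists 1%N, (fun _ lam => (lam a)%:P); split=> [j|c lam|c lam]; last by rewrite hornerC.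
    have a' : (a < d)%N by rewrite ltn_neqAle ne -ltnS.
    by apply: PF_eq (_ : PF d (fun _ lam => if j == 0%N then lam a else 0)) => [c lam|]; [rewrite coefC|case: eqP => _; [exact: PF_var|exact: PF_const]].
  exact: size_polyC_leq1.
- exists (maxn m m'), (fun c lam => P c lam + Q c lam); split=> [j|c lam|c lam].
  + by apply: PF_eq (PF_add (P1 j) (Q1 j)) => c lam; rewrite coefD.
  + by apply: leq_trans (size_polyD _ _) _; rewrite geq_max !leq_max P2 Q2 orbT.
  + by rewrite P3 Q3 hornerD.
- exists (m + m')%N, (fun c lam => P c lam * Q c lam); split=> [j|c lam|c lam].
  + by apply: PF_eq (PF_sum (index_enum 'I_j.+1) (fun i => PF_mul (P1 i) (Q1 (j - i)%N))) => c lam; rewrite coefM.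
  + apply: leq_trans (size_polyMleq _ _) _; apply: leq_trans (leq_pred _) _.
    by apply: leq_add.
  + by rewrite P3 Q3 hornerM.
Qed.

Variables (N : nat) (C : 'M[{poly k}]_N.+1).
Definition eig c mu := root (char_poly (ev c C)) mu.

(** [p] splits into linear factors, and det(M - z) vanishes exactly when z is an eigenvalue. *)
Lemma det_horner_eq0 (M : 'M[k]_N.+1) (p : {poly k}) :
  \det (horner_mx M p) = 0 <-> exists2 mu, root (char_poly M) mu & p.[mu] = 0.
Proof.
have detX z : (\det (horner_mx M ('X - z%:P)) == 0) = root (char_poly M) z.
  rewrite rmorphB /= horner_mx_X horner_mx_C -eigenvalue_root_char /eigenvalue /eigenspace.
  by rewrite kermx_eq0 row_free_unit unitmxE unitfE negbK.
have [->|p0] := eqVneq p 0.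
  rewrite rmorph0 det0; split=> // _.
  have [mu Hmu] : exists mu, root (char_poly M) mu by apply/closed_rootP; rewrite size_char_poly.
  by exists mu; rewrite ?horner0.
have [r Er] := closed_field_poly_normal p.
rewrite Er linearZ /= detZ.
have H1 : (lead_coef p ^+ N.+1 * \det (horner_mx M (\prod_(z <- r) ('X - z%:P))) == 0) = has (fun z => root (char_poly M) z) r.
  rewrite mulf_eq0 expf_eq0 lead_coef_eq0 (negPf p0) andbF /=.
  elim: r {Er} => [|z r IH]; first by rewrite big_nil rmorph1 det1 oner_eq0.
  by rewrite big_cons rmorphM /= det_mulmx mulf_eq0 IH detX.
have H2 mu : ((lead_coef p *: \prod_(z <- r) ('X - z%:P)).[mu] == 0) = (mu \in r).
  by rewrite hornerZ mulf_eq0 lead_coef_eq0 (negPf p0) /= -/(root _ _) root_prod_XsubC.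
split=> [/eqP|[mu Hmu /eqP]].
  by rewrite H1 => /hasP [z zr Hz]; exists z => //; apply/eqP; rewrite H2.
by rewrite H2 => mur; apply/eqP; rewrite H1; apply/hasP; exists mu.
Qed.

(** Substituting the matrix for the last variable and taking the determinant multiplies [F] over the
    eigenvalues, and the result is still polynomial in the remaining variables. *)
Lemma PF_norm d F : PF d.+1 F -> exists2 G, PF d G & forall c lam,
  G c lam = 0 <-> exists2 mu, eig c mu & F c (fun a => if a == d then mu else lam a) = 0.
Proof.
move=> HF; have [m [P [P1 P2 P3]]] := PF_split HF.
exists (fun c lam => \det (horner_mx (ev c C) (P c lam))); last first.
  move=> c lam; rewrite det_horner_eq0 /eig.
  have E mu : F c (fun a => if a == d then mu else lam a) = (P c lam).[mu].
    rewrite P3 eqxx; congr (_.[_]); apply/polyP => j.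
    by apply: (PF_ext c (P1 j)) => a ad; rewrite ltn_eqF.
  by split=> -[mu h1 h2]; exists mu; rewrite ?E // -E.
have PE i j : PF d (fun c lam => horner_mx (ev c C) (P c lam) i j).
  apply: PF_eq (_ : PF d (fun c lam => \sum_(l < m) (P c lam)`_l * (ev c C ^+ l) i j)).
    move=> c lam.
    rewrite (_ : horner_mx (ev c C) (P c lam) = \sum_(l < m) (P c lam)`_l *: ev c C ^+ l).
      by rewrite summxE; apply: eq_bigr => l _; rewrite mxE.
    have {1}-> : P c lam = \poly_(l < m) (P c lam)`_l.
      apply/polyP => l; rewrite coef_poly; case: ltnP => // ml.
      by rewrite nth_default // (leq_trans (P2 c lam) ml).
    rewrite poly_def rmorph_sum; apply: eq_bigr => l _.
    by rewrite /= linearZ /= rmorphXn /= horner_mx_X.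
  apply: PF_sum => l; apply: PF_mul; first exact: P1.
  apply: PF_eq (PF_poly d ((C ^+ l) i j)) => c lam.
  by rewrite -[ev c C ^+ l](rmorphXn (map_mx (horner_eval c))) mxE.
apply: PF_sum => s; apply: PF_mul; first by apply: PF_const.
by apply: PF_prod => i; apply: PE.
Qed.

Lemma PF_elim d F : PF d F -> exists g : {poly k}, forall c,
  g.[c] = 0 <-> exists lam, (forall a, (a < d)%N -> eig c (lam a)) /\ F c lam = 0.
Proof.
elim: d F => [|d IH] F HF.
  have [g Hg] : exists g : {poly k}, forall c lam, F c lam = g.[c].
    elim: HF => [p|a //|F' G _ [p Hp] _ [q Hq]|F' G _ [p Hp] _ [q Hq]].
    - by exists p.
    - by exists (p + q) => c lam; rewrite Hp Hq hornerD.
    - by exists (p * q) => c lam; rewrite Hp Hq hornerM.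
  exists g => c; split=> [H|[lam [_]]]; last by rewrite Hg.
  by exists (fun _ => 0); rewrite Hg.
have [G HG GE] := PF_norm HF; have [g Hg] := IH G HG.
exists g => c; rewrite Hg; split=> [[lam [Hl /GE [mu Hmu HF0]]]|[lam [Hl HF0]]].
  exists (fun a => if a == d then mu else lam a); split => // a ad.
  by case: eqP => // /eqP ne; apply: Hl; rewrite ltn_neqAle ne -ltnS.
exists lam; split; first by move=> a ad; apply: Hl; apply: ltnW.
apply/GE; exists (lam d); first exact: Hl.
by rewrite -HF0; apply: (PF_ext c HF) => a _; case: eqP => [->|].
Qed.

(* The points where the [G i] have a common zero in the eigenvalues form a closed set:
   eigenvalues are eliminated one at a time by taking norms. *)
Lemma elimination_fin d (I : finType) (G : I -> k -> (nat -> k) -> k) :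
  (forall i, PF d (G i)) ->
  infin (fun c => exists lam, (forall a, (a < d)%N -> eig c (lam a)) /\ forall i, G i c lam = 0) ->
  forall c, exists lam, (forall a, (a < d)%N -> eig c (lam a)) /\ forall i, G i c lam = 0.
Proof.
move=> HG Hinf c.
(* An auxiliary scalar [z] merges the equations into one, to which single-equation elimination
   applies; its powers keep them apart. *)
pose F z c lam := \sum_(i : I) z ^+ enum_rank i * G i c lam.
have HF z : PF d (F z).
  by apply: PF_sum => i; apply: PF_mul => //; apply: PF_const.
have Hz z : exists lam, (forall a, (a < d)%N -> eig c (lam a)) /\ F z c lam = 0.
  have [g Hg] := PF_elim (HF z); apply/Hg.
  suff -> : g = 0 by rewrite horner0.
  apply: infin_poly0; apply: infinW Hinf => c' [lam [H1 H2]]; apply/Hg; exists lam; split => //.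
  by rewrite /F big1 // => i _; rewrite H2 mulr0.
have [r Er] := closed_field_poly_normal (char_poly (ev c C)).
have eigE mu : eig c mu = (mu \in r).
  by rewrite /eig Er (monicP (char_poly_monic _)) scale1r root_prod_XsubC.
have eigr mu : eig c mu -> mu \in r by rewrite eigE.
pose lamf (s : {ffun 'I_d -> 'I_(size r)}) a :=
  if insub a is Some i then nth 0 r (s i) else 0.
(* At fixed [c] there are finitely many tuples of eigenvalues, so one of them solves the merged
   equation for infinitely many [z], and therefore every single equation. *)
have [|s Hs] := @infin_pigeonhole k {ffun 'I_d -> 'I_(size r)} (fun _ => True)
    (fun s z => F z c (lamf s) = 0) (cofin_infin (cofin_true (fun _ => Logic.I))).
  move=> z _; have [lam [Hl F0]] := Hz z.
  have Hi (i : 'I_d) : (index (lam i) r < size r)%N by rewrite index_mem eigr // Hl.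
  exists [ffun i => Ordinal (Hi i)]; rewrite -F0; apply: (PF_ext c (HF z)) => a ad.
  by rewrite /lamf insubT ffunE /= nth_index // eigr // Hl.
exists (lamf s); split=> [a ad|i].
  by rewrite /lamf insubT eigE mem_nth.
pose p := \poly_(j < #|I|) (if insub j is Some j' then G (enum_val (j' : 'I_#|I|)) c (lamf s) else 0).
have p0 : p = 0.
  apply: infin_poly0; apply: infinW Hs => z; rewrite /F => <-.
  rewrite /p horner_poly (reindex_onto (@enum_val I predT) enum_rank) /=; last by move=> j _; rewrite enum_rankK.
  rewrite [RHS](eq_bigl predT); last by move=> j; rewrite enum_valK eqxx.
  by apply: eq_bigr => j _; rewrite valK enum_valK mulrC.
have := congr1 (fun q : {poly k} => q`_(enum_rank i)) p0.
by rewrite coef_poly ltn_ord valK enum_rankK coef0.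
Qed.

(** If each of the finitely many eigenvalue tuples at [c] violated some equation, those finitely
    many equations would contradict the finite case. *)
Lemma elimination d (I : Type) (G : I -> k -> (nat -> k) -> k) :
  (forall i, PF d (G i)) ->
  infin (fun c => exists lam, (forall a, (a < d)%N -> eig c (lam a)) /\ forall i, G i c lam = 0) ->
  forall c, exists lam, forall i, G i c lam = 0.
Proof.
move=> HG Hinf c; apply: contrapT => Hno.
have [r Er] := closed_field_poly_normal (char_poly (ev c C)).
have eigr mu : eig c mu -> mu \in r.
  by rewrite /eig Er (monicP (char_poly_monic _)) scale1r root_prod_XsubC.
pose lamf (s : {ffun 'I_d -> 'I_(size r)}) a :=
  if insub a is Some i then nth 0 r (s i) else 0.
have /choice [h Hh] : forall s, exists i, G i c (lamf s) <> 0.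
  move=> s; apply: contrapT => H; apply: Hno; exists (lamf s) => i.
  by apply: contrapT => Hi; apply: H; exists i.
have [|lam [Hl H0]] := @elimination_fin d _ (fun s => G (h s)) (fun s => HG (h s)) _ c.
  by apply: infinW Hinf => c' [lam [h1 h2]]; exists lam.
have Hi (i : 'I_d) : (index (lam i) r < size r)%N by rewrite index_mem eigr // Hl.
apply: (Hh [ffun i => Ordinal (Hi i)]); rewrite -[RHS](H0 [ffun i => Ordinal (Hi i)]).
apply: (PF_ext c (HG _)) => a ad.
by rewrite /lamf insubT ffunE /= nth_index // eigr // Hl.
Qed.
End Elimination.

(** * Splitting idempotents of projectives *)

Section Splitting.
Variables (k : closedFieldType) (A : falgType k) (n : nat) (e : 'I_n -> A).
Hypothesis He : complete_projectives e.
Let Hp i : primitive_idem (e i). Proof. by case: He. Qed.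

Definition fsum m p (s : 'I_m -> 'I_n) (t : 'I_p -> 'I_n) (i : 'I_(m + p)) : 'I_n :=
  match split i with inl j => s j | inr j => t j end.
Definition cnt m (s : 'I_m -> 'I_n) v := (\sum_i (s i == v))%N.

Lemma fsum_l m p (s : 'I_m -> 'I_n) (t : 'I_p -> 'I_n) i : fsum s t (lshift p i) = s i.
Proof. by rewrite /fsum (unsplitK (inl i)). Qed.
Lemma fsum_r m p (s : 'I_m -> 'I_n) (t : 'I_p -> 'I_n) i : fsum s t (rshift m i) = t i.
Proof. by rewrite /fsum (unsplitK (inr i)). Qed.
Lemma cnt_fsum m p (s : 'I_m -> 'I_n) (t : 'I_p -> 'I_n) v : cnt (fsum s t) v = (cnt s v + cnt t v)%N.
Proof.
rewrite /cnt big_split_ord; congr (_ + _)%N; apply: eq_bigr => i _; by rewrite ?fsum_l ?fsum_r.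
Qed.
Lemma fsumE m p (s : 'I_(m + p) -> 'I_n) : s = fsum (fun i => s (lshift p i)) (fun i => s (rshift m i)).
Proof. by apply: funext => i; rewrite /fsum; case: splitP => j E; congr s; apply: val_inj. Qed.
Lemma Epr_fsum m p (s : 'I_m -> 'I_n) (t : 'I_p -> 'I_n) :
  Epr e (fsum s t) = block_mx (Epr e s) 0 0 (Epr e t).
Proof.
rewrite /Epr -diag_mx_row; congr diag_mx; apply/rowP => i; rewrite !mxE /fsum.
by case: splitP => j _; rewrite mxE.
Qed.
Lemma hom_col m p q (r : 'I_m -> 'I_n) (r' : 'I_p -> 'I_n) (s : 'I_q -> 'I_n) f g :
  hom e r s f -> hom e r' s g -> hom e (fsum r r') s (col_mx f g).
Proof.
move=> hf hg; apply: homI.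
  by rewrite Epr_fsum mul_block_col !mul0mx addr0 add0r (hom_l He hf) (hom_l He hg).
by rewrite mul_col_mx (hom_r He hf) (hom_r He hg).
Qed.
Lemma hom_row m p q (r : 'I_m -> 'I_n) (r' : 'I_p -> 'I_n) (s : 'I_q -> 'I_n) f g :
  hom e s r f -> hom e s r' g -> hom e s (fsum r r') (row_mx f g).
Proof.
move=> hf hg; apply: homI.
  by rewrite mul_mx_row (hom_l He hf) (hom_l He hg).
by rewrite Epr_fsum mul_row_block !mulmx0 addr0 add0r (hom_r He hf) (hom_r He hg).
Qed.

Definition image_of m (s : 'I_m -> 'I_n) (U : 'M[A]_m) q (r : 'I_q -> 'I_n) :=
  exists i p, [/\ hom e s r i, hom e r s p, p *m i = Epr e r & i *m p = U].

Definition splits m (s : 'I_m -> 'I_n) (U : 'M[A]_m) := exists q1 q2 (r : 'I_q1 -> 'I_n) (r' : 'I_q2 -> 'I_n),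
  [/\ image_of s U r, image_of s (Epr e s - U) r' & forall v, cnt s v = (cnt r v + cnt r' v)%N].

Lemma splits_sym m (s : 'I_m -> 'I_n) U : splits s (Epr e s - U) -> splits s U.
Proof.
case=> q1 [q2 [r [r' [H1 H2 H3]]]]; exists q2, q1, r', r; split => //.
  by rewrite opprB addrC subrK in H2.
by move=> v; rewrite addnC.
Qed.

Section Step.
Variables (m : nat) (v : 'I_1 -> 'I_n) (s : 'I_m -> 'I_n) (U : 'M[A]_(1 + m)).
Let t := fsum v s.
Hypotheses (hU : hom e t t U) (UU : U *m U = U).
Hypothesis IH : forall U', hom e s s U' -> U' *m U' = U' -> splits s U'.
Let Ev := Epr e v.
Let i0 : 'M[A]_(1 + m, 1) := col_mx Ev 0.
Let p0 : 'M[A]_(1, 1 + m) := row_mx Ev 0.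
Let i1 : 'M[A]_(1 + m, m) := col_mx 0 (Epr e s).
Let p1 : 'M[A]_(m, 1 + m) := row_mx 0 (Epr e s).
Let hv : hom e v v Ev. Proof. exact: hom_Epr. Qed.
Let hs : hom e s s (Epr e s). Proof. exact: hom_Epr. Qed.
Let hi0 : hom e t v i0. Proof. by apply: hom_col => //; apply: hom0. Qed.
Let hi1 : hom e t s i1. Proof. by apply: hom_col => //; apply: hom0. Qed.
Let hp0 : hom e v t p0. Proof. by apply: hom_row => //; apply: hom0. Qed.
Let hp1 : hom e s t p1. Proof. by apply: hom_row => //; apply: hom0. Qed.
Let p1i1 : p1 *m i1 = Epr e s. Proof. by rewrite mul_row_col mul0mx add0r (EprK He). Qed.
Let p0i1 : p0 *m i1 = 0. Proof. by rewrite mul_row_col mulmx0 mul0mx addr0. Qed.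
Let iip : i1 *m p1 = Epr e t - i0 *m p0.
Proof.
rewrite /t Epr_fsum !mul_col_row !mul0mx !mulmx0 !(EprK He) opp_block_mx add_block_mx.
by rewrite !oppr0 !addr0 subrr.
Qed.

(** Where the corner of [U] at P(v) is invertible, [T] projects onto a copy of P(v) inside the image
    of [U]. Its complement is isomorphic to the remaining summands through [j] and [q], and [U - T]
    becomes an idempotent there. *)
Lemma split_step (al : 'M[A]_1) : hom e v v al -> al *m (p0 *m U *m i0) = Ev ->
  (p0 *m U *m i0) *m al = Ev -> splits t U.
Proof.
move=> hal al1 al2; pose a := p0 *m U *m i0.
pose A0 := U *m i0; pose B0 := al *m p0 *m U; pose T := A0 *m B0.
have hA0 : hom e t v A0 by apply: homM hi0.
have hB0 : hom e v t B0 by apply: (homM He (homM He hal hp0) hU).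
have hT : hom e t t T by apply: homM hB0.
have B0A0 : B0 *m A0 = Ev by rewrite /B0 /A0 -!mulmxA [U *m (U *m _)]mulmxA UU mulmxA -al1 !mulmxA.
have TA0 : T *m A0 = A0 by rewrite /T -mulmxA B0A0 (hom_r He hA0).
have B0T : B0 *m T = B0 by rewrite /T mulmxA B0A0 (hom_l He hB0).
have TT : T *m T = T by rewrite {1}/T -mulmxA B0T.
have UT : U *m T = T by rewrite /T /A0 !mulmxA UU.
have TU : T *m U = T by rewrite /T /B0 -!mulmxA UU.
have hE : hom e t t (Epr e t) by apply: hom_Epr.
have ET : Epr e t *m T = T := hom_l He hT.
have TE : T *m Epr e t = T := hom_r He hT.
have EU : Epr e t *m U = U := hom_l He hU.
have UE : U *m Epr e t = U := hom_r He hU.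
(* [ct] projects onto the kernel of [p0] along the image of [A0]; this is what makes [q] inverse to
   [j]. *)
pose ct := Epr e t - A0 *m al *m p0.
pose j := (Epr e t - T) *m i1; pose q := p1 *m ct.
have hct : hom e t t ct by apply: homB hE _; apply: (homM He (homM He hA0 hal) hp0).
have hj : hom e t s j by apply: (homM He _ hi1); apply: homB.
have hq : hom e s t q by apply: homM hct.
have p0A0 : p0 *m A0 = a by rewrite /a /A0 mulmxA.
have ctA0 : ct *m A0 = 0.
  rewrite mulmxBl (hom_l He hA0) -[A0 *m al *m p0 *m A0]mulmxA p0A0 -[A0 *m al *m a]mulmxA.
  by rewrite al1 (hom_r He hA0) subrr.
have ctT : ct *m T = 0 by rewrite /T mulmxA ctA0 mul0mx.
have ctE : ct *m Epr e t = ct := hom_r He hct.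
have qj : q *m j = Epr e s.
  rewrite /q /j -mulmxA [ct *m _]mulmxA mulmxBr ctT ctE subr0 mulmxBl (hom_l He hi1).
  by rewrite -[A0 *m al *m p0 *m i1]mulmxA p0i1 mulmx0 subr0 p1i1.
have jq : j *m q = Epr e t - T.
  rewrite /q /j -mulmxA [i1 *m _]mulmxA iip [(Epr e t - i0 *m p0) *m ct]mulmxBl -[i0 *m p0 *m ct]mulmxA.
  have -> : p0 *m ct = 0.
    rewrite mulmxBr (hom_r He hp0) -[A0 *m al *m p0]mulmxA [p0 *m (A0 *m _)]mulmxA p0A0 mulmxA.
    by rewrite al2 (hom_l He hp0) subrr.
  rewrite mulmx0 subr0 (hom_l He hct) mulmxBr.
  rewrite -[A0 *m al *m p0]mulmxA [(Epr e t - T) *m (A0 *m _)]mulmxA [(Epr e t - T) *m A0]mulmxBl.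
  by rewrite (hom_l He hA0) TA0 subrr mul0mx subr0 mulmxBl (hom_l He hE) TE.
have qA0 : q *m A0 = 0 by rewrite /q -mulmxA ctA0 mulmx0.
have B0j : B0 *m j = 0.
  by rewrite /j mulmxA mulmxBr (hom_r He hB0) B0T subrr mul0mx.
have jqj : (Epr e t - T) *m j = j by rewrite -jq -mulmxA qj (hom_r He hj).
have qjq : q *m (Epr e t - T) = q by rewrite -jq mulmxA qj (hom_l He hq).
have cUc : (Epr e t - T) *m (U - T) *m (Epr e t - T) = U - T.
  by rewrite mulmxBl !mulmxBr EU ET TU TT subrr subr0 !mulmxBl UE UT TE TT subrr subr0.
have AB : A0 *m B0 = T by [].
clearbody q j T ct A0 B0.
have cD : (Epr e t - T) *m (U - T) = U - T by rewrite mulmxBl !mulmxBr EU ET TU TT subrr subr0.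
pose U' := q *m (U - T) *m j.
have UTT : (U - T) *m (U - T) = U - T by rewrite mulmxBl !mulmxBr UU UT TU TT subrr subr0.
have hU' : hom e s s U' by apply: (homM He _ hj); apply: (homM He hq); apply: homB.
have UU' : U' *m U' = U'.
  rewrite /U' -[q *m (U - T) *m j *m _]mulmxA [j *m _]mulmxA [j *m (q *m _)]mulmxA jq cD.
  by rewrite mulmxA -[q *m (U - T) *m (U - T)]mulmxA UTT.
have [q1 [q2 [r [r' [[i [p [hi hp pi ip]]] [i' [p' [hi' hp' pi' ip']]] Hc]]]]] := IH hU' UU'.
have jUq : j *m U' *m q = U - T.
  by rewrite /U' -[j *m _ *m q]mulmxA -[_ *m j *m q]mulmxA jq [j *m _]mulmxA [j *m (q *m _)]mulmxA jq cUc.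
exists (1 + q1)%N, q2, (fsum v r), r'; split.
- exists (row_mx A0 (j *m i)), (col_mx B0 (p *m q)); split.
  + by apply: hom_row => //; apply: homM hi.
  + by apply: hom_col => //; apply: homM hq.
  + rewrite mul_col_row Epr_fsum B0A0 mulmxA B0j mul0mx -mulmxA qA0 mulmx0; congr (block_mx _ _ _ _).
    by rewrite -mulmxA [q *m (j *m _)]mulmxA qj (hom_l He hi) pi.
  + rewrite mul_row_col AB -mulmxA [i *m (p *m q)]mulmxA ip mulmxA jUq.
    by rewrite addrC subrK.
- exists (j *m i'), (p' *m q); split; [exact: homM hi' | exact: homM hq | |].
    by rewrite -mulmxA [q *m (j *m _)]mulmxA qj (hom_l He hi') pi'.
  rewrite -mulmxA [i' *m (p' *m q)]mulmxA ip' mulmxA mulmxBr (hom_r He hj) mulmxBl jq jUq.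
  by rewrite opprB addrA subrK.
- by move=> w; rewrite !cnt_fsum Hc addnA.
Qed.
End Step.

(** Krull-Schmidt by induction on the number of summands: the corner at the first summand is local,
    so the corner of [U] or that of its complement is invertible there. *)
Lemma split_idem m (s : 'I_m -> 'I_n) U : hom e s s U -> U *m U = U -> splits s U.
Proof.
elim: m s U => [|m IH] s U hU UU.
  exists 0%N, 0%N, s, s; split.
  - by exists 0, 0; split; [exact: hom0|exact: hom0| |]; apply/matrixP => -[].
  - by exists 0, 0; split; [exact: hom0|exact: hom0| |]; apply/matrixP => -[].
  - by move=> v; rewrite /cnt !big_ord0.
move: s U hU UU; rewrite -[m.+1]/(1 + m)%N => s U; rewrite [s]fsumE.
set v := fun i => _; set s' := fun i => _ => hU UU.
pose p0 : 'M[A]_(1, 1 + m) := row_mx (Epr e v) 0.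
pose i0 : 'M[A]_(1 + m, 1) := col_mx (Epr e v) 0.
have hp0 : hom e v (fsum v s') p0 by apply: hom_row; [exact: hom_Epr | exact: hom0].
have hi0 : hom e (fsum v s') v i0 by apply: hom_col; [exact: hom_Epr | exact: hom0].
have hv : hom e v v (Epr e v) by apply: hom_Epr.
have unit1 (B : 'M[A]_1) : hom e v v B -> cunit (e (v 0)) (B 0 0) ->
    exists al, [/\ hom e v v al, al *m B = Epr e v & B *m al = Epr e v].
  move=> hB [z Hz [zb bz]]; exists z%:M.
  have E1 : Epr e v = (e (v 0))%:M by apply/matrixP => i j; rewrite EprE mxE !ord1.
  have EB : B = (B 0 0)%:M by apply/matrixP => i j; rewrite mxE !ord1.
  split; last 2 [by rewrite EB E1 -scalar_mxM ?zb ?bz].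
    by apply: homI; rewrite E1 -scalar_mxM ?(corner_l (Hp _) Hz) ?(corner_r (Hp _) Hz).
  by rewrite EB E1 -scalar_mxM bz.
have ha V : hom e (fsum v s') (fsum v s') V -> hom e v v (p0 *m V *m i0) by move=> hV; apply: (homM He (homM He hp0 hV) hi0).
have hc (B : 'M[A]_1) : hom e v v B -> corner (e (v 0)) (B 0 0).
  by move=> hB; rewrite /corner -{2}hB Epr_r Epr_l.
have [u|nu] := fitting (Hp (v 0)) (hc _ (ha _ hU)).
  have [al [h1 h2 h3]] := unit1 _ (ha _ hU) u.
  exact: (split_step hU UU (IH s') h1 h2 h3).
apply: splits_sym.
have hU' : hom e (fsum v s') (fsum v s') (Epr e (fsum v s') - U) by apply: homB => //; apply: hom_Epr.
have UU' : (Epr e (fsum v s') - U) *m (Epr e (fsum v s') - U) = Epr e (fsum v s') - U.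
  by rewrite mulmxBl !mulmxBr (EprK He) (hom_l He hU) (hom_r He hU) UU subrr subr0.
have [|al [h1 h2 h3]] := unit1 _ (ha _ hU').
  rewrite (_ : _ 0 0 = e (v 0) - (p0 *m U *m i0) 0 0).
    by apply: nilp_oneB => //; apply: hc; apply: ha.
  rewrite mulmxBr mulmxBl (hom_r He hp0) mul_row_col mul0mx addr0 (EprK He) !mxE.
  by rewrite eqxx mulr1n.
exact: (split_step hU' UU' (IH s') h1 h2 h3).
Qed.
End Splitting.

Lemma det_sylvester (R : comNzRingType) m p (X : 'M[R]_(m, p)) (Y : 'M[R]_(p, m)) :
  \det (1%:M + X *m Y) = \det (1%:M + Y *m X).
Proof.
have E : block_mx 1%:M 0 (- Y) 1%:M *m block_mx 1%:M X 0 (1%:M + Y *m X) =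
         block_mx (1%:M + X *m Y) X 0 1%:M *m block_mx 1%:M 0 (- Y) 1%:M.
  rewrite !mulmx_block !mul1mx !mulmx1 !mul0mx !mulmx0 ?mul1mx ?mulmx1 ?addr0 ?add0r.
  by rewrite mulmxN mulNmx addrK addrCA addNr addr0.
have := congr1 determinant E.
by rewrite !det_mulmx !det_lblock !det_ublock !det1 !mul1r !mulr1.
Qed.

(** det(1 - c X) is a polynomial in c without zeros, since the geometric sum inverts 1 - c X; over
    an algebraically closed field it is constant, equal to its value 1 at 0. *)
Lemma det_oneB_nilp (k : closedFieldType) m (X : 'M[k]_m) N : X ^+ N = 0 -> \det (1%:M - X) = 1.
Proof.
move=> XN; pose P : {poly k} := \det (1%:M - 'X *: map_mx polyC X).
have PE c : P.[c] = \det (1%:M - c *: X).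
  rewrite -horner_evalE -det_map_mx; congr determinant; apply/matrixP => i j.
  by rewrite mxE /= horner_evalE !mxE !hornerE hornerMn hornerC.
have nz c : P.[c] != 0.
  rewrite PE; apply/eqP => d0.
  have : (1%:M - c *: X) \in unitmx.
    have cN : (c *: X) ^+ N = 0.
      have E j : (c *: X) ^+ j = c ^+ j *: X ^+ j.
        by elim: j => [|j IH]; rewrite ?expr0 ?scale1r // !exprS IH -!mulmxE -scalemxAl -scalemxAr scalerA.
      by rewrite E XN scaler0.
    have H1 : (1%:M - c *: X) *m (\sum_(i < N) (c *: X) ^+ i) = 1%:M.
      have := subrX1 (c *: X) N; rewrite cN sub0r => /(congr1 -%R); rewrite opprK.
      by rewrite -mulNr opprB => H; rewrite mulmxE -H.
    by have [] := mulmx1_unit H1.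
  by rewrite unitmxE d0 unitr0.
have sP : size P = 1%N.
  apply/eqP; rewrite -[_ == _]negbK; apply/negP => s1.
  have [c /rootP Hc] := closed_rootP P s1.
  by move: (nz c); rewrite Hc eqxx.
have [x x0 Px] := size_poly1P _ (introT eqP sP).
by have := PE 0; have := PE 1; rewrite Px !hornerC scale1r scale0r subr0 det1 => <- ->.
Qed.

(** * Characteristic polynomials on the tops of projectives *)

Section Residues.
Variables (k : closedFieldType) (A : falgType k) (n : nat) (e : 'I_n -> A).
Hypothesis He : complete_projectives e.
Implicit Types v : 'I_n.

Definition Res v m p (s : 'I_m -> 'I_n) (t : 'I_p -> 'I_n) (x : 'M[A]_(m, p)) : 'M[k]_(m, p) :=
  \matrix_(i, j) if (s i == v) && (t j == v) then eps He v (x i j) else 0.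

(** A path from P(v) to P(v) through another indecomposable has residue 0 by [epsM_neq], so only the
    intermediate indices at [v] contribute. *)
Lemma ResM v m p q (s : 'I_m -> 'I_n) (t : 'I_p -> 'I_n) (u : 'I_q -> 'I_n) x y :
  hom e s t x -> Res v s u (x *m y) = Res v s t x *m Res v t u y.
Proof.
move=> /(hom_r He) hx; apply/matrixP => i j; rewrite !mxE.
case: (boolP (s i == v)) => [/eqP si|/negPf si] /=; last by rewrite big1 // => l _; rewrite !mxE si mul0r.
case: (boolP (u j == v)) => [/eqP uj|/negPf uj] /=; last first.
  by rewrite big1 // => l _; rewrite !mxE uj andbF mulr0.
rewrite eps_sum; apply: eq_bigr => l _; rewrite !mxE -{1}hx Epr_r si uj eqxx.
rewrite andbT /=; case: (t l =P v) => [->|/eqP tl]; first by rewrite epsM.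
by rewrite epsM_neq 1?eq_sym // mulr0.
Qed.
Lemma ResD v m p (s : 'I_m -> 'I_n) (t : 'I_p -> 'I_n) x y : Res v s t (x + y) = Res v s t x + Res v s t y.
Proof. by apply/matrixP => i j; rewrite !mxE epsD; case: ifP; rewrite ?addr0. Qed.
Lemma ResZ v m p (s : 'I_m -> 'I_n) (t : 'I_p -> 'I_n) c x : Res v s t (sc c x) = c *: Res v s t x.
Proof. by apply/matrixP => i j; rewrite !mxE epsZ; case: ifP; rewrite ?mulr0. Qed.
Lemma Res0 v m p (s : 'I_m -> 'I_n) (t : 'I_p -> 'I_n) : Res v s t 0 = 0.
Proof. by rewrite -(sc0 0) ResZ scale0r. Qed.
Lemma ResB v m p (s : 'I_m -> 'I_n) (t : 'I_p -> 'I_n) x y : Res v s t (x - y) = Res v s t x - Res v s t y.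
Proof. by apply/eqP; rewrite eq_sym subr_eq -ResD subrK. Qed.

Definition Dv v m (s : 'I_m -> 'I_n) : 'M[k]_m := diag_mx (\row_i (s i == v)%:R).
Lemma Res_Epr v m (s : 'I_m -> 'I_n) : Res v s s (Epr e s) = Dv v s.
Proof.
apply/matrixP => i j; rewrite mxE EprE !mxE; case: (i =P j) => [<-|ij].
  by rewrite !mulr1n andbb; case: eqP => // ->; rewrite eps_e.
by rewrite !mulr0n eps0 if_same.
Qed.
Lemma Dv_l v m p (s : 'I_m -> 'I_n) (t : 'I_p -> 'I_n) x : hom e s t x -> Dv v s *m Res v s t x = Res v s t x.
Proof. by move=> hx; rewrite -Res_Epr -ResM ?(hom_l He hx) //; apply: hom_Epr. Qed.
Lemma Dv_r v m p (s : 'I_m -> 'I_n) (t : 'I_p -> 'I_n) x : hom e s t x -> Res v s t x *m Dv v t = Res v s t x.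
Proof. by move=> hx; rewrite -Res_Epr -ResM ?(hom_r He hx). Qed.
Lemma DvK v m (s : 'I_m -> 'I_n) : Dv v s *m Dv v s = Dv v s.
Proof. by rewrite -{2 3}Res_Epr Dv_l //; apply: hom_Epr. Qed.

(* The characteristic polynomial at [y] of the action of [w] on the [e v]-isotypic part
   of the top of the projective; the complementary diagonal block contributes 1. *)
Definition chi v m (s : 'I_m -> 'I_n) (w : 'M[A]_m) (y : k) :=
  \det (1%:M + (y - 1) *: Dv v s - Res v s s w).

(** Sylvester's identity carries the determinant over to the two summands, whose cross terms vanish,
    so that the matrix becomes block diagonal. *)
Lemma chi_split v m (s : 'I_m -> 'I_n) q (r : 'I_q -> 'I_n) q' (r' : 'I_q' -> 'I_n) i p i' p' w y :
  hom e s r i -> hom e r s p -> hom e s r' i' -> hom e r' s p' -> hom e s s w ->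
  p *m i = Epr e r -> p' *m i' = Epr e r' -> i *m p + i' *m p' = Epr e s ->
  w *m (i *m p) = (i *m p) *m w ->
  chi v s w y = chi v r (p *m w *m i) y * chi v r' (p' *m w *m i') y.
Proof.
move=> hi hp hi' hp' hw pi pi' E wc.
have pi0 : p *m i' = 0.
  have : p *m (i *m p + i' *m p') *m i' = p *m i' by rewrite E (hom_r He hp).
  rewrite mulmxDr mulmxDl mulmxA pi (hom_l He hp) -!mulmxA pi' (hom_r He hi') => /eqP.
  by rewrite -subr_eq0 addrK => /eqP.
have pi0' : p' *m i = 0.
  have : p' *m (i *m p + i' *m p') *m i = p' *m i by rewrite E (hom_r He hp').
  rewrite mulmxDr mulmxDl !mulmxA pi' (hom_l He hp') -[p' *m i *m p *m i]mulmxA pi.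
  rewrite -mulmxA (hom_r He hi) => /eqP.
  by rewrite -subr_eq0 addrK => /eqP.
have wE : w = i *m (p *m w *m i) *m p + i' *m (p' *m w *m i') *m p'.
  have E2 : i' *m p' = Epr e s - i *m p by rewrite -E addrC addKr.
  have -> : i *m (p *m w *m i) *m p = i *m p *m w *m (i *m p) by rewrite !mulmxA.
  have -> : i' *m (p' *m w *m i') *m p' = i' *m p' *m w *m (i' *m p') by rewrite !mulmxA.
  have uu : i *m p *m (i *m p) = i *m p by rewrite mulmxA -[i *m p *m i]mulmxA pi (hom_r He hi).
  rewrite E2 !mulmxBl (hom_l He hw) !mulmxBr (hom_r He hw) -wc.
  rewrite -[w *m (i *m p) *m (i *m p)]mulmxA uu -[w *m (i *m p) *m Epr e s]mulmxA -[i *m p *m Epr e s]mulmxA (hom_r He hp).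
  by rewrite subrr subr0 addrC subrK.
have hr : hom e r r (p *m w *m i) by apply: (homM He (homM He hp hw) hi).
have hr' : hom e r' r' (p' *m w *m i') by apply: (homM He (homM He hp' hw) hi').
rewrite /chi; set R := Res v r r _; set R' := Res v r' r' _.
have Rw : Res v s s w = Res v s r i *m R *m Res v r s p + Res v s r' i' *m R' *m Res v r' s p'.
  by rewrite {1}wE ResD !(ResM _ _ _ (homM He hi hr)) !(ResM _ _ _ (homM He hi' hr')) (ResM _ _ _ hi) (ResM _ _ _ hi').
have Ds : Dv v s = Res v s r i *m Dv v r *m Res v r s p + Res v s r' i' *m Dv v r' *m Res v r' s p'.
  by rewrite (Dv_r v hi) (Dv_r v hi') -Res_Epr -E ResD (ResM _ _ _ hi) (ResM _ _ _ hi').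
pose X := (y - 1) *: Dv v r - R; pose X' := (y - 1) *: Dv v r' - R'.
have -> : 1%:M + (y - 1) *: Dv v s - Res v s s w = 1%:M + row_mx (Res v s r i) (Res v s r' i') *m
   (block_mx X 0 0 X' *m col_mx (Res v r s p) (Res v r' s p')).
  rewrite mul_block_col !mul0mx addr0 add0r mul_row_col !mulmxA -addrA; congr (_ + _).
  rewrite Rw Ds /X /X' !mulmxBr !mulmxBl -!scalemxAr -!scalemxAl scalerDr opprD.
  by rewrite addrACA.
have XD : X *m Dv v r = X by rewrite mulmxBl -scalemxAl DvK (Dv_r v hr).
have XD' : X' *m Dv v r' = X' by rewrite mulmxBl -scalemxAl DvK (Dv_r v hr').
rewrite det_sylvester -mulmxA mul_col_row -(ResM _ _ _ hp) pi -(ResM _ _ _ hp) pi0 -(ResM _ _ _ hp') pi0' -(ResM _ _ _ hp') pi'.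
rewrite !Res0 !Res_Epr mulmx_block !mul0mx !mulmx0 !addr0 !add0r XD XD' scalar_mx_block add_block_mx !addr0.
by rewrite det_ublock /X /X' !addrA.
Qed.

Lemma cntE v m (s : 'I_m -> 'I_n) y : \det (1%:M - Dv v s + y *: Dv v s) = y ^+ cnt s v.
Proof.
have -> : 1%:M - Dv v s + y *: Dv v s = diag_mx (\row_i if s i == v then y else 1).
  apply/matrixP => i j; rewrite !mxE; case: (i =P j) => // _; rewrite ?mulr1n ?mulr0n ?mulr0 ?subr0 ?addr0 //.
  by case: eqP => _; rewrite ?subrr ?add0r ?mulr1 ?mulr0 ?addr0 ?subr0.
rewrite det_diag /cnt; under eq_bigr => i _ do rewrite mxE.
rewrite -prodrXr; apply: eq_bigr => i _.
by case: (s i == v).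
Qed.

Lemma ResX v m (s : 'I_m -> 'I_n) x N : hom e s s x -> Res v s s (x ^+ N.+1) = Res v s s x ^+ N.+1.
Proof.
by move=> hx; elim: N => [|N IH]; rewrite ?expr1 // exprS -mulmxE (ResM _ _ _ hx) IH [in RHS]exprS.
Qed.

Lemma chi_nilp v m (s : 'I_m -> 'I_n) w mu N : hom e s s w ->
  (w - sc mu (Epr e s)) ^+ N = 0 -> forall y, chi v s w y = (y - mu) ^+ cnt s v.
Proof.
move=> hw wN; set x := w - _ in wN; have hx : hom e s s x by apply: homB hw _; apply/homZ/hom_Epr.
set X := Res v s s x.
have XN : X ^+ N.+1 = 0 by rewrite -ResX // exprS wN mulr0 Res0.
have DX : Dv v s *m X = X by apply: Dv_l.
have chiE y : chi v s w y = \det (1%:M - Dv v s + (y - mu) *: Dv v s - X).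
  rewrite /chi; congr determinant.
  have -> : Res v s s w = X + mu *: Dv v s by rewrite /X ResB ResZ Res_Epr subrK.
  by apply/matrixP => i j; rewrite !mxE; ring.
have ne y : y != mu -> chi v s w y = (y - mu) ^+ cnt s v.
  move=> ymu; have y0 : y - mu != 0 by rewrite subr_eq0.
  rewrite chiE -cntE.
  have -> : 1%:M - Dv v s + (y - mu) *: Dv v s - X = (1%:M - Dv v s + (y - mu) *: Dv v s) *m (1%:M - (y - mu)^-1 *: X).
    rewrite mulmxBr mulmx1; congr (_ - _).
    by rewrite -scalemxAr mulmxDl mulmxBl mul1mx -scalemxAl DX subrr add0r scalerA mulVf // scale1r.
  rewrite det_mulmx (@det_oneB_nilp _ _ _ N.+1) ?mulr1 //.
  have E j : ((y - mu)^-1 *: X) ^+ j = ((y - mu)^-1) ^+ j *: X ^+ j.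
    by elim: j => [|j IH]; rewrite ?expr0 ?scale1r // !exprS IH -!mulmxE -scalemxAl -scalemxAr scalerA.
  by rewrite E XN scaler0.
(* At y = mu the scalar cannot be factored out; both sides are polynomials in y that agree
   elsewhere. *)
move=> y; pose P : {poly k} := \det (1%:M - map_mx polyC (Res v s s w) + ('X - 1) *: map_mx polyC (Dv v s)).
have PE z : P.[z] = chi v s w z.
  rewrite -horner_evalE -det_map_mx; congr determinant; apply/matrixP => i j.
  rewrite mxE /= horner_evalE !mxE !hornerE !hornerMn !hornerC.
  by ring.
have : P - ('X - mu%:P) ^+ cnt s v = 0.
  apply: infin_poly0; apply: infinW (cofin_infin (_ : cofin (fun z => z != mu))).
    by move=> z /ne Ez'; rewrite !hornerE PE Ez' ?horner_exp ?hornerE subrr.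
  exists ('X - mu%:P); first by rewrite polyXsubC_eq0.
  by move=> z; rewrite !hornerE subr_eq0.
by move/eqP; rewrite subr_eq0 => /eqP E; rewrite -PE E !hornerE.
Qed.

(* All the residue matrices [Res v s s w] at once: every root of a [chi v s w] is an
   eigenvalue of it. *)
Definition RR m (s : 'I_m -> 'I_n) (w : 'M[A]_m) : 'M[k]_m :=
  \matrix_(i, j) if s i == s j then eps He (s i) (w i j) else 0.

(** A kernel row vector is supported on the indices at [v], where the matrix is 1 elsewhere, and on
    those rows [RR] and [Res v] agree. *)
Lemma chi_root v m (s : 'I_m -> 'I_n) w mu : hom e s s w -> chi v s w mu = 0 ->
  \det (mu%:M - RR s w) = 0.
Proof.
move=> hw /eqP/det0P [x x0 Hx]; apply/eqP/det0P; exists x => //.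
have DD := DvK v s; have RD := Dv_r v hw.
have xD : x *m Dv v s = x.
  have : x *m (1%:M + (mu - 1) *: Dv v s - Res v s s w) *m (1%:M - Dv v s) = 0 by rewrite Hx mul0mx.
  rewrite -mulmxA mulmxBr mulmx1 [_ *m Dv v s]mulmxBl mulmxDl mul1mx -scalemxAl DD RD => E.
  apply/eqP; rewrite eq_sym -subr_eq0; apply/eqP; rewrite -{}E -{1}[x]mulmx1 -mulmxBr.
  by congr (_ *m _); apply/matrixP => i j; rewrite !mxE; ring.
rewrite -xD -mulmxA mulmxBr.
have -> : Dv v s *m RR s w = Dv v s *m Res v s s w.
  apply/matrixP => i j; rewrite !mul_diag_mx !mxE; case: (s i =P v) => [->|_]; last by rewrite !mul0r.
  by rewrite eq_sym.
rewrite (Dv_l v hw) mul_mx_scalar -{}Hx.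
rewrite mulmxBr [RHS]mulmxBr mulmxDr mulmx1 -!scalemxAr xD; congr (_ - _).
by rewrite scalerBl scale1r addrC subrK.
Qed.
End Residues.

(** * Generalized eigenspaces of chain endomorphisms *)

Lemma fitting_mx (k : closedFieldType) D (M : 'M[k]_D) mu : exists g N z,
  [/\ g *m g = g, forall Z, Z *m M = M *m Z -> Z *m g = g *m Z,
      1%:M - g = (M - mu%:M) *m z & (M - mu%:M) ^+ N *m g = 0].
Proof.
case: D M => [|D] M; first by exists 0, 0%N, 0; split=> // *; rewrite ?[LHS]flatmx0 ?[RHS]flatmx0.
set Y := M - mu%:M.
have [m [q qr Eq]] := multiplicity_XsubC (char_poly Y) 0.
rewrite monic_neq0 ?char_poly_monic //= in qr.
rewrite subr0 in Eq.
have cop : coprimep ('X ^+ m.+1) q.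
  by apply: coprimep_expl; rewrite coprimep_sym -[X in coprimep _ X]subr0 coprimep_XsubC.
have [[a b] /= Eab] := Bezout_eq1_coprimepP _ _ cop.
pose h := horner_mx Y.
have hX : h 'X = Y := horner_mx_X Y.
have H0 : h ('X ^+ m * q) = 0 by rewrite mulrC -Eq; apply: Cayley_Hamilton.
have H0' p : h (p * ('X ^+ m * q)) = 0.
  by rewrite /h rmorphM /= [X in _ * X](H0 : horner_mx Y _ = 0) mulr0.
(* Bezout for X^(m+1) and the prime-to-X part of the characteristic polynomial. The projection is a
   polynomial in [M], so it commutes with all that commutes with [M]. *)
exists (h (b * q)), m.+1, (h ('X ^+ m * a)).
have H1 : 1 - b * q = 'X * ('X ^+ m * a) by rewrite -Eab addrK exprS mulrC mulrA.
have cm p Z : Z *m M = M *m Z -> Z *m h p = h p *m Z.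
  move=> E; have ZY : Z *m Y = Y *m Z by rewrite mulmxBr mulmxBl E mul_mx_scalar mul_scalar_mx.
  rewrite /h {h hX H0 H0'}; elim/poly_ind: p => [|p c IH]; first by rewrite rmorph0 mulmx0 mul0mx.
  rewrite rmorphD rmorphM /= horner_mx_X horner_mx_C mulmxDr mulmxDl.
  rewrite mul_mx_scalar mul_scalar_mx -mulmxE; congr (_ + _).
  by rewrite mulmxA IH -[_ *m Y *m Z]mulmxA -ZY mulmxA.
split=> [|Z|//|].
- have : h (b * q) * (1 - h (b * q)) = 0.
    rewrite -(rmorph1 h) -rmorphB -rmorphM H1.
    have R1 (b' q' x z a' : {poly k}) : b' * q' * (x * (z * a')) = b' * x * a' * (z * q') by ring.
    by rewrite R1; apply: H0'.
  by rewrite mulrBr mulr1 => /eqP; rewrite subr_eq0 => /eqP {3}->.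
- exact: cm.
- by have := congr1 h H1; rewrite /h rmorphB rmorph1 [RHS]rmorphM /= horner_mx_X.
- have := H0' ('X * b); rewrite (_ : 'X * b * ('X ^+ m * q) = 'X ^+ m.+1 * (b * q)); last by rewrite exprS; ring.
  by rewrite /h rmorphM rmorphXn /= horner_mx_X.
Qed.

(** By Cayley-Hamilton the linear factors of the characteristic polynomial, applied one after the
    other to [P], end in 0; the last nonzero product consists of eigenvectors. *)
Lemma eigen_comm (k : closedFieldType) D (M P : 'M[k]_D) : P != 0 -> P *m P = P -> P *m M = M *m P ->
  exists (mu : k) (Q : 'M[k]_D), [/\ Q != 0, Q *m P = Q & Q *m (M - mu%:M) = 0].
Proof.
case: D M P => [|D] M P P0 PP PM; first by rewrite [P]flatmx0 eqxx in P0.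
have [r Er] := closed_field_poly_normal (char_poly M).
have : P *m horner_mx M (\prod_(z <- r) ('X - z%:P)) = 0.
  by rewrite -[\prod_(_ <- _) _]scale1r -(monicP (char_poly_monic M)) -Er Cayley_Hamilton mulmx0.
suff: forall Q : 'M[k]_D.+1, Q != 0 -> Q *m P = Q -> Q *m horner_mx M (\prod_(z <- r) ('X - z%:P)) = 0 ->
    exists (mu : k) (Q : 'M[k]_D.+1), [/\ Q != 0, Q *m P = Q & Q *m (M - mu%:M) = 0] by apply.
elim: r {Er} => [|z r IH] Q Q0 QP.
  by rewrite big_nil rmorph1 mulmx1 => E; rewrite E eqxx in Q0.
rewrite big_cons rmorphM /= rmorphB /= horner_mx_X horner_mx_C -mulmxE mulmxA.
have [E _|N] := eqVneq (Q *m (M - z%:M)) 0; first by exists z, Q.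
apply: IH => //; rewrite -mulmxA mulmxBl mul_scalar_mx -PM -mul_mx_scalar -mulmxBr mulmxA QP //.
Qed.

Section Eigen.
Variables (k : closedFieldType) (A : falgType k).

(** The projection commutes with the [Lam], so it is a matrix over [A]. Taking the eigenvalue on the
    image of [E] is what keeps [G *m E] from vanishing. *)
Lemma fitting_ex m (W E : 'M[A]_m) : E != 0 -> E *m E = E -> E *m W = W *m E ->
  exists mu N G, [/\ G *m G = G, forall Z, Z *m W = W *m Z -> Z *m G = G *m Z,
     G *m E != 0 & (W - sc mu 1%:M) ^+ N *m G = 0].
Proof.
move=> E0 EE EW.
have [|||mu [Q [Q0 QP QM]]] := @eigen_comm _ _ (Phi W) (Phi E).
- by apply: contra_neq E0; rewrite -{1}[0](Phi0 _ m); apply: Phi_inj.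
- by rewrite -PhiM EE.
- by rewrite -!PhiM EW.
have [g [N [z [gg cg gz gN]]]] := fitting_mx (Phi W) mu.
have [|G EG] := @commutant _ _ _ g; first by move=> i; apply: cg; apply: Phi_Lam.
exists mu, N, G; split.
- by apply: Phi_inj; rewrite PhiM -EG.
- by move=> Z ZW; apply: Phi_inj; rewrite !PhiM -EG cg // -!PhiM ZW.
- apply/eqP => GE; move/eqP: Q0; apply.
  have : Q *m (1%:M - g) *m Phi E = 0 by rewrite gz mulmxA QM !mul0mx.
  by rewrite mulmxBr mulmx1 mulmxBl QP -mulmxA EG -PhiM GE Phi0 mulmx0 subr0.
apply: Phi_inj; rewrite PhiM Phi0 -EG -gN; congr (_ *m _).
have E1 : Phi (W - sc mu 1%:M) = Phi W - mu%:M by rewrite PhiB PhiZ Phi1 scalemx1.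
by elim: N {gN} => [|N IH]; rewrite ?expr0 ?Phi1 // !exprS -!mulmxE PhiM IH E1.
Qed.

Variables (n : nat) (e : 'I_n -> A).
Hypothesis He : complete_projectives e.

(** The spectral projection of the block diagonal (w0, w1) commutes with the block idempotents and,
    because w0 f = f w1, with [f] placed off the diagonal. Its diagonal corners are thus an
    idempotent chain endomorphism; it is nonzero, and if it is the identity there is just one
    eigenvalue. *)
Lemma eigen_or_split (S : shp n) (f : mor A S) w0 w1 : shom e S f ->
  hom e (y0 S) (y0 S) w0 -> hom e (y1 S) (y1 S) w1 -> w0 *m f = f *m w1 -> (0 < z0 S + z1 S)%N ->
  (exists mu N, (w0 - sc mu (Epr e (y0 S))) ^+ N = 0 /\ (w1 - sc mu (Epr e (y1 S))) ^+ N = 0) \/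
  exists u0 u1, [/\ [/\ hom e (y0 S) (y0 S) u0, hom e (y1 S) (y1 S) u1, u0 *m u0 = u0, u1 *m u1 = u1 & u0 *m f = f *m u1],
     u0 *m w0 = w0 *m u0, u1 *m w1 = w1 *m u1, ~ (u0 = 0 /\ u1 = 0) & ~ (u0 = Epr e (y0 S) /\ u1 = Epr e (y1 S))].
Proof.
move=> hf hw0 hw1 wf Sgt0; set E0 := Epr e (y0 S); set E1 := Epr e (y1 S).
have E00 : E0 *m E0 = E0 by apply: EprK.
have E11 : E1 *m E1 = E1 by apply: EprK.
pose E := block_mx E0 0 0 E1; pose W := block_mx w0 0 0 w1.
have e0 v : e v != 0 by case: He => /(_ v) [_ [/eqP]].
have Ep m (s : 'I_m -> 'I_n) : Epr e s = 0 -> m = 0%N.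
  case: m s => // m s /matrixP/(_ ord0 ord0) /eqP; rewrite EprE eqxx mulr1n mxE.
  by rewrite (negPf (e0 _)).
have Enz : E != 0.
  apply/eqP; rewrite /E -block_mx0 => /eq_block_mx [/Ep h0 _ _ /Ep h1].
  by rewrite h0 h1 in Sgt0.
have EE : E *m E = E by rewrite mulmx_block !mul0mx !mulmx0 !addr0 !add0r E00 E11.
have EW : E *m W = W.
  by rewrite mulmx_block !mul0mx !mulmx0 !addr0 !add0r (hom_l He hw0) (hom_l He hw1).
have WE : W *m E = W.
  by rewrite mulmx_block !mul0mx !mulmx0 !addr0 !add0r (hom_r He hw0) (hom_r He hw1).
have [|mu [N [G [GG cG GE GN]]]] := @fitting_ex _ W _ Enz EE; first by rewrite EW WE.
pose a := ulsubmx G; pose b := ursubmx G; pose c := dlsubmx G; pose d := drsubmx G.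
have Gbl : G = block_mx a b c d by rewrite submxK.
have [a0 b0 c0] : [/\ E0 *m a = a *m E0, E0 *m b = 0 & c *m E0 = 0].
  have : block_mx E0 0 0 0 *m G = G *m block_mx E0 0 0 0.
    by apply: cG; rewrite !mulmx_block !mul0mx !mulmx0 !addr0 (hom_l He hw0) (hom_r He hw0).
  rewrite Gbl !mulmx_block !mul0mx !mulmx0 !addr0.
  by case/eq_block_mx.
have [d1 b1] : E1 *m d = d *m E1 /\ b *m E1 = 0.
  have : block_mx 0 0 0 E1 *m G = G *m block_mx 0 0 0 E1.
    by apply: cG; rewrite !mulmx_block !mul0mx !mulmx0 !add0r (hom_l He hw1) (hom_r He hw1).
  rewrite Gbl !mulmx_block !mul0mx !mulmx0 !add0r.
  by case/eq_block_mx.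
have [aw dw] : a *m w0 = w0 *m a /\ d *m w1 = w1 *m d.
  have : W *m G = G *m W by apply: cG.
  rewrite Gbl !mulmx_block !mul0mx !mulmx0 !addr0 !add0r.
  by case/eq_block_mx.
have af : a *m f = f *m d.
  have : block_mx 0 f 0 0 *m G = G *m block_mx 0 f 0 0.
    by apply: cG; rewrite !mulmx_block !mul0mx !mulmx0 !addr0 !add0r wf.
  rewrite Gbl !mulmx_block !mul0mx !mulmx0 !addr0 !add0r.
  by case/eq_block_mx.
have [aa dd] : a *m a + b *m c = a /\ c *m b + d *m d = d.
  by move: GG; rewrite Gbl mulmx_block => /eq_block_mx [].
pose u0 := a *m E0; pose u1 := d *m E1.
have GE' : G *m E = block_mx u0 0 0 u1.
  by rewrite Gbl mulmx_block !mulmx0 c0 b1 !addr0 !add0r.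
have [[H0 H1]|ne] := pselect (u0 = E0 /\ u1 = E1).
  left; exists mu, N.+1.
  have GEE : G *m E = E by rewrite GE' H0 H1.
  have NE : (W - sc mu 1%:M) ^+ N *m E = 0 by rewrite -GEE mulmxA GN mul0mx.
  pose V := W - sc mu E.
  have V1 : V = (W - sc mu 1%:M) *m E by rewrite mulmxBl WE scMl mul1mx.
  have EV : E *m V = V by rewrite mulmxBr scMr EW EE.
  have VN j : V ^+ j.+1 = (W - sc mu 1%:M) ^+ j.+1 *m E.
    elim: j => [|j IH]; first by rewrite !expr1.
    by rewrite exprSr IH -mulmxE -mulmxA EV V1 mulmxA mulmxE -exprSr.
  have V2 : V = block_mx (w0 - sc mu E0) 0 0 (w1 - sc mu E1).
    by rewrite /V /W /E sc_block !sc_0 opp_block_mx add_block_mx !oppr0 !addr0.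
  have VX j : V ^+ j.+1 = block_mx ((w0 - sc mu E0) ^+ j.+1) 0 0 ((w1 - sc mu E1) ^+ j.+1).
    elim: j => [|j IH]; first by rewrite !expr1.
    by rewrite exprS IH V2 -mulmxE mulmx_block !mul0mx !mulmx0 !addr0 !add0r !mulmxE -!exprS.
  have : V ^+ N.+1 = 0 by rewrite VN exprS -mulmxE -mulmxA NE mulmx0.
  by rewrite VX -block_mx0 => /eq_block_mx [].
right; exists u0, u1; split=> //.
- split.
  + by apply: homI; rewrite /u0 ?mulmxA ?a0 -mulmxA E00.
  + by apply: homI; rewrite /u1 ?mulmxA ?d1 -mulmxA E11.
  + rewrite /u0 -a0 -mulmxA [a *m (E0 *m a)]mulmxA -a0 -mulmxA mulmxA E00.
    by rewrite -[in RHS]aa mulmxDr [E0 *m (b *m c)]mulmxA b0 mul0mx addr0.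
  + rewrite /u1 -mulmxA [E1 *m (d *m E1)]mulmxA d1 -mulmxA mulmxA E11.
    by rewrite -[in RHS]dd mulmxDl -[c *m b *m E1]mulmxA b1 mulmx0 add0r.
  + by rewrite /u0 /u1 -mulmxA (hom_l He hf) mulmxA -af -mulmxA (hom_r He hf).
- by rewrite /u0 -mulmxA (hom_l He hw0) mulmxA -aw -mulmxA (hom_r He hw0).
- by rewrite /u1 -mulmxA (hom_l He hw1) mulmxA -dw -mulmxA (hom_r He hw1).
- by case=> H0 H1; move/eqP: GE; apply; rewrite GE' H0 H1 block_mx0.
Qed.
End Eigen.

(** * Retracts and spectral decomposition of complexes *)

Section Retracts.
Variables (k : closedFieldType) (A : falgType k) (n : nat) (e : 'I_n -> A).
Hypothesis He : complete_projectives e.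

(** A split inclusion of complexes, strict rather than up to homotopy, so that shapes can be
    counted. *)
Record retr (S : shp n) (f : mor A S) (T : shp n) (g : mor A T) := Retr {
  ri0 : 'M[A]_(z0 S, z0 T); rp0 : 'M[A]_(z0 T, z0 S);
  ri1 : 'M[A]_(z1 S, z1 T); rp1 : 'M[A]_(z1 T, z1 S);
  ri0_hom : hom e (y0 S) (y0 T) ri0; rp0_hom : hom e (y0 T) (y0 S) rp0;
  ri1_hom : hom e (y1 S) (y1 T) ri1; rp1_hom : hom e (y1 T) (y1 S) rp1;
  rpi0 : rp0 *m ri0 = Epr e (y0 T); rpi1 : rp1 *m ri1 = Epr e (y1 T);
  ri_chain : ri0 *m g = f *m ri1; rp_chain : rp0 *m f = g *m rp1 }.

Lemma retr_refl S f : shom e S f -> inhabited (retr f f).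
Proof.
by move=> hf; split; exists (Epr e (y0 S)) (Epr e (y0 S)) (Epr e (y1 S)) (Epr e (y1 S));
  try exact: hom_Epr; rewrite ?EprK ?(hom_l He hf) ?(hom_r He hf).
Qed.

Lemma retr_trans S f T g U h : @retr S f T g -> @retr T g U h -> retr f h.
Proof.
move=> r r'; exists (ri0 r *m ri0 r') (rp0 r' *m rp0 r) (ri1 r *m ri1 r') (rp1 r' *m rp1 r).
- exact: homM (ri0_hom r) (ri0_hom r').
- exact: homM (rp0_hom r') (rp0_hom r).
- exact: homM (ri1_hom r) (ri1_hom r').
- exact: homM (rp1_hom r') (rp1_hom r).
- by rewrite -mulmxA [rp0 r *m _]mulmxA rpi0 (hom_l He (ri0_hom r')) rpi0.
- by rewrite -mulmxA [rp1 r *m _]mulmxA rpi1 (hom_l He (ri1_hom r')) rpi1.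
- by rewrite -mulmxA ri_chain mulmxA ri_chain mulmxA.
- by rewrite -mulmxA rp_chain mulmxA rp_chain mulmxA.
Qed.

Lemma Ez_retr_l S f T g U h : @retr S f T g -> Ez e S U f h -> Ez e T U g h.
Proof.
move=> r H h' hh'; have [a [b [ha hb E]]] := H (h' *m rp1 r) (homM He hh' (rp1_hom r)).
exists (a *m ri1 r), (b *m ri0 r); split.
- exact: homM ha (ri1_hom r).
- exact: homM hb (ri0_hom r).
- have := congr1 (fun x => x *m ri1 r) E.
  by rewrite -mulmxA rpi1 (hom_r He hh') mulmxDl -!mulmxA -(ri_chain r).
Qed.
Lemma Ez_retr_r S f T g U h : @retr S f T g -> Ez e U S h f -> Ez e U T h g.
Proof.
move=> r H h' hh'; have [a [b [ha hb E]]] := H (ri0 r *m h') (homM He (ri0_hom r) hh').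
exists (rp1 r *m a), (rp0 r *m b); split.
- exact: homM (rp1_hom r) ha.
- exact: homM (rp0_hom r) hb.
- have := congr1 (fun x => rp0 r *m x) E.
  by rewrite mulmxA rpi0 (hom_l He hh') mulmxDr !mulmxA (rp_chain r).
Qed.

Lemma complex_split S (f : mor A S) u0 u1 : shom e S f -> hom e (y0 S) (y0 S) u0 -> hom e (y1 S) (y1 S) u1 ->
  u0 *m u0 = u0 -> u1 *m u1 = u1 -> u0 *m f = f *m u1 ->
  exists (T : shp n) (g : mor A T) (T' : shp n) (g' : mor A T') (r : retr f g) (r' : retr f g'),
  [/\ shom e T g /\ shom e T' g', ri0 r *m rp0 r = u0 /\ ri0 r' *m rp0 r' = Epr e (y0 S) - u0,
      ri1 r *m rp1 r = u1 /\ ri1 r' *m rp1 r' = Epr e (y1 S) - u1,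
      forall v, cnt (y0 S) v = (cnt (y0 T) v + cnt (y0 T') v)%N &
      forall v, cnt (y1 S) v = (cnt (y1 T) v + cnt (y1 T') v)%N].
Proof.
move=> hf hu0 hu1 u00 u11 uf.
have [q1 [q2 [s [s' [[i0 [p0 [hi0 hp0 pi0 ip0]]] [i0' [p0' [hi0' hp0' pi0' ip0']]] C0]]]]] := split_idem He hu0 u00.
have [q3 [q4 [t [t' [[i1 [p1 [hi1 hp1 pi1 ip1]]] [i1' [p1' [hi1' hp1' pi1' ip1']]] C1]]]]] := split_idem He hu1 u11.
have uf' : (Epr e (y0 S) - u0) *m f = f *m (Epr e (y1 S) - u1).
  by rewrite mulmxBl mulmxBr uf (hom_l He hf) (hom_r He hf).
have mk (U0 : 'M[A]_(z0 S)) U1 q q' (r0 : 'I_q -> 'I_n) (r1 : 'I_q' -> 'I_n) (I0 : 'M[A]_(z0 S, q)) P0 (I1 : 'M[A]_(z1 S, q')) P1 :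
   hom e (y0 S) r0 I0 -> hom e r0 (y0 S) P0 -> P0 *m I0 = Epr e r0 -> I0 *m P0 = U0 ->
   hom e (y1 S) r1 I1 -> hom e r1 (y1 S) P1 -> P1 *m I1 = Epr e r1 -> I1 *m P1 = U1 ->
   U0 *m f = f *m U1 ->
   exists g : mor A (Shp r1 r0), shom e (Shp r1 r0) g /\ exists r : retr f g,
     ri0 r *m rp0 r = U0 /\ ri1 r *m rp1 r = U1.
  move=> hI0 hP0 PI0 IP0 hI1 hP1 PI1 IP1 UfE; exists (P0 *m f *m I1 : mor A (Shp r1 r0)).
  split; first exact: (homM He (homM He hP0 hf) hI1).
  unshelve eexists.
    exists I0 P0 I1 P1 => //=.
      by rewrite !mulmxA IP0 UfE -mulmxA -IP1 -mulmxA PI1 (hom_r He hI1).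
    by rewrite -[RHS]mulmxA IP1 -mulmxA -UfE -IP0 !mulmxA PI0 (hom_l He hP0).
  by [].
have [g [hg [r [r0 r1]]]] := mk _ _ _ _ _ _ _ _ _ _ hi0 hp0 pi0 ip0 hi1 hp1 pi1 ip1 uf.
have [g' [hg' [r' [r0' r1']]]] := mk _ _ _ _ _ _ _ _ _ _ hi0' hp0' pi0' ip0' hi1' hp1' pi1' ip1' uf'.
by exists (Shp t s), g, (Shp t' s'), g', r, r'.
Qed.

Lemma cnt_total m (s : 'I_m -> 'I_n) : (\sum_v cnt s v)%N = m.
Proof.
rewrite /cnt exchange_big /= -[RHS]card_ord -sum1_card; apply: eq_bigr => i _.
by rewrite (bigD1 (s i)) //= eqxx big1 // => v /negPf; rewrite eq_sym => ->.
Qed.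

Definition cmplx := {S : shp n & mor A S}.
Definition cnt2 (S : shp n) (b : bool) v := if b then cnt (y1 S) v else cnt (y0 S) v.
Definition chi2 S (w0 : 'M[A]_(z0 S)) (w1 : 'M[A]_(z1 S)) (b : bool) v y :=
  if b then chi He v (y1 S) w1 y else chi He v (y0 S) w0 y.

(** Induction on the number of indecomposable terms: [eigen_or_split] either ends with one
    eigenvalue or gives two smaller nonempty complexes, over which [chi] is multiplicative. *)
Lemma eigen_decomp S (f : mor A S) w0 w1 : shom e S f ->
  hom e (y0 S) (y0 S) w0 -> hom e (y1 S) (y1 S) w1 -> w0 *m f = f *m w1 ->
  exists d (P : nat -> cmplx) (lam : nat -> k),
  [/\ forall a, (a < d)%N -> [/\ shom e (tag (P a)) (tagged (P a)), inhabited (retr f (tagged (P a)))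
        & (0 < z0 (tag (P a)) + z1 (tag (P a)))%N],
      forall b v y, chi2 w0 w1 b v y = \prod_(a < d) (y - lam a) ^+ cnt2 (tag (P a)) b v &
      forall b v, cnt2 S b v = (\sum_(a < d) cnt2 (tag (P a)) b v)%N].
Proof.
move: {2}(z0 S + z1 S)%N (leqnn (z0 S + z1 S)) => N.
elim: N S f w0 w1 => [|N IH] S f w0 w1 le hf hw0 hw1 wf.
  have [Z0 Z1] : z0 S = 0%N /\ z1 S = 0%N by lia.
  exists 0%N, (fun _ => existT _ S f), (fun _ => 0); split=> // [b v y|b v]; rewrite big_ord0.
    rewrite /chi2 /chi; case: b; [move: (1%:M + _ - _) | move: (1%:M + _ - _)].
      by rewrite Z1 => M; rewrite det_mx00.
    by rewrite Z0 => M; rewrite det_mx00.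
  have c0 m (s : 'I_m -> 'I_n) : m = 0%N -> cnt s v = 0%N by case: m s => // s _; rewrite /cnt big_ord0.
  by rewrite /cnt2; case: b; apply: c0.
have [S0|Sgt] := posnP (z0 S + z1 S); first by apply: (IH S f w0 w1); rewrite // S0.
case: (eigen_or_split He hf hw0 hw1 wf Sgt) => [[mu [M [N0 N1]]]|].
  exists 1%N, (fun _ => existT _ S f), (fun _ => mu); split=> [a _|b v y|b v]; rewrite ?big_ord1 //.
    by split => //; apply: retr_refl.
  by rewrite /chi2; case: b; [apply: chi_nilp N1 y | apply: chi_nilp N0 y].
case=> u0 [u1 [[hu0 hu1 u00 u11 uf] uw0 uw1 n0 nE]].
have [T [g [T' [g' [r [r' [[hg hg'] [r0 r0'] [r1 r1'] C0 C1]]]]]]] := complex_split hf hu0 hu1 u00 u11 uf.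
have sz (U : shp n) : (z0 U + z1 U)%N = (\sum_v cnt (y0 U) v + \sum_v cnt (y1 U) v)%N by rewrite !cnt_total.
have szS : (z0 S + z1 S = (z0 T + z1 T) + (z0 T' + z1 T'))%N.
  rewrite !sz (eq_bigr _ (fun v _ => C0 v)) [X in (_ + X)%N](eq_bigr _ (fun v _ => C1 v)) !big_split /=; lia.
have pos (U : shp n) (h : mor A U) (q : retr f h) : ~ (ri0 q *m rp0 q = 0 /\ ri1 q *m rp1 q = 0) -> (0 < z0 U + z1 U)%N.
  move=> H; rewrite lt0n; apply/eqP => U0; apply: H.
  have [Z0 Z1] : z0 U = 0%N /\ z1 U = 0%N by lia.
  split; [move: (ri0 q) (rp0 q) | move: (ri1 q) (rp1 q)].
    by rewrite Z0 => x z; rewrite [x]thinmx0 mul0mx.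
  by rewrite Z1 => x z; rewrite [x]thinmx0 mul0mx.
have Tgt : (0 < z0 T + z1 T)%N by apply: (pos _ _ r); rewrite r0 r1.
have Tgt' : (0 < z0 T' + z1 T')%N.
  apply: (pos _ _ r'); rewrite r0' r1' => -[/eqP + /eqP]; rewrite !subr_eq0 => /eqP E0 /eqP E1.
  by apply: nE.
have sub (U : shp n) (h : mor A U) (q : retr f h) : (z0 U + z1 U <= N)%N -> shom e U h ->
   ri0 q *m rp0 q *m w0 = w0 *m (ri0 q *m rp0 q) -> ri1 q *m rp1 q *m w1 = w1 *m (ri1 q *m rp1 q) ->
   exists d (P : nat -> cmplx) (lam : nat -> k),
    [/\ forall a, (a < d)%N -> [/\ shom e (tag (P a)) (tagged (P a)), inhabited (retr f (tagged (P a)))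
        & (0 < z0 (tag (P a)) + z1 (tag (P a)))%N],
      forall b v y, chi2 (rp0 q *m w0 *m ri0 q) (rp1 q *m w1 *m ri1 q) b v y = \prod_(a < d) (y - lam a) ^+ cnt2 (tag (P a)) b v &
      forall b v, cnt2 U b v = (\sum_(a < d) cnt2 (tag (P a)) b v)%N].
  move=> le' hh c0 c1.
  have [|||d [P [lam [H1 H2 H3]]]] := IH U h (rp0 q *m w0 *m ri0 q) (rp1 q *m w1 *m ri1 q) le' hh.
  - exact: (homM He (homM He (rp0_hom q) hw0) (ri0_hom q)).
  - exact: (homM He (homM He (rp1_hom q) hw1) (ri1_hom q)).
  - rewrite -mulmxA ri_chain -[_ *m w0 *m _]mulmxA [w0 *m _]mulmxA wf !mulmxA rp_chain.
    by rewrite -!mulmxA.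
  exists d, P, lam; split=> // a /H1 [h1 [h2] h3]; split=> //; split; exact: retr_trans q h2.
have [|||d [P [lam [H1 H2 H3]]]] := sub T g r _ hg; try by rewrite ?r0 ?r1 //; lia.
have cm m (u w E : 'M[A]_m) : E *m w = w -> w *m E = w -> u *m w = w *m u -> (E - u) *m w = w *m (E - u).
  by move=> h1 h2 h3; rewrite mulmxBl mulmxBr h1 h2 h3.
have [|||d' [P' [lam' [H1' H2' H3']]]] := sub T' g' r' _ hg'.
- lia.
- by rewrite r0'; apply: cm => //; [apply: (hom_l He hw0) | apply: (hom_r He hw0)].
- by rewrite r1'; apply: cm => //; [apply: (hom_l He hw1) | apply: (hom_r He hw1)].
exists (d + d')%N, (fun a => if (a < d)%N then P a else P' (a - d)%N), (fun a => if (a < d)%N then lam a else lam' (a - d)%N).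
split.
- move=> a ad; case: ltnP => ad'; first exact: H1.
  by apply: H1'; lia.
- move=> b v y; rewrite big_split_ord /=.
  under eq_bigr => i _ do rewrite ltn_ord.
  under [X in _ * X]eq_bigr => i _ do rewrite ltnNge leq_addr addKn /=.
  rewrite -H2 -H2' /chi2; case: b.
    apply: chi_split (ri1_hom r) (rp1_hom r) (ri1_hom r') (rp1_hom r') hw1 (rpi1 r) (rpi1 r') _ _.
      by rewrite r1 r1' addrC subrK.
    by rewrite r1.
  apply: chi_split (ri0_hom r) (rp0_hom r) (ri0_hom r') (rp0_hom r') hw0 (rpi0 r) (rpi0 r') _ _.
    by rewrite r0 r0' addrC subrK.
  by rewrite r0.
- move=> b v; rewrite big_split_ord /=.
  under eq_bigr => i _ do rewrite ltn_ord.
  under [X in (_ + X)%N]eq_bigr => i _ do rewrite ltnNge leq_addr addKn /=.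
  by rewrite -H3 -H3'; case: b; [apply: C1 | apply: C0].
Qed.
End Retracts.

Lemma horner_char_poly (k : closedFieldType) m (M : 'M[k]_m) x : (char_poly M).[x] = \det (x%:M - M).
Proof.
rewrite /char_poly -horner_evalE -det_map_mx; congr determinant; apply/matrixP => i j.
by rewrite mxE /= horner_evalE !mxE !hornerE hornerMn hornerX.
Qed.

(** * Persistence of eigenvalue patterns *)

Section Pattern.
Variables (k : closedFieldType) (A : falgType k) (n : nat) (e : 'I_n -> A).
Hypothesis He : complete_projectives e.
Variables (S : shp n) (N : nat) (w0 : nat -> 'M[A]_(z0 S)) (w1 : nat -> 'M[A]_(z1 S)).
Hypotheses (hw0 : forall j, hom e (y0 S) (y0 S) (w0 j)) (hw1 : forall j, hom e (y1 S) (y1 S) (w1 j)).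

Lemma hom_psum m p (s : 'I_m -> 'I_n) (t : 'I_p -> 'I_n) (w : nat -> 'M[A]_(m, p)) c :
  (forall j, hom e s t (w j)) -> hom e s t (psum N w c).
Proof.
move=> hw; rewrite /psum; apply: (big_ind (fun x => hom e s t x)); first exact: hom0.
  by move=> x y; apply: homD.
by move=> i _; apply: homZ.
Qed.

Lemma Res_psum v m p (s : 'I_m -> 'I_n) (t : 'I_p -> 'I_n) (w : nat -> 'M[A]_(m, p)) c :
  Res He v s t (psum N w c) = \sum_(j < N) c ^+ j *: Res He v s t (w j).
Proof.
rewrite /psum (big_morph _ (ResD He v s t) (Res0 He v s t)).
by apply: eq_bigr => j _; rewrite ResZ.
Qed.

Lemma chi_psum v m (s : 'I_m -> 'I_n) (w : nat -> 'M[A]_m) y : exists p : {poly k},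
  forall c, chi He v s (psum N w c) y = p.[c].
Proof.
exists (\det (map_mx polyC (1%:M + (y - 1) *: Dv k v s) - \sum_(j < N) 'X^j *: map_mx polyC (Res He v s s (w j)))) => c.
rewrite -horner_evalE -det_map_mx /chi Res_psum; congr determinant; apply/matrixP => i j.
rewrite [RHS]mxE /= horner_evalE [in RHS]mxE hornerD [in RHS]mxE hornerC mxE; congr (_ + _).
rewrite !mxE hornerN !summxE horner_sum; congr (- _); apply: eq_bigr => l _.
by rewrite !mxE !hornerE ?hornerXn.
Qed.

Let RRpoly m (s : 'I_m -> 'I_n) (w : nat -> 'M[A]_m) : 'M[{poly k}]_m :=
  \sum_(j < N) 'X^j *: map_mx polyC (RR He s (w j)).
Lemma RR_psum m (s : 'I_m -> 'I_n) (w : nat -> 'M[A]_m) c : RR He s (psum N w c) = ev c (RRpoly s w).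
Proof.
apply/matrixP => i j; rewrite !mxE /horner_eval summxE /psum !summxE horner_sum.
case: ifP => E.
  rewrite eps_sum; apply: eq_bigr => l _.
  by rewrite !mxE E epsZ !hornerE ?hornerXn.
by rewrite big1 // => l _; rewrite !mxE E !hornerE.
Qed.

(** The extra 1 x 1 zero block makes the size a successor, as elimination demands; it only adds the
    eigenvalue 0. *)
Let C : 'M[{poly k}]_((z0 S + z1 S).+1) :=
  block_mx (0 : 'M[{poly k}]_1) 0 0 (block_mx (RRpoly (y0 S) w0) 0 0 (RRpoly (y1 S) w1)).

Lemma eig_C c mu : \det (mu%:M - RR He (y0 S) (psum N w0 c)) = 0 \/
  \det (mu%:M - RR He (y1 S) (psum N w1 c)) = 0 -> eig C c mu.
Proof.
move=> H; rewrite /eig /root horner_char_poly /C /ev.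
rewrite -[(_).+1]/(1 + (z0 S + z1 S))%N map_block_mx map_block_mx !map_mx0 !scalar_mx_block.
rewrite opp_block_mx add_block_mx !oppr0 !addr0 det_ublock opp_block_mx add_block_mx !oppr0 !addr0 det_ublock.
by case: H; rewrite RR_psum => ->; rewrite ?mul0r ?mulr0.
Qed.

(** Positivity of [tau] makes each [lam a] a root of some [chi], hence an eigenvalue of the
    polynomial matrix [C]. The pattern is then a system of equations in eigenvalues, indexed by b, v
    and all scalars y, and [elimination] applies. *)
Lemma pattern_closed d (tau : nat -> bool -> 'I_n -> nat) :
  (forall a, (a < d)%N -> exists b v, (0 < tau a b v)%N) ->
  infin (fun c => exists lam : nat -> k, forall b v y,
    chi2 He (psum N w0 c) (psum N w1 c) b v y = \prod_(a < d) (y - lam a) ^+ tau a b v) ->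
  forall c, exists lam : nat -> k, forall b v y,
    chi2 He (psum N w0 c) (psum N w1 c) b v y = \prod_(a < d) (y - lam a) ^+ tau a b v.
Proof.
move=> tau0 Hinf c.
pose G (i : bool * 'I_n * k) c (lam : nat -> k) :=
  chi2 He (psum N w0 c) (psum N w1 c) i.1.1 i.1.2 i.2 - \prod_(a < d) (i.2 - lam a) ^+ tau a i.1.1 i.1.2.
have HG i : PF d (G i).
  apply: PF_add.
    rewrite /chi2; case: i.1.1.
      have [p Hp] := chi_psum i.1.2 (y1 S) w1 i.2.
      by apply: PF_eq (PF_poly d p) => c' lam; rewrite Hp.
    have [p Hp] := chi_psum i.1.2 (y0 S) w0 i.2.
    by apply: PF_eq (PF_poly d p) => c' lam; rewrite Hp.
  apply: PF_eq (PF_mul (PF_const d (-1)) (PF_prod (index_enum 'I_d) (fun a => _))) => [c' lam|a]; first by rewrite mulN1r.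
  apply: PF_exp; apply: PF_add; first exact: PF_const.
  by apply: PF_eq (PF_mul (PF_const d (-1)) (@PF_var k d a (ltn_ord a))) => c' lam; rewrite mulN1r.
have [|lam Hl] := elimination HG _ c (C := C); last first.
  by exists lam => b v y; apply/eqP; rewrite -subr_eq0; apply/eqP; apply: (Hl (b, v, y)).
apply: infinW Hinf => c' [lam Hl]; exists lam; split; last first.
  by move=> [[b v] y]; rewrite /G Hl subrr.
move=> a ad; apply: eig_C; have [b [v bv]] := tau0 a ad.
have : chi2 He (psum N w0 c') (psum N w1 c') b v (lam a) = 0.
  rewrite Hl (bigD1 (Ordinal ad)) //= subrr expr0n; move: bv; rewrite lt0n => /negPf ->.
  by rewrite mul0r.
rewrite /chi2; case: b bv => _ H; [right|left]; by apply: chi_root H; apply: hom_psum.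
Qed.
End Pattern.

(** Merging of eigenvalues is allowed for: several indices on either side may share the root [x],
    and only the total multiplicities agree. *)
Lemma root_mult (k : closedFieldType) d (l : nat -> k) (a : nat -> nat) M (m : nat -> k) (b : nat -> nat) :
  (forall y, \prod_(i < d) (y - l i) ^+ a i = \prod_(i < M) (y - m i) ^+ b i) ->
  forall x, (\sum_(i < d | l i == x) a i = \sum_(i < M | m i == x) b i)%N.
Proof.
move=> H x.
have P0 N (u : nat -> k) (c : nat -> nat) : \prod_(i < N) ('X - (u i)%:P) ^+ c i != 0.
  by apply/prodf_neq0 => i _; rewrite expf_neq0 // polyXsubC_eq0.
have mu N (u : nat -> k) (c : nat -> nat) :
    mup x (\prod_(i < N) ('X - (u i)%:P) ^+ c i) = (\sum_(i < N | u i == x) c i)%N.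
  elim: N => [|N IH]; first by rewrite !big_ord0 mupNroot // /root hornerC oner_eq0.
  rewrite big_ord_recr mupM ?P0 ?expf_neq0 ?polyXsubC_eq0 //=.
  by rewrite IH mup_XsubCX [RHS]big_mkcond big_ord_recr -big_mkcond.
rewrite -!mu; congr mup; apply/eqP; rewrite -subr_eq0; apply/eqP; apply: infin_poly0.
apply: cofin_infin; apply: cofin_true => y; rewrite hornerD hornerN !horner_prod.
under eq_bigr => i _ do rewrite horner_exp !hornerE.
under [X in _ - X]eq_bigr => i _ do rewrite horner_exp !hornerE.
by rewrite H subrr.
Qed.

Lemma distinct_scalars (k : closedFieldType) M : exists s : seq k, uniq s /\ size s = M.
Proof.
elim: M => [|M [s [us ss]]]; first by exists [::].
have [|c Hc] := @poly_nonroot k (\prod_(x <- s) ('X - x%:P)).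
  exact/monic_neq0/monic_prod_XsubC.
exists (c :: s); split; last by rewrite /= ss.
by rewrite /= us andbT; move: Hc; rewrite -/(root _ _) root_prod_XsubC.
Qed.

(** * Biproducts of complexes with prescribed shape *)

Section Biproducts.
Variables (k : closedFieldType) (A : falgType k) (n : nat) (e : 'I_n -> A).
Hypothesis He : complete_projectives e.

Lemma cnt_iso m m' (s : 'I_m -> 'I_n) (s' : 'I_m' -> 'I_n) : (forall v, cnt s v = cnt s' v) ->
  exists U V, [/\ hom e s s' U, hom e s' s V, V *m U = Epr e s' & U *m V = Epr e s].
Proof.
move=> H; have E : m = m' by rewrite -(cnt_total s) -(cnt_total s'); apply: eq_bigr.
case: m' / E s' H => s' H.
have cE (t : 'I_m -> 'I_n) v : count_mem v [tuple t i | i < m] = cnt t v.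
  by rewrite /= count_map -sum1_count /cnt big_mkcond big_enum /=; apply: eq_bigr => i _; case: (t i == v).
have /tuple_permP [p Hp] : perm_eq [tuple s i | i < m] [tuple s' i | i < m].
  by apply/allP => v _ /=; rewrite !cE H.
have {}Hp i : s i = s' (p i).
  have := congr1 (fun t => tnth t i) (val_inj Hp : [tuple s i | i < m] = _).
  by rewrite !tnth_mktuple.
have EE : perm_mx p *m Epr e s' = Epr e s *m perm_mx p.
  apply/matrixP => i j; rewrite -row_permE Epr_l !mxE Hp.
  by case: eqP => _; rewrite ?mulr1n ?mulr0n ?mulr1 ?mulr0.
have pp : perm_mx p *m perm_mx p^-1 = 1%:M :> 'M[A]_m by rewrite -perm_mxM mulgV perm_mx1.
have pp' : perm_mx p^-1 *m perm_mx p = 1%:M :> 'M[A]_m by rewrite -perm_mxM mulVg perm_mx1.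
exists (perm_mx p *m Epr e s'), (Epr e s' *m perm_mx p^-1); split.
- by apply: homI; [rewrite {1}EE mulmxA EprK // -EE | rewrite -mulmxA EprK].
- apply: homI; first by rewrite mulmxA EprK.
  have -> : Epr e s' *m perm_mx p^-1 = perm_mx p^-1 *m Epr e s.
    by rewrite -[LHS]mul1mx -pp' -!mulmxA [perm_mx p *m _]mulmxA EE -mulmxA pp mulmx1.
  by rewrite -mulmxA EprK.
- by rewrite -mulmxA [perm_mx p^-1 *m _]mulmxA pp' mul1mx EprK.
- by rewrite mulmxA -[_ *m Epr e s' *m Epr e s']mulmxA EprK // EE -mulmxA pp mulmx1.
Qed.

(** Summands are indexed by natural numbers, so the families are total and the biproduct relations
    are imposed only below [M]. *)
Definition mxbip m (s : 'I_m -> 'I_n) M (q : nat -> nat) (r : forall i, 'I_(q i) -> 'I_n)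
    (I : forall i, 'M[A]_(m, q i)) (P : forall i, 'M[A]_(q i, m)) :=
  [/\ forall i, hom e s (r i) (I i), forall i, hom e (r i) s (P i),
      forall i, (i < M)%N -> P i *m I i = Epr e (r i),
      forall i j, (i < M)%N -> (j < M)%N -> i != j -> P i *m I j = 0
    & \sum_(i < M) I i *m P i = Epr e s].

Lemma mxbip_sum M (q : nat -> nat) (r : forall i, 'I_(q i) -> 'I_n) :
  exists m (s : 'I_m -> 'I_n) I P, mxbip s M r I P /\ forall v, cnt s v = (\sum_(i < M) cnt (r i) v)%N.
Proof.
elim: M => [|M [m [s [I [P [[hI hP PI PI0 IP] C]]]]]].
  have s : 'I_0 -> 'I_n by case.
  exists 0%N, s, (fun i => 0), (fun i => 0); split; last by move=> v; rewrite /cnt !big_ord0.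
  by split=> //; [move=> i; apply: hom0|move=> i; apply: hom0|apply/matrixP => -[]].
(* The size depends on [i], so [conform_mx] serves as a cast; at i = M the sizes agree and it is the
   identity. *)
pose D i : 'M[A]_(q M, q i) := if i == M then conform_mx 0 (Epr e (r M)) else 0.
pose D' i : 'M[A]_(q i, q M) := if i == M then conform_mx 0 (Epr e (r M)) else 0.
have DM : D M = Epr e (r M) by rewrite /D eqxx conform_mx_id.
have DM' : D' M = Epr e (r M) by rewrite /D' eqxx conform_mx_id.
have D0 i : i != M -> D i = 0 by rewrite /D => /negPf ->.
have D0' i : i != M -> D' i = 0 by rewrite /D' => /negPf ->.
have hE : hom e (r M) (r M) (Epr e (r M)) by apply: hom_Epr.
exists (m + q M)%N, (fsum s (r M)), (fun i => col_mx (if (i < M)%N then I i else 0) (D i)),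
  (fun i => row_mx (if (i < M)%N then P i else 0) (D' i)).
split; last by move=> v; rewrite cnt_fsum C big_ord_recr.
split.
- move=> i; apply: hom_col => //; first by case: ifP => _; [apply: hI | apply: hom0].
  by have [->|/D0 ->] := eqVneq i M; [rewrite DM | apply: hom0].
- move=> i; apply: hom_row => //; first by case: ifP => _; [apply: hP | apply: hom0].
  by have [->|/D0' ->] := eqVneq i M; [rewrite DM' | apply: hom0].
- move=> i; rewrite ltnS leq_eqVlt => /orP [/eqP -> | iM].
    by rewrite ltnn mul_row_col DM DM' mul0mx add0r EprK.
  by rewrite iM mul_row_col PI // D0' ?D0 ?mulmx0 ?addr0 // ltn_eqF.
- move=> i j iM jM ij; rewrite mul_row_col.
  have -> : D' i *m D j = 0.
    have [iE|/D0' ->] := eqVneq i M; last by rewrite mul0mx.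
    by rewrite (@D0 j) ?mulmx0 // -iE eq_sym.
  rewrite addr0; case: ltnP => iM'; last by rewrite mul0mx.
  by case: ltnP => jM'; rewrite ?mulmx0 // PI0.
- rewrite big_ord_recr /= ltnn DM DM' mul_col_row !mul0mx !mulmx0 EprK //.
  under eq_bigr => i _ do rewrite ltn_ord D0 ?D0' ?ltn_eqF ?ltn_ord // mul_col_row mul0mx !mulmx0.
  pose B (x : 'M[A]_m) : 'M[A]_(m + q M) := block_mx x 0 0 0.
  have BD : {morph B : x y / x + y} by move=> x y; rewrite /B add_block_mx !addr0.
  have B0 : B 0 = 0 by apply: block_mx0.
  by rewrite -/(B _) -(big_morph B BD B0) IP /B add_block_mx Epr_fsum !addr0 !add0r.
Qed.

Lemma mxbip_ex m (s : 'I_m -> 'I_n) M (q : nat -> nat) (r : forall i, 'I_(q i) -> 'I_n) :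
  (forall v, cnt s v = (\sum_(i < M) cnt (r i) v)%N) -> exists I P, mxbip s M r I P.
Proof.
move=> C; have [m' [s' [I [P [[hI hP PI PI0 IP] C']]]]] := mxbip_sum M r.
have [|U [V [hU hV VU UV]]] := @cnt_iso _ _ s s'; first by move=> v; rewrite C C'.
have VUI i : V *m (U *m I i) = I i by rewrite mulmxA VU (hom_l He (hI i)).
exists (fun i => U *m I i), (fun i => P i *m V); split.
- by move=> i; apply: (homM He hU (hI i)).
- by move=> i; apply: (homM He (hP i) hV).
- by move=> i iM; rewrite -mulmxA VUI PI.
- by move=> i j iM jM ij; rewrite -mulmxA VUI PI0.
- have -> : \sum_(i < M) U *m I i *m (P i *m V) = U *m (\sum_(i < M) I i *m P i) *m V.
    by rewrite mulmx_sumr mulmx_suml; apply: eq_bigr => i _; rewrite !mulmxA.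
  by rewrite IP -mulmxA (hom_l He hV) UV.
Qed.

Lemma mxbip_l m (s : 'I_m -> 'I_n) M q (r : forall i, 'I_(q i) -> 'I_n) I P p (x : 'I_p -> 'I_n) h :
  mxbip s M r I P -> hom e s x h -> \sum_(i < M) I i *m (P i *m h) = h.
Proof.
case=> _ _ _ _ IP hh; under eq_bigr => i _ do rewrite mulmxA.
by rewrite -mulmx_suml IP (hom_l He hh).
Qed.
Lemma mxbip_r m (s : 'I_m -> 'I_n) M q (r : forall i, 'I_(q i) -> 'I_n) I P p (x : 'I_p -> 'I_n) h :
  mxbip s M r I P -> hom e x s h -> \sum_(i < M) h *m I i *m P i = h.
Proof.
case=> _ _ _ _ IP hh; under eq_bigr => i _ do rewrite -mulmxA.
by rewrite -mulmx_sumr IP (hom_r He hh).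
Qed.

Lemma det_oneD_orth m (K : comNzRingType) (X : nat -> 'M[K]_m) M :
  (forall i j, (i < M)%N -> (j < M)%N -> i != j -> X i *m X j = 0) ->
  \det (1%:M + \sum_(i < M) X i) = \prod_(i < M) \det (1%:M + X i).
Proof.
elim: M => [|M IH] H; first by rewrite !big_ord0 addr0 det1.
rewrite !big_ord_recr /= -IH; last by move=> i j iM jM; apply: H; lia.
rewrite -det_mulmx; congr determinant; rewrite mulmxDr mulmx1 mulmxDl mul1mx mulmx_suml.
rewrite [X in _ = _ + (_ + X)]big1 ?addr0 ?addrA // => i _.
by apply: H; rewrite ?ltnS ?(ltnW (ltn_ord i)) // ltn_eqF.
Qed.

(** The orthogonal projections turn the determinant of the sum into a product, and Sylvester's
    identity reduces each factor to a scalar on its own summand. *)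
Lemma chi_diag v m (s : 'I_m -> 'I_n) M q (r : forall i, 'I_(q i) -> 'I_n) I P (l : nat -> k) y :
  mxbip s M r I P ->
  chi He v s (\sum_(i < M) sc (l i) (I i *m P i)) y = \prod_(i < M) (y - l i) ^+ cnt (r i) v.
Proof.
case=> hI hP PI PI0 IP.
pose X i := (y - 1 - l i) *: (Res He v s (r i) (I i) *m Res He v (r i) s (P i)).
transitivity (\det (1%:M + \sum_(i < M) X i)).
  rewrite /chi -addrA; congr (\det (_ + _)).
  rewrite -(Res_Epr He) -IP !(big_morph _ (ResD He v s s) (Res0 He v s s)) scaler_sumr -sumrB.
  apply: eq_bigr => i _; rewrite ResZ (ResM He v _ _ (hI i)) /X.
  by rewrite !scalerBl.
rewrite det_oneD_orth; last first.
  move=> i j iM jM ij; rewrite /X -scalemxAl -scalemxAr -mulmxA [Res _ _ _ _ (P i) *m _]mulmxA.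
  by rewrite -(ResM He v _ _ (hP i)) PI0 // Res0 mul0mx mulmx0 !scaler0.
apply: eq_bigr => i _; rewrite /X scalemxAl det_sylvester -scalemxAr -(ResM He v _ _ (hP i)) PI //.
rewrite Res_Epr -cntE; congr determinant.
by apply/matrixP => a b; rewrite !mxE; ring.
Qed.

Definition zsum S T (f : mor A S) (g : mor A T) (h : 'M[A]_(z0 T, z1 S)) := exists a b,
  [/\ hom e (y1 T) (y1 S) a, hom e (y0 T) (y0 S) b & h = g *m a + b *m f].
Lemma zsum_sum S T (f : mor A S) (g : mor A T) (J : Type) (x : seq J) (p : pred J) h :
  (forall i, p i -> zsum f g (h i)) -> zsum f g (\sum_(i <- x | p i) h i).
Proof.
move=> H; elim/big_ind: _ => //.
  by exists 0, 0; split; rewrite ?mulmx0 ?mul0mx ?addr0 //; apply: hom0.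
move=> _ _ [a [b [ha hb ->]]] [a' [b' [ha' hb' ->]]]; exists (a + a'), (b + b'); split.
- exact: homD.
- exact: homD.
- by rewrite mulmxDr mulmxDl addrACA.
Qed.

Definition biprod S (f : mor A S) M (P : nat -> cmplx A n)
    (I0 : forall i, 'M[A]_(z0 S, z0 (tag (P i)))) (P0 : forall i, 'M[A]_(z0 (tag (P i)), z0 S))
    (I1 : forall i, 'M[A]_(z1 S, z1 (tag (P i)))) (P1 : forall i, 'M[A]_(z1 (tag (P i)), z1 S)) :=
  [/\ mxbip (y0 S) M (fun i => y0 (tag (P i))) I0 P0, mxbip (y1 S) M (fun i => y1 (tag (P i))) I1 P1,
      forall i, (i < M)%N -> I0 i *m tagged (P i) = f *m I1 i
    & forall i, (i < M)%N -> P0 i *m f = tagged (P i) *m P1 i].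

Lemma biprod_ex S M (P : nat -> cmplx A n) : (forall i, shom e (tag (P i)) (tagged (P i))) ->
  (forall b v, cnt2 S b v = (\sum_(i < M) cnt2 (tag (P i)) b v)%N) ->
  exists (f : mor A S) I0 P0 I1 P1, shom e S f /\ @biprod S f M P I0 P0 I1 P1.
Proof.
move=> hP C.
have [I0 [P0 B0]] := @mxbip_ex _ (y0 S) M _ (fun i => y0 (tag (P i))) (C false).
have [I1 [P1 B1]] := @mxbip_ex _ (y1 S) M _ (fun i => y1 (tag (P i))) (C true).
case: (B0) (B1) => hI0 hP0 PI0 PI00 IP0 [hI1 hP1 PI1 PI10 IP1].
exists (\sum_(i < M) I0 i *m tagged (P i) *m P1 i), I0, P0, I1, P1; split.
  rewrite /shom; elim/big_ind: _ => [|x y|i _]; [exact: hom0|exact: homD|].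
  exact: (homM He (homM He (hI0 i) (hP i)) (hP1 i)).
split=> // i iM; [rewrite mulmx_suml | rewrite mulmx_sumr]; rewrite (bigD1 (Ordinal iM)) //= big1 ?addr0.
- by rewrite -[RHS]mulmxA PI1 // -mulmxA (hom_r He (hP i)).
- by move=> j ji; rewrite -mulmxA PI10 ?mulmx0 // ltn_ord.
- by rewrite !mulmxA PI0 // (hom_l He (hP i)).
- by move=> j ji; rewrite !mulmxA PI00 ?mul0mx ?ltn_ord // eq_sym.
Qed.

Lemma biprod_term S (f : mor A S) M P I0 P0 I1 P1 T (g : mor A T) M' P' I0' P0' I1' P1' i j h :
  @biprod S f M P I0 P0 I1 P1 -> @biprod T g M' P' I0' P0' I1' P1' -> (i < M)%N -> (j < M')%N ->
  Ez e (tag (P i)) (tag (P' j)) (tagged (P i)) (tagged (P' j)) -> hom e (y0 T) (y1 S) h ->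
  zsum f g (I0' j *m (P0' j *m (h *m I1 i *m P1 i))).
Proof.
move=> [[hI0 hP0 _ _ _] [hI1 hP1 _ _ _] bI bP] [[hI0' hP0' _ _ _] [hI1' hP1' _ _ _] bI' bP'] iM jM H hh.
have hx : hom e (y0 (tag (P' j))) (y1 (tag (P i))) (P0' j *m h *m I1 i) by apply: (homM He (homM He (hP0' j) hh) (hI1 i)).
have [a [b [ha hb E]]] := H _ hx.
exists (I1' j *m a *m P1 i), (I0' j *m b *m P0 i); split.
- exact: (homM He (homM He (hI1' j) ha) (hP1 i)).
- exact: (homM He (homM He (hI0' j) hb) (hP0 i)).
rewrite !mulmxA -(bI' j) // -[_ *m P0 i *m f]mulmxA bP // mulmxA -mulmxDl -!mulmxA -mulmxDr.
by rewrite !mulmxA in E *; rewrite -[I0' j *m P0' j *m h]mulmxA -[I0' j *m (P0' j *m h) *m I1 i]mulmxA E.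
Qed.

(** Cutting h into blocks from summand to summand leaves terms that are each of the form g a + b
    f. *)
Lemma biprod_Ez S (f : mor A S) M P I0 P0 I1 P1 T (g : mor A T) M' P' I0' P0' I1' P1' :
  @biprod S f M P I0 P0 I1 P1 -> @biprod T g M' P' I0' P0' I1' P1' ->
  (forall i j, (i < M)%N -> (j < M')%N -> Ez e (tag (P i)) (tag (P' j)) (tagged (P i)) (tagged (P' j))) ->
  Ez e S T f g.
Proof.
move=> B B' H h hh; rewrite -/(zsum f g h).
case: (B) (B') => _ B1 _ _ [B0' _ _ _]; case: (B1) => hI1 hP1 _ _ _.
rewrite -(mxbip_r B1 hh); apply: zsum_sum => i _.
rewrite -(mxbip_l B0' (homM He (homM He hh (hI1 i)) (hP1 i))); apply: zsum_sum => j _.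
by apply: biprod_term B B' _ _ _ hh => //; apply: H.
Qed.
End Biproducts.

(** * Compatibility of classes and simultaneous choices *)

Section Compat.
Variables (k : closedFieldType) (A : falgType k) (n : nat) (e : 'I_n -> A).
Hypothesis He : complete_projectives e.

(** The test module [coker e g] does not move with [f], so openness of [Esurj] transfers;
    [kernu e f] serves for the other variable. *)
Lemma Ez_open_l S T (g : mor A T) : shom e T g -> lopen e S (fun f => Ez e S T f g).
Proof.
move=> hg f f' hf hf' H.
have := @Esurj_open _ _ _ _ He S (coker e g) f f' hf hf'.
move=> /(_ (iffRL (Esurj_coker He hg hf) H)); apply: cofinW => c Hc.
exact/(Esurj_coker He hg (hom_ln c hf hf')).
Qed.
Lemma Ez_open_r S T (f : mor A S) : shom e S f -> lopen e T (fun g => Ez e S T f g).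
Proof.
move=> hf g g' hg hg' H.
have := @Hinj_open _ _ _ _ He T (kernu e f) g g' hg hg'.
move=> /(_ (iffRL (Hinj_ker He hf hg) H)); apply: cofinW => c Hc.
exact/(Hinj_ker He hf (hom_ln c hg hg')).
Qed.

Definition E0 S T := exists f g, [/\ shom e S f, shom e T g & Ez e S T f g].

(** Maps are fixed one index at a time, each new one meeting finitely many conditions that are open
    along lines. [Good s] keeps these conditions satisfiable: every map already fixed still has a
    partner in each class it must be compatible with. *)
Lemma simultaneous (S : nat -> shp n) (r : rel nat) M :
  (forall i j, (i < M)%N -> (j < M)%N -> r i j -> i != j /\ E0 (S i) (S j)) ->
  exists f : forall i, mor A (S i), (forall i, shom e (S i) (f i)) /\
    forall i j, (i < M)%N -> (j < M)%N -> r i j -> Ez e (S i) (S j) (f i) (f j).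
Proof.
move=> H.
pose Good s (f : forall i, mor A (S i)) := forall i j, (i < M)%N -> (j < M)%N -> r i j ->
    [/\ (i < s)%N -> (j < s)%N -> Ez e (S i) (S j) (f i) (f j),
        (i < s)%N -> exists2 g, shom e (S j) g & Ez e (S i) (S j) (f i) g &
        (j < s)%N -> exists2 g, shom e (S i) g & Ez e (S i) (S j) g (f j)].
suff [f [hf Hf]] : exists f : forall i, mor A (S i), (forall i, shom e (S i) (f i)) /\ Good M f.
  by exists f; split=> // i j iM jM rij; have [+ _ _] := Hf i j iM jM rij; apply.
have: (M <= M)%N by []; move: {1 3}M => s.
elim: s => [_|s IH sM].
  by exists (fun i => 0); split=> [i|i j _ _ _]; [apply: hom0 | split].
have [f [hf Hf]] := IH (ltnW sM).
pose Q (bj : bool * nat) (h : mor A (S s)) := if bj.1 then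
    r s bj.2 -> ((bj.2 < s)%N -> Ez e (S s) (S bj.2) h (f bj.2)) /\
       exists2 g, shom e (S bj.2) g & Ez e (S s) (S bj.2) h g
  else r bj.2 s -> ((bj.2 < s)%N -> Ez e (S bj.2) (S s) (f bj.2) h) /\
       exists2 g, shom e (S bj.2) g & Ez e (S bj.2) (S s) g h.
have lopen_imp (c : bool) T (P : mor A T -> Prop) : lopen e T P -> lopen e T (fun h => c -> P h).
  case: c => HP; last by move=> *; apply: cofin_true.
  by move=> h h' hh hh' Ph; apply: cofinW (HP h h' hh hh' (Ph isT)).
have oQ i : i \in [seq (b, j) | b <- [:: true; false], j <- iota 0 M] -> lopen e (S s) (Q i).
  move=> _; case: i => -[] j; rewrite /Q /=; apply: (lopen_imp); apply: lopen_and.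
  - by apply: (lopen_imp); apply: Ez_open_l.
  - by move=> h h' hh hh' [g hg Hg]; apply: cofinW (Ez_open_l hg hh hh' Hg) => c Hc; exists g.
  - by apply: (lopen_imp); apply: Ez_open_r.
  - by move=> h h' hh hh' [g hg Hg]; apply: cofinW (Ez_open_r hg hh hh' Hg) => c Hc; exists g.
have [|_ [h hh Hh]] := lopen_all oQ.
  case=> b j /allpairsP [[b' j'] /= [_ + [-> ->]]]; rewrite mem_iota add0n => jM.
  rewrite /Q /=; case: b' => {b j}.
    case: (boolP (r s j')) => [rs|_]; last by exists 0; [apply: hom0|].
    have [_ [f0 [g0 [hf0 hg0 H0]]]] := H _ _ sM jM rs.
    case: (ltnP j' s) => js; last by exists f0 => // _; split=> //; exists g0.
    by have [_ _ /(_ js) [g hg Hg]] := Hf _ _ sM jM rs; exists g => // _; split=> //; exists (f j').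
  case: (boolP (r j' s)) => [rs|_]; last by exists 0; [apply: hom0|].
  have [_ [f0 [g0 [hf0 hg0 H0]]]] := H _ _ jM sM rs.
  case: (ltnP j' s) => js; last by exists g0 => // _; split=> //; exists f0.
  by have [_ /(_ js) [g hg Hg] _] := Hf _ _ jM sM rs; exists g => // _; split=> //; exists (f j').
have {}Hh b j : (j < M)%N -> Q (b, j) h.
  by move=> jM; apply: Hh; apply/allpairsP; exists (b, j); split => //=; [case: b | rewrite mem_iota].
exists (dfwith f h); split=> [i|i j iM jM rij].
  by case: dfwithP.
have [ij _] := H _ _ iM jM rij; have [G1 G2 G3] := Hf _ _ iM jM rij.
have fo l : l != s -> dfwith f h l = f l by move=> ls; rewrite dfwith_out // eq_sym.
have lts l : l != s -> (l < s.+1)%N -> (l < s)%N by move=> ls; rewrite ltnS leq_eqVlt (negPf ls).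
have [ei|ni] := eqVneq i s.
  subst i; have nj : j != s by rewrite eq_sym.
  rewrite dfwith_in (fo _ nj); have [Q1 Q2] := Hh true j jM rij; split=> // js.
    by move=> /(lts _ nj)/Q1.
  exact/G3/lts.
rewrite (fo _ ni); have [ej|nj] := eqVneq j s.
  subst j; rewrite dfwith_in; have [Q1 Q2] := Hh false i iM rij; split=> // /(lts _ ni) // .
  by move=> /Q1 + _; apply.
by rewrite (fo _ nj); split=> [/(lts _ ni) il /(lts _ nj) jl|/(lts _ ni)|/(lts _ nj)]; auto.
Qed.

Lemma E0_sum S T M (S' : nat -> shp n) M' (T' : nat -> shp n) :
  (forall b v, cnt2 S b v = (\sum_(i < M) cnt2 (S' i) b v)%N) ->
  (forall b v, cnt2 T b v = (\sum_(i < M') cnt2 (T' i) b v)%N) ->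
  (forall i j, (i < M)%N -> (j < M')%N -> E0 (S' i) (T' j)) -> E0 S T.
Proof.
(* Sources and targets get disjoint indices, so that only pairs from a source to a target are
   constrained. *)
move=> CS CT H; pose U i := if (i < M)%N then S' i else T' (i - M)%N.
have [|f [hf Hf]] := @simultaneous U (fun i j => (i < M)%N && (M <= j)%N) (M + M').
  move=> i j iM jM /andP [iM' jM']; split; first by rewrite ltn_eqF // (leq_trans iM').
  by rewrite /U iM' ltnNge jM' /=; apply: H => //; lia.
have [|g [I0 [P0 [I1 [P1 [hg B]]]]]] := @biprod_ex _ A n e He S M (fun i => existT _ (U i) (f i)) (fun i => hf i).
  by move=> b v; rewrite CS; apply: eq_bigr => i _; rewrite /= /U ltn_ord.
have [|g' [I0' [P0' [I1' [P1' [hg' B']]]]]] :=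
    @biprod_ex _ A n e He T M' (fun j => existT _ (U (M + j)%N) (f (M + j)%N)) (fun j => hf _).
  by move=> b v; rewrite CT; apply: eq_bigr => j _; rewrite /= /U ltnNge leq_addr addKn.
exists g, g'; split=> //; apply: (biprod_Ez He B B') => i j iM jM /=.
by apply: Hf; rewrite ?iM ?leq_addr //; lia.
Qed.

Lemma E0_cnt S T S' T' : (forall b v, cnt2 S' b v = cnt2 S b v) -> (forall b v, cnt2 T' b v = cnt2 T b v) ->
  E0 S T -> E0 S' T'.
Proof.
move=> CS CT H; apply: (@E0_sum _ _ 1 (fun _ => S) 1 (fun _ => T)) => [b v|b v|//]; by rewrite big_ord1.
Qed.

Lemma shape_ex (c : bool -> 'I_n -> nat) : exists S, forall b v, cnt2 S b v = c b v.
Proof.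
have ex (m : 'I_n -> nat) : exists N (s : 'I_N -> 'I_n), forall v, cnt s v = m v.
  pose r (i : nat) : 'I_(if insub i is Some v then m v else 0%N) -> 'I_n :=
    match insub i as o return 'I_(if o is Some v then m v else 0%N) -> 'I_n with
    | Some v => fun _ => v | None => fun j => False_rect _ (notF (ltn_ord j)) end.
  have [N [s [I [P [_ C]]]]] := mxbip_sum He n r; exists N, s => v; rewrite C.
  rewrite (bigD1 v) //= big1 ?addn0 => [|w wv].
    rewrite /r valK /cnt; under eq_bigr => i _ do rewrite eqxx.
    by rewrite sum1_card card_ord.
  rewrite /r valK /cnt; under eq_bigr => i _ do rewrite (negPf wv).
  by rewrite big1.
have [N0 [s0 H0]] := ex (c false); have [N1 [s1 H1]] := ex (c true).
by exists (Shp s1 s0); case.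
Qed.

(** The obstructions run between the summand [i0] and the others, so only compatibility of [i0] with
    the others, in both directions, is used. *)
Lemma biprod_section S (f : mor A S) M P I0 P0 I1 P1 f1 i0 :
  shom e S f -> shom e S f1 -> @biprod _ A n e S f M P I0 P0 I1 P1 -> (i0 < M)%N ->
  (forall j, (j < M)%N -> j != i0 ->
     Ez e (tag (P i0)) (tag (P j)) (tagged (P i0)) (tagged (P j)) /\
     Ez e (tag (P j)) (tag (P i0)) (tagged (P j)) (tagged (P i0))) ->
  exists N w0 w1,
  [/\ forall j, hom e (y0 S) (y0 S) (w0 j) /\ hom e (y1 S) (y1 S) (w1 j),
      psum N w0 0 = I0 i0 *m P0 i0 /\ psum N w1 0 = I1 i0 *m P1 i0
    & forall c, psum N w0 c *m ln f f1 c = ln f f1 c *m psum N w1 c].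
Proof.
move=> hf hf1 [B0 B1 bI bP] iM H.
case: (B0) (B1) => hI0 hP0 PI0 _ IP0 [hI1 hP1 PI1 _ IP1].
have hu0 : hom e (y0 S) (y0 S) (I0 i0 *m P0 i0) by apply: homM (hP0 i0).
have hu1 : hom e (y1 S) (y1 S) (I1 i0 *m P1 i0) by apply: homM (hP1 i0).
have rest m (q : nat -> nat) (x : forall i, 'M[A]_(m, q i)) (y : forall i, 'M[A]_(q i, m)) E : \sum_(i < M) x i *m y i = E ->
    E - x i0 *m y i0 = \sum_(i < M | i != Ordinal iM) x i *m y i.
  by move=> <-; rewrite (bigD1 (Ordinal iM)) //= addrAC subrr add0r.
apply: homotopy_section => //.
- by rewrite mulmxA -[_ *m P0 i0 *m I0 i0]mulmxA PI0 // (hom_r He (hI0 i0)).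
- by rewrite mulmxA -[_ *m P1 i0 *m I1 i0]mulmxA PI1 // (hom_r He (hI1 i0)).
- by rewrite -mulmxA bP // mulmxA bI // mulmxA.
- move=> h hh; rewrite (rest _ _ _ _ _ IP1) mulmx_sumr; apply: zsum_sum => j ji.
  have := biprod_term He (And4 B0 B1 bI bP) (And4 B0 B1 bI bP) (ltn_ord j) iM (proj2 (H j (ltn_ord j) ji)) hh.
  by rewrite !mulmxA.
- move=> h hh; rewrite (rest _ _ _ _ _ IP0) !mulmx_suml; apply: zsum_sum => j ji.
  have := biprod_term He (And4 B0 B1 bI bP) (And4 B0 B1 bI bP) iM (ltn_ord j) (proj1 (H j (ltn_ord j) ji)) hh.
  by rewrite !mulmxA.
Qed.
End Compat.

(** * Polynomial families of endomorphisms and indecomposable classes *)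

Section PolynomialFamilies.
Variables (k : closedFieldType) (A : falgType k) (n : nat) (e : 'I_n -> A).
Hypothesis He : complete_projectives e.

Lemma scA m p a b (x : 'M[A]_(m, p)) : sc a (sc b x) = sc (a * b) x.
Proof. by apply/matrixP => i j; rewrite !mxE scalerA. Qed.
Lemma sc_sum m p a (J : Type) (r : seq J) (x : J -> 'M[A]_(m, p)) :
  sc a (\sum_(i <- r) x i) = \sum_(i <- r) sc a (x i).
Proof. by rewrite (big_morph (sc a) (scD a) (sc_0 _ _ _ a)). Qed.
Lemma sc_suml m p (J : Type) (r : seq J) (a : J -> k) (x : 'M[A]_(m, p)) :
  sc (\sum_(i <- r) a i) x = \sum_(i <- r) sc (a i) x.
Proof. by rewrite (big_morph (fun a => sc a x) (fun a b => scDl a b x) (sc0 x)). Qed.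

(** Coefficients are required to vanish from N on, so that two families can be brought to a common
    length. *)
Definition polyfam m p (s : 'I_m -> 'I_n) (t : 'I_p -> 'I_n) (W : k -> 'M[A]_(m, p)) :=
  exists N w, [/\ forall j, hom e s t (w j), forall j, (N <= j)%N -> w j = 0 & forall c, psum N w c = W c].

Lemma psum_widen m p N N' (w : nat -> 'M[A]_(m, p)) c : (N <= N')%N -> (forall j, (N <= j)%N -> w j = 0) ->
  psum N' w c = psum N w c.
Proof.
move=> le w0; rewrite /psum -(subnKC le) big_split_ord /= [X in _ + X]big1 ?addr0 // => i _.
by rewrite w0 ?leq_addr // sc_0.
Qed.

Section Fix.
Variables (m p : nat) (s : 'I_m -> 'I_n) (t : 'I_p -> 'I_n).
Lemma polyfam_eq W W' : (forall c, W c = W' c) -> polyfam s t W -> polyfam s t W'.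
Proof. by move=> E [N [w [h1 h2 h3]]]; exists N, w; split=> // c; rewrite h3. Qed.
Lemma polyfam_sc x (q : {poly k}) : hom e s t x -> polyfam s t (fun c => sc q.[c] x).
Proof.
move=> hx; exists (size q), (fun j => sc q`_j x); split=> [j|j le|c]; first exact: homZ.
  by rewrite nth_default // sc0.
rewrite horner_coef sc_suml; apply: eq_bigr => i _.
by rewrite scA mulrC.
Qed.
Lemma polyfamD W W' : polyfam s t W -> polyfam s t W' -> polyfam s t (fun c => W c + W' c).
Proof.
move=> [N [w [h1 h2 h3]]] [N' [w' [h1' h2' h3']]]; exists (maxn N N'), (fun j => w j + w' j).
split=> [j|j|c]; first exact: homD.
  by rewrite geq_max => /andP [/h2 -> /h2' ->]; rewrite addr0.
rewrite -h3 -h3' -(psum_widen c (leq_maxl N N') h2) -(psum_widen c (leq_maxr N N') h2').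
by rewrite /psum -big_split; apply: eq_bigr => i _; rewrite scD.
Qed.
Lemma polyfam_sum (J : Type) (r : seq J) (W : J -> k -> 'M[A]_(m, p)) :
  (forall i, polyfam s t (W i)) -> polyfam s t (fun c => \sum_(i <- r) W i c).
Proof.
move=> H; elim: r => [|i r IH].
  apply: polyfam_eq (polyfam_sc 0 (hom0 e s t)) => c; by rewrite big_nil sc_0.
by apply: polyfam_eq (polyfamD (H i) IH) => c; rewrite big_cons.
Qed.
Lemma polyfam_psum N w (q q' : {poly k}) : (forall j, hom e s t (w j)) ->
  polyfam s t (fun c => sc q.[c] (psum N w q'.[c])).
Proof.
move=> hw; apply: polyfam_eq (polyfam_sum (index_enum 'I_N) (fun j => polyfam_sc (q * q' ^+ j) (hw j))) => c.
by rewrite /psum sc_sum; apply: eq_bigr => j _; rewrite scA hornerM horner_exp.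
Qed.
End Fix.

Lemma pattern_closed_fam S (W0 : k -> 'M[A]_(z0 S)) (W1 : k -> 'M[A]_(z1 S)) d (tau : nat -> bool -> 'I_n -> nat) :
  polyfam (y0 S) (y0 S) W0 -> polyfam (y1 S) (y1 S) W1 ->
  (forall a, (a < d)%N -> exists b v, (0 < tau a b v)%N) ->
  infin (fun c => exists lam : nat -> k, forall b v y,
    chi2 He (W0 c) (W1 c) b v y = \prod_(a < d) (y - lam a) ^+ tau a b v) ->
  forall c, exists lam : nat -> k, forall b v y,
    chi2 He (W0 c) (W1 c) b v y = \prod_(a < d) (y - lam a) ^+ tau a b v.
Proof.
move=> [N [w [h1 h2 h3]]] [N' [w' [h1' h2' h3']]] t0 H c.
have E0 c' : psum (maxn N N') w c' = W0 c' by rewrite (psum_widen c' (leq_maxl N N') h2).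
have E1 c' : psum (maxn N N') w' c' = W1 c' by rewrite (psum_widen c' (leq_maxr N N') h2').
have [|lam Hl] := @pattern_closed _ _ _ _ He S (maxn N N') w w' h1 h1' d tau t0 _ c.
  by apply: infinW H => c' [lam Hl]; exists lam => b v y; rewrite E0 E1.
by exists lam => b v y; rewrite -E0 -E1.
Qed.

Lemma biprod_projections S (f : mor A S) M P I0 P0 I1 P1 (l : nat -> k) b v y :
  @biprod _ A n e S f M P I0 P0 I1 P1 ->
  chi2 He (\sum_(i < M) sc (l i) (I0 i *m P0 i)) (\sum_(i < M) sc (l i) (I1 i *m P1 i)) b v y =
  \prod_(i < M) (y - l i) ^+ cnt2 (tag (P i)) b v.
Proof.
by case=> B0 B1 _ _; rewrite /chi2; case: b; [rewrite (chi_diag He v l y B1) | rewrite (chi_diag He v l y B0)].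
Qed.

Definition sindec S (f : mor A S) := forall u0 u1,
  hom e (y0 S) (y0 S) u0 -> hom e (y1 S) (y1 S) u1 -> u0 *m u0 = u0 -> u1 *m u1 = u1 -> u0 *m f = f *m u1 ->
  (u0 = 0 /\ u1 = 0) \/ (u0 = Epr e (y0 S) /\ u1 = Epr e (y1 S)).
(* The general map of type [S] gives a complex without idempotent chain endomorphisms
   other than 0 and 1, "general" being tested along lines through one map [f1]. *)
Definition gindec S := (0 < z0 S + z1 S)%N /\
  exists f1, shom e S f1 /\ forall f0, shom e S f0 -> cofin (fun c => sindec (ln f0 f1 c)).

Lemma size_shp (S : shp n) : (z0 S + z1 S)%N = (\sum_b \sum_v cnt2 S b v)%N.
Proof. by rewrite big_bool /= !cnt_total addnC. Qed.

Lemma shp_gt0 (S : shp n) : (0 < z0 S + z1 S)%N -> exists b v, (0 < cnt2 S b v)%N.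
Proof.
rewrite size_shp => H; apply: contrapT => H'; move: H; rewrite big1 // => b _; apply: big1 => v _.
by apply/eqP; rewrite -leqn0 leqNgt; apply/negP => Hb; apply: H'; exists b, v.
Qed.

(** Extend the projection onto the summand of shape [T] along the line to [f1]. General members are
    indecomposable, so they have one eigenvalue carrying the whole shape [S]; this pattern persists
    at 0, where the eigenvalues 1 and 0 both occur. *)
Lemma gindec_nosplit S T T' : gindec S -> (forall b v, cnt2 S b v = (cnt2 T b v + cnt2 T' b v)%N) ->
  (0 < z0 T + z1 T)%N -> (0 < z0 T' + z1 T')%N -> E0 e T T' -> E0 e T' T -> False.
Proof.
move=> [Sgt [f1 [hf1 Hind]]] C Tgt Tgt' E E'.
pose U (i : nat) := if i == 0%N then T else T'.
have [|f [hf Hf]] := @simultaneous _ _ _ _ He U (fun i j => i != j) 2.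
  by case=> [|[|i]] [|[|j]] //.
pose P i : cmplx A n := existT _ (U i) (f i).
have [|f0 [I0 [P0 [I1 [P1 [hf0 B]]]]]] := @biprod_ex _ A n e He S 2 P hf.
  by move=> b v; rewrite C !big_ord_recl big_ord0 addn0.
have [|N [w0 [w1 [hw [w00 w10] Hw]]]] := biprod_section He hf0 hf1 B (isT : (0 < 2)%N).
  by case=> [|[|j]] // _ _; split; apply: Hf.
have hw0 j := proj1 (hw j); have hw1 j := proj2 (hw j).
have cpos (a : nat) : (a < 1)%N -> exists b v, (0 < cnt2 S b v)%N by move=> _; apply: shp_gt0.
have [|lam Hl] := @pattern_closed _ _ _ _ He S N w0 w1 hw0 hw1 1 (fun _ => cnt2 S) cpos _ 0.
  apply: infinW (cofin_infin (Hind f0 hf0)) => c Hc.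
  have hl := hom_ln c hf0 hf1.
  case: (eigen_or_split He hl (hom_psum N c hw0) (hom_psum N c hw1) (Hw c) Sgt).
    case=> mu [N' [N0 N1]]; exists (fun _ => mu) => b v y; rewrite big_ord1 /chi2.
    case: b; [exact: (chi_nilp He v (hom_psum N c hw1) N1 y) | exact: (chi_nilp He v (hom_psum N c hw0) N0 y)].
  by case=> u0 [u1 [[hu0 hu1 u00 u11 uf] _ _ n0 nE]]; case: (Hc u0 u1 hu0 hu1 u00 u11 uf).
pose l (i : nat) : k := if i == 0%N then 1 else 0.
have HP b v y : \prod_(a < 1) (y - lam a) ^+ cnt2 S b v = \prod_(i < 2) (y - l i) ^+ cnt2 (U i) b v.
  have := biprod_projections l b v y B; rewrite -Hl w00 w10 => <-.
  by rewrite !big_ord_recl !big_ord0 /l /= !sc1 !sc0 !addr0.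
have RM b v := @root_mult k 1 lam (fun _ => cnt2 S b v) 2 l (fun i => cnt2 (U i) b v) (HP b v).
have l0 : lam 0%N = 1.
  have [b [v bv]] := shp_gt0 Tgt; apply/eqP; apply: contraT => ne.
  have := RM b v 1; rewrite big_pred0 => [|i]; last by rewrite ord1 (negPf ne).
  by rewrite big_mkcond !big_ord_recl big_ord0 /= eqxx /U /=; move: bv; lia.
have [b [v bv]] := shp_gt0 Tgt'.
have := RM b v 0; rewrite big_pred0 => [|i]; last by rewrite ord1 l0 oner_eq0.
by rewrite big_mkcond !big_ord_recl big_ord0 /= eqxx /U /=; move: bv; lia.
Qed.
End PolynomialFamilies.

(** * A compatible class is a sum of the given ones *)

Section Summands.
Variables (k : closedFieldType) (A : falgType k) (n : nat) (e : 'I_n -> A).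
Hypothesis He : complete_projectives e.
Variables (Z R : shp n) (M : nat) (Th : nat -> shp n).
Hypothesis C : forall b v, (cnt2 Z b v + cnt2 R b v = \sum_(i < M) cnt2 (Th i) b v)%N.
Hypotheses (EZR : E0 e Z R) (ERZ : E0 e R Z).
Hypotheses (EZT : forall i, (i < M)%N -> E0 e Z (Th i)) (ERT : forall i, (i < M)%N -> E0 e R (Th i)).
Hypothesis ETT : forall i j, (i < M)%N -> (j < M)%N -> i != j -> E0 e (Th i) (Th j).
Hypothesis GT : forall i, (i < M)%N -> gindec e (Th i).

(** [tau] records the shapes of the eigensummands, which take finitely many values; the eigenvalues
    are left free. *)
Definition has_pattern (S : shp n) (f : mor A S) (w0 : 'M[A]_(z0 S)) (w1 : 'M[A]_(z1 S)) d (tau : nat -> bool -> 'I_n -> nat) :=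
  exists (P : nat -> cmplx A n) (lam : nat -> k),
  [/\ forall a, (a < d)%N -> [/\ shom e (tag (P a)) (tagged (P a)), inhabited (retr e f (tagged (P a)))
        & (0 < z0 (tag (P a)) + z1 (tag (P a)))%N],
      forall b v y, chi2 He w0 w1 b v y = \prod_(a < d) (y - lam a) ^+ tau a b v &
      forall a b v, (a < d)%N -> cnt2 (tag (P a)) b v = tau a b v].

(** The number of eigensummands and their multiplicities are bounded by the size of [S], so one
    pattern recurs for infinitely many c. *)
Lemma pattern_ex (S : shp n) (f : k -> mor A S) (w0 : k -> 'M[A]_(z0 S)) (w1 : k -> 'M[A]_(z1 S)) :
  (forall c, shom e S (f c)) -> (forall c, hom e (y0 S) (y0 S) (w0 c)) -> (forall c, hom e (y1 S) (y1 S) (w1 c)) ->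
  (forall c, w0 c *m f c = f c *m w1 c) ->
  exists d tau, infin (fun c => has_pattern (f c) (w0 c) (w1 c) d tau).
Proof.
move=> hf hw0 hw1 wf; pose B := (z0 S + z1 S)%N.
pose pt : finType := ('I_B.+1 * {ffun 'I_B.+1 * (bool * 'I_n) -> 'I_B.+1})%type.
pose tau (p : pt) a b v := val (p.2 (inord a, (b, v))).
have [|p Hp] := @infin_pigeonhole k pt (fun _ => True) (fun p c => has_pattern (f c) (w0 c) (w1 c) p.1 (tau p))
   (cofin_infin (cofin_true (fun _ => Logic.I))); last by exists (val p.1), (tau p).
move=> c _; have [d [P [lam [H1 H2 H3]]]] := eigen_decomp He (hf c) (hw0 c) (hw1 c) (wf c).
have leB (b : bool) v : (cnt2 S b v <= B)%N.
  by rewrite /B size_shp (bigD1 b) //= (bigD1 v) //= -addnA leq_addr.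
have dB : (d < B.+1)%N.
  rewrite ltnS /B size_shp.
  have -> : (\sum_b \sum_v cnt2 S b v = \sum_(a < d) (z0 (tag (P a)) + z1 (tag (P a))))%N.
    under [RHS]eq_bigr => a _ do rewrite size_shp.
    rewrite [RHS]exchange_big /=; apply: eq_bigr => b _; rewrite [RHS]exchange_big /=; apply: eq_bigr => v _.
    exact: H3.
  rewrite -[X in (X <= _)%N]card_ord -sum1_card; apply: leq_sum => a _.
  by have [_ _] := H1 a (ltn_ord a).
have cB a b v : (a < d)%N -> (cnt2 (tag (P a)) b v < B.+1)%N.
  move=> ad; rewrite ltnS; apply: leq_trans (leB b v).
  by rewrite H3 (bigD1 (Ordinal ad)) //= leq_addr.
exists (Ordinal dB, [ffun x => inord (cnt2 (tag (P (x.1 : 'I_B.+1))) x.2.1 x.2.2)]).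
have tE a b v : (a < d)%N -> cnt2 (tag (P a)) b v =
    tau (Ordinal dB, [ffun x => inord (cnt2 (tag (P (x.1 : 'I_B.+1))) x.2.1 x.2.2)]) a b v.
  move=> ad; have aB : (a < B.+1)%N := ltn_trans ad dB.
  by rewrite /tau /= ffunE /= (inordK aB) inordK //; apply: cB.
exists P, lam; split=> // b v y; rewrite H2; apply: eq_bigr => a _.
by congr (_ ^+ _); apply: tE.
Qed.

Lemma summands : exists d (io : nat -> nat) (B : pred nat),
  (forall a, (a < d)%N -> (io a < M)%N) /\
  forall b v, (cnt2 Z b v = \sum_(a < d | B a) cnt2 (Th (io a)) b v)%N.
Proof.
pose U i := match i with 0 => Z | 1 => R | i'.+2 => Th i' end.
(* [Z] and [R] need compatibility only towards the [Th i], because the map [f0] built from them is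
   the source in [Ez01] and [f1] is the target. *)
pose r i j := match i, j with
  0, 1 | 1, 0 | 0, _.+2 | 1, _.+2 => true | i'.+2, j'.+2 => i' != j' | _, _ => false end.
have [|f [hf Hf]] := @simultaneous _ _ _ _ He U r M.+2.
  case=> [|[|i]] [|[|j]] //= iM jM; rewrite ?ltnS in iM jM; move=> rij; split=> //.
  - exact: EZT.
  - exact: ERT.
  - exact: ETT.
have [S CS] := shape_ex He (fun b v => (cnt2 Z b v + cnt2 R b v)%N).
pose PZ i : cmplx A n := existT _ (U i) (f i).
pose PT i : cmplx A n := existT _ (U i.+2) (f i.+2).
have [|f0 [I0 [P0 [I1 [P1 [hf0 B]]]]]] := @biprod_ex _ A n e He S 2 PZ hf.
  by move=> b v; rewrite CS !big_ord_recl big_ord0 addn0.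
have [|f1 [I0' [P0' [I1' [P1' [hf1 B']]]]]] := @biprod_ex _ A n e He S M PT (fun i => hf i.+2).
  by move=> b v; rewrite CS C.
have Ez01 : Ez e S S f0 f1.
  by apply: biprod_Ez B B' _ => // -[|[|i]] j //= _ jM; [exact: (Hf 0%N j.+2) | exact: (Hf 1%N j.+2)].
have [|N [w0 [w1 [hw [w00 w10] Hw]]]] := biprod_section He hf0 hf1 B (isT : (0 < 2)%N).
  by case=> [|[|j]] // _ _; split; apply: Hf.
have /choice [x Hx] : forall i : 'I_M, exists x : nat * (nat -> 'M[A]_(z0 S)) * (nat -> 'M[A]_(z1 S)),
  [/\ forall j, hom e (y0 S) (y0 S) (x.1.2 j) /\ hom e (y1 S) (y1 S) (x.2 j),
      psum x.1.1 x.1.2 0 = I0' i *m P0' i /\ psum x.1.1 x.2 0 = I1' i *m P1' i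
    & forall c, psum x.1.1 x.1.2 c *m ln f1 f0 c = ln f1 f0 c *m psum x.1.1 x.2 c].
  move=> i; have [|N' [w0' [w1' H]]] := biprod_section He hf1 hf0 B' (ltn_ord i); last by exists (N', w0', w1').
  by move=> j jM ji; split; apply: Hf; rewrite ?ltnS //= eq_sym.
(* W(0) projects onto the summand [Z] of [f0] and W(1) acts by [l i] on the summand
   [Th i] of [f1]. *)
have [s [us ss]] := distinct_scalars k M; pose l i := nth 0 s i.
pose W0 c := sc (1 - c) (psum N w0 c) + \sum_(i < M) sc (l i * c) (psum (x i).1.1 (x i).1.2 (1 - c)).
pose W1 c := sc (1 - c) (psum N w1 c) + \sum_(i < M) sc (l i * c) (psum (x i).1.1 (x i).2 (1 - c)).
have fam m (t : 'I_m -> 'I_n) (w : nat -> 'M[A]_m) (y : 'I_M -> nat -> 'M[A]_m) :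
    (forall j, hom e t t (w j)) -> (forall i j, hom e t t (y i j)) ->
    polyfam e t t (fun c => sc (1 - c) (psum N w c) + \sum_(i < M) sc (l i * c) (psum (x i).1.1 (y i) (1 - c))).
  move=> hw' hy; apply: polyfamD.
    by apply: polyfam_eq (polyfam_psum N (1 - 'X) 'X hw') => c; rewrite !hornerE.
  apply: polyfam_sum => // i.
  by apply: polyfam_eq (polyfam_psum _ (l i *: 'X) (1 - 'X) (hy i)) => c; rewrite !hornerE.
have F0 : polyfam e (y0 S) (y0 S) W0.
  by apply: fam => [j|i j]; [have [] := hw j | have [/(_ j) []] := Hx i].
have F1 : polyfam e (y1 S) (y1 S) W1.
  by apply: fam => [j|i j]; [have [] := hw j | have [/(_ j) []] := Hx i].
have hfam m (t : 'I_m -> 'I_n) (W : k -> 'M[A]_m) c : polyfam e t t W -> hom e t t (W c).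
  by case=> N' [w [hw' _ <-]]; apply: hom_psum.
have hln c : shom e S (ln f0 f1 c) by apply: hom_ln.
have chain c : W0 c *m ln f0 f1 c = ln f0 f1 c *m W1 c.
  have Hxc i : psum (x i).1.1 (x i).1.2 (1 - c) *m ln f0 f1 c = ln f0 f1 c *m psum (x i).1.1 (x i).2 (1 - c).
    by rewrite ln_sym; have [_ _] := Hx i.
  move: (Hw c) Hxc; rewrite /W0 /W1; move: (ln f0 f1 c) => L Hwc Hxc.
  rewrite mulmxDl mulmxDr scMl scMr Hwc; congr (_ + _).
  by rewrite mulmx_suml mulmx_sumr; apply: eq_bigr => i _; rewrite scMl scMr Hxc.
have [d [tau Hinf]] := pattern_ex hln (fun c => hfam _ _ _ c F0) (fun c => hfam _ _ _ c F1) chain.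
(* Two parameters [t], [u] with the same pattern make the eigensummands pairwise
   compatible. *)
have [t [[P [lamt [HP1 _ HP3]]] Ht]] := Hinf _ (Ez_open_l He hf1 hf0 hf1 Ez01).
have [u [[P' [lamu [HP1' _ HP3']]] Hu]] := Hinf _ (lopen_back (Ez_open_r He (hln t)) hf0 hf1 Ht).
pose T a := tag (P a).
have ET a b : (a < d)%N -> (b < d)%N -> E0 e (T a) (T b).
  move=> ad bd; have [ha [ra] _] := HP1 a ad; have [hb [rb] _] := HP1' b bd.
  apply: (E0_cnt He (S := tag (P a)) (T := tag (P' b))) => // [b' v|].
    by rewrite HP3 // HP3'.
  by exists (tagged (P a)), (tagged (P' b)); split=> //; apply: (Ez_retr_l He ra); apply: (Ez_retr_r He rb).
have tpos a : (a < d)%N -> exists b v, (0 < tau a b v)%N.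
  move=> ad; have [_ _ /shp_gt0 [b [v H]]] := HP1 a ad; exists b, v.
  by rewrite -(HP3 a b v ad).
have closed c := pattern_closed_fam F0 F1 tpos (infinW (fun c (H : has_pattern _ _ _ _ _) =>
  let: ex_intro _ (ex_intro lam (And3 _ h _)) := H in ex_intro _ lam h) Hinf) c.
have W00 : W0 0 = I0 0%N *m P0 0%N.
  rewrite /W0 subr0 sc1 w00 big1 ?addr0 // => i _; by rewrite mulr0 sc0.
have W10 : W1 0 = I1 0%N *m P1 0%N.
  rewrite /W1 subr0 sc1 w10 big1 ?addr0 // => i _; by rewrite mulr0 sc0.
have W01 : W0 1 = \sum_(i < M) sc (l i) (I0' i *m P0' i).
  rewrite /W0 subrr sc0 add0r; apply: eq_bigr => i _; rewrite mulr1.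
  by have [_ [-> _] _] := Hx i.
have W11 : W1 1 = \sum_(i < M) sc (l i) (I1' i *m P1' i).
  rewrite /W1 subrr sc0 add0r; apply: eq_bigr => i _; rewrite mulr1.
  by have [_ [_ ->] _] := Hx i.
have [lam1 H1] := closed 1; have [lam0 H0] := closed 0.
have RM1 b v y : (\sum_(a < d | lam1 a == y) tau a b v = \sum_(i < M | l i == y) cnt2 (Th i) b v)%N.
  apply: (@root_mult k d lam1 (fun a => tau a b v) M l (fun i => cnt2 (Th i) b v)) => z.
  by rewrite -H1 W01 W11 (biprod_projections He l b v z B').
have lamE a : (a < d)%N -> exists2 i, (i < M)%N & lam1 a = l i.
  move=> ad; apply: contrapT => H; have [b [v]] := tpos a ad.
  have := RM1 b v (lam1 a); rewrite [RHS]big_pred0 => [|i].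
    by rewrite (bigD1 (Ordinal ad)) //=; lia.
  by apply/negP => /eqP E; apply: H; exists i.
have RM1' i b v : (i < M)%N -> (\sum_(a < d | lam1 a == l i) tau a b v = cnt2 (Th i) b v)%N.
  move=> iM; rewrite RM1 (bigD1 (Ordinal iM)) //= big1 ?addn0 // => j /andP [/eqP E].
  by rewrite -val_eqE /= => /eqP; case; apply/eqP; rewrite -(nth_uniq 0 _ _ us) ?ss //; apply/eqP.
(* [Th i] is a sum of patterns [tau a]; by indecomposability, of exactly one. *)
have tauE a i : (a < d)%N -> (i < M)%N -> lam1 a = l i -> forall b v, tau a b v = cnt2 (Th i) b v.
  move=> ad iM E.
  have [T' CT'] := shape_ex He (fun b v => \sum_(j < d | (lam1 j == l i) && (j != Ordinal ad)) tau j b v)%N.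
  have Csum b v : cnt2 (Th i) b v = (cnt2 (T a) b v + cnt2 T' b v)%N.
    by rewrite -RM1' // (bigD1 (Ordinal ad)) ?E //= CT' HP3.
  have [T0|Tpos] := posnP (z0 T' + z1 T')%N.
    move=> b v; rewrite Csum HP3 // [X in (_ + X)%N](_ : _ = 0%N) ?addn0 //.
    move: T0; rewrite size_shp => /eqP; rewrite sum_nat_eq0 => /forallP/(_ b)/=; rewrite sum_nat_eq0.
    by move=> /forallP/(_ v)/eqP.
  have [_ _ Tapos] := HP1 a ad; exfalso.
  (* Indices with another eigenvalue, and [a] itself, are replaced by the empty shape, so that the
     complement is a sum over all of ['I_d]. *)
  pose T'' j := if (lam1 j == l i) && (j != a) then T j else Shp (fun j : 'I_0 => False_rect 'I_n (notF (ltn_ord j))) (fun j : 'I_0 => False_rect 'I_n (notF (ltn_ord j))).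
  have Cempty b v : cnt2 (Shp (fun j : 'I_0 => False_rect 'I_n (notF (ltn_ord j))) (fun j : 'I_0 => False_rect 'I_n (notF (ltn_ord j)))) b v = 0%N.
    by rewrite /cnt2; case: b; rewrite /cnt big_ord0.
  have CT'' b v : cnt2 T' b v = (\sum_(j < d) cnt2 (T'' j) b v)%N.
    rewrite CT' big_mkcond; apply: eq_bigr => j _; rewrite /T'' -val_eqE /=.
    by case: ifP => _; rewrite ?Cempty // HP3.
  apply: (gindec_nosplit He (GT iM) Csum) => //.
    apply: (E0_sum He (M := 1) (S' := fun _ => T a) _ CT'') => [b v|j j' _ jd]; first by rewrite big_ord1.
    rewrite /T''; case: ifP => _; first exact: ET.
    by apply: (E0_sum He (M := 1) (S' := fun _ => T a) (M' := 0) (T' := fun _ => T a)) => // b v; rewrite ?big_ord1 ?big_ord0 ?Cempty.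
  apply: (E0_sum He (M' := 1) (T' := fun _ => T a) CT'') => [b v|j j' jd _]; first by rewrite big_ord1.
  rewrite /T''; case: ifP => _; first exact: ET.
  by apply: (E0_sum He (M := 0) (S' := fun _ => T a) (M' := 1) (T' := fun _ => T a)) => // b v; rewrite ?big_ord1 ?big_ord0 ?Cempty.
have /choice [io Hio] : forall a, exists i, (a < d)%N -> (i < M)%N /\ forall b v, tau a b v = cnt2 (Th i) b v.
  move=> a; case: (ltnP a d) => ad; last by exists 0%N.
  by have [i iM E] := lamE a ad; exists i => _; split=> //; apply: tauE.
(* At parameter 0 the family is 1 on the summand [Z] and 0 on [R], so the patterns of eigenvalue 1
   add up to the shape of [Z]. *)
exists d, io, (fun a => lam0 a == 1%R); split=> [a /Hio []//|b v].
pose l0 (i : nat) : k := if i == 0%N then 1 else 0.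
have S0 : \sum_(i < 2) sc (l0 i) (I0 i *m P0 i) = W0 0 by rewrite W00 !big_ord_recl big_ord0 /l0 /= sc1 sc0 !addr0.
have S1 : \sum_(i < 2) sc (l0 i) (I1 i *m P1 i) = W1 0 by rewrite W10 !big_ord_recl big_ord0 /l0 /= sc1 sc0 !addr0.
have RM0 : (\sum_(a < d | lam0 a == 1%R) tau a b v = \sum_(i < 2 | l0 i == 1%R) cnt2 (U i) b v)%N.
  apply: (@root_mult k d lam0 (fun a => tau a b v) 2 l0 (fun i => cnt2 (U i) b v)) => y.
  by rewrite -H0 -S0 -S1 (biprod_projections He l0 b v y B).
rewrite (eq_bigr (fun a : 'I_d => tau a b v)) => [|a _]; last by have [_ ->] := Hio a (ltn_ord a).
by rewrite RM0 big_mkcond !big_ord_recl big_ord0 /l0 /= eqxx eq_sym oner_eq0 !addn0.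
Qed.
End Summands.

(* [part b (th 0 v)] is the multiplicity of [P(v)] in [P1seq th] if [b], in [P0seq th]
   otherwise. *)
Definition part (b : bool) (z : int) : nat :=
  if b then (if z <= 0 then absz z else 0%N) else (if 0 <= z then absz z else 0%N).

Lemma partB (z : int) : (part false z)%:Z - (part true z)%:Z = z.
Proof. by rewrite /part; case: lerP => ?; case: lerP => ?; lia. Qed.
Lemma part_gt0 b (z : int) : (0 < part b z)%N = if b then z < 0 else 0 < z.
Proof. by case: b; case: z => [[|m]|m]. Qed.
Lemma part_add b (x y : int) : (0 <= x) && (0 <= y) || (x <= 0) && (y <= 0) -> part b (x + y) = (part b x + part b y)%N.
Proof. by rewrite /part; case: b => H; do ?[case: lerP => ?]; lia. Qed.

Lemma part_sum (J : eqType) (s : seq J) (z : J -> int) b :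
  (forall i j, i \in s -> j \in s -> ~ (z i < 0 /\ 0 < z j)) ->
  (\sum_(i <- s) part b (z i) = part b (\sum_(i <- s) z i))%N.
Proof.
move=> H.
have [all_ge|/allPn [j js]] := boolP (all (fun i => 0 <= z i) s).
  have: (\sum_(i <- s) part b (z i) = part b (\sum_(i <- s) z i))%N /\ 0 <= \sum_(i <- s) z i.
    elim: s {H} all_ge => [|i s IH] /=; first by rewrite !big_nil; case: b.
    by rewrite !big_cons; case/andP=> zi /IH [-> s0]; rewrite part_add ?zi ?s0 // addr_ge0.
  by case.
rewrite -ltNge => zj; have: all (fun i => z i <= 0) s.
  by apply/allP => i si; rewrite leNgt; apply/negP => zi; apply: (H j i js si).
move=> all_le; have: (\sum_(i <- s) part b (z i) = part b (\sum_(i <- s) z i))%N /\ \sum_(i <- s) z i <= 0.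
  elim: s {H js} all_le => [|i s IH] /=; first by rewrite !big_nil; case: b.
  by rewrite !big_cons; case/andP=> zi /IH [-> s0]; rewrite part_add ?zi ?s0 ?orbT //; split=> //; rewrite -oppr_ge0 opprD addr_ge0 ?oppr_ge0.
by case.
Qed.

(** * From shapes to classes in K_0 *)

Section ClassShape.
Variable n : nat.
Implicit Types (th : 'rV[int]_n) (v : 'I_n).

Definition shT th : shp n := Shp (tnth (in_tuple (P1seq th))) (tnth (in_tuple (P0seq th))).

Lemma cnt_tnth (s : seq 'I_n) v : cnt (tnth (in_tuple s)) v = count_mem v s.
Proof.
rewrite /cnt -sum1_count [RHS]big_mkcond [RHS]big_tnth; apply: eq_bigr => i _.
by rewrite /=; case: (_ == v).
Qed.

Lemma cnt2_shT th b v : cnt2 (shT th) b v = part b (th 0 v).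
Proof.
have fl (c : 'I_n -> nat) : count_mem v (flatten [seq nseq (c i) i | i <- enum 'I_n]) = c v.
  rewrite count_flatten -map_comp sumnE big_map big_enum (bigD1 v) //= count_nseq /= eqxx mul1n.
  by rewrite big1 ?addn0 // => i /negPf iv; rewrite count_nseq /= iv mul0n.
by rewrite /cnt2 /part; case: b; rewrite cnt_tnth fl.
Qed.

Lemma cls_cnt2 (S : shp n) v : cls S 0 v = (cnt2 S false v)%:Z - (cnt2 S true v)%:Z.
Proof. by rewrite /cls mxE /cnt2 /cnt !raddf_sum. Qed.

Lemma cls_shT th : cls (shT th) = th.
Proof. by apply/rowP => v; rewrite cls_cnt2 !cnt2_shT partB. Qed.

End ClassShape.

Section ClassCompat.
Variables (k : closedFieldType) (A : falgType k) (n : nat) (e : 'I_n -> A).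
Hypothesis He : complete_projectives e.

Lemma Res_disjoint v m p (s : 'I_m -> 'I_n) (t : 'I_p -> 'I_n) (x : 'M[A]_(m, p)) :
  ~ (0 < cnt s v /\ 0 < cnt t v)%N -> Res He v s t x = 0.
Proof.
move=> H; apply/matrixP => i j; rewrite !mxE; case: ifP => // /andP [si tj]; case: H.
by rewrite /cnt (bigD1 i) //= si (bigD1 j) //= tj.
Qed.

(** The elementary map that is the identity of P(v) has residue 1, while g a + b f has residue 0 at
    [v]: neither complex has P(v) in both degrees, so the residues of [f] and [g] vanish. *)
Lemma Ez_disjoint S T (f : mor A S) (g : mor A T) v : shom e S f -> shom e T g -> Ez e S T f g ->
  ~ (0 < cnt (y0 S) v /\ 0 < cnt (y1 S) v)%N -> ~ (0 < cnt (y0 T) v /\ 0 < cnt (y1 T) v)%N ->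
  ~ (0 < cnt (y1 S) v /\ 0 < cnt (y0 T) v)%N.
Proof.
move=> hf hg H rS rT [pS pT].
have ex m (s : 'I_m -> 'I_n) : (0 < cnt s v)%N -> exists i, s i = v.
  move=> H'; apply: contrapT => N; move: H'; rewrite /cnt big1 // => i _.
  by apply/eqP; rewrite eqb0; apply/eqP => si; apply: N; exists i.
have [i si] := ex _ _ pS; have [j tj] := ex _ _ pT.
pose h : 'M[A]_(z0 T, z1 S) := \matrix_(j', i') if (j' == j) && (i' == i) then e v else 0.
have ee : e v * e v = e v by case: He => /(_ v) [].
have hh : hom e (y0 T) (y1 S) h.
  apply: homI; apply/matrixP => j' i'; rewrite ?Epr_l ?Epr_r !mxE; case: ifP => //;
    rewrite ?mulr0 ?mul0r // => /andP [/eqP jE /eqP iE]; by rewrite ?jE ?iE ?si ?tj.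
have [a [b [ha hb E]]] := H h hh.
have : Res He v (y0 T) (y1 S) h = 0.
  rewrite E ResD (ResM He v _ _ hg) (ResM He v _ _ hb) (Res_disjoint _ rT) (Res_disjoint _ rS).
  by rewrite mul0mx mulmx0 addr0.
move/matrixP/(_ j i)/eqP; rewrite !mxE si tj !eqxx /= eps_e; exact/negP/oner_neq0.
Qed.

Lemma E0_sign (x y : 'rV[int]_n) v : E0 e (shT x) (shT y) -> ~ (x 0 v < 0 /\ 0 < y 0 v).
Proof.
move=> [f [g [hf hg H]]] [xv yv]; apply: (Ez_disjoint hf hg H (v := v)).
- rewrite -[cnt (y0 _) v]/(cnt2 _ false v) -[cnt (y1 _) v]/(cnt2 _ true v) !cnt2_shT !part_gt0 => -[a b].
  by have := lt_trans a b; rewrite ltxx.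
- rewrite -[cnt (y0 _) v]/(cnt2 _ false v) -[cnt (y1 _) v]/(cnt2 _ true v) !cnt2_shT !part_gt0 => -[a b].
  by have := lt_trans a b; rewrite ltxx.
by rewrite -[cnt (y0 _) v]/(cnt2 _ false v) -[cnt (y1 _) v]/(cnt2 _ true v) !cnt2_shT !part_gt0.
Qed.

Lemma cnt2_sum (s : seq 'rV[int]_n) b v : (forall x y, x \in s -> y \in s -> E0 e (shT x) (shT y)) ->
  cnt2 (shT (\sum_(x <- s) x)) b v = (\sum_(x <- s) cnt2 (shT x) b v)%N.
Proof.
move=> H; rewrite cnt2_shT summxE -part_sum; first by apply: eq_bigr => x _; rewrite cnt2_shT.
by move=> x y xs ys; apply: (E0_sign (v := v)); apply: H.
Qed.

(** Compatibility excludes opposite signs, so no cancellation occurs and the equality of classes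
    becomes the equality of shapes that [summands] takes as input. *)
Lemma class_summands (ze rho : 'rV[int]_n) (ths : seq 'rV[int]_n) m :
  ze + rho = (\sum_(x <- ths) x) *+ m ->
  E0 e (shT ze) (shT rho) -> E0 e (shT rho) (shT ze) ->
  (forall x, x \in ths -> E0 e (shT ze) (shT x)) -> (forall x, x \in ths -> E0 e (shT rho) (shT x)) ->
  (forall x y, x \in ths -> y \in ths -> E0 e (shT x) (shT y)) ->
  (forall x, x \in ths -> gindec e (shT x)) ->
  exists c : nat -> nat, ze = \sum_(i < size ths) nth 0 ths i *+ c i.
Proof.
move=> Esum EZR ERZ EZT ERT ETT GT.
have [s0|sgt] := posnP (size ths).
  exists (fun _ => 0%N); rewrite s0 big_ord0; apply/rowP => v; rewrite mxE.
  have : ze + rho = 0 by rewrite Esum (size0nil s0) big_nil mul0rn.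
  move/rowP/(_ v); rewrite !mxE => E; have H1 := E0_sign (v := v) EZR; have H2 := E0_sign (v := v) ERZ.
  move: (ze 0 v) (rho 0 v) E H1 H2 => a b; lia.
(* Reducing indices modulo the length lists every member of [ths] exactly [m] times below [M]. *)
pose Th i := shT (nth 0 ths (i %% size ths)).
have mem i : nth 0 ths (i %% size ths) \in ths by rewrite mem_nth // ltn_mod.
pose M := (m * size ths)%N.
have sumM (V : nmodType) (F : nat -> V) : \sum_(i < M) F (i %% size ths)%N = (\sum_(i < size ths) F i) *+ m.
  rewrite /M; elim: m {Esum M} => [|m' IH]; first by rewrite big_ord0 mulr0n.
  rewrite mulSn big_split_ord /= mulrS; congr (_ + _).
    by apply: eq_bigr => i _; rewrite modn_small.
  by rewrite -IH; apply: eq_bigr => i _; rewrite modnDl.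
have C b v : (cnt2 (shT ze) b v + cnt2 (shT rho) b v = \sum_(i < M) cnt2 (Th i) b v)%N.
  transitivity (part b (\sum_(i < M) nth 0 ths (i %% size ths) 0 v)).
    rewrite (sumM _ (fun i => nth 0 ths i 0 v)).
    have -> : (\sum_(i < size ths) nth 0 ths i 0 v) *+ m = ze 0 v + rho 0 v.
      by have /rowP/(_ v) := Esum; rewrite mxE => ->; rewrite mulmxnE summxE [in RHS](big_nth 0) big_mkord.
    have := @part_sum bool [:: true; false] (fun i => if i then ze 0 v else rho 0 v) b.
    rewrite !big_cons !big_nil !addr0 addn0 -!cnt2_shT; apply=> -[] [] _ _ /=.
    - lia.
    - exact: (E0_sign (v := v)).
    - exact: (E0_sign (v := v)).
    - lia.
  rewrite -(big_mkord predT (fun i => nth 0 ths (i %% size ths) 0 v)) -part_sum.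
    by rewrite big_mkord; apply: eq_bigr => i _; rewrite cnt2_shT.
  by move=> i j _ _; apply: (E0_sign (v := v)); apply: ETT.
have [d [io [B [_ H]]]] := summands He C EZR ERZ (fun i _ => EZT _ (mem i)) (fun i _ => ERT _ (mem i))
  (fun i j _ _ _ => ETT _ _ (mem i) (mem j)) (fun i _ => GT _ (mem i)).
exists (fun i => \sum_(a < d | B a) (io a %% size ths == i))%N.
transitivity (\sum_(a < d | B a) nth 0 ths (io a %% size ths)).
  have PS (F : 'I_d -> nat) : (\sum_(a < d | B a) F a)%N%:Z = \sum_(a < d | B a) (F a)%:Z by rewrite raddf_sum.
  apply/rowP => v; rewrite -{1}(cls_shT ze) cls_cnt2 !H !PS summxE -sumrB; apply: eq_bigr => a _.
  by rewrite -cls_cnt2 cls_shT.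
under [RHS]eq_bigr => i _ do rewrite -sumrMnr.
rewrite exchange_big; apply: eq_bigr => a _.
have lt : (io a %% size ths < size ths)%N by rewrite ltn_mod.
rewrite (bigD1 (Ordinal lt)) //= eqxx mulr1n big1 ?addr0 // => i.
by rewrite -val_eqE /= eq_sym => /negPf ->; rewrite mulr0n.
Qed.
End ClassCompat.

(** * Translation between encoded complexes and matrices over the algebra *)

Section Interface.
Variables (k : closedFieldType) (A : falgType k) (n : nat) (e : 'I_n -> A).
Hypothesis He : complete_projectives e.

Definition toM m p (x : pmat A) : 'M[A]_(m, p) := \matrix_(i, j) x i j.
Definition ofM m p (M : 'M[A]_(m, p)) : pmat A := fun u t =>
  if insub u is Some i then (if insub t is Some j then M i j else 0) else 0.

Lemma ofME m p (M : 'M[A]_(m, p)) (i : 'I_m) (j : 'I_p) : ofM M i j = M i j.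
Proof. by rewrite /ofM !valK. Qed.
Lemma ofM_out m p (M : 'M[A]_(m, p)) u t : ~~ ((u < m) && (t < p))%N -> ofM M u t = 0.
Proof.
rewrite negb_and /ofM => /orP [H|H]; first by rewrite insubF //; apply: negbTE.
by case: insub => // i; rewrite insubF //; apply: negbTE.
Qed.
Lemma ofMK m p (M : 'M[A]_(m, p)) : toM m p (ofM M) = M.
Proof. by apply/matrixP => i j; rewrite mxE ofME. Qed.

Definition rep (s : seq 'I_n) m (t : 'I_m -> 'I_n) := size s = m /\ forall i : 'I_m, ee e s i = e (t i).

Lemma rep_tnth s : rep s (tnth (in_tuple s)).
Proof.
split=> // i; rewrite /ee (nth_map (tnth (in_tuple s) i)) //; congr e.
by rewrite [RHS](tnth_nth (tnth (in_tuple s) i)).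
Qed.
Lemma rep_codom m (t : 'I_m -> 'I_n) : rep [tuple t i | i < m] t.
Proof.
split; first by rewrite size_tuple.
move=> i; rewrite /ee (nth_map (t i)) ?size_tuple // -(tnth_nth (t i) [tuple t i | i < m]).
by rewrite tnth_mktuple.
Qed.
Lemma ee_out (s : seq 'I_n) u : (size s <= u)%N -> ee e s u = 0.
Proof. by move=> H; rewrite /ee nth_default // size_map. Qed.
Lemma rep_cat s m (t : 'I_m -> 'I_n) s' m' (t' : 'I_m' -> 'I_n) : rep s t -> rep s' t' -> rep (s ++ s') (fsum t t').
Proof.
move=> [s1 s2] [s1' s2']; split; first by rewrite size_cat s1 s1'.
move=> i; rewrite /ee map_cat nth_cat size_map s1 /fsum; case: splitP => j E.
  by rewrite -s2 E.
by rewrite -s2' E addKn.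
Qed.

Section Pair.
Variables (r s : seq 'I_n) (m p : nat) (t : 'I_m -> 'I_n) (t' : 'I_p -> 'I_n).
Hypotheses (Hr : rep r t) (Hs : rep s t').
Lemma is_mor_out x u v : is_mor e r s x -> ~~ ((u < m) && (v < p))%N -> x u v = 0.
Proof.
move=> hx; rewrite negb_and -!leqNgt => /orP [H|H]; rewrite hx.
  by rewrite ee_out ?mul0r // (proj1 Hr).
by rewrite [ee e s v]ee_out ?mulr0 // (proj1 Hs).
Qed.
Lemma is_mor_hom x : is_mor e r s x -> hom e t t' (toM m p x).
Proof.
by move=> hx; apply/matrixP => i j; rewrite Epr_r Epr_l !mxE [RHS]hx (proj2 Hr) (proj2 Hs).
Qed.
Lemma hom_is_mor M : hom e t t' M -> is_mor e r s (ofM M).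
Proof.
move=> hM u v; have [/andP [um vp]|out] := boolP ((u < m) && (v < p))%N; last first.
  by rewrite ofM_out // mulr0 mul0r.
rewrite (ofME M (Ordinal um) (Ordinal vp)) -[u]/(val (Ordinal um)) -[v]/(val (Ordinal vp)).
by rewrite (proj2 Hr) (proj2 Hs) -{1}hM Epr_r Epr_l.
Qed.
Lemma toMK x : is_mor e r s x -> ofM (toM m p x) = x.
Proof.
move=> hx; apply: funext => u; apply: funext => v.
have [/andP [um vp]|out] := boolP ((u < m) && (v < p))%N; last by rewrite ofM_out // (is_mor_out hx).
by rewrite (ofME _ (Ordinal um) (Ordinal vp)) mxE.
Qed.
End Pair.

Lemma toM_comp m p q x y : toM m p (Defs.comp q x y) = toM m q x *m toM q p y.
Proof. by apply/matrixP => i j; rewrite !mxE; apply: eq_bigr => l _; rewrite !mxE. Qed.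
Lemma is_mor_comp r s t q x y : size s = q -> is_mor e r s x -> is_mor e s t y -> is_mor e r t (Defs.comp q x y).
Proof.
move=> sq hx hy u v; rewrite /Defs.comp mulr_sumr mulr_suml; apply: eq_bigr => j _.
have ei a (w : seq 'I_n) : ee e w a * ee e w a = ee e w a.
  rewrite /ee; case: (ltnP a (size w)) => aw; last by rewrite nth_default ?size_map // mul0r.
  rewrite (nth_map (tnth (in_tuple w) (Ordinal aw))) //.
  by case: He => /(_ (nth (tnth (in_tuple w) (Ordinal aw)) w a)) [].
by rewrite (hx u j) (hy j v) !mulrA ei -!mulrA ei.
Qed.

Lemma toM_eq r s m p (t : 'I_m -> 'I_n) (t' : 'I_p -> 'I_n) x y : rep r t -> rep s t' ->
  is_mor e r s x -> is_mor e r s y -> toM m p x = toM m p y -> x = y.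
Proof. by move=> Hr Hs hx hy E; rewrite -(toMK Hr Hs hx) E (toMK Hr Hs hy). Qed.

Definition crep (P : cplx n A) (S : shp n) (f : mor A S) :=
  [/\ rep (c1 P) (y1 S), rep (c0 P) (y0 S), valid_cplx e P & toM (z0 S) (z1 S) (cd P) = f].

Lemma crep_hom P S f : @crep P S f -> shom e S f.
Proof. by case=> h1 h0 hv <-; apply: is_mor_hom hv. Qed.

Lemma crep_ex P : valid_cplx e P -> exists S f, @crep P S f.
Proof.
move=> hv; exists (Shp (tnth (in_tuple (c1 P))) (tnth (in_tuple (c0 P)))), (toM _ _ (cd P)).
by split=> //; apply: rep_tnth.
Qed.

Lemma is_mor_add r s x y : is_mor e r s x -> is_mor e r s y -> is_mor e r s (padd x y).
Proof. by move=> hx hy u v; rewrite /padd mulrDr mulrDl -hx -hy. Qed.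

Lemma hom_shift_zeroP P S f Q T g : @crep P S f -> @crep Q T g -> hom_shift_zero e P Q <-> Ez e S T f g.
Proof.
move=> [P1 P0 vP <-] [Q1 Q0 vQ <-]; split=> [H h hh|H h hh].
  have [a [b [ha [hb E]]]] := H _ (hom_is_mor Q0 P1 hh).
  exists (toM (z1 T) (z1 S) a), (toM (z0 T) (z0 S) b); split.
  - exact: (is_mor_hom Q1 P1 ha).
  - exact: (is_mor_hom Q0 P0 hb).
  - apply/matrixP => i j; rewrite -ofME E /padd /Defs.comp !mxE (proj1 Q1) (proj1 P0).
    by congr (_ + _); apply: eq_bigr => l _; rewrite !mxE.
have [a [b [ha hb E]]] := H _ (is_mor_hom Q0 P1 hh).
exists (ofM a), (ofM b); split; first exact: (hom_is_mor Q1 P1 ha).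
split; first exact: (hom_is_mor Q0 P0 hb).
move=> u v; move: u v; suff -> : h = padd (Defs.comp (size (c1 Q)) (cd Q) (ofM a)) (Defs.comp (size (c0 P)) (ofM b) (cd P)) by [].
apply: (toM_eq Q0 P1 hh).
  apply: is_mor_add; [apply: is_mor_comp vQ _ => //|apply: is_mor_comp _ vP => //].
    exact: (hom_is_mor Q1 P1 ha).
  exact: (hom_is_mor Q0 P0 hb).
rewrite E; have -> x y : toM (z0 T) (z1 S) (padd x y) = toM _ _ x + toM _ _ y by apply/matrixP => i j; rewrite !mxE.
by rewrite !toM_comp (proj1 Q1) (proj1 P0) !ofMK.
Qed.

Lemma null_homotopicP P S f Q T g u1 u0 : @crep P S f -> @crep Q T g -> null_homotopic e P Q u1 u0 ->
  exists h : 'M[A]_(z1 T, z0 S), [/\ hom e (y1 T) (y0 S) h, toM _ _ u0 = g *m h & toM _ _ u1 = h *m f].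
Proof.
move=> [P1 P0 vP <-] [Q1 Q0 vQ <-] [h [hh [E0 E1]]]; exists (toM (z1 T) (z0 S) h); split.
- exact: (is_mor_hom Q1 P0 hh).
- by rewrite -toM_comp -(proj1 Q1); apply/matrixP => i j; rewrite !mxE E0.
- by rewrite -toM_comp -(proj1 P0); apply/matrixP => i j; rewrite !mxE E1.
Qed.

Lemma toM_pid s m (t : 'I_m -> 'I_n) : rep s t -> toM m m (pid e s) = Epr e t.
Proof.
move=> [_ Hs]; apply/matrixP => i j; rewrite EprE mxE /pid -val_eqE /=.
by case: eqP => _; rewrite ?mulr1n ?mulr0n // Hs.
Qed.

Definition hequiv S (f : mor A S) T (g : mor A T) := exists u0 u1 v0 v1,
  [/\ [/\ hom e (y0 T) (y0 S) u0, hom e (y1 T) (y1 S) u1, hom e (y0 S) (y0 T) v0 & hom e (y1 S) (y1 T) v1],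
   u0 *m f = g *m u1, v0 *m g = f *m v1,
   exists2 h, hom e (y1 S) (y0 S) h & v0 *m u0 - Epr e (y0 S) = f *m h /\ v1 *m u1 - Epr e (y1 S) = h *m f
   & exists2 h, hom e (y1 T) (y0 T) h & u0 *m v0 - Epr e (y0 T) = g *m h /\ u1 *m v1 - Epr e (y1 T) = h *m g].

Lemma kiso_hequiv P S f Q T g : @crep P S f -> @crep Q T g -> kiso e P Q -> hequiv f g.
Proof.
move=> RP RQ; case: (RP) (RQ) => P1 P0 vP Ef [Q1 Q0 vQ Eg].
case=> u1 [u0 [v1 [v0 [[hu1 [hu0 Eu]] [[hv1 [hv0 Ev]] [N1 N2]]]]]].
have toMB m p x y : toM m p (psub x y) = toM _ _ x - toM _ _ y by apply/matrixP => i j; rewrite !mxE.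
exists (toM (z0 T) (z0 S) u0), (toM (z1 T) (z1 S) u1), (toM (z0 S) (z0 T) v0), (toM (z1 S) (z1 T) v1); split.
- split; [exact: (is_mor_hom Q0 P0 hu0)|exact: (is_mor_hom Q1 P1 hu1)|exact: (is_mor_hom P0 Q0 hv0)|exact: (is_mor_hom P1 Q1 hv1)].
- by rewrite -Ef -Eg -!toM_comp -(proj1 P0) -(proj1 Q1); apply/matrixP => i j; rewrite !mxE Eu.
- by rewrite -Ef -Eg -!toM_comp -(proj1 P1) -(proj1 Q0); apply/matrixP => i j; rewrite !mxE Ev.
- have [h [hh E0 E1]] := null_homotopicP RP RP N1; exists h => //.
  by rewrite -E0 -E1 !toMB !toM_comp (toM_pid P0) (toM_pid P1) (proj1 Q0) (proj1 Q1).
- have [h [hh E0 E1]] := null_homotopicP RQ RQ N2; exists h => //.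
  by rewrite -E0 -E1 !toMB !toM_comp (toM_pid Q0) (toM_pid Q1) (proj1 P0) (proj1 P1).
Qed.

Lemma iso_kiso P S f Q T g u0 u1 v0 v1 : @crep P S f -> @crep Q T g ->
  hom e (y0 T) (y0 S) u0 -> hom e (y1 T) (y1 S) u1 -> hom e (y0 S) (y0 T) v0 -> hom e (y1 S) (y1 T) v1 ->
  u0 *m f = g *m u1 -> v0 *m g = f *m v1 -> v0 *m u0 = Epr e (y0 S) -> v1 *m u1 = Epr e (y1 S) ->
  u0 *m v0 = Epr e (y0 T) -> u1 *m v1 = Epr e (y1 T) -> kiso e P Q.
Proof.
move=> RP RQ hu0 hu1 hv0 hv1 Eu Ev vu0 vu1 uv0 uv1.
case: (RP) (RQ) => P1 P0 vP Ef [Q1 Q0 vQ Eg].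
have mu0 := hom_is_mor Q0 P0 hu0; have mu1 := hom_is_mor Q1 P1 hu1.
have mv0 := hom_is_mor P0 Q0 hv0; have mv1 := hom_is_mor P1 Q1 hv1.
have eqp s m (t : 'I_m -> 'I_n) x (M : 'M[A]_m) : rep s t -> is_mor e s s x -> toM m m x = Epr e t -> psub x (pid e s) = fun _ _ => 0.
  move=> Hs hx E; apply: funext => u; apply: funext => v; rewrite /psub.
  suff -> : x = pid e s by rewrite subrr.
  have pm : is_mor e s s (pid e s).
    move=> a b; rewrite /pid; case: eqP => [->|_]; last by rewrite mulr0 mul0r.
    have [bs|bs] := ltnP b m; last by rewrite ee_out ?mul0r // (proj1 Hs).
    by rewrite -[b]/(val (Ordinal bs)) (proj2 Hs); case: He => /(_ (t (Ordinal bs))) [ii _] _; rewrite !ii.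
  by apply: (toM_eq Hs Hs hx pm); rewrite E (toM_pid Hs).
have mM r s m p (t : 'I_m -> 'I_n) (t' : 'I_p -> 'I_n) (x : 'M[A]_(m, p)) : rep r t -> rep s t' -> hom e t t' x -> is_mor e r s (ofM x).
  by move=> hr hs hx; apply: hom_is_mor hx.
have null B : null_homotopic e B B (fun _ _ => 0) (fun _ _ => 0).
  exists (fun _ _ => 0); split; first by move=> u v; rewrite mulr0 mul0r.
  by split=> u v; rewrite /Defs.comp big1 // => j _; rewrite ?mulr0 ?mul0r.
have chain B V h1 B' V' h1' (x0 : 'M[A]_(z0 V', z0 V)) x1 : @crep B V h1 -> @crep B' V' h1' ->
    hom e (y0 V') (y0 V) x0 -> hom e (y1 V') (y1 V) x1 -> x0 *m h1 = h1' *m x1 ->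
    chain_map e B B' (ofM x1) (ofM x0).
  move=> [B1 B0 vB EB] [B1' B0' vB' EB'] hx0 hx1 E; split; first exact: (mM _ _ _ _ _ _ _ B1' B1).
  split; first exact: (mM _ _ _ _ _ _ _ B0' B0).
  move=> u v; move: u v; suff -> : Defs.comp (size (c0 B)) (ofM x0) (cd B) = Defs.comp (size (c1 B')) (cd B') (ofM x1) by [].
  apply: (toM_eq B0' B1).
  - by apply: is_mor_comp vB => //; apply: (mM _ _ _ _ _ _ _ B0' B0).
  - by apply: is_mor_comp vB' _ => //; apply: (mM _ _ _ _ _ _ _ B1' B1).
  - by rewrite !toM_comp (proj1 B0) (proj1 B1') !ofMK EB EB'.
exists (ofM u1), (ofM u0), (ofM v1), (ofM v0).
split; first exact: chain RP RQ hu0 hu1 Eu.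
split; first exact: chain RQ RP hv0 hv1 Ev.
have cc s m (t : 'I_m -> 'I_n) s' m' (t' : 'I_m' -> 'I_n) x y : rep s t -> rep s' t' -> hom e t t' x -> hom e t' t y ->
    x *m y = Epr e t -> psub (Defs.comp (size s') (ofM x) (ofM y)) (pid e s) = fun _ _ => 0.
  move=> hs hs' hx hy E; apply: (eqp _ _ _ _ 0 hs).
    by apply: is_mor_comp; [|exact: (mM _ _ _ _ _ _ _ hs hs' hx)|exact: (mM _ _ _ _ _ _ _ hs' hs hy)].
  by rewrite toM_comp (proj1 hs') !ofMK.
rewrite (cc _ _ _ _ _ _ _ _ P1 Q1 hv1 hu1 vu1) (cc _ _ _ _ _ _ _ _ P0 Q0 hv0 hu0 vu0).
rewrite (cc _ _ _ _ _ _ _ _ Q1 P1 hu1 hv1 uv1) (cc _ _ _ _ _ _ _ _ Q0 P0 hu0 hv0 uv0).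
by split; apply: null.
Qed.

Lemma crep_dsum P S f Q T g : @crep P S f -> @crep Q T g ->
  @crep (dsum P Q) (Shp (fsum (y1 S) (y1 T)) (fsum (y0 S) (y0 T))) (block_mx f 0 0 g).
Proof.
move=> [P1 P0 vP <-] [Q1 Q0 vQ <-]; have R1 := rep_cat P1 Q1; have R0 := rep_cat P0 Q0.
have ltP1 i : (i < z1 S)%N = (i < size (c1 P))%N by rewrite (proj1 P1).
have ltP0 i : (i < z0 S)%N = (i < size (c0 P))%N by rewrite (proj1 P0).
split=> //.
  move=> u v; rewrite /= /bdiag /ee !map_cat !nth_cat !size_map.
  case: ifP => up; case: ifP => vp; rewrite ?mulr0 ?mul0r //.
apply/matrixP => /= i j; rewrite [LHS]mxE /= /bdiag -ltP0 -ltP1.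
case: (split_ordP i) => i' ->; case: (split_ordP j) => j' ->.
- by rewrite block_mxEul mxE.
- by rewrite block_mxEur mxE.
- by rewrite block_mxEdl mxE.
- by rewrite block_mxEdr mxE -(proj1 P0) -(proj1 P1) /= !addKn.
Qed.

Lemma crep_dsum_retr P S f Q T g : @crep P S f -> @crep Q T g ->
  inhabited (@retr _ A n e (Shp (fsum (y1 S) (y1 T)) (fsum (y0 S) (y0 T))) (block_mx f 0 0 g) S f) /\
  inhabited (@retr _ A n e (Shp (fsum (y1 S) (y1 T)) (fsum (y0 S) (y0 T))) (block_mx f 0 0 g) T g).
Proof.
move=> /crep_hom hf /crep_hom hg.
have hE m (s : 'I_m -> 'I_n) : hom e s s (Epr e s) by apply: hom_Epr.
split; split.
  exists (col_mx (Epr e (y0 S)) 0) (row_mx (Epr e (y0 S)) 0) (col_mx (Epr e (y1 S)) 0) (row_mx (Epr e (y1 S)) 0) => //=.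
  - by apply: hom_col => //; apply: hom0.
  - by apply: hom_row => //; apply: hom0.
  - by apply: hom_col => //; apply: hom0.
  - by apply: hom_row => //; apply: hom0.
  - by rewrite mul_row_col mul0mx addr0 EprK.
  - by rewrite mul_row_col mul0mx addr0 EprK.
  - by rewrite mul_col_mx mul_block_col !mul0mx !mulmx0 !addr0 (hom_l He hf) (hom_r He hf).
  - by rewrite mul_mx_row mul_row_block !mul0mx !mulmx0 !addr0 (hom_l He hf) (hom_r He hf).
exists (col_mx 0 (Epr e (y0 T))) (row_mx 0 (Epr e (y0 T))) (col_mx 0 (Epr e (y1 T))) (row_mx 0 (Epr e (y1 T))) => //=.
- by apply: hom_col => //; apply: hom0.
- by apply: hom_row => //; apply: hom0.
- by apply: hom_col => //; apply: hom0.
- by apply: hom_row => //; apply: hom0.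
- by rewrite mul_row_col mul0mx add0r EprK.
- by rewrite mul_row_col mul0mx add0r EprK.
- by rewrite mul_col_mx mul_block_col !mul0mx !mulmx0 !add0r (hom_l He hg) (hom_r He hg).
- by rewrite mul_mx_row mul_row_block !mul0mx !mulmx0 !add0r (hom_l He hg) (hom_r He hg).
Qed.

(** Going to [f] and back changes x by x h f', which is itself of the admissible form b f'. *)
Lemma Ez_hequiv_l S f S' f' T g : @hequiv S f S' f' -> Ez e S T f g -> Ez e S' T f' g.
Proof.
move=> [u0 [u1 [v0 [v1 [[hu0 hu1 hv0 hv1] Eu Ev _ [h hh [H0 H1]]]]]]] H x hx.
have [a [b [ha hb E]]] := H _ (homM He hx hu1).
exists (a *m v1), (b *m v0 - x *m h); split.
- exact: (homM He ha hv1).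
- by apply: homB; [apply: (homM He hb hv0) | apply: (homM He hx hh)].
transitivity (x *m u1 *m v1 - x *m h *m f').
  by rewrite -[x *m h *m f']mulmxA -H1 -[x *m u1 *m v1]mulmxA -mulmxBr opprB addrC subrK (hom_r He hx).
by rewrite E mulmxDl mulmxBl mulmxA -[b *m f *m v1]mulmxA -Ev !mulmxA addrA.
Qed.
Lemma Ez_hequiv_r S f T g T' g' : @hequiv T g T' g' -> Ez e S T f g -> Ez e S T' f g'.
Proof.
move=> [u0 [u1 [v0 [v1 [[hu0 hu1 hv0 hv1] Eu Ev _ [h hh [H0 H1]]]]]]] H x hx.
have [a [b [ha hb E]]] := H _ (homM He hv0 hx).
exists (u1 *m a - h *m x), (u0 *m b); split.
- by apply: homB; [apply: (homM He hu1 ha) | apply: (homM He hh hx)].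
- exact: (homM He hu0 hb).
transitivity (u0 *m (v0 *m x) - g' *m (h *m x)).
  by rewrite [g' *m _]mulmxA -H0 mulmxA -mulmxBl opprB addrC subrK (hom_l He hx).
by rewrite E mulmxDr mulmxBr !mulmxA Eu addrAC.
Qed.
End Interface.

(** * General maps and canonical decompositions *)

Section Generic.
Variables (k : closedFieldType) (A : falgType k) (n : nat) (e : 'I_n -> A).
Hypothesis He : complete_projectives e.

Lemma polyfun_line (p : pmat A -> k) (f g : pmat A) : polyfun p ->
  exists q : {poly k}, forall c, p (fun u t => f u t + c *: (g u t - f u t)) = q.[c].
Proof.
elim=> [x|u t j|p1 p2 _ [q1 H1] _ [q2 H2]|p1 p2 _ [q1 H1] _ [q2 H2]].
- by exists x%:P => c; rewrite hornerC.
- exists ((coord (vbasis fullv) j (f u t))%:P + coord (vbasis fullv) j (g u t - f u t) *: 'X) => c.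
  by rewrite !hornerE linearD linearZ /= mulrC.
- by exists (q1 + q2) => c; rewrite hornerD H1 H2.
- by exists (q1 * q2) => c; rewrite hornerM H1 H2.
Qed.

Lemma crep_Pf th f : in_Hom e th f -> crep e (Pf th f) (toM (z0 (shT th)) (z1 (shT th)) f : mor A (shT th)).
Proof. by move=> hf; split=> //; apply: rep_tnth. Qed.

Lemma in_Hom_ofM th (M : mor A (shT th)) : shom e (shT th) M -> in_Hom e th (ofM M).
Proof. by move=> hM; apply: (hom_is_mor (rep_tnth e _) (rep_tnth e _) hM). Qed.

Lemma crep_ofM th (M : mor A (shT th)) : shom e (shT th) M -> crep e (Pf th (ofM M)) M.
Proof. by move=> /in_Hom_ofM/crep_Pf; rewrite ofMK. Qed.

(** The polynomial that defines the open set is nonzero at [f1], so its restriction to any line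
    through [f1] is a nonzero polynomial in one variable. *)
Lemma general_open th (Q : pmat A -> Prop) : general e th Q ->
  exists f1, shom e (shT th) f1 /\ forall f0, shom e (shT th) f0 -> cofin (fun c => Q (ofM (ln f0 f1 c))).
Proof.
move=> [p [Hp [[f [hf pf]] HQ]]].
have R := crep_Pf hf; have hM := crep_hom R.
exists (toM (z0 (shT th)) (z1 (shT th)) f); split=> // f0 hf0.
have [q Hq] := polyfun_line (ofM f0) f Hp.
exists q.
  apply/eqP => q0; move: (Hq 1); rewrite q0 horner0 => H; move/eqP: pf; apply; rewrite -{}H; congr p.
  by apply: funext => u; apply: funext => t; rewrite scale1r addrC subrK.
move=> c; rewrite -Hq => pc; apply: HQ; first by apply: in_Hom_ofM; apply: hom_ln.
move: pc; congr (p _ != 0); apply: funext => u; apply: funext => t.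
have fE := toMK (rep_tnth e _) (rep_tnth e _) hf.
have [/andP [um tp]|out] := boolP ((u < z0 (shT th)) && (t < z1 (shT th)))%N.
  rewrite -[u]/(val (Ordinal um)) -[t]/(val (Ordinal tp)) !ofME !mxE.
  by [].
by rewrite !ofM_out // -fE ofM_out // subrr scaler0 addr0.
Qed.

Lemma E0_of_zero th : E_zero e th -> E0 e (shT th) (shT th).
Proof.
move=> [f [g [hf [hg H]]]]; have Rf := crep_Pf hf; have Rg := crep_Pf hg.
exists (toM (z0 (shT th)) (z1 (shT th)) f), (toM (z0 (shT th)) (z1 (shT th)) g).
by split; [exact: crep_hom Rf | exact: crep_hom Rg | exact: (iffLR (hom_shift_zeroP He Rf Rg) H)].
Qed.

(** A contraction h writes the identities of the two terms as -g h and -h g. With no common summand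
    in the two degrees, [g] has zero residues, so both terms are empty. *)
Lemma kiso_zero Q T g : @crep _ A n e Q T g -> (forall v, ~ (0 < cnt (y0 T) v /\ 0 < cnt (y1 T) v)%N) ->
  kiso e Q (zero_cplx A n) -> z0 T = 0%N /\ z1 T = 0%N.
Proof.
move=> RQ red HK.
pose nof (i : 'I_0) : 'I_n := False_rect _ (notF (ltn_ord i)).
have RZ : @crep _ A n e (zero_cplx A n) (Shp nof nof) 0.
  by split; [split=> // -[] | split=> // -[] | move=> u v; rewrite mulr0 mul0r | apply/matrixP => -[]].
have [u0 [u1 [v0 [v1 [_ _ _ [h hh [H0 H1]] _]]]]] := kiso_hequiv RQ RZ HK.
have hg := crep_hom RQ.
rewrite [v0]thinmx0 mul0mx sub0r in H0; rewrite [v1]thinmx0 mul0mx sub0r in H1.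
have D0 v : Dv k v (y0 T) = 0.
  rewrite -(Res_Epr He) -[Epr e _]opprK H0 -[- _]sub0r ResB Res0 (ResM He v _ _ hg) (Res_disjoint He _ (red v)).
  by rewrite mul0mx subr0.
have D1 v : Dv k v (y1 T) = 0.
  rewrite -(Res_Epr He) -[Epr e _]opprK H1 -[- _]sub0r ResB Res0 (ResM He v _ _ hh) (Res_disjoint He _ (red v)).
  by rewrite mulmx0 subr0.
have Z m (s : 'I_m -> 'I_n) : (forall v, Dv k v s = 0) -> m = 0%N.
  case: m s => // m s H; have /matrixP/(_ ord0 ord0) := H (s ord0).
  by rewrite !mxE !eqxx mulr1n => /eqP; rewrite oner_eq0.
by split; [apply: Z D0 | apply: Z D1].
Qed.

(** An idempotent chain endomorphism splits the complex; indecomposability up to homotopy makes one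
    part contractible, and a contractible part without common summands is zero. *)
Lemma kindec_sindec P S f : @crep _ A n e P S f -> (forall v, ~ (0 < cnt (y0 S) v /\ 0 < cnt (y1 S) v)%N) ->
  kindec e P -> sindec e f.
Proof.
move=> RP red [_ Hk] u0 u1 hu0 hu1 u00 u11 uf; have hf := crep_hom RP.
have [T [g [T' [g' [r [r' [[hg hg'] [r0 r0'] [r1 r1'] C0 C1]]]]]]] := complex_split He hf hu0 hu1 u00 u11 uf.
pose mk (U : shp n) (h : mor A U) : cplx n A := Cplx [tuple y1 U i | i < z1 U] [tuple y0 U i | i < z0 U] (ofM h).
have Rmk (U : shp n) (h : mor A U) : shom e U h -> crep e (mk U h) h.
  move=> hh; have R1 := rep_codom e (y1 U); have R0 := rep_codom e (y0 U).
  by split=> //; [exact: (hom_is_mor R0 R1 hh) | exact: ofMK].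
have Rg := Rmk _ _ hg; have Rg' := Rmk _ _ hg'.
have ii0 : ri0 r *m rp0 r + ri0 r' *m rp0 r' = Epr e (y0 S) by rewrite r0 r0' addrC subrK.
have ii1 : ri1 r *m rp1 r + ri1 r' *m rp1 r' = Epr e (y1 S) by rewrite r1 r1' addrC subrK.
have cross m (s : 'I_m -> 'I_n) q (t : 'I_q -> 'I_n) q' (t' : 'I_q' -> 'I_n) i p i' p' :
    hom e s t i -> hom e t s p -> hom e s t' i' -> hom e t' s p' ->
    p *m i = Epr e t -> p' *m i' = Epr e t' -> i *m p + i' *m p' = Epr e s -> p *m i' = 0.
  move=> hi hp hi' hp' pi pi' E.
  have : p *m (i *m p + i' *m p') *m i' = p *m i' by rewrite E (hom_r He hp).
  rewrite mulmxDr mulmxDl mulmxA pi (hom_l He hp) -!mulmxA pi' (hom_r He hi') => /eqP.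
  by rewrite -subr_eq0 addrK => /eqP.
have x0 := cross _ _ _ _ _ _ _ _ _ _ (ri0_hom r) (rp0_hom r) (ri0_hom r') (rp0_hom r') (rpi0 r) (rpi0 r') ii0.
have x1 := cross _ _ _ _ _ _ _ _ _ _ (ri1_hom r) (rp1_hom r) (ri1_hom r') (rp1_hom r') (rpi1 r) (rpi1 r') ii1.
have x0' := cross _ _ _ _ _ _ _ _ _ _ (ri0_hom r') (rp0_hom r') (ri0_hom r) (rp0_hom r) (rpi0 r') (rpi0 r) (etrans (addrC _ _) ii0).
have x1' := cross _ _ _ _ _ _ _ _ _ _ (ri1_hom r') (rp1_hom r') (ri1_hom r) (rp1_hom r) (rpi1 r') (rpi1 r) (etrans (addrC _ _) ii1).
have K : kiso e P (dsum (mk T g) (mk T' g')).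
  refine (@iso_kiso _ _ _ _ He P S f _ (Shp (fsum (y1 T) (y1 T')) (fsum (y0 T) (y0 T'))) (block_mx g 0 0 g') (col_mx (rp0 r) (rp0 r')) (col_mx (rp1 r) (rp1 r'))
     (row_mx (ri0 r) (ri0 r')) (row_mx (ri1 r) (ri1 r')) RP (crep_dsum Rg Rg') _ _ _ _ _ _ _ _ _ _).
  - exact: hom_col (rp0_hom r) (rp0_hom r').
  - exact: hom_col (rp1_hom r) (rp1_hom r').
  - exact: hom_row (ri0_hom r) (ri0_hom r').
  - exact: hom_row (ri1_hom r) (ri1_hom r').
  - by rewrite mul_col_mx mul_block_col !mul0mx addr0 add0r !rp_chain.
  - by rewrite mul_mx_row mul_row_block !mulmx0 addr0 add0r !ri_chain.
  - by rewrite mul_row_col.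
  - by rewrite mul_row_col.
  - by rewrite mul_col_row Epr_fsum !rpi0 x0 x0'.
  - by rewrite mul_col_row Epr_fsum !rpi1 x1 x1'.
have empty (U : shp n) (h : mor A U) (q : retr e f h) : z0 U = 0%N /\ z1 U = 0%N -> ri0 q *m rp0 q = 0 /\ ri1 q *m rp1 q = 0.
  move=> [Z0 Z1]; split; [move: (ri0 q) (rp0 q) | move: (ri1 q) (rp1 q)].
    by rewrite Z0 => x z; rewrite [x]thinmx0 mul0mx.
  by rewrite Z1 => x z; rewrite [x]thinmx0 mul0mx.
have [_ _ vg _] := Rg; have [_ _ vg' _] := Rg'.
case: (Hk _ _ vg vg' K) => KZ.
  have [|Z0 Z1] := kiso_zero Rg _ KZ.
    by move=> v [a b]; apply: (red v); rewrite C0 C1 !ltn_addr.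
  by left; rewrite -r0 -r1; apply: empty.
have [|Z0 Z1] := kiso_zero Rg' _ KZ.
  by move=> v [a b]; apply: (red v); rewrite C0 C1 !ltn_addl.
right; have [] := empty _ _ r' (conj Z0 Z1); rewrite r0' r1' => /eqP + /eqP.
by rewrite !subr_eq0 => /eqP <- /eqP <-.
Qed.

Lemma shT_reduced (th : 'rV[int]_n) v : ~ (0 < cnt (y0 (shT th)) v /\ 0 < cnt (y1 (shT th)) v)%N.
Proof.
rewrite -[cnt (y0 _) v]/(cnt2 _ false v) -[cnt (y1 _) v]/(cnt2 _ true v) !cnt2_shT !part_gt0 => -[a b].
by have := lt_trans a b; rewrite ltxx.
Qed.

Lemma indec_gindec th : indec_K0 e th -> gindec e (shT th).
Proof.
move=> Hi; have [f1 [hf1 Hf1]] := general_open Hi; split.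
  rewrite lt0n; apply/eqP => E; have [S0 S1] : z0 (shT th) = 0%N /\ z1 (shT th) = 0%N by lia.
  have [c [Hn _]] := cofin_ex (Hf1 f1 hf1); apply: Hn.
  pose nof (i : 'I_0) : 'I_n := False_rect _ (notF (ltn_ord i)).
  have RZ : @crep _ A n e (zero_cplx A n) (Shp nof nof) 0.
    by split; [split=> // -[] | split=> // -[] | move=> u v; rewrite mulr0 mul0r | apply/matrixP => -[]].
  have thin m q (x y : 'M[A]_(m, q)) : m = 0%N -> x = y by move=> m0; move: x y; rewrite m0 => x y; rewrite [x]flatmx0 [y]flatmx0.
  apply: (iso_kiso He (crep_ofM (hom_ln c hf1 hf1)) RZ (u0 := 0) (u1 := 0) (v0 := 0) (v1 := 0)); rewrite ?mul0mx ?mulmx0 //; try exact: hom0; by apply: thin.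
exists f1; split=> // f0 hf0; apply: cofinW (Hf1 f0 hf0) => c.
by apply: kindec_sindec (crep_ofM (hom_ln c hf0 hf1)) _; apply: shT_reduced.
Qed.

Lemma bigdsum_valid (s : seq (cplx n A)) : (forall i, (i < size s)%N -> valid_cplx e (nth (zero_cplx A n) s i)) ->
  valid_cplx e (bigdsum s).
Proof.
elim: s => [|P s IH] H; first by move=> u v; rewrite /= mulr0 mul0r.
have [S [f R]] := crep_ex (H 0%N isT : valid_cplx e P).
have [T [g R']] := crep_ex (IH (fun i => H i.+1)).
by have [] := crep_dsum R R'.
Qed.

Lemma hsz_bigdsum_l (s : seq (cplx n A)) Q : (forall i, (i < size s)%N -> valid_cplx e (nth (zero_cplx A n) s i)) ->
  valid_cplx e Q -> hom_shift_zero e (bigdsum s) Q ->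
  forall i, (i < size s)%N -> hom_shift_zero e (nth (zero_cplx A n) s i) Q.
Proof.
move=> + vQ; have [T [g RQ]] := crep_ex vQ; elim: s => [//|P s IH] vs H.
have vP : valid_cplx e P := vs 0%N isT.
have vs' i : (i < size s)%N -> valid_cplx e (nth (zero_cplx A n) s i) := vs i.+1.
have [S [f RP]] := crep_ex vP; have [S' [f' RS]] := crep_ex (bigdsum_valid vs').
have [[r] [r']] := crep_dsum_retr He RP RS.
have E := iffLR (hom_shift_zeroP He (crep_dsum RP RS) RQ) H.
case=> [_|i] /=; first exact/(hom_shift_zeroP He RP RQ)/(Ez_retr_l He r E).
by apply: IH => //; apply/(hom_shift_zeroP He RS RQ)/(Ez_retr_l He r' E).
Qed.
Lemma hsz_bigdsum_r (s : seq (cplx n A)) Q : (forall i, (i < size s)%N -> valid_cplx e (nth (zero_cplx A n) s i)) ->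
  valid_cplx e Q -> hom_shift_zero e Q (bigdsum s) ->
  forall i, (i < size s)%N -> hom_shift_zero e Q (nth (zero_cplx A n) s i).
Proof.
move=> + vQ; have [T [g RQ]] := crep_ex vQ; elim: s => [//|P s IH] vs H.
have vP : valid_cplx e P := vs 0%N isT.
have vs' i : (i < size s)%N -> valid_cplx e (nth (zero_cplx A n) s i) := vs i.+1.
have [S [f RP]] := crep_ex vP; have [S' [f' RS]] := crep_ex (bigdsum_valid vs').
have [[r] [r']] := crep_dsum_retr He RP RS.
have E := iffLR (hom_shift_zeroP He RQ (crep_dsum RP RS)) H.
case=> [_|i] /=; first exact/(hom_shift_zeroP He RQ RP)/(Ez_retr_r He r E).
by apply: IH => //; apply/(hom_shift_zeroP He RQ RS)/(Ez_retr_r He r' E).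
Qed.

(** The two witnesses of E(theta, theta) = 0 are moved in turn along lines to maps with the
    canonical decomposition, keeping compatibility; it is invariant under homotopy equivalence and
    passes to summands. *)
Lemma canonical_compat th ths : E_zero e th -> canonical_decomposition e th ths ->
  forall x y, x \in ths -> y \in ths -> E0 e (shT x) (shT y).
Proof.
move=> /E0_of_zero [f [g [hf hg Efg]]] [_ [_ Hgen]] x y xs ys.
have [f1 [hf1 Hf1]] := general_open Hgen.
have [c [Hc Kc]] := cofin_ex (cofin_and (Ez_open_l He hg hf hf1 Efg) (Hf1 f hf)).
have hfc := hom_ln c hf hf1.
have [c' [Hc' Kc']] := cofin_ex (cofin_and (Ez_open_r He hfc hg hf1 Hc) (Hf1 g hg)).
have hgc := hom_ln c' hg hf1.
have Rf := crep_ofM hfc; have Rg := crep_ofM hgc.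
case: Kc => fs [_ [Hfs Kf]]; case: Kc' => gs [_ [Hgs Kg]].
set Pfs := [seq _ | i <- _] in Kf; set Pgs := [seq _ | i <- _] in Kg.
have szf : size Pfs = size ths by rewrite size_map size_iota.
have szg : size Pgs = size ths by rewrite size_map size_iota.
have nf i : (i < size ths)%N -> nth (zero_cplx A n) Pfs i = Pf (nth 0 ths i) (nth (fun _ _ => 0) fs i).
  by move=> il; rewrite (nth_map 0%N) ?size_iota // nth_iota.
have ng i : (i < size ths)%N -> nth (zero_cplx A n) Pgs i = Pf (nth 0 ths i) (nth (fun _ _ => 0) gs i).
  by move=> il; rewrite (nth_map 0%N) ?size_iota // nth_iota.
have vf i : (i < size Pfs)%N -> valid_cplx e (nth (zero_cplx A n) Pfs i).
  by rewrite szf => il; rewrite nf //; apply: Hfs.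
have vg i : (i < size Pgs)%N -> valid_cplx e (nth (zero_cplx A n) Pgs i).
  by rewrite szg => il; rewrite ng //; apply: Hgs.
have [S [F RS]] := crep_ex (bigdsum_valid vf); have [T [G RT]] := crep_ex (bigdsum_valid vg).
have E1 := Ez_hequiv_l He (kiso_hequiv Rf RS Kf) Hc'.
have E2 := Ez_hequiv_r He (kiso_hequiv Rg RT Kg) E1.
have H0 := iffRL (hom_shift_zeroP He RS RT) E2.
have [_ _ vT _] := RT.
have xi : (index x ths < size ths)%N by rewrite index_mem.
have yi : (index y ths < size ths)%N by rewrite index_mem.
have H1 := hsz_bigdsum_l vf vT H0; have := H1 (index x ths); rewrite szf => /(_ xi) H2.
have vx := vf (index x ths); rewrite szf in vx; have {}vx := vx xi.
have := hsz_bigdsum_r vg vx H2 (i := index y ths); rewrite szg => /(_ yi).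
rewrite nf // ng // => H3.
have hx := Hfs _ xi; have hy := Hgs _ yi; rewrite !nth_index // in H3 hx hy.
have Rx := crep_Pf hx; have Ry := crep_Pf hy.
by do 2 eexists; split; [exact: crep_hom Rx | exact: crep_hom Ry | exact: (iffLR (hom_shift_zeroP He Rx Ry) H3)].
Qed.
End Generic.

(** * Integral classes that vanish on the semistable modules *)

Section Integral.
Variables (k : closedFieldType) (A : falgType k) (n : nat) (e : 'I_n -> A).
Hypothesis He : complete_projectives e.
Variables (th : 'rV[int]_n) (ths : seq 'rV[int]_n).
Hypothesis th_sum : th = \sum_(x <- ths) x.
Hypothesis compat : forall x y, x \in ths -> y \in ths -> E0 e (shT x) (shT y).

Lemma biprod_retr S f M P I0 P0 I1 P1 i : @biprod k A n e S f M P I0 P0 I1 P1 -> (i < M)%N -> retr e f (tagged (P i)).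
Proof.
move=> [[hI0 hP0 PI0 _ _] [hI1 hP1 PI1 _ _] bI bP] iM.
by exists (I0 i) (P0 i) (I1 i) (P1 i) => //; auto.
Qed.

(** Each class gets two maps, the second one at index [size ths + i], because one map may fail to be
    compatible with itself. *)
Lemma compatible_families : exists (S : nat -> shp n) (f : forall i, mor A (S i)),
  [/\ forall i, (i < size ths)%N -> S i = shT (nth 0 ths i),
      forall i, (i < size ths)%N -> S (size ths + i)%N = shT (nth 0 ths i),
      forall i, shom e (S i) (f i) &
      forall i j, (i < size ths)%N -> (j < size ths)%N -> Ez e (S i) (S (size ths + j)%N) (f i) (f (size ths + j)%N)].
Proof.
pose l := size ths; pose S i := shT (nth 0 ths (if (i < l)%N then i else i - l)%N).
have Sl i : (i < l)%N -> S i = shT (nth 0 ths i) by rewrite /S => ->.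
have Sr i : S (l + i)%N = shT (nth 0 ths i) by rewrite /S ltnNge leq_addr /= addKn.
have [|f [hf Hf]] := @simultaneous _ _ _ _ He S (fun i j => (i < l)%N && (l <= j)%N) (l + l)%N.
  move=> i j il jl /andP [il' jl']; split; first by rewrite ltn_eqF // (leq_trans il').
  rewrite Sl // -(subnKC jl') Sr; apply: compat; apply: mem_nth => //.
  by rewrite ltn_subLR.
exists S, f; split=> // i j il jl; apply: Hf; rewrite ?leq_addr ?andbT ?ltn_add2l //.
by apply: leq_trans il _; apply: leq_addr.
Qed.

Lemma torsion_ths X : exists Y Z R K, @exact_seq k A Y X Z R K /\
  forall x, x \in ths -> Tz e x Y /\ Fz e x Z.
Proof.
have [S [f [Sl Sr hf H]]] := compatible_families.
pose I := 'I_(size ths).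
have [Y [Z [R [K [E HY HZ]]]]] := @torsion_seq k A n e He I I (fun i => S (size ths + i)%N) (fun j => S j)
   (fun i => f (size ths + i)%N) (fun j => f j) (fun i j => H j i (ltn_ord j) (ltn_ord i)) X.
exists Y, Z, R, K; split=> // x xs.
have xl : (index x ths < size ths)%N by rewrite index_mem.
have nx : nth 0 ths (index x ths) = x by rewrite nth_index.
have := Esurj_Tz He (hf _) (HY (Ordinal xl)); have := Hinj_Fz He (hf _) (HZ (Ordinal xl)).
by rewrite (Sr _ xl) (Sl _ xl) nx cls_shT.
Qed.

Lemma Esurj_shT_Tz z (f : mor A (shT z)) X : shom e (shT z) f -> Esurj e (shT z) f X -> Tz e z X.
Proof. by move=> hf H; have := Esurj_Tz He hf H; rewrite cls_shT. Qed.
Lemma Hinj_shT_Fz z (f : mor A (shT z)) X : shom e (shT z) f -> Hinj e (shT z) f X -> Fz e z X.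
Proof. by move=> hf H; have := Hinj_Fz He hf H; rewrite cls_shT. Qed.

(** [f] and [g] are the direct sums of the first and of the second maps of the classes. Each class
    is thus a summand of [g], and compatibility with [g] descends to it. *)
Lemma generic_pair : exists f g : mor A (shT th),
  [/\ shom e (shT th) f, shom e (shT th) g, Ez e (shT th) (shT th) f g &
   forall S h, shom e S h -> Ez e S (shT th) h g -> forall x, x \in ths -> E0 e S (shT x)].
Proof.
have [S [f [Sl Sr hf H]]] := compatible_families.
have C b v : cnt2 (shT th) b v = (\sum_(i < size ths) cnt2 (shT (nth 0%R ths i)) b v)%N.
  by rewrite th_sum (cnt2_sum He b v compat) (big_nth 0) big_mkord.
have [|F [I0 [P0 [I1 [P1 [hF B]]]]]] := @biprod_ex _ A n e He (shT th) (size ths) (fun i => existT _ (S i) (f i)) hf.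
  by move=> b v; rewrite C; apply: eq_bigr => i _; rewrite /= Sl.
have [|G [I0' [P0' [I1' [P1' [hG B']]]]]] := @biprod_ex _ A n e He (shT th) (size ths)
     (fun i => existT _ (S (size ths + i)%N) (f (size ths + i)%N)) (fun i => hf _).
  by move=> b v; rewrite C; apply: eq_bigr => i _; rewrite /= Sr.
exists F, G; split=> //; first by apply: (biprod_Ez He B B') => i j il jl; apply: H.
move=> T h hh E x xs.
have xl : (index x ths < size ths)%N by rewrite index_mem.
have := Ez_retr_r He (biprod_retr B' xl) E.
have := hf (size ths + index x ths)%N; rewrite /=; move: (f _); rewrite Sr // nth_index //.
by move=> f' hf' Ef'; exists h, f'.
Qed.

Definition semistable X := Tz e th X /\ Fz e th X.

Lemma Tz_factor ze X X' : Tz e ze X -> factor_module X' X -> Tz e ze X'.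
Proof. by move=> H f X'' f'; apply: H; apply: factor_trans f f'. Qed.
Lemma Fz_sub ze X X' : Fz e ze X -> sub_module X' X -> Fz e ze X'.
Proof. by move=> H f X'' f'; apply: H; apply: sub_trans f f'. Qed.
Lemma semistable_factor X X' : Tz e th X -> factor_module X' X -> itheta e th X' = 0 -> semistable X'.
Proof.
move=> H f t0; split; first exact: Tz_factor f.
move=> Y /sub_exact [Z [R [K E]]].
have := H _ (factor_trans f (exact_factor E)); have := itheta_exact He th E.
by rewrite t0 => /eqP; rewrite eq_sym addr_eq0 => /eqP -> H'; rewrite oppr_le0.
Qed.
Lemma semistable_sub X X' : Fz e th X -> sub_module X' X -> itheta e th X' = 0 -> semistable X'.
Proof.
move=> H f t0; split; last exact: Fz_sub f.
move=> Z /factor_exact [Y [R [K E]]].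
have := H _ (sub_trans f (exact_sub E)); have := itheta_exact He th E.
by rewrite t0 => /eqP; rewrite eq_sym addrC addr_eq0 => /eqP -> H'; rewrite oppr_ge0.
Qed.

Definition norm1 (ze : 'rV[int]_n) : nat := (\sum_v absz (ze 0%R v))%N.
Lemma itheta_bound ze X m : (forall v, (\rank (mact X (e v)) <= m)%N) -> (absz (itheta e ze X) <= norm1 ze * m)%N.
Proof.
move=> Hm; rewrite /itheta /norm1 big_distrl /=; elim/big_ind2: _ => //.
  by move=> x a y b ax by_; apply: leq_trans (leq_add ax by_); lia.
by move=> v _; rewrite abszM absz_nat leq_mul.
Qed.

(** Where theta vanishes on a factor, the factor is semistable and [ze] vanishes too; elsewhere
    theta is a positive integer, so [m] times it outweighs [ze]. *)
Lemma Tz_shift ze X m : (forall W, semistable W -> itheta e ze W = 0) -> Tz e th X ->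
  (norm1 ze * mdim X <= m)%N -> Tz e (th *+ m - ze) X.
Proof.
move=> H0 HT le X' f; rewrite ithetaD ithetaN ithetaMn.
have t0 := HT _ f; have [z|nz] := eqVneq (itheta e th X') 0.
  by rewrite z (H0 X') ?mul0rn ?subr0 //; apply: semistable_factor f z.
have b : (absz (itheta e ze X') <= m)%N.
  apply: leq_trans le; apply: itheta_bound => v.
  have ee : e v * e v = e v by case: He => /(_ v) [].
  by apply: leq_trans (factor_rank f ee) (rank_leq_row _).
by move: (itheta e th X') (itheta e ze X') t0 nz b => a c; rewrite -mulr_natr; nia.
Qed.
Lemma Fz_shift ze X m : (forall W, semistable W -> itheta e ze W = 0) -> Fz e th X ->
  (norm1 ze * mdim X <= m)%N -> Fz e (th *+ m - ze) X.
Proof.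
move=> H0 HT le X' f; rewrite ithetaD ithetaN ithetaMn.
have t0 := HT _ f; have [z|nz] := eqVneq (itheta e th X') 0.
  by rewrite z (H0 X') ?mul0rn ?subr0 //; apply: semistable_sub f z.
have b : (absz (itheta e ze X') <= m)%N.
  apply: leq_trans le; apply: itheta_bound => v.
  have ee : e v * e v = e v by case: He => /(_ v) [].
  by apply: leq_trans (sub_rank f ee) (rank_leq_row _).
by move: (itheta e th X') (itheta e ze X') t0 nz b => a c; rewrite -mulr_natr; nia.
Qed.

Hypothesis tame : E_tame e.
Hypothesis indec : forall x, x \in ths -> gindec e (shT x).

(** Sign conditions on test modules are turned into maps twice: for [ze] on [coker g] and [kernu f],
    giving [fz] and [gz]; then for [rho] on [coker gz] and [kernu fz], giving compatibility of [rho]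
    with [ze], and on [coker g], giving it with the [theta_i]. *)
Lemma integral_cone (f g : mor A (shT th)) ze : shom e (shT th) f -> shom e (shT th) g -> Ez e (shT th) (shT th) f g ->
  (forall S h, shom e S h -> Ez e S (shT th) h g -> forall x, x \in ths -> E0 e S (shT x)) ->
  (forall W, semistable W -> itheta e ze W = 0) -> Tz e ze (coker e g) -> Fz e ze (kernu e f) ->
  exists c : nat -> nat, ze = \sum_(i < size ths) nth 0 ths i *+ c i.
Proof.
move=> hf hg Efg Hg H0 HT HF.
have [a0 [b0 [ha0 hb0 Eab]]] := E0_of_zero He (tame ze).
have [f' hf' Ef'] : exists2 f', shom e (shT ze) f' & Esurj e (shT ze) f' (coker e g).
  by apply: (Tz_Esurj He ha0 hb0 Eab); rewrite cls_shT.
(* [fz] has two duties: with [g] to reach the [theta_i], and with [b0] so that a compatible [gz] can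
   be chosen afterwards. *)
have [fz [hfz Ez1 Ez2]] := lopen_meet (Ez_open_l He hg) (Ez_open_l He hb0) hf' ha0 (iffLR (Esurj_coker He hg hf') Ef') Eab.
have [g' hg' Eg'] : exists2 g', shom e (shT ze) g' & Hinj e (shT ze) g' (kernu e f).
  by apply: (Fz_Hinj He ha0 hb0 Eab); rewrite cls_shT.
have [gz [hgz Ez3 Ez4]] := lopen_meet (Ez_open_r He hf) (Ez_open_r He hfz) hg' hb0 (iffLR (Hinj_ker He hf hg') Eg') Ez2.
have T1 : Tz e th (coker e gz) by apply: (Esurj_shT_Tz hf); apply/(Esurj_coker He hgz hf).
have T2 : Tz e th (coker e g) by apply: (Esurj_shT_Tz hf); apply/(Esurj_coker He hg hf).
have T3 : Fz e th (kernu e fz) by apply: (Hinj_shT_Fz hg); apply/(Hinj_ker He hfz hg).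
(* One multiple that is large enough for all three modules on which [rho] is tested. *)
pose m := (norm1 ze * (mdim (coker e gz) + mdim (coker e g) + mdim (kernu e fz)))%N.
pose rho := th *+ m - ze.
have R1 : Tz e rho (coker e gz) by apply: Tz_shift => //; rewrite leq_mul2l -addnA leq_addr orbT.
have R2 : Tz e rho (coker e g) by apply: Tz_shift => //; rewrite leq_mul2l [X in (_ <= X + _)%N]addnC -addnA leq_addr orbT.
have R3 : Fz e rho (kernu e fz) by apply: Fz_shift => //; rewrite leq_mul2l leq_addl orbT.
have [a1 [b1 [ha1 hb1 Eab1]]] := E0_of_zero He (tame rho).
have [f1 hf1 Ef1] : exists2 f', shom e (shT rho) f' & Esurj e (shT rho) f' (coker e gz).
  by apply: (Tz_Esurj He ha1 hb1 Eab1); rewrite cls_shT.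
have [f2 hf2 Ef2] : exists2 f', shom e (shT rho) f' & Esurj e (shT rho) f' (coker e g).
  by apply: (Tz_Esurj He ha1 hb1 Eab1); rewrite cls_shT.
have [g1 hg1 Eg1] : exists2 g', shom e (shT rho) g' & Hinj e (shT rho) g' (kernu e fz).
  by apply: (Fz_Hinj He ha1 hb1 Eab1); rewrite cls_shT.
apply: (class_summands He (rho := rho) (m := m)) => //.
- by rewrite /rho addrC subrK th_sum.
- by exists fz, g1; split=> //; apply: (iffLR (Hinj_ker He hfz hg1)).
- by exists f1, gz; split=> //; apply: (iffLR (Esurj_coker He hgz hf1)).
- exact: Hg hfz Ez1.
- by apply: (Hg _ _ hf2); apply: (iffLR (Esurj_coker He hg hf2)).
Qed.
End Integral.

(** * Integral vectors spanning a real annihilator *)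

Section RationalSpan.
Variable R : realType.

Lemma common_denominator (T : finType) (q : T -> rat) : exists2 D : int, D != 0 &
  forall t, exists z : int, q t * D%:~R = z%:~R.
Proof.
exists (\prod_t denq (q t)); first by apply/prodf_neq0 => t _; apply: denq_neq0.
move=> t; exists (numq (q t) * \prod_(t' | t' != t) denq (q t')).
rewrite (bigD1 t) //= !rmorphM /= mulrA; congr (_ * _).
by rewrite -{1}[q t]divq_num_den divfK // intr_eq0 denq_neq0.
Qed.

(** A matrix of largest rank with rows in [L] already spans [L]. Its kernel is rational and commutes
    with the extension to the reals; clearing denominators in the kernel matrix gives the [z i]. *)
Lemma rational_span n (L : 'rV[int]_n -> Prop) : exists z : 'I_n -> 'rV[int]_n,
  (forall i d, L d -> \sum_v z i 0 v * d 0 v = 0) /\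
  forall eta : 'rV[R]_n, (forall d, L d -> \sum_v eta 0 v * (d 0 v)%:~R = 0) ->
    exists a : 'I_n -> R, eta = \sum_i a i *: map_mx intr (z i).
Proof.
pose P r := `[< exists m (B : 'M[rat]_(m, n)),
  (forall i, exists2 d, L d & row i B = map_mx intr d) /\ \rank B = r >].
have P0 : exists r, P r.
  by exists 0%N; apply/asboolP; exists 0%N, 0; split; [case | rewrite mxrank0].
have Pm r : P r -> (r <= n)%N by case/asboolP => m [B [_ <-]]; apply: rank_leq_col.
case: (ex_maxnP P0 Pm) => r /asboolP [m [B [HB rB]]] maxB {P0 Pm}.
have LB d : L d -> (map_mx intr d <= B)%MS.
  move=> Ld; have le : (B <= col_mx (map_mx intr d) B)%MS by rewrite -addsmxE addsmxSr.
  apply: submx_trans (_ : (col_mx (map_mx intr d) B <= B)%MS); first by rewrite -addsmxE addsmxSl.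
  rewrite -(geq_leqif (mxrank_leqif_sup le)) rB; apply: maxB; apply/asboolP.
  exists (1 + m)%N, (col_mx (map_mx intr d) B); split=> // i; case: (split_ordP i) => j ->.
    by exists d => //; rewrite rowKu; apply/rowP => v; rewrite mxE ord1.
  by have [d' Ld' E] := HB j; exists d'; rewrite ?rowKd.
pose K := kermx B^T.
have [D D0 HD] := common_denominator (fun ij : 'I_n * 'I_n => K ij.1 ij.2).
have /choice [w Hw] : forall ij : 'I_n * 'I_n, exists x : int, K ij.1 ij.2 * D%:~R = x%:~R by [].
exists (fun i => \row_j w (i, j)); split=> [i d Ld|eta He].
  have KB : K *m (map_mx intr d : 'rV[rat]_n)^T = 0.
    by have /submxP [u ->] := LB d Ld; rewrite trmx_mul mulmxA mulmx_ker mul0mx.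
  move/matrixP/(_ i 0): KB; rewrite !mxE => /(congr1 ( *%R D%:~R)); rewrite mulr0 mulr_sumr => E.
  suff : (\sum_v (\row_j w (i, j)) 0 v * d 0 v)%:~R = 0 :> rat by move/eqP; rewrite intr_eq0 => /eqP.
  rewrite rmorph_sum -[RHS]E; apply: eq_bigr => v _.
  have -> : ((map_mx intr d)^T : 'cV[rat]_n) v 0 = (d 0 v)%:~R by rewrite !mxE.
  have -> : (\row_j w (i, j)) 0 v = w (i, v) by rewrite mxE.
  by rewrite rmorphM /= -(Hw (i, v)) /= mulrA [_ * D%:~R]mulrC.
have : (eta <= map_mx (ratr : rat -> R) K)%MS.
  rewrite map_kermx; apply/sub_kermxP/matrixP => i j; rewrite !mxE.
  have [d Ld E] := HB j; rewrite -[RHS](He d Ld); apply: eq_bigr => v _; rewrite ord1; congr (_ * _).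
  move/rowP/(_ v): E; rewrite !mxE => ->; exact: ratr_int.
case/submxP => a Ea; exists (fun i => a 0 i / D%:~R); rewrite Ea; apply/rowP => v.
rewrite mxE summxE; apply: eq_bigr => i _.
have -> : (map_mx (ratr : rat -> R) K) i v = ratr (K i v) by rewrite mxE.
have -> : ((a 0 i / D%:~R) *: map_mx intr (\row_j w (i, j))) 0 v = a 0 i / D%:~R * (w (i, v))%:~R by rewrite !mxE.
have DR : (D%:~R : R) != 0 by rewrite intr_eq0.
rewrite -mulrA; congr (_ * _).
by rewrite -(ratr_int R (w (i, v))) -(Hw (i, v)) rmorphM /= ratr_int mulrC mulfK.
Qed.

Lemma archi_family (T : finType) (x : T -> R) (b : R) : exists M : nat, forall t, 0 < x t -> b <= M%:R * x t.
Proof.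
pose f t := Num.bound `|b / x t|.
exists (\sum_t f t)%N => t xt; rewrite -ler_pdivrMr //.
apply: le_trans (ler_norm _) _; apply: le_trans (ltW (archi_boundP (normr_ge0 _))) _.
by rewrite ler_nat (bigD1 t) //= leq_addr.
Qed.
End RationalSpan.

(** * The open cone lies in one TF-class *)

Section RealCone.
Variables (k : closedFieldType) (A : falgType k) (n : nat) (e : 'I_n -> A) (R : realType).
Hypothesis He : complete_projectives e.
Implicit Types (eta : 'rV[R]_n) (X Y Z : module A).
Local Notation ev := (@theta_eval k A n e R).
Let intv (z : 'rV[int]_n) : 'rV[R]_n := map_mx (fun x : int => x%:~R) z.

Lemma theta_evalD a b X : ev (a + b) X = ev a X + ev b X.
Proof. by rewrite -big_split; apply: eq_bigr => v _; rewrite mxE mulrDl. Qed.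
Lemma theta_evalZ c a X : ev (c *: a) X = c * ev a X.
Proof. by rewrite /ev mulr_sumr; apply: eq_bigr => v _; rewrite mxE mulrA. Qed.
Lemma theta_eval0 X : ev 0 X = 0.
Proof. by apply: big1 => v _; rewrite mxE mul0r. Qed.
Lemma theta_eval_sum (J : Type) (r : seq J) (a : J -> 'rV[R]_n) X : ev (\sum_(i <- r) a i) X = \sum_(i <- r) ev (a i) X.
Proof. by rewrite (big_morph (fun a => ev a X) (fun a b => theta_evalD a b X) (theta_eval0 X)). Qed.
Lemma theta_eval_int z X : ev (intv z) X = (itheta e z X)%:~R.
Proof. by rewrite /itheta rmorph_sum; apply: eq_bigr => v _; rewrite mxE rmorphM. Qed.
Lemma theta_eval_exact a X Y Z u w : @exact_seq k A Y X Z u w -> ev a X = ev a Y + ev a Z.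
Proof.
move=> E; rewrite -big_split; apply: eq_bigr => v _.
have ee : e v * e v = e v by case: He => /(_ v) [].
by rewrite (exact_rank E) // natrD mulrDr.
Qed.

Lemma Tbar_int z X : Tbar e (intv z) X <-> Tz e z X.
Proof. by split=> H X' /H; rewrite theta_eval_int ler0z. Qed.
Lemma Fbar_int z X : Fbar e (intv z) X <-> Fz e z X.
Proof. by split=> H X' /H; rewrite theta_eval_int lerz0. Qed.

Lemma Tbar_factor (a : 'rV[R]_n) X X' : Tbar e a X -> factor_module X' X -> Tbar e a X'.
Proof. by move=> H f X'' f'; apply: H; apply: factor_trans f f'. Qed.
Lemma Fbar_sub (a : 'rV[R]_n) X X' : Fbar e a X -> sub_module X' X -> Fbar e a X'.
Proof. by move=> H f X'' f'; apply: H; apply: sub_trans f f'. Qed.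
Lemma Tbar_Fbar_factor (a : 'rV[R]_n) X X' : Tbar e a X -> factor_module X' X -> ev a X' = 0 -> Tbar e a X' /\ Fbar e a X'.
Proof.
move=> H f t0; split; first exact: Tbar_factor f.
move=> Y /sub_exact [Z [u [w E]]].
have := H _ (factor_trans f (exact_factor E)); have := theta_eval_exact a E.
by rewrite t0 => /eqP; rewrite eq_sym addr_eq0 => /eqP -> H'; rewrite oppr_le0.
Qed.
Lemma Tbar_Fbar_sub (a : 'rV[R]_n) X X' : Fbar e a X -> sub_module X' X -> ev a X' = 0 -> Tbar e a X' /\ Fbar e a X'.
Proof.
move=> H f t0; split; last exact: Fbar_sub f.
move=> Z /factor_exact [Y [u [w E]]].
have := H _ (sub_trans f (exact_sub E)); have := theta_eval_exact a E.
by rewrite t0 => /eqP; rewrite eq_sym addrC addr_eq0 => /eqP -> H'; rewrite oppr_ge0.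
Qed.

Variables (th : 'rV[int]_n) (ths : seq 'rV[int]_n).
Hypothesis th_sum : th = \sum_(x <- ths) x.
Hypothesis compat : forall x y, x \in ths -> y \in ths -> E0 e (shT x) (shT y).

Lemma theta_eval_cone (c : nat -> R) X :
  ev (\sum_(i < size ths) c i *: intv (nth 0 ths i)) X = \sum_(i < size ths) c i * (itheta e (nth 0 ths i) X)%:~R.
Proof. by rewrite theta_eval_sum; apply: eq_bigr => i _; rewrite theta_evalZ theta_eval_int. Qed.

(** On the quotient [Z] of the torsion sequence of a factor all theta_i are nonpositive, while their
    positive combination is nonnegative. So all vanish on [Z], and each theta_i takes on the factor
    its nonnegative value on [Y]. *)
Lemma cone_Tbar (c : nat -> R) X : (forall i, (i < size ths)%N -> 0 < c i) ->
  Tbar e (\sum_(i < size ths) c i *: intv (nth 0 ths i)) X <-> forall x, x \in ths -> Tz e x X.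
Proof.
move=> c0; split=> [H x xs X' f|H X' f]; last first.
  rewrite theta_eval_cone; apply: sumr_ge0 => i _; apply: mulr_ge0; first exact/ltW/c0.
  by rewrite ler0z; apply: H f; apply: mem_nth.
have [Y [Z [u [w [E HYZ]]]]] := torsion_ths He compat X'.
have [HY HZ] := HYZ x xs; have HZ' i : (i < size ths)%N -> itheta e (nth 0 ths i) Z <= 0.
  by move=> il; have [_ ] := HYZ _ (mem_nth 0 il); apply; apply: sub_refl.
have := H _ (factor_trans f (exact_factor E)); rewrite theta_eval_cone => S0.
have xl : (index x ths < size ths)%N by rewrite index_mem.
have Z0 : itheta e x Z = 0.
  have terms (i : 'I_(size ths)) : true -> 0 <= - (c i * (itheta e (nth 0 ths i) Z)%:~R).
    by move=> _; rewrite oppr_ge0 mulr_ge0_le0 ?lerz0 ?HZ' // ltW ?c0.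
  have /eqP : \sum_(i < size ths) - (c i * (itheta e (nth 0 ths i) Z)%:~R) = 0.
    by apply/eqP; rewrite eq_le (sumr_ge0 _ terms) andbT sumrN oppr_le0.
  rewrite psumr_eq0 // => /allP/(_ (Ordinal xl)); rewrite mem_index_enum => /(_ isT) /=.
  by rewrite oppr_eq0 mulf_eq0 gt_eqF ?c0 //= intr_eq0 nth_index // => /eqP.
by rewrite (itheta_exact He x E) Z0 addr0; apply: HY; apply: factor_refl.
Qed.
Lemma cone_Fbar (c : nat -> R) X : (forall i, (i < size ths)%N -> 0 < c i) ->
  Fbar e (\sum_(i < size ths) c i *: intv (nth 0 ths i)) X <-> forall x, x \in ths -> Fz e x X.
Proof.
move=> c0; split=> [H x xs X' f|H X' f]; last first.
  rewrite theta_eval_cone; apply: sumr_le0 => i _; apply: mulr_ge0_le0; first exact/ltW/c0.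
  by rewrite lerz0; apply: H f; apply: mem_nth.
have [Y [Z [u [w [E HYZ]]]]] := torsion_ths He compat X'.
have [HY HZ] := HYZ x xs; have HY' i : (i < size ths)%N -> 0 <= itheta e (nth 0 ths i) Y.
  by move=> il; have [+ _] := HYZ _ (mem_nth 0 il); apply; apply: factor_refl.
have := H _ (sub_trans f (exact_sub E)); rewrite theta_eval_cone => S0.
have xl : (index x ths < size ths)%N by rewrite index_mem.
have Y0 : itheta e x Y = 0.
  have terms (i : 'I_(size ths)) : true -> 0 <= c i * (itheta e (nth 0 ths i) Y)%:~R.
    by move=> _; rewrite mulr_ge0 ?ler0z ?HY' // ltW ?c0.
  have /eqP : \sum_(i < size ths) c i * (itheta e (nth 0 ths i) Y)%:~R = 0.
    by apply/eqP; rewrite eq_le (sumr_ge0 _ terms) andbT.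
  rewrite psumr_eq0 // => /allP/(_ (Ordinal xl)); rewrite mem_index_enum => /(_ isT) /=.
  by rewrite mulf_eq0 gt_eqF ?c0 //= intr_eq0 nth_index // => /eqP.
by rewrite (itheta_exact He x E) Y0 add0r; apply: HZ; apply: sub_refl.
Qed.

Lemma th_cone : intv th = \sum_(i < size ths) 1 *: intv (nth 0 ths i).
Proof.
by rewrite th_sum (big_nth 0) big_mkord /intv map_mx_sum; apply: eq_bigr => i _; rewrite scale1r.
Qed.

Lemma cone_TF (c : nat -> R) : (forall i, (i < size ths)%N -> 0 < c i) ->
  TF_equiv e (\sum_(i < size ths) c i *: intv (nth 0 ths i)) (intv th).
Proof.
move=> c0 X; rewrite th_cone.
have p1 i : (i < size ths)%N -> (0 : R) < (fun _ : nat => 1) i by rewrite ltr01.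
by split; [rewrite (cone_Tbar X c0) (cone_Tbar X p1) | rewrite (cone_Fbar X c0) (cone_Fbar X p1)].
Qed.
End RealCone.

(** * The TF-class lies in the open cone *)

Section Converse.
Variables (k : closedFieldType) (A : falgType k) (n : nat) (e : 'I_n -> A) (R : realType).
Hypothesis He : complete_projectives e.
Local Notation ev := (@theta_eval k A n e R).
Local Notation intv := (map_mx (fun x : int => x%:~R : R)).
Variables (th : 'rV[int]_n) (ths : seq 'rV[int]_n).
Hypothesis th_sum : th = \sum_(x <- ths) x.
Hypothesis compat : forall x y, x \in ths -> y \in ths -> E0 e (shT x) (shT y).
Hypothesis tame : E_tame e.
Hypothesis indec : forall x, x \in ths -> gindec e (shT x).
Variable eta : 'rV[R]_n.
Hypothesis eq_eta : TF_equiv e eta (intv th).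

Let Tbar_eta X : Tbar e eta X <-> Tz e th X.
Proof. by have [-> _] := eq_eta X; apply: Tbar_int. Qed.
Let Fbar_eta X : Fbar e eta X <-> Fz e th X.
Proof. by have [_ ->] := eq_eta X; apply: Fbar_int. Qed.

Lemma semistable_eta X : semistable e th X -> ev eta X = 0.
Proof.
case=> /Tbar_eta HT /Fbar_eta HF; apply/eqP.
by rewrite eq_le (HT _ (factor_refl X)) (HF _ (sub_refl X)).
Qed.
Lemma semistable_th X : semistable e th X -> itheta e th X = 0.
Proof.
case=> HT HF; apply/eqP.
by rewrite eq_le (HT _ (factor_refl X)) (HF _ (sub_refl X)).
Qed.

Section Lattice.
Variable z : 'I_n -> 'rV[int]_n.
Definition comb (u : 'I_n -> int) : 'rV[int]_n := \row_v \sum_j u j * z j 0 v.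
Lemma intv_comb u : intv (comb u) = \sum_j (u j)%:~R *: intv (z j).
Proof.
apply/rowP => v; rewrite !mxE summxE rmorph_sum; apply: eq_bigr => j _.
by rewrite !mxE rmorphM.
Qed.
Lemma itheta_comb u X : itheta e (comb u) X = \sum_j u j * itheta e (z j) X.
Proof.
rewrite /itheta; under [RHS]eq_bigr => j _ do rewrite mulr_sumr.
rewrite exchange_big; apply: eq_bigr => v _ /=; rewrite mxE mulr_suml.
by apply: eq_bigr => j _; rewrite mulrA.
Qed.
Lemma ev_comb u (a : 'I_n -> R) N X m : (forall j, `|(u j)%:~R - a j| <= N%:R) ->
  (forall v, (\rank (mact X (e v)) <= m)%N) ->
  `|ev (intv (comb u)) X - ev (\sum_j a j *: intv (z j)) X| <= (N * (\sum_j norm1 (z j)) * m)%:R.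
Proof.
move=> Hu Hm; rewrite intv_comb !theta_eval_sum -sumrB.
apply: le_trans (ler_norm_sum _ _ _) _; rewrite -mulnA natrM big_distrl /= natr_sum mulr_sumr.
apply: ler_sum => j _; rewrite !theta_evalZ -mulrBl normrM theta_eval_int.
apply: ler_pM => //; rewrite -intr_norm -[`|_|]/((absz _)%:Z) -pmulrn ler_nat.
exact: itheta_bound.
Qed.
End Lattice.

Lemma TF_cone : in_open_cone ths eta.
Proof.
have [f [g [hf hg Efg Hg]]] := generic_pair He th_sum compat.
(* [L] consists of the dimension vectors of semistable modules; both eta and theta vanish on them,
   so M eta - theta is a real combination of the integral [z j]. *)
pose L (d : 'rV[int]_n) := exists2 W, semistable e th W & d = \row_v (\rank (mact W (e v)))%:Z.
have [z [zL span]] := rational_span R L.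
have zW j W : semistable e th W -> itheta e (z j) W = 0.
  move=> sW; rewrite -[RHS](zL j _ (ex_intro2 _ _ W sW erefl)) /itheta.
  by apply: eq_bigr => v _; rewrite mxE.
pose mx := (mdim (coker e g) + mdim (kernu e f))%N.
(* On modules with dimension vector bounded by [mx], [B] bounds the distance of M eta from a
   combination of the [z j] with coefficients within [n.+1] of [a]: [norm1 th] pays for the
   subtracted theta, the rest for the rounding. *)
pose B := ((norm1 th + n.+1 * \sum_j norm1 (z j)) * mx)%N.
(* Only finitely many dimension vectors are bounded by [mx], so a single multiple makes |M eta| at
   least [B] wherever eta is nonzero. *)
have [M0 HM0] := archi_family (fun t : {ffun 'I_n -> 'I_mx.+1} => `|\sum_v eta 0 v * (t v)%:R|) B%:R.
pose M := M0.+1; have Mgt : 0 < M%:R :> R by rewrite ltr0n.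
have HM X : (forall v, (\rank (mact X (e v)) <= mx)%N) -> ev eta X != 0 -> B%:R <= M%:R * `|ev eta X|.
  move=> Hm nz; pose t : {ffun 'I_n -> 'I_mx.+1} := [ffun v => inord (\rank (mact X (e v)))].
  have E : ev eta X = \sum_v eta 0 v * (t v)%:R by apply: eq_bigr => v _; rewrite ffunE inordK // ltnS.
  have := HM0 t; rewrite -E normr_gt0 => /(_ nz) h; apply: le_trans h _.
  by rewrite ler_wpM2r // ler_nat.
have [|a Ea] := span (M%:R *: eta - intv th).
  move=> d [W sW ->]; have := semistable_eta sW; have := semistable_th sW => t0 e0.
  have : ev (M%:R *: eta - intv th) W = 0.
    by rewrite -scaleN1r theta_evalD !theta_evalZ theta_eval_int t0 e0 !mulr0 addr0.
  rewrite /theta_eval => E; rewrite -[RHS]E; apply: eq_bigr => v _; congr (_ * _).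
  by rewrite mxE.
pose q j := Num.floor (a j); pose phi j := a j - (q j)%:~R.
have phi_ge0 j : 0 <= phi j by rewrite subr_ge0 floor_le.
have phi_lt1 j : phi j < 1 by rewrite ltrBlDl -[1]/(1%:~R) -intrD floorD1_gt.
have near u X : (forall j, `|(u j)%:~R - a j| <= n.+1%:R) -> (forall v, (\rank (mact X (e v)) <= mx)%N) ->
    `|(itheta e (comb z u) X)%:~R - M%:R * ev eta X| <= B%:R.
  move=> Hu Hm; have := ev_comb z Hu Hm; rewrite -Ea theta_eval_int -scaleN1r theta_evalD !theta_evalZ theta_eval_int.
  rewrite mulN1r => H; have -> : (itheta e (comb z u) X)%:~R - M%:R * ev eta X =
    ((itheta e (comb z u) X)%:~R - (M%:R * ev eta X - (itheta e th X)%:~R)) - (itheta e th X)%:~R :> R by ring.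
  apply: le_trans (ler_normB _ _) _; rewrite /B mulnDl natrD addrC lerD //.
  rewrite -intr_norm -[`|_|]/((absz _)%:Z) -pmulrn ler_nat; exact: itheta_bound.
(* A factor of [coker g] on which eta vanishes is semistable, so every rounding vanishes on it; on
   the others M eta is at least [B] and survives the rounding. Submodules of [kernu f] are treated
   dually. *)
have cone u : (forall j, `|(u j)%:~R - a j| <= n.+1%:R) ->
    exists c : nat -> nat, comb z u = \sum_(i < size ths) nth 0 ths i *+ c i.
  move=> Hu; have zero W : semistable e th W -> itheta e (comb z u) W = 0.
    by move=> sW; rewrite itheta_comb big1 // => j _; rewrite zW // mulr0.
  have ee v : e v * e v = e v by case: He => /(_ v) [].
  have TC : Tbar e eta (coker e g).
    by apply/Tbar_eta; apply: (Esurj_shT_Tz He hf); apply/(Esurj_coker He hg hf).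
  have FK : Fbar e eta (kernu e f).
    by apply/Fbar_eta; apply: (Hinj_shT_Fz He hg); apply/(Hinj_ker He hf hg).
  apply: (integral_cone He th_sum compat tame indec hf hg Efg Hg zero).
    move=> X' fX; have [e0|nz] := eqVneq (ev eta X') 0.
      by rewrite zero //; have [/Tbar_eta ? /Fbar_eta ?] := Tbar_Fbar_factor He TC fX e0.
    have rk v : (\rank (mact X' (e v)) <= mx)%N.
      by apply: leq_trans (factor_rank fX (ee v)) _; apply: leq_trans (rank_leq_row _) (leq_addr _ _).
    have := near u X' Hu rk; have := HM X' rk nz; rewrite (ger0_norm (TC _ fX)) => h1.
    rewrite -(ler0z R) ler_norml => /andP [h2 _].
    by lra.
  move=> X' fX; have [e0|nz] := eqVneq (ev eta X') 0.
    by rewrite zero //; have [/Tbar_eta ? /Fbar_eta ?] := Tbar_Fbar_sub He FK fX e0.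
  have rk v : (\rank (mact X' (e v)) <= mx)%N.
    by apply: leq_trans (sub_rank fX (ee v)) _; apply: leq_trans (rank_leq_row _) (leq_addl _ _).
  have := near u X' Hu rk; have := HM X' rk nz; rewrite (ler0_norm (FK _ fX)) mulrN => h1.
  rewrite -(lerz0 R) ler_norml => /andP [_ h2].
  by lra.
have Nge1 : 1 <= n.+1%:R :> R by rewrite ler1n.
have [|c0 Ec0] := cone q.
  by move=> j; rewrite distrC ger0_norm ?phi_ge0 // (le_trans (ltW (phi_lt1 j))).
(* [a] is the convex combination of [q] and of the vertices [q + n.+1 * delta_i], with
   weights [1 - s] and [phi i / n.+1]. *)
pose qi i j := q j + (i == j)%:Z * n.+1%:Z.
have /choice [c Ec] : forall i, exists c : nat -> nat, comb z (qi i) = \sum_(i < size ths) nth 0 ths i *+ c i.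
  move=> i; apply: cone => j; rewrite /qi; have := phi_ge0 j; have := phi_lt1 j; rewrite /phi.
  case: (i =P j) => _ h1 h2; rewrite ?mul0r ?addr0 ?mul1r ?rmorphD /=.
    have -> : (n.+1%:Z%:~R : R) = n.+1%:R by [].
    rewrite ler_norml; apply/andP; split; lra.
  rewrite ler_norml; apply/andP; split; lra.
have intvs (c' : nat -> nat) : intv (\sum_(i < size ths) nth 0 ths i *+ c' i) = \sum_(i < size ths) (c' i)%:R *: intv (nth 0 ths i).
  rewrite map_mx_sum; apply: eq_bigr => i _; apply/rowP => v.
  have HMn (x : int) m : (x *+ m)%:~R = m%:R * x%:~R :> R by elim: m => [|m IH]; rewrite ?mul0r // mulrSr intrD IH -[m.+1%:R]natr1 mulrDl mul1r.
  by rewrite [LHS]mxE mulmxnE /= HMn !mxE.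
pose s := \sum_j phi j / n.+1%:R.
have N0 : n.+1%:R != 0 :> R by rewrite pnatr_eq0.
have s_le1 : s <= 1.
  rewrite /s -mulr_suml ler_pdivrMr ?ltr0n // mul1r.
  have : \sum_(j < n) phi j <= \sum_(j < n) (1 : R) by apply: ler_sum => j _; apply: ltW.
  rewrite sumr_const card_ord => h; apply: le_trans h _; by rewrite ler_nat.
pose C l := (1 - s) * (c0 l)%:R + \sum_i phi i / n.+1%:R * (c i l)%:R.
have C_ge0 l : 0 <= C l.
  apply: addr_ge0; first by rewrite mulr_ge0 ?subr_ge0.
  by apply: sumr_ge0 => i _; rewrite !mulr_ge0 // invr_ge0.
have EC : M%:R *: eta - intv th = \sum_(l < size ths) C l *: intv (nth 0 ths l).
  transitivity ((1 - s) *: intv (comb z q) + \sum_i (phi i / n.+1%:R) *: intv (comb z (qi i))).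
    rewrite Ea.
    have -> : \sum_i (phi i / n.+1%:R) *: intv (comb z (qi i)) = s *: intv (comb z q) + \sum_i phi i *: intv (z i).
      rewrite /s scaler_suml -big_split; apply: eq_bigr => i _ /=.
      have -> : intv (comb z (qi i)) = intv (comb z q) + n.+1%:R *: intv (z i).
        rewrite !intv_comb /qi; under eq_bigr => j _ do rewrite rmorphD rmorphM /= scalerDl.
        rewrite big_split /=; congr (_ + _); rewrite (bigD1 i) //= eqxx mul1r big1 ?addr0 // => j.
        by rewrite eq_sym => /negPf ->; rewrite mul0r scale0r.
      by rewrite scalerDr scalerA divfK.
    rewrite addrA -scalerDl subrK scale1r intv_comb -big_split; apply: eq_bigr => j _ /=.
    by rewrite -scalerDl /phi addrC subrK.
  rewrite Ec0 intvs; under [X in _ + X]eq_bigr => i _ do rewrite Ec intvs scaler_sumr.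
  rewrite exchange_big scaler_sumr -big_split; apply: eq_bigr => l _ /=.
  rewrite /C [RHS]scalerDl [in RHS]scaler_suml; congr (_ + _); first by rewrite scalerA.
  by apply: eq_bigr => i _; rewrite scalerA.
(* Adding theta back and dividing by M gives the coefficients (1 + C l) / M, positive even where
   [C l] is 0. *)
exists (fun l => M%:R^-1 * (1 + C l)); split.
  by move=> l _; rewrite mulr_gt0 ?invr_gt0 // ltr_pwDl // C_ge0.
transitivity (M%:R^-1 *: (M%:R *: eta - intv th + intv th)).
  by rewrite subrK scalerA mulVf ?scale1r // gt_eqF.
rewrite EC (th_cone R th_sum) -big_split scaler_sumr; apply: eq_bigr => l _ /=.
by rewrite -scalerDl scalerA [C l + 1]addrC.
Qed.
End Converse.

Theorem theorem6p6 (k : closedFieldType) (A : falgType k) (n : nat)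
  (e : 'I_n -> A) (R : realType) (th : 'rV[int]_n) (ths : seq 'rV[int]_n) :
  complete_projectives e -> E_tame e -> canonical_decomposition e th ths ->
  forall eta : 'rV[R]_n,
    TF_equiv e eta (map_mx (fun z : int => z%:~R) th) <-> in_open_cone ths eta.
Proof.
move=> He tame Hcan eta; have [th_sum [Hind _]] := Hcan.
have compat := canonical_compat He (tame th) Hcan.
split=> [H|[c [c0 ->]]]; last exact: (cone_TF He th_sum compat c0).
by apply: (TF_cone He th_sum compat tame _ H) => x /Hind /(indec_gindec He).
Qed.
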